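(* Let $\underline b>0$ and suppose that $\mathbb{E}[g_m^2(X)]\ge\underline b$ and $\mathbb{E}[|h_m(X,X')|^{2+\ell}]\le B_n^\ell$ for $\ell=1,2$ and all $m=1,\dots,d$. Let $\gamma\in(0,e^{-1})$ and assume $\log(1/\gamma)\le K\log(dn)$ and $\log d\le\bar b n$ for some constants $K,\bar b>0$. Set $$\varpi_{1,n}=\left(\frac{B_n^2\log^7(nd)}{n}\right)^{1/6},\qquad \varpi^B_{2,n}(\gamma)=\left(\frac{B_n^2\log^3(nd)}{\gamma^{2/q}n^{1-2/q}}\right)^{1/3}.$$ (i) If $\|h_m(X,X')\|_{\psi_1}\le B_n$ for all $m=1,\dots,d$, then there exists a constant $C>0$ depending only on $\underline b,\bar b,K$ such that $\rho^B(T_n,T_n^\flat)\le C\varpi_{1,n}$ holds with probability at least $1-\gamma$. (ii) If $\mathbb{E}[\max_{1\le m\le d}(|h_m(X,X')|/B_n)^q]\le1$ for some $q\ge4$, then there exists a constant $C>0$ depending only on $\underline b,\bar b,q,K$ such that $\rho^B(T_n,T_n^\flat)\le C\{\varpi_{1,n}+\varpi^B_{2,n}(\gamma)\}$ holds with probability at least $1-\gamma$.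
   Context: Throughout $n\ge 4$, $d\ge 3$. $X_1,\dots,X_n$ are iid random vectors in $\mathbb{R}^p$ with distribution $F$, $X_1^n=(X_1,\dots,X_n)$, and $X,X'$ are independent with distribution $F$, independent of $X_1^n$. $h:\mathbb{R}^p\times\mathbb{R}^p\to\mathbb{R}^d$ is measurable with $h(x_1,x_2)=h(x_2,x_1)$ and $\mathbb{E}|h_k(X_1,X_2)|<\infty$ for all $k$. Put $\theta=\mathbb{E}[h(X_1,X_2)]$ (not assumed to be zero), $U_n=\frac1{n(n-1)}\sum_{1\le i\ne j\le n}h(X_i,X_j)$, $T_n=\sqrt n(U_n-\theta)/2$, $g(x)=\mathbb{E}[h(x,X')]-\theta$. $p,d,F$ may depend on $n$; $B_n\ge1$ is a sequence of reals possibly tending to infinity. Modified randomly reweighted bootstrap: $w_1,\dots,w_n$ are iid $N(1,1)$ random variables independent of $X_1^n$, $\bar w=n^{-1}\sum_{i=1}^nw_i$, $$U_n^\flat=\frac1{n(n-1)}\sum_{1\le i\ne j\le n}w_iw_jh(X_i,X_j)-2(\bar w-1)U_n,\qquad T_n^\flat=\sqrt n(U_n^\flat-U_n)/2.$$ $\mathcal{A}^{re}$ is the class of all hyperrectangles $\{x\in\mathbb{R}^d:a_j\le x_j\le b_j,\ j=1,\dots,d\}$ with $-\infty\le a_j\le b_j\le\infty$, and $\rho^B(T_n,T_n^\flat)=\sup_{A\in\mathcal{A}^{re}}|\mathbb{P}(T_n\in A)-\mathbb{P}(T_n^\flat\in A\mid X_1^n)|$. For a real random variable $\xi$, $\|\xi\|_{\psi_1}=\inf\{C>0:\mathbb{E}[\exp(|\xi|/C)-1]\le1\}$.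 *)

(* Defs.v *)
From HB Require Import structures.
From mathcomp Require Import all_boot all_order all_algebra.
From mathcomp Require Import all_classical all_reals all_analysis.
Set Implicit Arguments.
Unset Strict Implicit.
Unset Printing Implicit Defensive.
Import Order.TTheory GRing.Theory Num.Theory.
Import numFieldNormedType.Exports.
Local Open Scope classical_set_scope.
Local Open Scope ring_scope.

(* R^k is [k.-tuple R] with its product sigma-algebra, which is the Borel
   sigma-algebra of R^k. *)

Definition mutually_independent (R : realType) (dO dT : measure_display)
    (Omega : measurableType dO) (T : measurableType dT)
    (P : probability Omega R) (I : finType) (Y : I -> Omega -> T) : Prop :=
  forall (J : {set I}) (A : I -> set T), (forall i, measurable (A i)) ->
    P (\bigcap_(i in [set i | i \in J]) (Y i @^-1` A i)) =
    (\prod_(i in J) P (Y i @^-1` A i))%E.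

Definition independent (R : realType) (dO d1 d2 : measure_display)
    (Omega : measurableType dO) (T1 : measurableType d1)
    (T2 : measurableType d2) (P : probability Omega R)
    (Y1 : Omega -> T1) (Y2 : Omega -> T2) : Prop :=
  forall (A1 : set T1) (A2 : set T2), measurable A1 -> measurable A2 ->
    P ((Y1 @^-1` A1) `&` (Y2 @^-1` A2)) =
    (P (Y1 @^-1` A1) * P (Y2 @^-1` A2))%E.

Definition has_law (R : realType) (dO dT : measure_display)
    (Omega : measurableType dO) (T : measurableType dT)
    (P : probability Omega R) (Y : {RV P >-> T})
    (mu : set T -> \bar R) : Prop :=
  forall A, measurable A -> distribution P Y A = mu A.

(* Valued in the extended reals, so that the norm is +oo when no C fits. *)
Definition psi1_norm (R : realType) (dO : measure_display)
    (Omega : measurableType dO) (P : probability Omega R)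
    (xi : Omega -> R) : \bar R :=
  ereal_inf [set C%:E | C in [set C : R | 0 < C /\
    ('E_P[(fun o => expR (`|xi o| / C) - 1)%R] <= 1%:E)%E]].

Definition hyperrectangles (R : realType) (d : nat) : set (set (d.-tuple R)) :=
  [set A | exists a b : 'I_d -> \bar R, (forall j, (a j <= b j)%E) /\
    A = [set x | forall j, (a j <= (tnth x j)%:E <= b j)%E]].

(* When the event S is measurable this says that P S >= a. *)
Definition holds_with_prob_ge (R : realType) (dO : measure_display)
    (Omega : measurableType dO) (P : probability Omega R) (a : R)
    (S : set Omega) : Prop :=
  exists E : set Omega, [/\ measurable E, E `<=` S & (a%:E <= P E)%E].

Definition ord1st (n : nat) (hn : (4 <= n)%N) : 'I_n :=
  Ordinal (leq_trans (isT : 0 < 4)%N hn).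
Definition ord2nd (n : nat) (hn : (4 <= n)%N) : 'I_n :=
  Ordinal (leq_trans (isT : 1 < 4)%N hn).

(* [Xa] and [Xb] are the generic copies X and X'; [normal_prob] takes the
   standard deviation as second argument. *)
Record model (R : realType) (n d p : nat) := Model {
  n_ge4 : (4 <= n)%N;
  d_ge3 : (3 <= d)%N;
  dO : measure_display;
  Omega : measurableType dO;
  Pr : probability Omega R;
  lawF : probability (p.-tuple R) R;
  Xs : 'I_n -> {RV Pr >-> p.-tuple R};
  Xa : {RV Pr >-> p.-tuple R};
  Xb : {RV Pr >-> p.-tuple R};
  ws : 'I_n -> {RV Pr >-> R};
  hker : p.-tuple R -> p.-tuple R -> d.-tuple R;
  X_indep : mutually_independent Pr (fun i => Xs i : Omega -> p.-tuple R);
  X_law : forall i, has_law (Xs i) lawF;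
  Xa_law : has_law Xa lawF;
  Xb_law : has_law Xb lawF;
  XaXb_indep : independent Pr Xa Xb;
  XaXb_X_indep : independent Pr (fun o => (Xa o, Xb o))
    (fun o => [tuple Xs i o | i < n]);
  h_measurable : measurable_fun setT
    (fun z : p.-tuple R * p.-tuple R => hker z.1 z.2);
  h_sym : forall x y, hker x y = hker y x;
  h_integrable : forall k, Pr.-integrable setT (fun o =>
    (tnth (hker (Xs (ord1st n_ge4) o) (Xs (ord2nd n_ge4) o)) k)%:E);
  w_indep : mutually_independent Pr (fun i => ws i : Omega -> R);
  w_law : forall i, has_law (ws i) (normal_prob 1 1);
  w_X_indep : independent Pr (fun o => [tuple ws i o | i < n])
    (fun o => [tuple Xs i o | i < n])
}.

Definition X1n (R : realType) (n d p : nat) (M : model R n d p)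
    (o : Omega M) : n.-tuple (p.-tuple R) :=
  [tuple Xs M i o | i < n].

Definition theta (R : realType) (n d p : nat) (M : model R n d p)
    (k : 'I_d) : R :=
  fine ('E_(Pr M)[(fun o => tnth (hker M (Xs M (ord1st (n_ge4 M)) o)
                                    (Xs M (ord2nd (n_ge4 M)) o)) k)%R])%E.

(* h(x, X') is integrable only for F-almost every x; elsewhere [fine] returns
   an irrelevant real value. *)
Definition gproj (R : realType) (n d p : nat) (M : model R n d p)
    (x : p.-tuple R) (k : 'I_d) : R :=
  fine ('E_(Pr M)[(fun o => tnth (hker M x (Xb M o)) k)%R])%E - theta M k.

Definition Un (R : realType) (n d p : nat) (M : model R n d p)
    (o : Omega M) (k : 'I_d) : R :=
  (n%:R * (n%:R - 1))^-1 *
  \sum_(i < n) \sum_(j < n | i != j) tnth (hker M (Xs M i o) (Xs M j o)) k.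

Definition Tn (R : realType) (n d p : nat) (M : model R n d p)
    (o : Omega M) : d.-tuple R :=
  [tuple Num.sqrt n%:R * (Un o k - theta M k) / 2 | k < d].

Definition wbar (R : realType) (n d p : nat) (M : model R n d p)
    (o : Omega M) : R :=
  n%:R^-1 * \sum_(i < n) ws M i o.

Definition Uflat (R : realType) (n d p : nat) (M : model R n d p)
    (o : Omega M) (k : 'I_d) : R :=
  (n%:R * (n%:R - 1))^-1 *
  (\sum_(i < n) \sum_(j < n | i != j)
     ws M i o * ws M j o * tnth (hker M (Xs M i o) (Xs M j o)) k)
  - 2 * (wbar o - 1) * Un o k.

Definition Tflat (R : realType) (n d p : nat) (M : model R n d p)
    (o : Omega M) : d.-tuple R :=
  [tuple Num.sqrt n%:R * (Uflat o k - Un o k) / 2 | k < d].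

(* [kappa (X1n o) A] is a version of P(Tflat \in A | X_1^n)(o), jointly a
   probability measure in A (regular conditional distribution). *)
Definition cond_law_Tflat (R : realType) (n d p : nat) (M : model R n d p)
    (kappa : R.-pker (n.-tuple (p.-tuple R)) ~> (d.-tuple R)) : Prop :=
  forall (A : set (d.-tuple R)) (B : set (n.-tuple (p.-tuple R))),
    measurable A -> measurable B ->
    Pr M ((@Tflat _ _ _ _ M @^-1` A) `&` (@X1n _ _ _ _ M @^-1` B)) =
    (\int[Pr M]_(o in @X1n _ _ _ _ M @^-1` B) kappa (X1n o) A)%E.

Definition rhoB (R : realType) (n d p : nat) (M : model R n d p)
    (kappa : R.-pker (n.-tuple (p.-tuple R)) ~> (d.-tuple R))
    (o : Omega M) : \bar R :=
  ereal_sup [set `|Pr M (@Tn _ _ _ _ M @^-1` A) - kappa (X1n o) A|%E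
            | A in @hyperrectangles R d].

Definition varpi1 (R : realType) (n d : nat) (B : R) : R :=
  (B ^+ 2 * ln (n * d)%:R ^+ 7 / n%:R) `^ (1 / 6).

Definition varpi2B (R : realType) (n d : nat) (B q gamma : R) : R :=
  (B ^+ 2 * ln (n * d)%:R ^+ 3 /
   (gamma `^ (2 / q) * n%:R `^ (1 - 2 / q))) `^ (1 / 3).

Definition moment_conditions (R : realType) (n d p : nat)
    (M : model R n d p) (b B : R) : Prop :=
  forall m : 'I_d,
    (b%:E <= 'E_(Pr M)[(fun o => gproj M (Xa M o) m ^+ 2)%R])%E /\
    forall l : nat, l = 1%N \/ l = 2%N ->
      ('E_(Pr M)[(fun o => `|tnth (hker M (Xa M o) (Xb M o)) m| ^+ (2 + l))%R]
         <= (B ^+ l)%:E)%E.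

Definition growth_conditions (R : realType) (n d : nat)
    (bbar K gamma : R) : Prop :=
  [/\ 0 < gamma < expR (- 1),
      ln (1 / gamma) <= K * ln (d * n)%:R &
      ln d%:R <= bbar * n%:R].

(* Main.v *)
(* Given the sample, the reweighted statistic is, up to a Gaussian chaos of order two, a centred
   Gaussian vector whose covariance is a U-statistic of order three estimating Cov g(X). By the
   Hoeffding decomposition T_n is a normalised sum of the g(X_i) up to a degenerate U-statistic.
   Both second-order remainders are small in sup norm by Nemirovski's inequality.

   The Gaussian vector has the form sum_i e_i a_i. It is compared with the normalised sum by
   a Lindeberg argument for a smoothed indicator of a soft maximum. Each step replaces
   one summand by an independent copy of the Gaussian vector divided by sqrt n; its third-order
   error is localised to a window, whose mass is controlled by Gaussian
   anti-concentration and by the distance being estimated. Covariances agree up to the error of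
   the U-statistic, which is bounded outside an event of probability gamma by truncation and a
   Bernstein inequality for kernels of order three. The two tail assumptions enter only through
   the truncated second moment of the sup norm of h. *)
Require Import Defs.
From HB Require Import structures.
From mathcomp Require Import all_boot all_order all_algebra.
From mathcomp Require Import fingroup perm.
From mathcomp Require Import all_classical all_reals all_analysis.
From mathcomp Require Import measurable_realfun simple_functions ring lra.
Set Implicit Arguments.
Unset Strict Implicit.
Unset Printing Implicit Defensive.
Import Order.TTheory GRing.Theory Num.Theory.
Import numFieldNormedType.Exports.
Local Open Scope classical_set_scope.
Local Open Scope ring_scope.

(** * A smooth cutoff *)

Section derivative_rules.
Context (R : realType).
Implicit Types (f g : R -> R) (x a b c : R).

(** The rate comes from one balance. With [x] the target error over [L = ln (n * d)], take [beta] of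
    order [sqrt L / x] and [delta] of order [x sqrt L], so that [beta * delta] is of order [L].
    Apart from tails, one exchange costs the window mass times a multiple of
    [(beta^2 D + beta^3 m3) / (beta delta)], where [D = x^2 / n] bounds the covariance mismatch and
    [m3] is of order [B / n^(3/2)]. Over [n] exchanges this factor is a constant as soon as
    [B^2 L <= n x^6], which is the sixth power of [varpi1]. A constant below a fixed fraction is
    enough, because the window mass is bounded through the distance being estimated; hence
    covariances known up to [x^2] suffice. The Gaussian vector is kept as a linear image of the
    weights with coefficients read off the sample, so its covariance may be singular and no
    covariance root or population Gaussian appears. Variances are normalised to one, since
    anti-concentration needs them bounded below; the cost is a power of [1 + 1 / b]. When the target
    is not small, [rhoB <= 1] is absorbed into the constant. *)

Lemma is_derive_mul f g x a b : is_derive x 1 f a -> is_derive x 1 g b ->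
  is_derive x 1 (fun s => f s * g s) (a * g x + f x * b).
Proof.
move=> fa gb; have H := is_deriveM fa gb.
rewrite (_ : (fun s => _) = f * g)//; apply: is_derive_eq.
by rewrite addrC; congr (_ + _); rewrite /GRing.scale/= mulrC.
Qed.

Lemma is_derive_add f g x a b : is_derive x 1 f a -> is_derive x 1 g b ->
  is_derive x 1 (fun s => f s + g s) (a + b).
Proof. by move=> fa gb; exact: (@is_deriveD _ _ _ f g). Qed.

Lemma is_derive_val f x a b : a = b -> is_derive x (1 : R) f a ->
  is_derive x (1 : R) f b.
Proof. by move=> ->. Qed.

Lemma is_derive_mulc f x a c : is_derive x 1 f a ->
  is_derive x 1 (fun s => c * f s) (c * a).
Proof. by move=> fa; exact: (@is_deriveZ _ _ _ f). Qed.

Lemma is_derive_addc f x a c : is_derive x 1 f a ->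
  is_derive x 1 (fun s => f s + c) a.
Proof.
move=> fa; have := @is_derive_add f (cst c) x a 0 fa (is_derive_cst _ _ _).
by rewrite addr0.
Qed.

Lemma is_derive_comp f g x a b : is_derive (f x) 1 g b -> is_derive x 1 f a ->
  is_derive x 1 (fun s => g (f s)) (b * a).
Proof. by move=> gb fa; exact: (@is_derive1_comp _ g f). Qed.

Lemma is_derive_bigsum (I : finType) (h : I -> R -> R) (dh : I -> R) x :
  (forall i, is_derive x 1 (h i) (dh i)) ->
  is_derive x 1 (fun s => \sum_i h i s) (\sum_i dh i).
Proof.
move=> H.
suff : forall r : seq I, is_derive x 1 (fun s => \sum_(i <- r) h i s) (\sum_(i <- r) dh i).
  by apply.
elim=> [|i r IH].
  rewrite big_nil (_ : (fun s => _) = cst 0); first exact: is_derive_cst.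
  by apply/funext => s; rewrite big_nil.
rewrite big_cons (_ : (fun s => _) = fun s => h i s + \sum_(j <- r) h j s).
  exact: is_derive_add.
by apply/funext => s; rewrite big_cons.
Qed.

Lemma is_derive_continuous f (f' : R -> R) :
  (forall x, is_derive x 1 f (f' x)) -> continuous f.
Proof.
move=> df x; apply: differentiable_continuous.
by apply/derivable1_diffP; have [] := df x.
Qed.

Lemma mvt f (f' : R -> R) a b : (forall x, is_derive x 1 f (f' x)) -> a <= b ->
  exists2 c, a <= c <= b & f b - f a = f' c * (b - a).
Proof.
move=> df ab.
have [|c + ->] := @MVT_segment R f f' a b ab (fun x _ => df x).
  exact/continuous_subspaceT/(is_derive_continuous df).
by rewrite in_itv/= => cab; exists c.
Qed.

Definition derives f f' := forall s : R, is_derive s (1 : R) f (f' s).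

Lemma taylor1 (h h1 : R -> R) (M : R) : derives h h1 ->
  (forall s, 0 <= s <= 1 -> `|h1 s| <= M) -> `|h 1 - h 0| <= M.
Proof.
move=> dh hM; have [c c01 ->] := mvt dh (@ler01 R).
by rewrite subr0 mulr1 hM.
Qed.

Lemma taylor2 (h h1 h2 : R -> R) (M : R) : derives h h1 ->
  derives h1 h2 ->
  (forall s, 0 <= s <= 1 -> `|h2 s| <= M) -> `|h 1 - h 0 - h1 0| <= M.
Proof.
move=> dh dh1 hM.
pose k s := h s + - h1 0 * s.
have dk : derives k (fun s => h1 s - h1 0).
  move=> s.
  apply: is_derive_add => //; apply: (is_derive_val (mulr1 _)).
rewrite (_ : _ - _ - _ = k 1 - k 0); last by rewrite /k; ring.
apply: (taylor1 dk) => s /andP[s0 s1].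
have [c /andP[c0 cs] ->] := mvt dh1 s0.
rewrite subr0 normrM -[leRHS]mulr1 ler_pM// ?hM ?c0 ?(le_trans cs)//.
by rewrite ger0_norm.
Qed.

(** Subtracting the quadratic term reduces to [taylor2]. The mean value theorem gives up the factor
    [1 / 6], which only affects constants. *)
Lemma taylor3 (h h1 h2 h3 : R -> R) (M : R) : derives h h1 ->
  derives h1 h2 -> derives h2 h3 ->
  (forall s, 0 <= s <= 1 -> `|h3 s| <= M) ->
  `|h 1 - h 0 - h1 0 - h2 0 / 2| <= M.
Proof.
move=> dh dh1 dh2 hM.
pose k s := h s + - (h2 0 / 2) * (s * s).
pose k1 s := h1 s + - h2 0 * s.
have dk : derives k k1.
  move=> s.
  apply: (@is_derive_val _ _ (h1 s + - (h2 0 / 2) * (1 * s + s * 1))).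
    by rewrite /k1; field.
  by apply: is_derive_add => //; apply: is_derive_mulc; exact: is_derive_mul.
have dk1 : derives k1 (fun s => h2 s - h2 0).
  move=> s.
  apply: is_derive_add => //; apply: (is_derive_val (mulr1 _)).
rewrite (_ : _ - _ - _ - _ = k 1 - k 0 - k1 0); last by rewrite /k /k1; field.
apply: (taylor2 dk dk1) => s /andP[s0 s1].
have [c /andP[c0 cs] ->] := mvt dh2 s0.
rewrite subr0 normrM -[leRHS]mulr1 ler_pM// ?hM ?c0 ?(le_trans cs)//.
by rewrite ger0_norm.
Qed.

Lemma expR_taylor3 (y : R) :
  `|expR y - 1 - y - y ^+ 2 / 2| <= `|y| ^+ 3 * expR `|y|.
Proof.
pose e k s := y ^+ k * expR (s * y).
have de k : derives (e k) (e k.+1).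
  move=> s.
  apply: (@is_derive_val _ _ (y ^+ k * (expR (s * y) * (1 * y + s * 0)))).
    by rewrite /e exprS; ring.
  apply: is_derive_mulc; apply: is_derive_comp.
  exact: (@is_derive_mul id (cst y)).
have hM (s : R) : 0 <= s <= 1 -> `|e 3%N s| <= `|y| ^+ 3 * expR `|y|.
  move=> /andP[s0 s1].
  rewrite normrM normrX (ger0_norm (expR_ge0 _)) ler_wpM2l ?exprn_ge0// ler_expR.
  rewrite (le_trans (ler_norm _))// normrM -[leRHS]mul1r ler_wpM2r//.
  by rewrite ger0_norm.
have := @taylor3 (e 0%N) _ _ _ _ (de _) (de _) (de _) hM.
rewrite (_ : _ - _ = expR y - 1 - y - y ^+ 2 / 2)//.
by rewrite /e !mul0r mul1r expR0; field.
Qed.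

(** Invert [1 - u <= expR (- u)]; on [[0, 1/2]] the reciprocal of [1 - u] is at most [1 + 2 u]. *)
Lemma expR_le1D2x (u : R) : 0 <= u <= 2^-1 -> expR u <= 1 + 2 * u.
Proof.
move=> /andP[u0 u1].
have h : 1 - u <= expR (- u) by exact: expR_ge1Dx.
rewrite -[u in expR u]opprK expRN.
have p : 0 < 1 - u by lra.
apply: le_trans (_ : (1 - u)^-1 <= _).
  by rewrite lef_pV2 ?posrE ?expR_gt0.
rewrite -(ler_pM2r p) mulVf ?gt_eqF//; nra.
Qed.

(* C^3 cutoff: the piecewise polynomial equal to 1 on the negative axis and to 0
   beyond 1, glued with three matching derivatives at 0 and 1. *)
Definition glue (a : R) (f g : R -> R) (x : R) : R := if x <= a then f x else g x.

(** At the junction Caratheodory's form of differentiability applies: the slope function of the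
    glued map is the glued slope function, continuous because both slopes tend to the common
    derivative. *)
Lemma is_derive_glue a f f' g g' :
  derives f f' -> derives g g' -> f a = g a -> f' a = g' a ->
  derives (glue a f g) (glue a f' g').
Proof.
move=> df dg fga fga' x.
have [xa|ax|xa] := ltgtP x a.
- rewrite {2}/glue (ltW xa); apply: near_eq_is_derive; last exact: (df x).
  near=> y; rewrite /glue ifT// ltW//.
  by near: y; exact: lt_nbhsl.
- rewrite {2}/glue leNgt ax/=; apply: near_eq_is_derive; last exact: (dg x).
  near=> y; rewrite /glue ifN// -ltNge.
  by near: y; exact: lt_nbhsr.
subst x; rewrite {2}/glue lexx.
have [F [F1 F2 F3]] := (is_derive1_caratheodory f a (f' a)).1 (df a).
have [G [G1 G2 G3]] := (is_derive1_caratheodory g a (g' a)).1 (dg a).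
apply/is_derive1_caratheodory; exists (fun z => if z <= a then F z else G z); split.
- by move=> z; rewrite /glue lexx; case: ifP => _; [exact: F1|rewrite fga; exact: G1].
- apply/cvgrPdist_lt => e e0; rewrite lexx.
  move/cvgrPdist_lt : F2 => /(_ _ e0) F2; move/cvgrPdist_lt : G2 => /(_ _ e0) G2.
  near=> z; case: ifP => _; first by near: z.
  by rewrite F3 fga' -G3; near: z.
- by rewrite lexx.
Unshelve. all: by end_near.
Qed.

(** The Hermite interpolant of degree seven: its derivative is [- 140 c^3 (1 - c)^3], so three
    derivatives vanish at 0 and at 1 while the value drops from 1 to 0. *)
Definition smoothp (c : R) : R := 1 - 35 * c ^+ 4 + 84 * c ^+ 5 - 70 * c ^+ 6 + 20 * c ^+ 7.
Definition smoothp1 (c : R) : R := - 140 * c ^+ 3 + 420 * c ^+ 4 - 420 * c ^+ 5 + 140 * c ^+ 6.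
Definition smoothp2 (c : R) : R := - 420 * c ^+ 2 + 1680 * c ^+ 3 - 2100 * c ^+ 4 + 840 * c ^+ 5.
Definition smoothp3 (c : R) : R := - 840 * c + 5040 * c ^+ 2 - 8400 * c ^+ 3 + 4200 * c ^+ 4.

Lemma is_derive_expn n x : is_derive x 1 (fun s : R => s ^+ n) (n%:R * x ^+ n.-1).
Proof.
have := @is_deriveX R R id n x 1 1 (is_derive_id _ _) => H.
rewrite (_ : (fun s => _) = id ^+ n :> (R -> R)).
  by apply: is_derive_val H; exact: mulr1.
by apply/funext => s; rewrite /=; elim: n {H} => // n IH; rewrite !exprS IH.
Qed.

Lemma derives_smoothp : derives smoothp smoothp1.
Proof.
move=> x; apply: (@is_derive_val _ _ (0 + - (35 * (4 * x ^+ 3)) + 84 * (5 * x ^+ 4) + - (70 * (6 * x ^+ 5)) + 20 * (7 * x ^+ 6))).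
  by rewrite /smoothp1; ring.
apply: is_derive_add; last by apply: is_derive_mulc; exact: (is_derive_expn 7).
apply: is_derive_add; last by apply: is_deriveN; apply: is_derive_mulc; exact: (is_derive_expn 6).
apply: is_derive_add; last by apply: is_derive_mulc; exact: (is_derive_expn 5).
apply: is_derive_add; last by apply: is_deriveN; apply: is_derive_mulc; exact: (is_derive_expn 4).
Qed.

Lemma derives_smoothp1 : derives smoothp1 smoothp2.
Proof.
move=> x; apply: (@is_derive_val _ _ (- 140 * (3 * x ^+ 2) + 420 * (4 * x ^+ 3) + - (420 * (5 * x ^+ 4)) + 140 * (6 * x ^+ 5))).
  by rewrite /smoothp2; ring.
apply: is_derive_add; last by apply: is_derive_mulc; exact: (is_derive_expn 6).
apply: is_derive_add; last by apply: is_deriveN; apply: is_derive_mulc; exact: (is_derive_expn 5).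
apply: is_derive_add; last by apply: is_derive_mulc; exact: (is_derive_expn 4).
by apply: is_derive_mulc; exact: (is_derive_expn 3).
Qed.

Lemma derives_smoothp2 : derives smoothp2 smoothp3.
Proof.
move=> x; apply: (@is_derive_val _ _ (- 420 * (2 * x ^+ 1) + 1680 * (3 * x ^+ 2) + - (2100 * (4 * x ^+ 3)) + 840 * (5 * x ^+ 4))).
  by rewrite /smoothp3; ring.
apply: is_derive_add; last by apply: is_derive_mulc; exact: (is_derive_expn 5).
apply: is_derive_add; last by apply: is_deriveN; apply: is_derive_mulc; exact: (is_derive_expn 4).
apply: is_derive_add; last by apply: is_derive_mulc; exact: (is_derive_expn 3).
by apply: is_derive_mulc; exact: (is_derive_expn 2).
Qed.

Definition cutoff := glue 0 (cst 1) (glue 1 smoothp (cst 0)).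
Definition cutoff1 := glue 0 (cst 0) (glue 1 smoothp1 (cst 0)).
Definition cutoff2 := glue 0 (cst 0) (glue 1 smoothp2 (cst 0)).
Definition cutoff3 := glue 0 (cst 0) (glue 1 smoothp3 (cst 0)).

Lemma derives_cst (c : R) : derives (cst c) (cst 0).
Proof. by move=> x; exact: is_derive_cst. Qed.

Lemma derives_cutoff : derives cutoff cutoff1.
Proof.
apply: is_derive_glue; first exact: derives_cst.
- apply: is_derive_glue; first exact: derives_smoothp.
  + exact: derives_cst.
  + by rewrite /smoothp /cst !expr1n; ring.
  + by rewrite /smoothp1 /cst !expr1n; ring.
- by rewrite /glue ler01 /smoothp !expr0n/= ; ring.
- by rewrite /glue ler01 /smoothp1 !expr0n/= ; ring.
Qed.

Lemma derives_cutoff1 : derives cutoff1 cutoff2.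
Proof.
apply: is_derive_glue; first exact: derives_cst.
- apply: is_derive_glue; first exact: derives_smoothp1.
  + exact: derives_cst.
  + by rewrite /smoothp1 /cst !expr1n; ring.
  + by rewrite /smoothp2 /cst !expr1n; ring.
- by rewrite /glue ler01 /smoothp1 !expr0n/= ; ring.
- by rewrite /glue ler01 /smoothp2 !expr0n/= ; ring.
Qed.

Lemma derives_cutoff2 : derives cutoff2 cutoff3.
Proof.
apply: is_derive_glue; first exact: derives_cst.
- apply: is_derive_glue; first exact: derives_smoothp2.
  + exact: derives_cst.
  + by rewrite /smoothp2 /cst !expr1n; ring.
  + by rewrite /smoothp3 /cst !expr1n; ring.
- by rewrite /glue ler01 /smoothp2 !expr0n/= ; ring.
- by rewrite /glue ler01 /smoothp3 !expr0n/= ; ring.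
Qed.

Lemma cutoff_le0 u : u <= 0 -> cutoff u = 1.
Proof. by move=> u0; rewrite /cutoff /glue u0. Qed.

Lemma cutoff_ge1 u : 1 <= u -> cutoff u = 0.
Proof.
move=> u1; rewrite /cutoff /glue ifN; last by rewrite -ltNge (lt_le_trans _ u1).
case: ifPn => // u1'; have -> : u = 1 by apply/eqP; rewrite eq_le u1 u1'.
by rewrite /smoothp !expr1n; ring.
Qed.

Lemma cutoff_derivatives_out u : u <= 0 \/ 1 <= u ->
  [/\ cutoff1 u = 0, cutoff2 u = 0 & cutoff3 u = 0].
Proof.
move=> [u0|u1]; first by rewrite /cutoff1 /cutoff2 /cutoff3 /glue u0.
have u0 : (u <= 0) = false by rewrite leNgt (lt_le_trans _ u1).
rewrite /cutoff1 /cutoff2 /cutoff3 /glue u0.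
have [u1'|//] := leP u 1; have -> : u = 1 by apply/eqP; rewrite eq_le u1 u1'.
by rewrite /smoothp1 /smoothp2 /smoothp3 !expr1n; split; ring.
Qed.

Lemma norm_poly_bound (a b c d : R) (x : R) i j k l : 0 <= x <= 1 ->
  `|a * x ^+ i + b * x ^+ j + c * x ^+ k + d * x ^+ l| <= `|a| + `|b| + `|c| + `|d|.
Proof.
move=> /andP[x0 x1].
have h (e : R) m : `|e * x ^+ m| <= `|e|.
  by rewrite normrM ler_piMr// ger0_norm ?exprn_ge0// exprn_ile1.
by do 3 (rewrite (le_trans (ler_normD _ _))// lerD//).
Qed.

(** The moduli of all coefficients of the three derivative polynomials, summed so that one constant
    serves every order. *)
Definition cutoff_const : R :=
  (`|- 140| + `|420| + `|- 420| + `|140|) +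
  (`|- 420| + `|1680| + `|- 2100| + `|840|) +
  (`|- 840| + `|5040| + `|- 8400| + `|4200|).

Lemma cutoff_const_ge0 : 0 <= cutoff_const.
Proof. by rewrite /cutoff_const !addr_ge0. Qed.

Lemma le_add3 (x a b c : R) : 0 <= a -> 0 <= b -> 0 <= c ->
  [\/ x <= a, x <= b | x <= c] -> x <= a + b + c.
Proof. by move=> a0 b0 c0 [] h; lra. Qed.

Lemma cutoff_bounds u : [/\ `|cutoff1 u| <= cutoff_const,
  `|cutoff2 u| <= cutoff_const & `|cutoff3 u| <= cutoff_const].
Proof.
have c0 := cutoff_const_ge0.
have [u0|u0] := leP u 0.
  have [|-> -> ->] := @cutoff_derivatives_out u; first by left.
  by rewrite normr0.
have [u1|u1] := leP 1 u.
  have [|-> -> ->] := @cutoff_derivatives_out u; first by right.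
  by rewrite normr0.
have u01 : 0 <= u <= 1 by rewrite !ltW.
have u0' : (u <= 0) = false by rewrite leNgt u0.
rewrite /cutoff1 /cutoff2 /cutoff3 /glue u0' (ltW u1).
have h1 := @norm_poly_bound (- 140) 420 (- 420) 140 u 3 4 5 6 u01.
have h2 := @norm_poly_bound (- 420) 1680 (- 2100) 840 u 2 3 4 5 u01.
have h3 := @norm_poly_bound (- 840) 5040 (- 8400) 4200 u 1 2 3 4 u01; rewrite expr1 in h3.
rewrite /smoothp1 /smoothp2 /smoothp3 -!(mulNr _ (u ^+ _)).
have S1 : 0 <= `|- 140 : R| + `|420 : R| + `|- 420 : R| + `|140 : R| by rewrite !addr_ge0.
have S2 : 0 <= `|- 420 : R| + `|1680 : R| + `|- 2100 : R| + `|840 : R| by rewrite !addr_ge0.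
have S3 : 0 <= `|- 840 : R| + `|5040 : R| + `|- 8400 : R| + `|4200 : R| by rewrite !addr_ge0.
by split; apply: le_add3 => //; [constructor 1|constructor 2|constructor 3].
Qed.

(** The factored derivative [- 140 v^3 (1 - v)^3] makes the cutoff nonincreasing, so its values lie
    between those at 1 and at 0. *)
Lemma cutoff_itv u : 0 <= cutoff u <= 1.
Proof.
have [u0|u0] := leP u 0; first by rewrite cutoff_le0// ler01 lexx.
have [u1|u1] := leP 1 u; first by rewrite cutoff_ge1// ler01 lexx.
have c1 v : cutoff1 v <= 0.
  rewrite /cutoff1 /glue; case: ifPn => //; rewrite -ltNge => v0; case: ifPn => // v1.
  rewrite /smoothp1 (_ : _ + _ = - (140 * v ^+ 3 * (1 - v) ^+ 3)); last by ring.
  by rewrite oppr_le0; apply: mulr_ge0; [apply: mulr_ge0 => //|]; rewrite exprn_ge0// ?subr_ge0// ltW.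
have dec v w : v <= w -> cutoff w <= cutoff v.
  move=> vw; have [c _ E] := mvt derives_cutoff vw.
  by rewrite -subr_le0 E mulr_le0_ge0 ?subr_ge0.
have := dec u 1 (ltW u1); rewrite cutoff_ge1// => ->.
by have := dec 0 u (ltW u0); rewrite (cutoff_le0 (lexx 0)).
Qed.

End derivative_rules.

(** * Product laws, expectations and sup norms *)

(** Replacing one coordinate is the basic operation on product laws here: independence is always
    used by integrating a single coordinate against a fresh draw. *)
Definition upd (T : Type) n (x : n.-tuple T) (i : 'I_n) (y : T) : n.-tuple T :=
  [tuple if j == i then y else tnth x j | j < n].

Lemma tnth_upd (T : Type) n (x : n.-tuple T) (i j : 'I_n) (y : T) :
  tnth (upd x i y) j = if j == i then y else tnth x j.
Proof. by rewrite tnth_mktuple. Qed.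

Lemma measurable_upd d (T : measurableType d) n (i : 'I_n) :
  measurable_fun setT (fun z : n.-tuple T * T => upd z.1 i z.2).
Proof.
apply/measurable_fun_tnthP => j.
rewrite (_ : _ \o _ = fun z : n.-tuple T * T =>
   if j == i then z.2 else tnth z.1 j); last first.
  by apply/funext => z /=; rewrite tnth_upd.
case: (j == i); first exact: measurable_snd.
exact: (@measurableT_comp _ _ _ _ _ _ (fun x => tnth x j) _ fst (measurable_tnth j)).
Qed.

Lemma measurable_upd2 d (T : measurableType d) n (i : 'I_n) (x : n.-tuple T) :
  measurable_fun setT (fun y : T => upd x i y).
Proof.
apply: (@measurableT_comp _ _ _ _ _ _ (fun z : n.-tuple T * T => upd z.1 i z.2) _ (fun y => (x, y))).
  exact: measurable_upd.
exact: pair1_measurable.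
Qed.

Definition rect (T : Type) n (A : 'I_n -> set T) : set (n.-tuple T) :=
  [set x | forall i, A i (tnth x i)].

(** * Rectangles generate the product sigma-algebra *)

Section tuple_generation.
Context d (T : measurableType d) (n : nat).

Definition rects : set (set (n.-tuple T)) :=
  [set B | exists2 A : 'I_n -> set T, (forall i, measurable (A i)) & B = rect A].

Lemma measurable_rect (A : 'I_n -> set T) :
  (forall i, measurable (A i)) -> measurable (rect A).
Proof.
move=> mA.
rewrite (_ : rect A = \bigcap_(i in [set: 'I_n]) ((@tnth n T)^~ i @^-1` A i)).
  apply: fin_bigcap_measurable => // i _.
  by rewrite -[X in measurable X]setTI; exact: measurable_tnth.
by apply/seteqP; split => [x Hx i _|x Hx i]; [exact: Hx|exact: Hx].
Qed.

Lemma rects_setI : setI_closed rects.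
Proof.
move=> _ _ [A mA ->] [B mB ->]; exists (fun i => A i `&` B i).
  by move=> i; exact: measurableI.
by apply/seteqP; split => [x [HA HB] i|x H]; [split|split => i; case: (H i)].
Qed.

Lemma rects_setT : rects setT.
Proof. by exists (fun=> setT) => //; apply/seteqP; split. Qed.

Lemma measurable_rects : measurable = <<s rects >>.
Proof.
apply/seteqP; split.
  apply: smallest_sub; first exact: smallest_sigma_algebra.
  move=> B; rewrite -bigcup_seq => -[i _ [A mA <-]].
  apply: sub_sigma_algebra; exists (fun j => if j == i then A else setT).
    by move=> j; case: ifP.
  apply/seteqP; split => [x [_ /= Ax] j|x /(_ i)] /=.
    by case: eqP => // ->.
  by rewrite eqxx.
apply: smallest_sub; first exact: sigma_algebra_measurable.
by move=> B [A mA ->]; exact: measurable_rect.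
Qed.

Lemma tuple_measure_unique (R : realType)
    (m1 m2 : probability (n.-tuple T) R) :
  (forall A, (forall i, measurable (A i)) -> m1 (rect A) = m2 (rect A)) ->
  forall B, measurable B -> m1 B = m2 B.
Proof.
move=> m12 B mB.
apply: (measure_unique rects (fun=> setT)) => //.
- exact: measurable_rects.
- exact: rects_setI.
- by move=> _; exact: rects_setT.
- by rewrite bigcup_const.
- by move=> _ [A mA ->]; exact: m12.
- by move=> _; rewrite -ge0_fin_numE// fin_num_measure.
Qed.

End tuple_generation.

(** * Product laws and resampling of one coordinate *)

Section prodlike.
Context (R : realType) d (T : measurableType d) (n : nat).
Implicit Types (F : probability T R) (Q : probability (n.-tuple T) R).

(** Characterises the [n]-fold product by its values on a generating pi-system. This is the form in
    which the law of the sample or of the weights comes out of mutual independence, so no product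
    measure on tuples is constructed. *)
Definition prodlike F Q := forall A : 'I_n -> set T,
  (forall i, measurable (A i)) -> Q (rect A) = (\prod_i F (A i))%E.

Variables (F : probability T R) (Q : probability (n.-tuple T) R).
Hypothesis FQ : prodlike F Q.

Let updm i : n.-tuple T * T -> n.-tuple T := fun z => upd z.1 i z.2.
Let updm_fun i := HB.pack_for {mfun _ >-> _} (updm i)
  (isMeasurableFun.Build _ _ _ _ (updm i) (measurable_upd i)).

(** By uniqueness on rectangles: the overwritten coordinate contributes the full set, of mass one,
    and the fresh draw restores the missing factor. *)
Lemma resample_set i B : measurable B ->
  Q B = (Q \x F)%E (updm i @^-1` B).
Proof.
move: B; pose m2 := distribution (Q \x F : probability _ _)%E (updm_fun i).
apply: (@tuple_measure_unique _ _ _ _ Q m2) => A mA.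
rewrite FQ// /m2 /distribution /pushforward.
rewrite [RHS](_ : _ = (Q \x F)%E (rect (fun j => if j == i then setT else A j) `*` A i)); last first.
  congr ((Q \x F)%E _).
  apply/seteqP; split => [[x y] /= H|[x y] /= [H1 H2] j].
    split; last by have := H i; rewrite tnth_upd eqxx.
    by move=> j; have := H j; rewrite tnth_upd; case: ifP.
  by rewrite tnth_upd; have := H1 j; case: eqP => // ->.
have mA' j : measurable (if j == i then setT else A j) by case: ifP.
rewrite product_measure1E//; last exact: measurable_rect.
apply: etrans (congr1 (fun z => (z * F (A i))%E) (esym (FQ mA'))).
rewrite (bigD1 i)//= [in RHS](bigD1 i)//= eqxx probability_setT mul1e muleC.
by congr (_ * _)%E; apply: eq_bigr => j /negbTE ->.
Qed.

Lemma resample (i : 'I_n) (f : n.-tuple T -> \bar R) : measurable_fun [set: n.-tuple T] f ->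
  (forall x, (0 <= f x)%E) ->
  (\int[Q]_x f x = \int[Q]_x \int[F]_y f (upd x i y))%E.
Proof.
move=> mf f0.
rewrite -(@fubini_tonelli1 _ _ _ _ _ Q F (fun z => f (upd z.1 i z.2)))//; last 1 first.
  by apply: measurableT_comp => //; exact: measurable_upd.
have <- := @ge0_integral_distribution _ _ _ _ _ (Q \x F : probability _ _)%E
   (updm_fun i) f mf f0.
apply: eq_measure_integral => B mB _; exact: resample_set.
Qed.

End prodlike.

(** * Real-valued expectations and probabilities *)

Section expectations.
Context d (T : measurableType d) (R : realType) (P : probability T R).
Implicit Types (f g : T -> R) (c : R).

Definition intg f := P.-integrable setT (EFin \o f).
(** Real-valued, so informative only next to [intg]; a divergent integral is sent by [fine] to a
    default value. *)
Definition Ex f : R := fine (\int[P]_x (f x)%:E).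

Lemma intg_measurable f : intg f -> measurable_fun setT f.
Proof. by move=> /integrableP[/measurable_EFinP]. Qed.

Lemma Ex_EFin f : intg f -> (\int[P]_x (f x)%:E = (Ex f)%:E)%E.
Proof. by move=> If; rewrite /Ex fineK// integrable_fin_num. Qed.

Lemma intg_cst c : intg (fun=> c).
Proof. exact: finite_measure_integrable_cst. Qed.

Lemma Ex_cst c : Ex (fun=> c) = c.
Proof. by rewrite /Ex integral_cst// [X in (_ * X)%E]probability_setT mule1. Qed.

Lemma intgD f g : intg f -> intg g -> intg (fun x => f x + g x).
Proof. by move=> If Ig; exact: (integrableD measurableT If Ig). Qed.

Lemma ExD f g : intg f -> intg g -> Ex (fun x => f x + g x) = Ex f + Ex g.
Proof. by move=> If Ig; exact: (@RintegralD _ _ _ P _ _ _ measurableT If Ig). Qed.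

Lemma intgZ c f : intg f -> intg (fun x => c * f x).
Proof. by move=> If; exact: (integrableZl measurableT c If). Qed.

Lemma ExZ c f : intg f -> Ex (fun x => c * f x) = c * Ex f.
Proof. by move=> If; exact: (@RintegralZl _ _ _ P _ _ _ measurableT If). Qed.

Lemma intgN f : intg f -> intg (fun x => - f x).
Proof.
move=> If; rewrite (_ : (fun x => _) = fun x => -1 * f x); first exact: intgZ.
by apply/funext => x; rewrite mulN1r.
Qed.

Lemma ExN f : intg f -> Ex (fun x => - f x) = - Ex f.
Proof.
move=> If; rewrite (_ : (fun x => _) = fun x => -1 * f x).
  by rewrite ExZ// mulN1r.
by apply/funext => x; rewrite mulN1r.
Qed.

Lemma intgB f g : intg f -> intg g -> intg (fun x => f x - g x).
Proof. by move=> If Ig; apply: intgD => //; exact: intgN. Qed.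

Lemma ExB f g : intg f -> intg g -> Ex (fun x => f x - g x) = Ex f - Ex g.
Proof. by move=> If Ig; rewrite ExD// ?ExN//; exact: intgN. Qed.

Lemma intg_sum (I : Type) (r : seq I) (p : pred I) (F : I -> T -> R) :
  (forall i, intg (F i)) -> intg (fun x => \sum_(i <- r | p i) F i x).
Proof.
move=> IF; elim: r => [|i r IH].
  rewrite (_ : (fun x => _) = fun=> 0); first exact: intg_cst.
  by apply/funext => x; rewrite big_nil.
rewrite (_ : (fun x => _) = fun x => (if p i then F i x else 0) + \sum_(j <- r | p j) F j x).
  by apply: intgD => //; case: (p i) => //; exact: intg_cst.
by apply/funext => x; rewrite big_cons; case: ifP => // _; rewrite add0r.
Qed.

Lemma Ex_sum (I : Type) (r : seq I) (p : pred I) (F : I -> T -> R) :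
  (forall i, intg (F i)) ->
  Ex (fun x => \sum_(i <- r | p i) F i x) = \sum_(i <- r | p i) Ex (F i).
Proof.
move=> IF; elim: r => [|i r IH].
  rewrite big_nil (_ : (fun x => _) = fun=> 0); first exact: Ex_cst.
  by apply/funext => x; rewrite big_nil.
rewrite big_cons -IH; case: ifP => pi.
  rewrite -ExD//; last exact: intg_sum.
  by congr Ex; apply/funext => x; rewrite big_cons pi.
by congr Ex; apply/funext => x; rewrite big_cons pi.
Qed.

Lemma intg_dom f g : measurable_fun setT f -> intg g ->
  (forall x, `|f x| <= g x) -> intg f.
Proof.
move=> mf Ig fg; apply: (le_integrable measurableT _ _ Ig).
  exact/measurable_EFinP.
by move=> x _; rewrite lee_fin (le_trans (fg x))// ler_norm.
Qed.

Lemma intg_bounded f c : measurable_fun setT f -> (forall x, `|f x| <= c) -> intg f.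
Proof. by move=> mf fc; apply: (intg_dom mf (intg_cst c)). Qed.

Lemma intg_abs f : intg f -> intg (fun x => `|f x|).
Proof.
move=> If; have mf := intg_measurable If.
apply: (le_integrable measurableT _ _ If).
  by apply/measurable_EFinP; exact: measurableT_comp.
by move=> x _; rewrite lee_fin normr_id.
Qed.

Lemma Ex_le f g : intg f -> intg g -> (forall x, f x <= g x) -> Ex f <= Ex g.
Proof. by move=> If Ig fg; exact: (@le_Rintegral _ _ _ P _ _ _ measurableT If Ig). Qed.

Lemma Ex_ge0 f : (forall x, 0 <= f x) -> 0 <= Ex f.
Proof. by move=> f0; exact: (@Rintegral_ge0 _ _ _ P setT). Qed.

Lemma Ex_abs f : intg f -> `|Ex f| <= Ex (fun x => `|f x|).
Proof. by move=> If; exact: (@le_normr_Rintegral _ _ _ P _ _ measurableT). Qed.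

Lemma Ex_abs_le f g : intg f -> intg g -> (forall x, `|f x| <= g x) -> `|Ex f| <= Ex g.
Proof.
move=> If Ig fg; rewrite (le_trans (Ex_abs If))// Ex_le//; exact: intg_abs.
Qed.

Lemma eq_Ex f g : (forall x, f x = g x) -> Ex f = Ex g.
Proof. by move=> fg; congr Ex; apply/funext. Qed.

Lemma intg_ge0 f (c : R) : measurable_fun setT f -> (forall x, 0 <= f x) ->
  (\int[P]_x (f x)%:E <= c%:E)%E -> intg f /\ Ex f <= c.
Proof.
move=> mf f0 fc.
have If : intg f.
  apply/integrableP; split; first exact/measurable_EFinP.
  under eq_integral => x _ do rewrite /= ger0_norm//.
  by rewrite (le_lt_trans fc)// ltry.
by split=> //; rewrite -lee_fin -Ex_EFin.
Qed.

Definition pr (A : set T) : R := fine (P A).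

Lemma pr_EFin A : measurable A -> P A = (pr A)%:E.
Proof. by move=> mA; rewrite /pr fineK// fin_num_measure. Qed.

Lemma pr_Ex A : measurable A -> pr A = Ex (\1_A).
Proof. by move=> mA; rewrite /Ex integral_indic// setIT. Qed.

Lemma pr_ge0 A : 0 <= pr A.
Proof. by rewrite fine_ge0. Qed.

Lemma pr_le1 A : measurable A -> pr A <= 1.
Proof. by move=> mA; rewrite -lee_fin -pr_EFin// probability_le1. Qed.

Lemma pr_le A B : measurable A -> measurable B -> A `<=` B -> pr A <= pr B.
Proof.
move=> mA mB AB; rewrite -lee_fin -!pr_EFin//.
by apply: le_measure => //; rewrite inE.
Qed.

Lemma pr_setU A B : measurable A -> measurable B -> pr (A `|` B) <= pr A + pr B.
Proof.
move=> mA mB; rewrite -lee_fin EFinD -!pr_EFin//; last exact: measurableU.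
exact: measureU2.
Qed.

Lemma pr_setC A : measurable A -> pr (~` A) = 1 - pr A.
Proof.
move=> mA; apply: EFin_inj; rewrite EFinB -!pr_EFin//; last exact: measurableC.
exact: probability_setC.
Qed.

Lemma intg_indic A : measurable A -> intg (\1_A).
Proof.
move=> mA; apply: (@intg_bounded _ 1); first exact: measurable_indic.
by move=> x; rewrite indicE; case: (_ \in _); rewrite ?normr1 ?normr0.
Qed.

Lemma markov_le f A c : intg f -> (forall x, 0 <= f x) -> measurable A ->
  0 < c -> (forall x, A x -> c <= f x) -> pr A <= Ex f / c.
Proof.
move=> If f0 mA c0 H; rewrite ler_pdivlMr// mulrC pr_Ex// -ExZ; last exact: intg_indic.
apply: Ex_le => //; first by apply: intgZ; exact: intg_indic.
move=> x; rewrite indicE; case: (boolP (x \in A)) => [|_]; last by rewrite mulr0.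
by rewrite inE mulr1; exact: H.
Qed.

(* Jensen for the square, by the tangent-line inequality. *)
Lemma Ex_sqr_le f : intg f -> intg (fun x => f x ^+ 2) -> Ex f ^+ 2 <= Ex (fun x => f x ^+ 2).
Proof.
move=> If I2; rewrite -subr_ge0.
have -> : Ex (fun x => f x ^+ 2) - Ex f ^+ 2 = Ex (fun x => (f x - Ex f) ^+ 2).
  rewrite [RHS](@eq_Ex _ (fun x => f x ^+ 2 - (2 * Ex f) * f x + Ex f ^+ 2)); last by move=> x; ring.
  rewrite ExD; [|by apply: intgB => //; exact: intgZ|exact: intg_cst].
  rewrite ExB//; last exact: intgZ.
  by rewrite ExZ// Ex_cst; ring.
by apply: Ex_ge0 => x; exact: sqr_ge0.
Qed.

End expectations.

Lemma Ex_le_int d (T : measurableType d) (R : realType) (P : probability T R) (f : T -> R) c :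
  intg P f -> Ex P f <= c -> (\int[P]_x (f x)%:E <= c%:E)%E.
Proof. by move=> If; rewrite Ex_EFin// lee_fin. Qed.

Section product_formula.
Context (R : realType) d (T : measurableType d) (n : nat).
Variables (F : probability T R) (Q : probability (n.-tuple T) R).
Hypothesis FQ : prodlike F Q.

Lemma measurable_tnth_comp d' (S : measurableType d') (i : 'I_n) (f : T -> S) :
  measurable_fun setT f -> measurable_fun setT (fun x : n.-tuple T => f (tnth x i)).
Proof. by move=> mf; exact: (measurableT_comp mf (measurable_tnth i)). Qed.

Lemma integral_tnth (i : 'I_n) (f : T -> \bar R) : measurable_fun setT f ->
  (forall x, (0 <= f x)%E) -> (\int[Q]_x f (tnth x i) = \int[F]_y f y)%E.
Proof.
move=> mf f0; rewrite (resample FQ i)//; last exact: measurable_tnth_comp.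
under eq_integral => x _ do under eq_integral => y _ do rewrite tnth_upd eqxx.
by rewrite integral_cst// [X in (_ * X)%E]probability_setT mule1.
Qed.

Lemma integral_tnth2 (i j : 'I_n) (f : T -> T -> \bar R) : i != j ->
  measurable_fun setT (fun z : T * T => f z.1 z.2) ->
  (forall x y, (0 <= f x y)%E) ->
  (\int[Q]_x f (tnth x i) (tnth x j) = \int[F]_y \int[F]_z f y z)%E.
Proof.
move=> ij mf f0.
have mfi : measurable_fun setT (fun x : n.-tuple T => f (tnth x i) (tnth x j)).
  apply: (@measurableT_comp _ _ _ _ _ _ (fun z : T * T => f z.1 z.2) _ (fun x => (tnth x i, tnth x j))) => //.
  by apply/measurable_fun_pair => /=; exact: measurable_tnth.
rewrite (resample FQ j)//.
under eq_integral => x _ do under eq_integral => y _ do rewrite !tnth_upd eqxx (negbTE ij).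
rewrite (@integral_tnth i (fun y => \int[F]_z f y z)%E)//.
  exact: (@measurable_fun_fubini_tonelli_F _ _ _ _ _ F _ mf).
by move=> x; exact: integral_ge0.
Qed.

Lemma integral_prod (r : seq 'I_n) (f : 'I_n -> T -> R) : uniq r ->
  (forall i, measurable_fun setT (f i)) -> (forall i x, 0 <= f i x) ->
  (\int[Q]_x (\prod_(i <- r) f i (tnth x i))%:E =
   \prod_(i <- r) \int[F]_y (f i y)%:E)%E.
Proof.
move=> + mf f0; elim: r => [|i r IH] /=.
  move=> _; under eq_integral => x _ do rewrite big_nil.
  by rewrite big_nil integral_cst// [X in (_ * X)%E]probability_setT mule1.
move=> /andP[ir ur]; rewrite big_cons -IH//.
have mp : measurable_fun setT (fun x : n.-tuple T => \prod_(j <- r) f j (tnth x j)).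
  apply: measurable_prod => j _; exact: measurable_tnth_comp.
have p0 (x : n.-tuple T) : 0 <= \prod_(j <- r) f j (tnth x j).
  by apply: prodr_ge0.
rewrite [LHS](resample FQ i); last 2 first.
- apply/measurable_EFinP.
  rewrite (_ : (fun x => _) = fun x => f i (tnth x i) * \prod_(j <- r) f j (tnth x j)).
    by apply: measurable_funM => //; exact: measurable_tnth_comp.
  by apply/funext => x; rewrite big_cons.
- by move=> x; rewrite lee_fin; apply: prodr_ge0.
rewrite -ge0_integralZl//; last 3 first.
- exact/measurable_EFinP.
- by move=> x _; rewrite lee_fin.
- by apply: integral_ge0 => y _; rewrite lee_fin.
apply: eq_integral => x _.
rewrite -ge0_integralZr//; last 3 first.
- exact/measurable_EFinP.
- by move=> y _; rewrite lee_fin.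
- by rewrite lee_fin.
apply: eq_integral => y _; rewrite big_cons tnth_upd eqxx -EFinM; congr (_ * _)%:E.
apply: eq_big_seq => j jr; rewrite tnth_upd; case: eqP => // ji.
by move: ir; rewrite -ji jr.
Qed.

End product_formula.

Lemma prodlike_unique (R : realType) d (T : measurableType d) n
    (F : probability T R) (Q1 Q2 : probability (n.-tuple T) R) :
  prodlike F Q1 -> prodlike F Q2 -> forall A, measurable A -> Q1 A = Q2 A.
Proof. by move=> H1 H2; apply: tuple_measure_unique => A mA; rewrite H1// H2. Qed.

Section measurable_levels.
Context d (T : measurableType d) (R : realType).

Lemma measurable_set_gt (f : T -> R) (u : R) :
  measurable_fun setT f -> measurable [set x | u < f x].
Proof.
move=> mf; rewrite (_ : [set x | u < f x] = f @^-1` `]u, +oo[%classic); last first.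
  by apply/seteqP; split => x /=; rewrite in_itv/= andbT.
by rewrite -[X in measurable X]setTI; exact: mf.
Qed.

Lemma measurable_set_le (f : T -> R) (u : R) :
  measurable_fun setT f -> measurable [set x | f x <= u].
Proof.
move=> mf; rewrite (_ : [set x | f x <= u] = f @^-1` `]-oo, u]%classic); last first.
  by apply/seteqP; split => x /=; rewrite in_itv.
by rewrite -[X in measurable X]setTI; exact: mf.
Qed.

Lemma measurable_fun_indic_gt (f : T -> R) (u : R) :
  measurable_fun setT f -> measurable_fun setT (fun x => (u < f x)%R%:R : R).
Proof.
move=> mf; rewrite (_ : (fun x => _) = \1_([set x | u < f x])).
  exact/measurable_indic/measurable_set_gt.
by apply/funext => x; rewrite indicE mem_setE.
Qed.

End measurable_levels.

(** * The sup norm over a finite index set *)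

Section supnorm.
Context (R : realType) (J : finType).
Implicit Types y z : J -> R.

Definition supn y : R := \big[Num.max/0]_j `|y j|.

Lemma supn_ge0 y : 0 <= supn y.
Proof. exact: bigmax_ge_id. Qed.

Lemma le_supn y j : `|y j| <= supn y.
Proof. exact: le_bigmax. Qed.

Lemma supn_le y (r : R) : 0 <= r -> (forall j, `|y j| <= r) -> supn y <= r.
Proof. by move=> r0 yr; apply: bigmax_le. Qed.

Lemma supn_triangle y z : supn (fun j => y j + z j) <= supn y + supn z.
Proof.
apply: supn_le => [|j]; first by rewrite addr_ge0// supn_ge0.
by rewrite (le_trans (ler_normD _ _))// lerD// le_supn.
Qed.

Lemma supn_scale (c : R) y : supn (fun j => c * y j) <= `|c| * supn y.
Proof.
apply: supn_le => [|j]; first by rewrite mulr_ge0// supn_ge0.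
by rewrite normrM ler_wpM2l// le_supn.
Qed.

Lemma supn_sum (I : Type) (r : seq I) (p : pred I) (y : I -> J -> R) :
  supn (fun j => \sum_(i <- r | p i) y i j) <= \sum_(i <- r | p i) supn (y i).
Proof.
apply: supn_le => [|j]; first by apply: sumr_ge0 => i _; exact: supn_ge0.
by rewrite (le_trans (ler_norm_sum _ _ _))// ler_sum// => i _; exact: le_supn.
Qed.

Lemma measurable_supn d (T : measurableType d) (xi : T -> J -> R) :
  (forall j, measurable_fun setT (fun x => xi x j)) ->
  measurable_fun setT (fun x => supn (xi x)).
Proof.
move=> mxi; rewrite /supn.
suff : forall r : seq J, measurable_fun setT (fun x => \big[Num.max/0]_(j <- r) `|xi x j|) by apply.
elim=> [|j r IH].
  rewrite (_ : (fun x => _) = cst 0); first exact: measurable_cst.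
  by apply/funext => x; rewrite big_nil.
rewrite (_ : (fun x => _) = fun x => Num.max `|xi x j| (\big[Num.max/0]_(j <- r) `|xi x j|)).
  by apply: measurable_maxr => //; exact: measurableT_comp.
by apply/funext => x; rewrite big_cons.
Qed.

End supnorm.

(** * Standard Gaussian vectors *)

Section density.
Import HBNNSimple.
Context d (T : measurableType d) (R : realType).
Variables (mu : {measure set T -> \bar R}) (nu : {measure set T -> \bar R}).
Variable g : T -> R.
Hypotheses (mg : measurable_fun setT g) (g0 : forall x, 0 <= g x).
Hypothesis nuE : forall A, measurable A -> nu A = (\int[mu]_(x in A) (g x)%:E)%E.

Lemma ge0_integral_density (f : T -> \bar R) :
  measurable_fun setT f -> (forall x, (0 <= f x)%E) ->
  (\int[nu]_x f x = \int[mu]_x (f x * (g x)%:E))%E.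
Proof.
move=> mf f0.
pose h : nat -> {nnsfun T >-> R} := nnsfun_approx measurableT mf.
have mgE : measurable_fun setT (EFin \o g) by exact/measurable_EFinP.
have -> : (\int[nu]_x f x = lim (\int[nu]_x (h n x)%:E @[n --> \oo]))%E.
  rewrite -monotone_convergence//.
  - by apply: eq_integral => x _; apply/esym/cvg_lim => //; exact: cvg_nnsfun_approx.
  - by move=> n; exact/measurable_EFinP.
  - by move=> n x _; rewrite lee_fin.
  - by move=> x _ a b ab; rewrite lee_fin; exact/lefP/nd_nnsfun_approx.
have -> : (\int[mu]_x (f x * (g x)%:E) =
   lim (\int[mu]_x ((h n x)%:E * (g x)%:E) @[n --> \oo]))%E.
  rewrite -monotone_convergence//.
  - apply: eq_integral => x _; apply/esym/cvg_lim => //.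
    by apply: cvgeZr => //; exact: cvg_nnsfun_approx.
  - by move=> n; apply: emeasurable_funM => //; exact/measurable_EFinP.
  - by move=> n x _; rewrite mule_ge0// lee_fin.
  - move=> x _ a b ab; rewrite lee_wpmul2r ?lee_fin//.
    exact/lefP/nd_nnsfun_approx.
congr (lim (_ @ \oo)); apply/funext => n.
transitivity (\int[nu]_x (\sum_(y \in range (h n))
   (y * \1_(h n @^-1` [set y]) x)%:E))%E.
  by apply: eq_integral => x _; rewrite /= fimfunE -fsumEFin.
rewrite ge0_integral_fsum//; last 2 first.
  - by move=> y; exact/measurable_EFinP/measurable_funM.
  - by move=> y x _; exact: nnfun_muleindic_ge0.
transitivity (\int[mu]_x (\sum_(y \in range (h n))
   ((y * \1_(h n @^-1` [set y]) x)%:E * (g x)%:E)))%E; last first.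
  apply: eq_integral => x _.
  rewrite -ge0_mule_fsuml; last by move=> y; exact: nnfun_muleindic_ge0.
  by rewrite fsumEFin// -fimfunE.
rewrite ge0_integral_fsum//; last 2 first.
  - move=> y; apply: emeasurable_funM => //.
    exact/measurable_EFinP/measurable_funM.
  - by move=> y x _; rewrite mule_ge0 ?lee_fin// -lee_fin nnfun_muleindic_ge0.
apply: eq_fsbigr => r rhn.
rewrite integralZl_indic_nnsfun// integral_indic// setIT nuE//.
under [RHS]eq_integral do rewrite EFinM -muleA.
rewrite ge0_integralZl//; last 3 first.
- by apply: emeasurable_funM => //; exact/measurable_EFinP.
- by move=> x _; rewrite mule_ge0 ?lee_fin.
- by move: rhn; rewrite inE => -[t _ <-]; rewrite lee_fin.
congr (_ * _)%E; rewrite integral_mkcond; apply: eq_integral => x _.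
rewrite patchE indicE; case: ifPn => _ /=; by rewrite ?mul1e ?mul0e.
Qed.

End density.

(** * Integrals against the normal law *)

Section normal_integrals.
Context (R : realType).
Implicit Types (m s x t : R) (f : R -> R).
Local Notation lam := (@lebesgue_measure R).
Local Notation N01 := (normal_prob (0 : R) 1).

Lemma ge0_integral_normal m s (f : R -> \bar R) :
  measurable_fun setT f -> (forall x, (0 <= f x)%E) ->
  (\int[normal_prob m s]_x f x = \int[lam]_x (f x * (normal_pdf m s x)%:E))%E.
Proof.
move=> mf f0; apply: ge0_integral_density => //.
- exact: measurable_normal_pdf.
- by move=> x; exact: normal_pdf_ge0.
Qed.

Lemma normal_pdf1E m x :
  normal_pdf m 1 x = normal_peak 1 * expR (- (x - m) ^+ 2 / 2).
Proof. by rewrite normal_pdfE ?oner_neq0// /normal_fun expr1n. Qed.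

Lemma measurable_normal_pdfE m s : measurable_fun setT (EFin \o normal_pdf m s).
Proof. by apply/measurable_EFinP; exact: measurable_normal_pdf. Qed.

Lemma normal_pdfE_ge0 m s x : (0 <= (normal_pdf m s x)%:E)%E.
Proof. by rewrite lee_fin normal_pdf_ge0. Qed.

(** Completing the square: [expR (t * x)] times the centred density is [expR (t^2 / 2)] times the
    density centred at [t]. *)
Lemma normal_mgf t : (\int[N01]_x (expR (t * x))%:E = (expR (t ^+ 2 / 2))%:E)%E.
Proof.
have m1 : measurable_fun setT (fun x : R => (expR (t * x))%:E).
  by apply/measurable_EFinP; apply: measurableT_comp.
have p1 x : (0 <= (expR (t * x))%:E)%E by rewrite lee_fin expR_ge0.
rewrite (ge0_integral_normal 0 1 m1 p1).
rewrite (_ : (fun x => _) = fun x =>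
  ((expR (t ^+ 2 / 2))%:E * (normal_pdf t 1 x)%:E)%E); last first.
  apply/funext => x; rewrite -!EFinM; congr EFin.
  rewrite !normal_pdf1E mulrCA [RHS]mulrCA; congr (_ * _).
  by rewrite -!expRD; congr expR; field.
rewrite ge0_integralZl ?lee_fin ?expR_ge0//.
- by rewrite integral_normal_pdf mule1.
- exact: measurable_normal_pdfE.
- by move=> x _; exact: normal_pdfE_ge0.
Qed.

(** By uniqueness of Lebesgue measure: [s] times its image under the affine map gives every
    half-open interval its length. *)
Lemma ge0_integral_lebesgue_affine s m (f : R -> \bar R) : 0 < s ->
  measurable_fun setT f -> (forall x, (0 <= f x)%E) ->
  (\int[lam]_x f (s * x + m)%R = (s^-1)%:E * \int[lam]_x f x)%E.
Proof.
move=> s0 mf f0.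
pose phi (x : measurableTypeR R) : measurableTypeR R := s * x + m.
have mphi : measurable_fun setT phi.
  by apply: measurable_funD => //; exact: mulrl_measurable.
pose nu := mscale (NngNum (ltW s0)) (pushforward lam phi).
have nuE (A : set (measurableTypeR R)) : measurable A -> lam A = nu mphi A.
  apply: lebesgue_measure_unique => _ [[a b] /= _ <-].
  pose a' := (a - m) / s; pose b' := (b - m) / s.
  transitivity (s%:E * lam `]a', b']%classic)%E.
    rewrite !lebesgue_measure_itv/= !lte_fin /a' /b' ltr_pM2r ?invr_gt0// ltrD2r.
    case: ifP => _; last by rewrite mule0.
    by rewrite -!EFinD -EFinM; congr EFin; field; rewrite gt_eqF.
  congr (_ * lam _)%E.
  by apply/seteqP; split => x /=; rewrite !in_itv/= /phi /a' /b';
    rewrite ltr_pdivrMr// ler_pdivlMr// ltrBlDr lerBrDr mulrC.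
have -> : (\int[lam]_x f x = \int[nu mphi]_x f x)%E.
  by apply: eq_measure_integral => A mA _; exact: nuE.
rewrite ge0_integral_mscale//= muleA -EFinM mulVf ?gt_eqF// mul1e.
by rewrite ge0_integral_pushforward.
Qed.

(* With c^2 + s^2 = 1 the joint density of (a, c a + s b) factors as the
   standard normal density of u = c a + s b times an N(c u, s) density in a. *)
Lemma normal_stable c s (f : R -> R) : c ^+ 2 + s ^+ 2 = 1 -> 0 < s ->
  measurable_fun setT f -> (forall x, 0 <= f x) ->
  (\int[N01]_a \int[N01]_b (f (c * a + s * b))%:E = \int[N01]_u (f u)%:E)%E.
Proof.
move=> cs s0 mf f0.
have sn0 : s != 0 by rewrite gt_eqF.
have pdfs m x : normal_pdf m s x =
    s^-1 * (normal_peak 1 * expR (- ((x - m) / s) ^+ 2 / 2)).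
  rewrite normal_pdfE// /normal_fun mulrA; congr (_ * expR _); last by field.
  rewrite /normal_peak expr1n -[in LHS]mulrnAr sqrtrM ?sqr_ge0//.
  by rewrite sqrtr_sqr gtr0_norm// invfM mul1r.
have mpdf : measurable_fun setT (fun z : R * R => normal_pdf (c * z.1) s z.2).
  rewrite (_ : (fun z => _) = fun z : R * R =>
    s^-1 * (normal_peak 1 * expR (- ((z.2 - c * z.1) / s) ^+ 2 / 2))); last first.
    by apply/funext => z; rewrite pdfs.
  apply: measurable_funM; first exact: measurable_cst.
  apply: measurable_funM; first exact: measurable_cst.
  apply: measurableT_comp => //.
  apply: measurable_funM; last exact: measurable_cst.
  apply: measurableT_comp => //.
  apply: measurable_funX.
  apply: measurable_funM; last exact: measurable_cst.
  apply: measurable_funB => //.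
  apply: measurable_funM => //.
have mfpdf : measurable_fun setT
    (fun z : R * R => (f z.2 * normal_pdf (c * z.1) s z.2)%:E).
  apply/measurable_EFinP/measurable_funM => //.
  exact: measurableT_comp.
have pfpdf (z : R * R) : (0 <= (f z.2 * normal_pdf (c * z.1) s z.2)%:E)%E.
  by rewrite lee_fin mulr_ge0// normal_pdf_ge0.
have inner a : (\int[N01]_b (f (c * a + s * b))%:E =
    \int[lam]_u (f u * normal_pdf (c * a) s u)%:E)%E.
  have m1 : measurable_fun setT (fun b : R => (f (c * a + s * b))%:E).
    apply/measurable_EFinP; apply: measurableT_comp => //.
    by apply: measurable_funD => //; apply: measurable_funM.
  have p1 b : (0 <= (f (c * a + s * b))%:E)%E by rewrite lee_fin.
  rewrite (ge0_integral_normal 0 1 m1 p1).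
  transitivity (\int[lam]_b (s%:E * (f (s * b + c * a) * normal_pdf (c * a) s (s * b + c * a))%:E))%E.
    apply: eq_integral => b _; rewrite -!EFinM; congr EFin.
    rewrite [s * b + _]addrC mulrCA; congr (_ * _).
    rewrite pdfs normal_pdf1E mulrA mulfV// mul1r; congr (_ * expR _).
    by field.
  have m2 : measurable_fun setT (fun u => (f u * normal_pdf (c * a) s u)%:E).
    exact: (measurableT_comp mfpdf (pair1_measurable a)).
  have p2 u : (0 <= (f u * normal_pdf (c * a) s u)%:E)%E by exact: (pfpdf (a, u)).
  have m3 : measurable_fun setT (fun b => (f (s * b + c * a) * normal_pdf (c * a) s (s * b + c * a))%:E).
    by apply: (measurableT_comp m2); apply: measurable_funD => //; exact: mulrl_measurable.
  rewrite ge0_integralZl// ?lee_fin ?ltW//.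
  rewrite (ge0_integral_lebesgue_affine (c * a) s0 m2 p2).
  by rewrite muleA -EFinM mulfV// mul1e.
transitivity (\int[N01]_a \int[lam]_u (f u * normal_pdf (c * a) s u)%:E)%E.
  by apply: eq_integral => a _; exact: inner.
have m2 : measurable_fun setT (fun a => \int[lam]_u (f u * normal_pdf (c * a) s u)%:E)%E.
  exact: (@measurable_fun_fubini_tonelli_F _ _ _ _ _ lam _ mfpdf pfpdf).
have p2 a : (0 <= \int[lam]_u (f u * normal_pdf (c * a) s u)%:E)%E.
  by apply: integral_ge0 => x _; exact: (pfpdf (a, x)).
rewrite (ge0_integral_normal 0 1 m2 p2).
have m3 : measurable_fun setT (EFin \o f) by exact/measurable_EFinP.
have p3 x : (0 <= (f x)%:E)%E by rewrite lee_fin.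
rewrite (ge0_integral_normal 0 1 m3 p3).
transitivity (\int[lam]_a \int[lam]_u
   ((f u * normal_pdf (c * a) s u)%:E * (normal_pdf 0 1 a)%:E))%E.
  apply: eq_integral => a _; rewrite ge0_integralZr//.
  - exact: (measurableT_comp mfpdf (pair1_measurable a)).
  - by move=> x _; exact: (pfpdf (a, x)).
  - exact: normal_pdfE_ge0.
rewrite (@fubini_tonelli _ _ _ _ _ lam lam (fun z =>
  (f z.2 * normal_pdf (c * z.1) s z.2)%:E * (normal_pdf 0 1 z.1)%:E)%E); last 2 first.
- apply: emeasurable_funM => //.
  exact: (@measurableT_comp _ _ _ _ _ _ _ _ fst (measurable_normal_pdfE 0 1)).
- by move=> z; rewrite mule_ge0// normal_pdfE_ge0.
apply: eq_integral => u _ /=.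
transitivity (\int[lam]_a ((f u)%:E * (normal_pdf 0 1 u)%:E * (normal_pdf (c * u) s a)%:E))%E.
  apply: eq_integral => a _; rewrite -!EFinM; congr EFin.
  rewrite -!mulrA; congr (_ * _).
  rewrite !pdfs !normal_pdf1E.
  set N := normal_peak 1.
  transitivity (N * N * s^-1 * expR (- ((u - c * a) / s) ^+ 2 / 2 + - (a - 0) ^+ 2 / 2)).
    by rewrite expRD; ring.
  transitivity (N * N * s^-1 * expR (- (u - 0) ^+ 2 / 2 + - ((a - c * u) / s) ^+ 2 / 2)).
    congr (_ * expR _).
    have -> : - ((u - c * a) / s) ^+ 2 / 2 + - (a - 0) ^+ 2 / 2 =
      - (u ^+ 2 - 2 * c * a * u + (c ^+ 2 + s ^+ 2) * a ^+ 2) / (2 * s ^+ 2) by field.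
    have -> : - (u - 0) ^+ 2 / 2 + - ((a - c * u) / s) ^+ 2 / 2 =
      - (a ^+ 2 - 2 * c * a * u + (c ^+ 2 + s ^+ 2) * u ^+ 2) / (2 * s ^+ 2) by field.
    by rewrite cs !mul1r; congr (- _ / _); ring.
  by rewrite expRD; ring.
rewrite ge0_integralZl ?integral_normal_pdf ?mule1//.
- exact: measurable_normal_pdfE.
- by move=> x _; exact: normal_pdfE_ge0.
- by rewrite -EFinM lee_fin mulr_ge0// normal_pdf_ge0.
Qed.

End normal_integrals.

Section std_normal.
Context (R : realType) (N : probability R R).
Local Notation N01 := (normal_prob (0 : R) 1).

Definition std_normal := forall A : set R, measurable A -> N A = N01 A.
Hypothesis NE : std_normal.

Lemma std_normal_integral (f : R -> \bar R) :
  measurable_fun setT f -> (forall x, (0 <= f x)%E) ->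
  (\int[N]_x f x = \int[N01]_x f x)%E.
Proof.
move=> mf f0.
(* [normal_prob] lives on [measurableTypeR R]; the identity map carries the integral from one
   measurable structure on the line to the other. *)
pose i (x : R) : measurableTypeR R := x.
have mi : measurable_fun setT i by move=> _ A mA; rewrite setTI.
have -> := esym (ge0_integral_pushforward mi N measurableT mf (fun y _ => f0 y)).
by apply: eq_measure_integral => A mA _; exact: NE.
Qed.

Lemma std_normal_mgf t : (\int[N]_x (expR (t * x))%:E = (expR (t ^+ 2 / 2))%:E)%E.
Proof.
rewrite -normal_mgf std_normal_integral//.
by apply/measurable_EFinP; apply: measurableT_comp.
Qed.

Lemma std_normal_stable c s (f : R -> R) : c ^+ 2 + s ^+ 2 = 1 -> 0 < s ->
  measurable_fun setT f -> (forall x, 0 <= f x) ->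
  (\int[N]_a \int[N]_b (f (c * a + s * b))%:E = \int[N]_u (f u)%:E)%E.
Proof.
move=> cs s0 mf f0.
have mE : measurable_fun setT (EFin \o f) by exact/measurable_EFinP.
rewrite [RHS]std_normal_integral// -(normal_stable cs s0 mf f0).
have m2 : measurable_fun setT (fun z : R * R => (f (c * z.1 + s * z.2))%:E).
  apply/measurable_EFinP; apply: measurableT_comp => //.
  by apply: measurable_funD; apply: measurable_funM.
rewrite std_normal_integral; last 2 first.
- by apply: (@measurable_fun_fubini_tonelli_F _ _ _ _ _ N _ m2) => z; rewrite lee_fin.
- by move=> a; apply: integral_ge0 => b _; rewrite lee_fin.
apply: eq_integral => a _; rewrite std_normal_integral//.
  exact: (measurableT_comp m2 (pair1_measurable a)).
by move=> x; rewrite lee_fin.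
Qed.

End std_normal.

Lemma EFin_prod (R : realType) (I : Type) (r : seq I) (p : pred I) (F : I -> R) :
  (\prod_(i <- r | p i) (F i)%:E = (\prod_(i <- r | p i) F i)%R%:E)%E.
Proof. by rewrite (big_morph EFin (@EFinM R) (erefl _)). Qed.

(** Replaces a passage to the limit: the expansion parameter [t] is divided out and sent to zero. It
    yields mean and variance from the moment generating function and the density bound in
    [spread]. *)
Lemma small_slope (R : realType) (e c t0 : R) : 0 < t0 ->
  (forall t, 0 < t <= t0 -> e <= t * c) -> e <= 0.
Proof.
move=> t00 H; rewrite leNgt; apply/negP => e0.
have c0 : 0 < c.
  have := H t0; rewrite t00 lexx => /(_ isT); move=> h.
  by rewrite -(pmulr_rgt0 _ t00) (lt_le_trans e0).
pose t := Num.min t0 (e / (2 * c)).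
have tp : 0 < t by rewrite lt_min t00 divr_gt0// mulr_gt0.
have /H : 0 < t <= t0 by rewrite tp ge_min lexx.
rewrite leNgt => /negP; apply.
apply: le_lt_trans (_ : e / (2 * c) * c < e); first by rewrite ler_wpM2r ?(ltW c0)// /t ge_min lexx orbT.
rewrite (_ : _ * c = e / 2); first lra.
by field; rewrite gt_eqF.
Qed.

(** * Moments read off a Gaussian moment generating function *)

Section mgf_moments.
Context d (T : measurableType d) (R : realType) (P : probability T R).
Variables (Z : T -> R) (v : R).
Hypotheses (mZ : measurable_fun setT Z) (v0 : 0 <= v).
Hypothesis mgf : forall t, (\int[P]_x (expR (t * Z x))%:E = (expR (t ^+ 2 * v / 2))%:E)%E.

Lemma measurable_expR_mul t : measurable_fun setT (fun x => expR (t * Z x)).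
Proof.
apply: measurableT_comp => //; apply: measurable_funM => //.
Qed.

Lemma mgf_intg t : intg P (fun x => expR (t * Z x)).
Proof.
have := @intg_ge0 _ _ _ P _ _ (measurable_expR_mul t) (fun x => expR_ge0 _).
by move=> /(_ (expR (t ^+ 2 * v / 2))); rewrite mgf lexx => -[].
Qed.

Lemma mgf_Ex t : Ex P (fun x => expR (t * Z x)) = expR (t ^+ 2 * v / 2).
Proof. by rewrite /Ex mgf. Qed.

Lemma expR_abs_le (t z : R) : expR (t * `|z|) <= expR (t * z) + expR (- t * z).
Proof.
have [z0|z0] := leP 0 z; first by rewrite ger0_norm// lerDl expR_ge0.
by rewrite ltr0_norm// mulrN mulNr lerDr expR_ge0.
Qed.

Let intg_sym t : intg P (fun x => expR (t * Z x) + expR (- t * Z x)).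
Proof. by apply: intgD; exact: mgf_intg. Qed.

Lemma mgf_abs_intg t : intg P (fun x => expR (t * `|Z x|)).
Proof.
apply: (intg_dom _ (intg_sym t)).
- by apply: measurableT_comp => //; apply: measurable_funM => //; exact: measurableT_comp.
- by move=> x; rewrite ger0_norm ?expR_ge0// expR_abs_le.
Qed.

Lemma mgf_abs_le t : Ex P (fun x => expR (t * `|Z x|)) <= 2 * expR (t ^+ 2 * v / 2).
Proof.
apply: le_trans (_ : Ex P (fun x => expR (t * Z x) + expR (- t * Z x)) <= _).
  by apply: Ex_le => // [|x]; [exact: mgf_abs_intg|exact: expR_abs_le].
by rewrite ExD ?mgf_Ex; [rewrite sqrrN; lra|exact: mgf_intg|exact: mgf_intg].
Qed.

Lemma powr_le_expR n (z : R) : 0 <= z -> z ^+ n.+1 <= n.+1`!%:R * expR z.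
Proof.
move=> z0; have := expR_ge1Dxn n z0.
have f0 : 0 < n.+1`!%:R :> R by rewrite ltr0n fact_gt0.
move=> h; have {}h : z ^+ n.+1 / n.+1`!%:R <= expR z by rewrite (le_trans _ h)// lerDr.
by move: h; rewrite ler_pdivrMr// mulrC.
Qed.

Lemma mgf_intg_pow n : intg P (fun x => Z x ^+ n.+1).
Proof.
apply: (intg_dom _ (intgZ n.+1`!%:R (mgf_abs_intg 1))); first exact: measurable_funX.
by move=> x; rewrite normrX mul1r powr_le_expR.
Qed.

Lemma mgf_intg1 : intg P Z.
Proof. exact: (mgf_intg_pow 0). Qed.

Let vt (t : R) : 0 < t <= (1 + v)^-1 -> t * v <= 1 /\ t <= 1.
Proof.
move=> /andP[t0 t1].
have v1 : 0 < 1 + v by rewrite ltr_pwDl.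
have ht : t * (1 + v) <= 1 by rewrite -ler_pdivlMr// mul1r.
have tv0 : 0 <= t * v by rewrite mulr_ge0// ltW.
by rewrite mulrDr mulr1 in ht; split; lra.
Qed.

Let t2v (t : R) : 0 < t <= (1 + v)^-1 -> 0 <= t ^+ 2 * v / 2 <= 2^-1.
Proof.
move=> t01; have [tv t1] := vt t01; have /andP[t0 _] := t01.
apply/andP; split; first by rewrite divr_ge0// mulr_ge0// sqr_ge0.
rewrite ler_pdivrMr// mulVf//.
by rewrite expr2 -mulrA mulr_ile1// ?mulr_ge0// ltW.
Qed.

Let iv0 : 0 < (1 + v)^-1.
Proof. by rewrite invr_gt0 ltr_pwDl. Qed.

(** [1 + t s E Z <= E expR (t s Z) = expR (t^2 v / 2) <= 1 + t^2 v]; divide by [t] and let it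
    vanish. The two signs [s] together give mean zero. *)
Let mgf_mean_ub (s : R) : s ^+ 2 = 1 -> s * Ex P Z <= 0.
Proof.
move=> s2; apply: (@small_slope _ _ v _ iv0) => t t01.
have h : 1 + (t * s) * Ex P Z <= expR ((t * s) ^+ 2 * v / 2).
  rewrite -mgf_Ex -ExZ; last exact: mgf_intg1.
  rewrite -[X in X + _](Ex_cst P 1) -ExD; last 2 first.
  - exact: intg_cst.
  - by apply: intgZ; exact: mgf_intg1.
  apply: Ex_le; [|exact: mgf_intg|by move=> x; exact: expR_ge1Dx].
  by apply: intgD; [exact: intg_cst|apply: intgZ; exact: mgf_intg1].
have /andP[t0 _] := t01.
rewrite -(ler_pM2l t0); rewrite exprMn s2 mulr1 in h.
have := expR_le1D2x (t2v t01) => h2.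
have := le_trans h h2; rewrite -mulrA expr2; lra.
Qed.

Lemma mgf_mean : Ex P Z = 0.
Proof.
have h1 := @mgf_mean_ub 1 (expr1n _ _).
have h2 := @mgf_mean_ub (- 1) (etrans (sqrrN 1) (expr1n _ _)).
by apply/eqP; rewrite eq_le; apply/andP; split; lra.
Qed.

(** Dominates [6 * E expR (2 |Z|)], the coefficient of [t^3] in the expansion of the moment
    generating function at zero. *)
Definition mgf_const : R := 6 * (2 * expR (2 ^+ 2 * v / 2)).

Lemma abs3_expR_le (t z : R) : 0 <= t <= 1 ->
  `|t * z| ^+ 3 * expR `|t * z| <= t ^+ 3 * (6 * expR (2 * `|z|)).
Proof.
move=> /andP[t0 t1]; rewrite normrM (ger0_norm t0) exprMn -mulrA ler_wpM2l ?exprn_ge0//.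
rewrite (_ : 2 * `|z| = `|z| + `|z|); last by ring.
rewrite expRD mulrA ler_pM ?exprn_ge0 ?expR_ge0//.
  exact: (@powr_le_expR 2 `|z|).
by rewrite ler_expR ler_piMl.
Qed.

(** Expand to second order both the expectation and the known value [expR (t^2 v / 2)]; their
    quadratic coefficients agree up to a remainder of order [t], which [small_slope] removes in
    either direction. *)
Lemma mgf_var : Ex P (fun x => Z x ^+ 2) = v.
Proof.
have I1 := mgf_intg1; have I2 := mgf_intg_pow 1.
have key t : 0 < t <= 1 ->
    `|expR (t ^+ 2 * v / 2) - 1 - t ^+ 2 / 2 * Ex P (fun x => Z x ^+ 2)| <= t ^+ 3 * mgf_const.
  move=> /andP[t0 t1].
  have E : expR (t ^+ 2 * v / 2) - 1 - t ^+ 2 / 2 * Ex P (fun x => Z x ^+ 2) =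
      Ex P (fun x => expR (t * Z x) - 1 - t * Z x - t ^+ 2 / 2 * Z x ^+ 2).
    rewrite ExB; [|by apply: intgB; [apply: intgB; [exact: mgf_intg|exact: intg_cst]|exact: intgZ]|exact: intgZ].
    rewrite ExB; [|by apply: intgB; [exact: mgf_intg|exact: intg_cst]|exact: intgZ].
    rewrite ExB; [|exact: mgf_intg|exact: intg_cst].
    by rewrite !ExZ// mgf_Ex Ex_cst mgf_mean mulr0 subr0.
  rewrite E; apply: le_trans (Ex_abs_le _ (intgZ (t ^+ 3) (intgZ 6 (mgf_abs_intg 2))) _) _.
  - apply: intgB; last exact: intgZ.
    by apply: intgB; [apply: intgB; [exact: mgf_intg|exact: intg_cst]|exact: intgZ].
  - move=> x; have := expR_taylor3 (t * Z x).
    rewrite exprMn mulrAC => /le_trans; apply.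
    by apply: abs3_expR_le; rewrite ltW.
  - have J := mgf_abs_intg 2.
    rewrite ExZ; last exact: intgZ.
    apply: ler_wpM2l; first by rewrite exprn_ge0// ltW.
    by rewrite ExZ// ler_wpM2l// mgf_abs_le.
have m0 : 0 <= mgf_const by rewrite !mulr_ge0// expR_ge0.
set e2 := Ex P _ in key *.
have ub : e2 - v <= 0.
  apply: (@small_slope _ _ (v ^+ 2 + 2 * mgf_const) _ iv0) => t t01.
  have [_ t1] := vt t01; have /andP[t0 _] := t01.
  have /andP[u0 u1] := t2v t01.
  have := key t; rewrite t0 t1 ler_norml => /(_ isT)/andP[k1 _].
  set u := t ^+ 2 * v / 2 in u0 u1 k1 *.
  have hu : expR u <= 1 + u + 2 * u ^+ 2.
    have h : 1 - u <= expR (- u) by exact: expR_ge1Dx.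
    rewrite -[u in expR u]opprK expRN.
    have p : 0 < 1 - u by lra.
    apply: le_trans (_ : (1 - u)^-1 <= _); first by rewrite lef_pV2 ?posrE ?expR_gt0.
    rewrite -(ler_pM2r p) mulVf ?gt_eqF//.
    have -> : (1 + u + 2 * u ^+ 2) * (1 - u) = 1 + u ^+ 2 * (1 - 2 * u) by ring.
    by rewrite lerDl mulr_ge0 ?sqr_ge0// subr_ge0; lra.
  have h1 : t ^+ 2 / 2 * (e2 - v) <= 2 * u ^+ 2 + t ^+ 3 * mgf_const.
    have -> : t ^+ 2 / 2 * (e2 - v) = t ^+ 2 / 2 * e2 - u by rewrite /u; field.
    lra.
  have t2 : 0 < t ^+ 2 / 2 by rewrite divr_gt0// exprn_gt0.
  rewrite -(ler_pM2l t2) (le_trans h1)//.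
  have -> : 2 * u ^+ 2 + t ^+ 3 * mgf_const = t ^+ 2 / 2 * (t * (t * v ^+ 2 + 2 * mgf_const)) by rewrite /u; field.
  rewrite ler_pM2l// ler_pM2l// lerD2r ler_piMl ?sqr_ge0//.
have lb : v - e2 <= 0.
  apply: (@small_slope _ _ (2 * mgf_const) _ iv0) => t t01.
  have [_ t1] := vt t01; have /andP[t0 _] := t01.
  have := key t; rewrite t0 t1 ler_norml => /(_ isT)/andP[_ k1].
  have hu := expR_ge1Dx (t ^+ 2 * v / 2).
  have h1 : t ^+ 2 / 2 * (v - e2) <= t ^+ 3 * mgf_const.
    have -> : t ^+ 2 / 2 * (v - e2) = t ^+ 2 * v / 2 - t ^+ 2 / 2 * e2 by field.
    lra.
  have t2 : 0 < t ^+ 2 / 2 by rewrite divr_gt0// exprn_gt0.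
  rewrite -(ler_pM2l t2) (le_trans h1)//.
  by have -> : t ^+ 3 * mgf_const = t ^+ 2 / 2 * (t * (2 * mgf_const)) by field.
by apply/eqP; rewrite eq_le; apply/andP; split; lra.
Qed.

Lemma mgf_abs3 : intg P (fun x => `|Z x| ^+ 3) /\
  Ex P (fun x => `|Z x| ^+ 3) <= 6 * (2 * expR (v / 2)).
Proof.
have I : intg P (fun x => `|Z x| ^+ 3).
  apply: (intg_dom _ (intgZ 6 (mgf_abs_intg 1))).
    by apply: measurable_funX; exact: measurableT_comp.
  by move=> x; rewrite ger0_norm ?exprn_ge0// mul1r (@powr_le_expR 2).
split=> //; apply: le_trans (_ : Ex P (fun x => 6 * expR (1 * `|Z x|)) <= _).
  by apply: Ex_le => //; [exact: intgZ (mgf_abs_intg 1)|move=> x; rewrite mul1r (@powr_le_expR 2)].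
rewrite ExZ ?ler_wpM2l//; last exact: mgf_abs_intg.
by rewrite (le_trans (mgf_abs_le 1))// expr1n mul1r.
Qed.

(** On [u < |Z|] multiply by [expR (|Z| - u) >= 1] and absorb the square into [2 expR |Z|]; what is
    left is the moment generating function at 2. *)
Lemma mgf_tail (u : R) : intg P (fun x => Z x ^+ 2 * (u < `|Z x|)%R%:R) /\
  Ex P (fun x => Z x ^+ 2 * (u < `|Z x|)%R%:R) <= 4 * expR (2 * v - u).
Proof.
have m : measurable_fun setT (fun x => Z x ^+ 2 * (u < `|Z x|)%R%:R).
  apply: measurable_funM; first exact: measurable_funX.
  by apply: measurable_fun_indic_gt; exact: measurableT_comp.
have le x : Z x ^+ 2 * (u < `|Z x|)%R%:R <= 2 * expR (- u) * expR (2 * `|Z x|).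
  case: ltP => h; last by rewrite mulr0 !mulr_ge0 ?expR_ge0.
  rewrite mulr1 -(real_normK (num_real _)).
  rewrite (_ : 2 * expR (- u) * _ = 2 * expR `|Z x| * expR (`|Z x| - u)); last first.
    by rewrite -!mulrA; congr (_ * _); rewrite -!expRD; congr expR; ring.
  apply: le_trans (_ : 2 * expR `|Z x| * 1 <= _).
    by rewrite mulr1; exact: (@powr_le_expR 1).
  rewrite ler_wpM2l ?mulr_ge0 ?expR_ge0// -expR0 ler_expR subr_ge0 ltW//.
have J := intgZ (2 * expR (- u)) (mgf_abs_intg 2).
have I : intg P (fun x => Z x ^+ 2 * (u < `|Z x|)%R%:R).
  by apply: (intg_dom m J) => x; rewrite ger0_norm// mulr_ge0// sqr_ge0.
split=> //; apply: (le_trans (Ex_le I J le)).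
rewrite ExZ; last exact: mgf_abs_intg.
apply: le_trans (_ : 2 * expR (- u) * (2 * expR (2 ^+ 2 * v / 2)) <= _).
  by rewrite ler_wpM2l ?mgf_abs_le// mulr_ge0 ?expR_ge0.
rewrite (_ : _ * _ = 4 * (expR (- u) * expR (2 ^+ 2 * v / 2))); last by ring.
rewrite -expRD ler_wpM2l// ler_expR; lra.
Qed.

End mgf_moments.

(** * Linear forms in independent standard normals *)

Section gaussian_tuple.
Context (R : realType) (n : nat) (N : probability R R) (G : probability (n.-tuple R) R).
Hypotheses (NE : std_normal N) (NG : prodlike N G).

Definition linf (a : 'I_n -> R) (e : n.-tuple R) : R := \sum_i a i * tnth e i.

Lemma measurable_linf a : measurable_fun setT (linf a).
Proof.
apply: measurable_sum => i; apply: measurable_funM => //.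
exact: measurable_tnth.
Qed.

Lemma linf_mgf a t : (\int[G]_e (expR (t * linf a e))%:E =
  (expR (t ^+ 2 * (\sum_i a i ^+ 2) / 2))%:E)%E.
Proof.
transitivity (\int[G]_e (\prod_(i <- index_enum 'I_n) expR ((t * a i) * tnth e i))%:E)%E.
  apply: eq_integral => e _; rewrite /linf mulr_sumr expR_sum; congr EFin.
  by apply: eq_bigr => i _; rewrite mulrA.
rewrite (@integral_prod _ _ _ _ _ _ NG (index_enum _) (fun i y => expR (t * a i * y)))//.
- rewrite (eq_bigr (fun i => (expR ((t * a i) ^+ 2 / 2))%:E)); last first.
    by move=> i _; rewrite (std_normal_mgf NE).
  rewrite EFin_prod -expR_sum; congr (expR _)%:E.
  by rewrite mulr_sumr mulr_suml; apply: eq_bigr => i _; rewrite exprMn.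
- exact: index_enum_uniq.
- by move=> i; apply: measurableT_comp.
Qed.

Let s0 (a : 'I_n -> R) : 0 <= \sum_i a i ^+ 2.
Proof. by apply: sumr_ge0 => i _; exact: sqr_ge0. Qed.

Lemma linf_intg_pow a k : intg G (fun e => linf a e ^+ k.+1).
Proof. exact: mgf_intg_pow (measurable_linf a) (linf_mgf a) k. Qed.

Lemma linf_mean a : Ex G (linf a) = 0.
Proof. exact: mgf_mean (measurable_linf a) (s0 a) (linf_mgf a). Qed.

Lemma linf_var a : Ex G (fun e => linf a e ^+ 2) = \sum_i a i ^+ 2.
Proof. exact: mgf_var (measurable_linf a) (s0 a) (linf_mgf a). Qed.

Lemma linf_cov_intg a b : intg G (fun e => linf a e * linf b e).
Proof.
rewrite (_ : (fun e => _) = fun e => 4^-1 * (linf (fun i => a i + b i) e ^+ 2 - linf (fun i => a i - b i) e ^+ 2)).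
  by apply: intgZ; apply: intgB; exact: linf_intg_pow.
apply/funext => e.
have -> : linf (fun i => a i + b i) e = linf a e + linf b e.
  by rewrite /linf -big_split; apply: eq_bigr => i _; rewrite mulrDl.
have -> : linf (fun i => a i - b i) e = linf a e - linf b e.
  by rewrite /linf -sumrB; apply: eq_bigr => i _; rewrite mulrBl.
by field.
Qed.

(** Polarisation of [linf_var], since both the sum and the difference of two linear forms are linear
    forms. *)
Lemma linf_cov a b : Ex G (fun e => linf a e * linf b e) = \sum_i a i * b i.
Proof.
rewrite (@eq_Ex _ _ _ _ _ (fun e => 4^-1 * (linf (fun i => a i + b i) e ^+ 2 - linf (fun i => a i - b i) e ^+ 2))).
  rewrite ExZ; last by apply: intgB; exact: linf_intg_pow.
  rewrite ExB; [|exact: linf_intg_pow|exact: linf_intg_pow].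
  by rewrite !linf_var -sumrB mulr_sumr; apply: eq_bigr => i _; field.
move=> e.
have -> : linf (fun i => a i + b i) e = linf a e + linf b e.
  by rewrite /linf -big_split; apply: eq_bigr => i _; rewrite mulrDl.
have -> : linf (fun i => a i - b i) e = linf a e - linf b e.
  by rewrite /linf -sumrB; apply: eq_bigr => i _; rewrite mulrBl.
by field.
Qed.

Definition comb (c s : R) (e e' : n.-tuple R) : n.-tuple R :=
  [tuple c * tnth e i + s * tnth e' i | i < n].

Lemma linf_comb a c s e e' : linf a (comb c s e e') = c * linf a e + s * linf a e'.
Proof.
rewrite /linf !mulr_sumr -big_split; apply: eq_bigr => i _ /=.
by rewrite tnth_mktuple; ring.
Qed.

Lemma measurable_comb c s :
  measurable_fun setT (fun z : n.-tuple R * n.-tuple R => comb c s z.1 z.2).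
Proof.
apply/measurable_fun_tnthP => i.
rewrite (_ : _ \o _ = fun z : n.-tuple R * n.-tuple R => c * tnth z.1 i + s * tnth z.2 i); last first.
  by apply/funext => z /=; rewrite tnth_mktuple.
apply: measurable_funD; apply: measurable_funM => //.
  exact: (@measurableT_comp _ _ _ _ _ _ (fun x => tnth x i) _ fst (measurable_tnth i)).
exact: (@measurableT_comp _ _ _ _ _ _ (fun x => tnth x i) _ snd (measurable_tnth i)).
Qed.

(** Checked on rectangles, where integrating over both copies factorises over coordinates and each
    factor is the one-dimensional stability. *)
Lemma gaussian_stable c s (f : n.-tuple R -> \bar R) : c ^+ 2 + s ^+ 2 = 1 -> 0 < s ->
  measurable_fun setT f -> (forall x, (0 <= f x)%E) ->
  (\int[G]_e \int[G]_e' f (comb c s e e') = \int[G]_e f e)%E.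
Proof.
move=> cs s0' mf f0.
pose cb (z : n.-tuple R * n.-tuple R) := comb c s z.1 z.2.
pose cbm : {mfun _ >-> _} := HB.pack_for {mfun _ >-> _} cb (isMeasurableFun.Build _ _ _ _ cb (measurable_comb c s)).
pose Q := distribution (G \x G : probability _ _)%E cbm.
rewrite -(@fubini_tonelli1 _ _ _ _ _ G G (fun z => f (comb c s z.1 z.2)))//; last first.
  by apply: measurableT_comp => //; exact: measurable_comb.
have <- := @ge0_integral_distribution _ _ _ _ _ (G \x G : probability _ _)%E cbm f mf f0.
apply: eq_measure_integral => B mB _; apply: (@prodlike_unique _ _ _ _ N) => //.
move=> A mA; rewrite /distribution /pushforward.
have mS i : measurable [set z : R * R | A i (c * z.1 + s * z.2)].
  rewrite -[X in measurable X]setTI.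
  apply: (_ : measurable_fun setT (fun z : R * R => c * z.1 + s * z.2)) => //.
  by apply: measurable_funD; apply: measurable_funM.
(* The probability, over the second copy alone, that coordinate [i] of the combination falls into
   [A i]. *)
pose psi i y := pr N [set y' | A i (c * y + s * y')].
have mA1 i y : measurable [set y' | A i (c * y + s * y')].
  have := measurable_xsection y (mS i).
  by rewrite (_ : xsection _ _ = [set y' | A i (c * y + s * y')])//;
    apply/seteqP; split => z; rewrite /xsection/= ?inE.
have psiE i y : (psi i y)%:E = (\int[N]_y' (\1_(A i) (c * y + s * y')%R : R)%:E)%E.
  rewrite -pr_EFin// (@eq_integral _ _ _ N setT
    (fun y' => (\1_([set y' | A i (c * y + s * y')]) y')%:E)).
    by rewrite integral_indic// setIT.
  by move=> y' _; rewrite !indicE; congr (_%:R%:E); apply/idP/idP; rewrite !inE.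
have mpsi i : measurable_fun setT (psi i).
  apply: (@measurableT_comp _ _ _ _ _ _ fine).
    exact: (fine_measurable measurableT).
  rewrite (_ : (fun x => _) = (fun y => N (xsection [set z : R * R | A i (c * z.1 + s * z.2)] y))).
    exact: measurable_fun_xsection.
  apply/funext => y; congr (N _); apply/seteqP; split => z; rewrite /xsection/= ?inE//.
transitivity (\int[G]_e (\prod_(i <- index_enum 'I_n) psi i (tnth e i))%:E)%E.
  transitivity (\int[G]_e G (xsection (cb @^-1` rect A) e))%E; first by [].
  apply: eq_integral => e _.
  rewrite -EFin_prod.
  transitivity (G (rect (fun i => [set y' | A i (c * tnth e i + s * y')]))).
    congr (G _); apply/seteqP; split => z; rewrite /xsection/= ?inE /=.
      by move=> H i; have := H i; rewrite /cb tnth_mktuple.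
    by move=> H i; rewrite /cb tnth_mktuple; exact: H.
  rewrite NG//; apply: eq_bigr => i _; rewrite pr_EFin//.
rewrite (@integral_prod _ _ _ _ _ _ NG (index_enum _) psi)//.
- apply: eq_bigr => i _.
  under eq_integral => y _ do rewrite psiE.
  have mi : measurable_fun setT (\1_(A i) : R -> R) by exact: measurable_indic.
  have i0 u : 0 <= (\1_(A i) : R -> R) u by rewrite indicE.
  rewrite (std_normal_stable NE cs s0' mi i0).
  by rewrite integral_indic// setIT.
- exact: index_enum_uniq.
- by move=> i y; exact: pr_ge0.
Qed.

End gaussian_tuple.

Lemma normal_shift (R : realType) (A : set R) : measurable A ->
  normal_prob (1 : R) 1 ((fun x => x - 1) @^-1` A) = normal_prob (0 : R) 1 A.
Proof.
move=> mA; rewrite /normal_prob integral_mkcond [RHS]integral_mkcond.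
pose f (u : R) : \bar R := ((EFin \o normal_pdf 0 1) \_ A) u.
have mf : measurable_fun setT f.
  apply/(measurable_restrictT _ _).1 => //.
  by apply: measurable_funTS; exact: measurable_normal_pdfE.
have f0 u : (0 <= f u)%E by rewrite /f patchE; case: ifP => // _; exact: normal_pdfE_ge0.
have := @ge0_integral_lebesgue_affine R 1 (- 1) f ltr01 mf f0.
rewrite invr1 mul1e => <-; apply: eq_integral => x _.
rewrite /f !patchE mul1r.
rewrite (_ : (x \in (fun x : R => x - 1) @^-1` A) = (x - 1 \in A)); last first.
  by apply/idP/idP; rewrite !inE.
by case: ifP => // _; rewrite /= !normal_pdf1E subr0.
Qed.

(** * Derivatives of the soft maximum *)

Lemma young3 (R : realType) (u v : R) : 0 <= u -> 0 <= v ->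
  u * v ^+ 2 <= u ^+ 3 / 3 + 2 * v ^+ 3 / 3.
Proof.
move=> u0 v0; rewrite -subr_ge0.
rewrite (_ : _ - _ = (u - v) ^+ 2 * (u + 2 * v) / 3); last by field.
by rewrite divr_ge0// mulr_ge0 ?sqr_ge0// addr_ge0// mulr_ge0.
Qed.

Section tilted_moments.
Context (R : realType) (J : finType).
Implicit Types (a y : J -> R) (s : R).

(** For [k = 0] this is the partition function along the line in direction [y], and raising [k]
    differentiates in [s]. Thus [tmom] are the moments of [y] under the Gibbs weights [tw]. *)
Definition tsum a y k s : R := \sum_j a j * y j ^+ k * expR (s * y j).
Definition tmom a y k s : R := tsum a y k s / tsum a y 0 s.

Lemma is_derive_tsum a y k : derives (tsum a y k) (tsum a y k.+1).
Proof.
move=> s; apply: is_derive_bigsum => j.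
apply: (@is_derive_val _ _ _ (a j * y j ^+ k * (expR (s * y j) * (1 * y j + s * 0)))).
  by rewrite exprS; ring.
by apply: is_derive_mulc; apply: is_derive_comp; exact: (@is_derive_mul _ id (cst (y j))).
Qed.

Variables (a y : J -> R).
Hypothesis a0 : forall j, 0 <= a j.
Hypothesis ap : exists j, 0 < a j.

Lemma tsum0_gt0 s : 0 < tsum a y 0 s.
Proof.
have [j aj] := ap; rewrite /tsum (bigD1 j)//= ltr_pwDl//.
  by rewrite expr0 mulr1 mulr_gt0// expR_gt0.
by apply: sumr_ge0 => i _; rewrite expr0 mulr1 mulr_ge0// expR_ge0.
Qed.

Lemma is_derive_tmom k : derives (tmom a y k)
  (fun s => tmom a y k.+1 s - tmom a y k s * tmom a y 1 s).
Proof.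
move=> s; have S0 := tsum0_gt0 s; have Sn0 : tsum a y 0 s != 0 by rewrite gt_eqF.
have dV := @is_deriveV R (tsum a y 0) s _ 1 Sn0 (is_derive_tsum a y 0 s).
apply: is_derive_val (is_derive_mul (is_derive_tsum a y k s) dV).
rewrite /tmom /GRing.scale/=; field.
by rewrite Sn0.
Qed.

Lemma is_derive_lntsum : derives (fun s => ln (tsum a y 0 s)) (tmom a y 1).
Proof.
move=> s; have S0 := tsum0_gt0 s.
apply: is_derive_val (is_derive_comp (is_derive1_ln S0) (is_derive_tsum a y 0 s)).
by rewrite /tmom mulrC.
Qed.

Definition tw s j : R := a j * expR (s * y j) / tsum a y 0 s.

Lemma tw_ge0 s j : 0 <= tw s j.
Proof. by rewrite divr_ge0 ?mulr_ge0 ?expR_ge0// ltW// tsum0_gt0. Qed.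

Lemma tw_sum1 s : \sum_j tw s j = 1.
Proof.
rewrite -mulr_suml (eq_bigr (fun j => a j * y j ^+ 0 * expR (s * y j))).
  by rewrite mulfV// gt_eqF// tsum0_gt0.
by move=> j _; rewrite expr0 mulr1.
Qed.

Lemma tmomE k s : tmom a y k s = \sum_j tw s j * y j ^+ k.
Proof. by rewrite /tmom mulr_suml; apply: eq_bigr => j _; rewrite /tw; ring. Qed.

Definition tabs3 s : R := \sum_j tw s j * `|y j| ^+ 3.

Lemma tabs3_ge0 s : 0 <= tabs3 s.
Proof. by apply: sumr_ge0 => j _; rewrite mulr_ge0 ?tw_ge0 ?exprn_ge0. Qed.

Let A1 s : R := \sum_j tw s j * `|y j|.

Let A1_ge0 s : 0 <= A1 s.
Proof. by apply: sumr_ge0 => j _; rewrite mulr_ge0 ?tw_ge0. Qed.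

Let norm_m1 s : `|tmom a y 1 s| <= A1 s.
Proof.
rewrite tmomE (le_trans (ler_norm_sum _ _ _))// ler_sum// => j _.
by rewrite expr1 normrM (ger0_norm (tw_ge0 _ _)).
Qed.

Let m2_ge0 s : 0 <= tmom a y 2 s.
Proof. by rewrite tmomE sumr_ge0// => j _; rewrite mulr_ge0 ?tw_ge0// sqr_ge0. Qed.

(* Chebyshev-type product bound via x y^2 <= (x^3 + 2 y^3) / 3. *)
Let A1m2 s : A1 s * tmom a y 2 s <= tabs3 s.
Proof.
rewrite tmomE /A1 mulr_suml.
apply: le_trans (_ : \sum_i \sum_j tw s i * tw s j * (`|y i| ^+ 3 / 3 + 2 * `|y j| ^+ 3 / 3) <= _).
  apply: ler_sum => i _; rewrite mulr_sumr; apply: ler_sum => j _.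
  rewrite -(real_normK (num_real (y j))) mulrACA.
  by apply: ler_wpM2l; [rewrite mulr_ge0// tw_ge0|exact: young3].
rewrite le_eqVlt; apply/orP; left; apply/eqP.
transitivity (\sum_i (tw s i * `|y i| ^+ 3 / 3 + tw s i * (2 * tabs3 s / 3))).
  apply: eq_bigr => i _.
  transitivity (\sum_j ((tw s i * `|y i| ^+ 3 / 3) * tw s j +
      tw s i * (2 / 3) * (tw s j * `|y j| ^+ 3))).
    by apply: eq_bigr => j _; field.
  by rewrite big_split/= -mulr_sumr tw_sum1 mulr1 -mulr_sumr; congr (_ + _); rewrite /tabs3; field.
have e1 : \sum_i tw s i * `|y i| ^+ 3 / 3 = tabs3 s / 3 by rewrite /tabs3 mulr_suml.
have e2 (c : R) : \sum_i tw s i * c = c by rewrite -mulr_suml tw_sum1 mul1r.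
by rewrite big_split/= e1 e2; field.
Qed.

Let A1sq s : A1 s ^+ 2 <= tmom a y 2 s.
Proof.
rewrite tmomE -subr_ge0.
have -> : \sum_j tw s j * y j ^+ 2 - A1 s ^+ 2 = \sum_j tw s j * (`|y j| - A1 s) ^+ 2.
  transitivity (\sum_j (tw s j * y j ^+ 2 + (- 2 * A1 s) * (tw s j * `|y j|) + A1 s ^+ 2 * tw s j)).
    rewrite !big_split/= -!mulr_sumr tw_sum1 -/(A1 s); ring.
  apply: eq_bigr => j _; rewrite -(real_normK (num_real (y j))); ring.
by apply: sumr_ge0 => j _; rewrite mulr_ge0 ?tw_ge0// sqr_ge0.
Qed.

Lemma m1_cube s : `|tmom a y 1 s| ^+ 3 <= tabs3 s.
Proof.
apply: le_trans (_ : A1 s ^+ 3 <= _).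
  by rewrite lerXn2r ?nnegrE.
apply: le_trans (A1m2 s).
by rewrite exprS; apply: ler_wpM2l => //; exact: A1sq.
Qed.

Lemma m1m2 s : `|tmom a y 1 s| * tmom a y 2 s <= tabs3 s.
Proof. by apply: le_trans (A1m2 s); rewrite ler_wpM2r. Qed.

Lemma m3_le s : `|tmom a y 3 s| <= tabs3 s.
Proof.
rewrite tmomE (le_trans (ler_norm_sum _ _ _))// ler_sum// => j _.
by rewrite normrM (ger0_norm (tw_ge0 _ _)) normrX.
Qed.

Lemma m1sq_le_m2 s : tmom a y 1 s ^+ 2 <= tmom a y 2 s.
Proof.
rewrite -(real_normK (num_real _)) (le_trans _ (A1sq s))//.
by rewrite lerXn2r ?nnegrE.
Qed.

Definition tvar s := tmom a y 2 s - tmom a y 1 s ^+ 2.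

Lemma tvar_ge0 s : 0 <= tvar s. Proof. by rewrite subr_ge0 m1sq_le_m2. Qed.

(** The third cumulant of [y] under the Gibbs weights, that is the third derivative of the
    log-partition function; [tvar] is the second. *)
Definition tcum3 s := tmom a y 3 s - 3 * tmom a y 1 s * tmom a y 2 s + 2 * tmom a y 1 s ^+ 3.

Lemma is_derive_tvar : derives tvar tcum3.
Proof.
move=> s; apply: (@is_derive_val _ _ _ (tmom a y 3 s - tmom a y 2 s * tmom a y 1 s
   + - ((2%:R * tmom a y 1 s ^+ 1) * (tmom a y 2 s - tmom a y 1 s * tmom a y 1 s)))).
  by rewrite /tcum3; ring.
apply: is_derive_add; first exact: is_derive_tmom.
apply: is_deriveN; apply: (is_derive_comp (is_derive_expn 2 _)).
exact: is_derive_tmom.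
Qed.

Lemma tcum3_le s : `|tcum3 s| <= 6 * tabs3 s.
Proof.
rewrite /tcum3.
apply: le_trans (ler_normD _ _) _; rewrite (le_trans (lerD (ler_normB _ _) (lexx _)))//.
have -> : `|3 * tmom a y 1 s * tmom a y 2 s| = 3 * (`|tmom a y 1 s| * tmom a y 2 s).
  by rewrite -mulrA normrM normrM (ger0_norm (m2_ge0 s)) (ger0_norm (ler0n _ 3)).
have -> : `|2 * tmom a y 1 s ^+ 3| = 2 * `|tmom a y 1 s| ^+ 3.
  by rewrite normrM normrX (ger0_norm (ler0n _ 2)).
have := m3_le s; have := m1m2 s; have := m1_cube s; lra.
Qed.

(** A move of size at most one changes the numerator and the partition function by a factor at most
    [e] each. It allows the Taylor remainder at an intermediate point to be evaluated at the
    starting point, where the weights do not depend on the increment. *)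
Lemma tw_stable s j : (forall i, `|y i| <= 1) -> 0 <= s <= 1 ->
  tw s j <= expR 2 * tw 0 j.
Proof.
move=> y1 /andP[s0 s1].
have sy i : `|s * y i| <= 1.
  by rewrite normrM ger0_norm// -[leRHS]mulr1 ler_pM// y1.
have h0 : 0 < tsum a y 0 0 by exact: tsum0_gt0.
have hs : 0 < tsum a y 0 s by exact: tsum0_gt0.
have hS : expR (- 1) * tsum a y 0 0 <= tsum a y 0 s.
  rewrite /tsum mulr_sumr; apply: ler_sum => i _.
  rewrite expr0 !mulr1 mul0r expR0 mulr1 mulrC ler_wpM2l// ler_expR.
  by have := sy i; rewrite ler_norml => /andP[].
rewrite /tw mul0r expR0 mulr1 mulrA ler_pdivrMr//.
rewrite mulrAC ler_pdivlMr//.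
have -> : (2 : R) = 1 + 1 by ring.
rewrite expRD.
have h1 : a j * expR (s * y j) <= a j * expR 1.
  rewrite ler_wpM2l// ler_expR.
  by have := sy j; rewrite ler_norml => /andP[].
apply: le_trans (_ : a j * expR 1 * tsum a y 0 0 <= _).
  by rewrite ler_wpM2r// ltW.
have -> : expR 1 * expR 1 * a j * tsum a y 0 s = a j * expR 1 * (expR 1 * tsum a y 0 s) by ring.
rewrite ler_wpM2l ?mulr_ge0 ?expR_ge0//.
have e1 : expR 1 * expR (- 1) = 1 :> R by rewrite -expRD subrr expR0.
have := ler_wpM2l (expR_ge0 1) hS.
by rewrite mulrA e1 mul1r.
Qed.

Lemma tabs3_stable s : (forall i, `|y i| <= 1) -> 0 <= s <= 1 ->
  tabs3 s <= expR 2 * tabs3 0.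
Proof.
move=> y1 s01; rewrite /tabs3 mulr_sumr; apply: ler_sum => j _.
by rewrite mulrA ler_wpM2r ?exprn_ge0// tw_stable.
Qed.

Lemma lntsum_lip s (r : R) : (forall i, `|y i| <= r) -> 0 <= s <= 1 ->
  `|ln (tsum a y 0 s) - ln (tsum a y 0 0)| <= r.
Proof.
move=> yr /andP[s0 s1]; have [c _ ->] := mvt is_derive_lntsum s0.
rewrite subr0 normrM -[leRHS]mulr1 ler_pM//; last by rewrite ger0_norm.
rewrite (le_trans (norm_m1 c))//.
rewrite -[leRHS]mul1r -(tw_sum1 c) mulr_suml ler_sum// => j _.
by rewrite ler_wpM2l ?tw_ge0.
Qed.

Variables (l tau : R).
Hypothesis l1 : 1 <= l.

Let l0 : 0 < l. Proof. exact: lt_le_trans l1. Qed.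

(* The cutoff of the rescaled log-partition function, which is the smooth
   surrogate of the indicator of a half-line of the maximum. *)
Definition smoothind s := cutoff (ln (tsum a y 0 s) / l - tau).
Let arg s := ln (tsum a y 0 s) / l - tau.
Definition smoothind1 s := cutoff1 (arg s) * (tmom a y 1 s / l).
Definition smoothind2 s := cutoff2 (arg s) * (tmom a y 1 s / l) ^+ 2
  + cutoff1 (arg s) * (tvar s / l).
Definition smoothind3 s := cutoff3 (arg s) * (tmom a y 1 s / l) ^+ 3
  + 3 * cutoff2 (arg s) * (tmom a y 1 s / l) * (tvar s / l)
  + cutoff1 (arg s) * (tcum3 s / l).

Let darg s : is_derive s (1 : R) arg (tmom a y 1 s / l).
Proof.
apply: is_derive_addc; rewrite [_ / l]mulrC.
rewrite (_ : (fun s => _) = fun s => l^-1 * ln (tsum a y 0 s)); last first.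
  by apply/funext => r; rewrite mulrC.
by apply: is_derive_mulc; exact: is_derive_lntsum.
Qed.

Let dm1l : derives (fun s => tmom a y 1 s / l) (fun s => tvar s / l).
Proof.
move=> s; rewrite [_ / l]mulrC.
rewrite (_ : (fun s => _) = fun s => l^-1 * tmom a y 1 s); last first.
  by apply/funext => r; rewrite mulrC.
by apply: is_derive_mulc; rewrite /tvar expr2; exact: is_derive_tmom.
Qed.

Let dvarl : derives (fun s => tvar s / l) (fun s => tcum3 s / l).
Proof.
move=> s; rewrite [_ / l]mulrC.
rewrite (_ : (fun s => _) = fun s => l^-1 * tvar s); last first.
  by apply/funext => r; rewrite mulrC.
by apply: is_derive_mulc; exact: is_derive_tvar.
Qed.

Lemma derives_smoothind : derives smoothind smoothind1.
Proof.
by move=> s; exact: (is_derive_comp (derives_cutoff _) (darg s)).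
Qed.

Lemma derives_smoothind1 : derives smoothind1 smoothind2.
Proof.
move=> s.
apply: is_derive_val (is_derive_mul
  (is_derive_comp (derives_cutoff1 _) (darg s)) (dm1l s)).
by rewrite /smoothind2; ring.
Qed.

Lemma derives_smoothind2 : derives smoothind2 smoothind3.
Proof.
move=> s.
apply: is_derive_val (is_derive_add
  (is_derive_mul (is_derive_comp (derives_cutoff2 _) (darg s))
    (is_derive_comp (is_derive_expn 2 _) (dm1l s)))
  (is_derive_mul (is_derive_comp (derives_cutoff1 _) (darg s)) (dvarl s))).
by rewrite /smoothind3; ring.
Qed.

Let C := @cutoff_const R.

Let il1 : l^-1 <= 1. Proof. by rewrite invf_le1. Qed.
Let il0 : 0 <= l^-1. Proof. by rewrite invr_ge0 ltW. Qed.

Lemma smoothind1_le s r : (forall j, `|y j| <= r) -> `|smoothind1 s| <= C / l * r.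
Proof.
move=> yr; rewrite /smoothind1 normrM.
have [c1 _ _] := cutoff_bounds (arg s).
have m1r : `|tmom a y 1 s| <= r.
  rewrite (le_trans (norm_m1 s))// -[leRHS]mul1r -(tw_sum1 s) mulr_suml ler_sum// => j _.
  by rewrite ler_wpM2l ?tw_ge0.
rewrite -mulrA [_^-1 * _]mulrC ler_pM// normrM ler_pM//.
by rewrite ger0_norm.
Qed.

Let m2r s r : 0 <= r -> (forall j, `|y j| <= r) -> tmom a y 2 s <= r ^+ 2.
Proof.
move=> r0 yr; rewrite tmomE -[leRHS]mul1r -(tw_sum1 s) mulr_suml ler_sum// => j _.
rewrite ler_wpM2l ?tw_ge0// -(real_normK (num_real (y j))).
by rewrite lerXn2r ?nnegrE.
Qed.

Lemma smoothind2_le s r : 0 <= r -> (forall j, `|y j| <= r) ->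
  `|smoothind2 s| <= 2 * C / l * r ^+ 2.
Proof.
move=> r0 yr; have [c1 c2 _] := cutoff_bounds (arg s).
have C0 := cutoff_const_ge0 R.
have h2 := m2r s r0 yr; have h1 := m1sq_le_m2 s; have h0 := tvar_ge0 s.
rewrite /smoothind2 (le_trans (ler_normD _ _))//.
have h3 : tvar s <= r ^+ 2 by rewrite /tvar lerBlDr (le_trans h2)// lerDl sqr_ge0.
have h4 : tmom a y 1 s ^+ 2 <= r ^+ 2 by exact: le_trans h2.
move: (tmom a y 1 s) (tvar s) (arg s) c1 c2 h0 h3 h4 => m v u c1 c2 h0 h3 h4.
rewrite (_ : 2 * C / l * r ^+ 2 = C * (r ^+ 2 / l) + C * (r ^+ 2 / l)); last by field; rewrite gt_eqF.
rewrite lerD// normrM ler_pM//.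
  rewrite ger0_norm ?sqr_ge0// expr_div_n; apply: ler_pM => //; first exact: sqr_ge0.
    by rewrite invr_ge0 sqr_ge0.
  by rewrite lef_pV2 ?posrE ?exprn_gt0// expr2 ler_peMr// ltW.
by rewrite normrM (ger0_norm h0) (ger0_norm il0) ler_wpM2r.
Qed.

(** The three terms contribute [1], [3] and [6] times the third absolute moment, hence 10; powers of
    [l^-1] beyond the first are dropped because [1 <= l]. *)
Lemma smoothind3_le s : `|smoothind3 s| <= 10 * C / l * tabs3 s.
Proof.
have [c1 c2 c3] := cutoff_bounds (arg s).
have C0 := cutoff_const_ge0 R.
have h0 := tvar_ge0 s; have t0 := tabs3_ge0 s.
have hv : `|tmom a y 1 s| * tvar s <= tabs3 s.
  apply: le_trans (m1m2 s); rewrite ler_wpM2l// /tvar lerBlDr lerDl sqr_ge0//.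
have hm := m1_cube s; have hc := tcum3_le s.
rewrite /smoothind3.
move: (tmom a y 1 s) (tvar s) (tcum3 s) (tabs3 s) (arg s) c1 c2 c3 h0 t0 hv hm hc
  => m v k t u c1 c2 c3 h0 t0 hv hm hc.
have a1 : `|cutoff3 u * (m / l) ^+ 3| <= C * (t / l).
  rewrite normrM ler_pM// normrX normrM (ger0_norm il0) exprMn.
  rewrite ler_pM ?exprn_ge0//.
  by rewrite exprS ler_piMr// exprn_ile1.
have a2 : `|3 * cutoff2 u * (m / l) * (v / l)| <= 3 * (C * (t / l)).
  rewrite -!mulrA normrM (ger0_norm (ler0n _ 3)) ler_pM2l// normrM ler_pM//.
  rewrite !normrM (ger0_norm il0) (ger0_norm h0).
  rewrite (_ : _ * _ = (`|m| * v) * (l^-1 * l^-1)); last by ring.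
  rewrite ler_pM ?mulr_ge0//.
  by rewrite ler_piMr.
have a3 : `|cutoff1 u * (k / l)| <= C * (6 * t / l).
  by rewrite normrM ler_pM// normrM (ger0_norm il0) ler_wpM2r.
rewrite (le_trans (ler_normD _ _))//.
rewrite (le_trans (lerD (ler_normD _ _) (lexx _)))//.
rewrite (_ : 10 * C / l * t = C * (t / l) + 3 * (C * (t / l)) + C * (6 * t / l)).
  by rewrite !lerD.
by field; rewrite gt_eqF.
Qed.

Lemma smoothind_flat s : ln (tsum a y 0 s) / l <= tau \/ tau + 1 <= ln (tsum a y 0 s) / l ->
  [/\ smoothind1 s = 0, smoothind2 s = 0 & smoothind3 s = 0].
Proof.
move=> H; have [|c1 c2 c3] := @cutoff_derivatives_out R (arg s).
  by rewrite /arg subr_le0 lerBrDl; case: H => ?; [left|right].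
by rewrite /smoothind1 /smoothind2 /smoothind3 c1 c2 c3 !mulr0 !mul0r !addr0.
Qed.

End tilted_moments.

(** * Nemirovski's inequality *)

Section power_smoothing.
Context (R : realType) (J : finType) (k : nat).
Hypothesis k0 : (0 < k)%N.
Hypothesis Nk : #|J|%:R <= expR k%:R :> R.
Variables (c : R) (c0 : 0 < c).

Definition psum (x : J -> R) : R := c + \sum_j x j ^+ k.*2.
(* The power k of order log |J| makes this a smooth surrogate of [supn x ^+ 2], and the
   constant c keeps it away from the singularity at 0. *)
Definition pnorm2 (x : J -> R) : R := expR (k%:R^-1 * ln (psum x)).
Definition pnorm2_grad (x : J -> R) (j : J) : R :=
  pnorm2 x * (2 * x j ^+ k.*2.-1 / psum x).

Let even_pow (a : R) m : 0 <= a ^+ m.*2.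
Proof. by rewrite -mul2n exprM exprn_ge0// sqr_ge0. Qed.

Lemma psum_gt0 x : 0 < psum x.
Proof. by rewrite ltr_pwDl// sumr_ge0. Qed.

Lemma pnorm2_gt0 x : 0 < pnorm2 x.
Proof. exact: expR_gt0. Qed.

Let kn0 : (k%:R : R) != 0. Proof. by rewrite pnatr_eq0 -lt0n. Qed.
Let kp : 0 < k%:R :> R. Proof. by rewrite ltr0n. Qed.

Lemma pnorm2X x : pnorm2 x ^+ k = psum x.
Proof. by rewrite /pnorm2 -expRM_natl mulrA mulfV// mul1r lnK// posrE psum_gt0. Qed.

Lemma supn_le_pnorm2 x : supn x ^+ 2 <= pnorm2 x.
Proof.
have h j : `|x j| ^+ 2 <= pnorm2 x.
  have pk := pnorm2_gt0 x.
  rewrite -(@ler_pXn2r _ k)// ?nnegrE ?sqr_ge0 ?(ltW pk)//.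
  rewrite pnorm2X -exprM mul2n -normrX ger0_norm//.
  rewrite /psum (bigD1 j)//= addrCA lerDl.
  by apply: addr_ge0; [exact: ltW|apply: sumr_ge0].
have : supn x <= Num.sqrt (pnorm2 x).
  apply: supn_le => [|j]; first exact: sqrtr_ge0.
  by rewrite -(ler_pXn2r (isT : (0 < 2)%N)) ?nnegrE ?sqrtr_ge0// sqr_sqrtr ?h// ltW// pnorm2_gt0.
rewrite -(ler_pXn2r (isT : (0 < 2)%N)) ?nnegrE ?sqrtr_ge0 ?supn_ge0//.
by rewrite sqr_sqrtr// ltW// pnorm2_gt0.
Qed.

Lemma pnorm2_0 : pnorm2 (fun=> 0) = expR (k%:R^-1 * ln c).
Proof.
rewrite /pnorm2 /psum big1 ?addr0// => j _.
by rewrite expr0n double_eq0 eqn0Ngt k0.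
Qed.

(* Split according to whether x_j^2 is at least e^-1 times the norm. *)
Lemma pow_sum_bound x : \sum_j x j ^+ k.-1.*2 * pnorm2 x / psum x <= 2 * expR 1.
Proof.
set S := pnorm2 x; have S0 : 0 < S by exact: pnorm2_gt0.
have p0 := psum_gt0 x.
pose u j := x j ^+ 2 / S.
have u0 j : 0 <= u j by rewrite divr_ge0 ?sqr_ge0// ltW.
have e1 j : x j ^+ k.-1.*2 * S / psum x = u j ^+ k.-1.
  rewrite -(pnorm2X x) -/S /u expr_div_n -exprM mul2n.
  rewrite -[in S ^+ k](prednK k0) exprS; field.
  by rewrite !gt_eqF// exprn_gt0.
have e2 : \sum_j u j ^+ k <= 1.
  rewrite (eq_bigr (fun j => x j ^+ k.*2 / psum x)); last first.
    by move=> j _; rewrite /u expr_div_n -exprM mul2n -(pnorm2X x).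
  by rewrite -mulr_suml ler_pdivrMr// mul1r /psum lerDr ltW.
rewrite (eq_bigr (fun j => u j ^+ k.-1)); last by move=> j _; rewrite e1.
have e3 j : u j ^+ k.-1 <= expR 1 * u j ^+ k + expR 1 / expR k%:R.
  have [h|h] := leP (expR (- 1)) (u j).
    rewrite ler_wpDr ?divr_ge0 ?expR_ge0// -[in u j ^+ k](prednK k0) exprS mulrA.
    rewrite ler_peMl ?exprn_ge0//.
    have := ler_wpM2l (expR_ge0 1) h.
    by rewrite -expRD subrr expR0.
  rewrite ler_wpDl ?mulr_ge0 ?expR_ge0 ?exprn_ge0//.
  rewrite -expRB (_ : 1 - k%:R = k.-1%:R * (- 1)); last first.
    by rewrite -[in k%:R](prednK k0) -natr1; ring.
  by rewrite expRM_natl lerXn2r ?nnegrE ?expR_ge0// ltW.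
apply: le_trans (ler_sum _ (fun j _ => e3 j)) _.
rewrite big_split/= -mulr_sumr sumr_const.
rewrite -[X in _ + X]mulr_natl.
have h : expR 1 * \sum_j u j ^+ k <= expR 1 by rewrite ler_piMr ?expR_ge0.
have h2 : #|J|%:R * (expR 1 / expR k%:R) <= expR 1 :> R.
  rewrite mulrA ler_pdivrMr ?expR_gt0// mulrC ler_wpM2l ?expR_ge0//.
lra.
Qed.

Section line.
Variables (x y : J -> R) (r : R).
Hypothesis (r0 : 0 <= r) (yr : forall j, `|y j| <= r).
Let pt s j := x j + s * y j.
Let p s := psum (pt s).
Let p1 s := \sum_j k.*2%:R * pt s j ^+ k.*2.-1 * y j.
Let p2 s := \sum_j k.*2%:R * (k.*2.-1%:R * pt s j ^+ k.*2.-2) * y j * y j.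
Let f s := pnorm2 (pt s).
Let f1 s := f s * (k%:R^-1 * (p1 s / p s)).
Let f2 s := f s * (k%:R^-1 * (p1 s / p s)) ^+ 2 + f s * (k%:R^-1 * (p2 s / p s - (p1 s / p s) ^+ 2)).

Let dpt j s : is_derive s (1 : R) (fun s => pt s j) (y j).
Proof.
rewrite /pt; apply: (@is_derive_val _ _ _ (0 + (1 * y j + s * 0))); first by ring.
apply: (@is_derive_add _ (cst (x j))); exact: is_derive_mul.
Qed.

Let dp : derives p p1.
Proof.
move=> s; rewrite /p /psum; apply: (@is_derive_val _ _ _ (0 + p1 s)); first by rewrite add0r.
apply: (@is_derive_add _ (cst c)); apply: is_derive_bigsum => j.
exact: (is_derive_comp (is_derive_expn _ _) (dpt j s)).
Qed.

Let dp1 : derives p1 p2.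
Proof.
move=> s; apply: is_derive_bigsum => j.
have h := is_derive_comp (is_derive_expn k.*2.-1 _) (dpt j s).
have h2 := is_derive_mulc k.*2%:R h.
apply: (@is_derive_val _ _ _ (k.*2%:R * (k.*2.-1%:R * pt s j ^+ k.*2.-2 * y j) * y j + k.*2%:R * pt s j ^+ k.*2.-1 * 0)).
  by ring.
exact: (@is_derive_mul _ _ (cst (y j))).
Qed.

Let dpp s : is_derive s (1 : R) (fun s => p1 s / p s) (p2 s / p s - (p1 s / p s) ^+ 2).
Proof.
have p0 : p s != 0 by rewrite gt_eqF// psum_gt0.
have dV := @is_deriveV R p s _ 1 p0 (dp s).
apply: is_derive_val (is_derive_mul (dp1 s) dV).
by rewrite /GRing.scale/=; field.
Qed.

Let df : derives f f1.
Proof.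
move=> s; have p0 : 0 < p s by exact: psum_gt0.
apply: is_derive_val (is_derive_comp (is_derive_expR _) (is_derive_mulc k%:R^-1 (is_derive_comp (is_derive1_ln p0) (dp s)))).
by rewrite /f1 /f /pnorm2 -/(p s); congr (_ * (_ * _)); rewrite mulrC.
Qed.

Let df1 : derives f1 f2.
Proof.
move=> s; apply: is_derive_val (is_derive_mul (df s) (is_derive_mulc k%:R^-1 (dpp s))).
by rewrite /f1 /f2; ring.
Qed.

(** The constant is [2 * (2 k) * (2 e)]: two factors from differentiating the power [2 k] twice and
    dividing by [k], the last one from [pow_sum_bound]. *)
Let f2_le s : f2 s <= 8 * expR 1 * k%:R * r ^+ 2.
Proof.
have p0 : 0 < p s by exact: psum_gt0.
have f0 : 0 < f s by exact: pnorm2_gt0.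
(* The square of [p1 / p] enters with coefficient [k^-2 - k^-1 <= 0] and is dropped. *)
have h1 : f2 s <= f s * (k%:R^-1 * (p2 s / p s)).
  rewrite /f2 -mulrDr ler_pM2l// -subr_ge0.
  rewrite (_ : _ - _ = k%:R^-1 * (1 - k%:R^-1) * (p1 s / p s) ^+ 2); last by ring.
  apply: mulr_ge0; last exact: sqr_ge0.
  apply: mulr_ge0; first by rewrite invr_ge0 ltW.
  by rewrite subr_ge0 invf_le1// ler1n.
have k2n : k.*2.-2 = k.-1.*2 by case: (k) k0.
have kk : k.*2%:R = 2 * k%:R :> R by rewrite -muln2 natrM mulrC.
have h2 : p2 s <= 2 * k%:R * k.*2.-1%:R * r ^+ 2 * \sum_j pt s j ^+ k.-1.*2.
  rewrite /p2 mulr_sumr; apply: ler_sum => j _; rewrite k2n kk.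
  rewrite (_ : _ * y j * y j = 2 * k%:R * k.*2.-1%:R * y j ^+ 2 * pt s j ^+ k.-1.*2); last by ring.
  rewrite ler_wpM2r// ler_wpM2l ?mulr_ge0// -(real_normK (num_real (y j))).
  by rewrite lerXn2r ?nnegrE.
apply: le_trans h1 _.
apply: le_trans (_ : f s * (k%:R^-1 * (2 * k%:R * k.*2.-1%:R * r ^+ 2 * \sum_j pt s j ^+ k.-1.*2 / p s)) <= _).
  apply: ler_wpM2l; first exact: ltW.
  apply: ler_wpM2l; first by rewrite invr_ge0 ltW.
  rewrite -mulr_suml mulrA; apply: ler_wpM2r => //.
  by rewrite invr_ge0 ltW.
rewrite (_ : f s * _ = 2 * k.*2.-1%:R * r ^+ 2 * (\sum_j pt s j ^+ k.-1.*2 * f s / p s)); last first.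
  by rewrite -!mulr_suml; field; rewrite gt_eqF ?kn0.
have hs := pow_sum_bound (pt s).
apply: le_trans (_ : 2 * k.*2.-1%:R * r ^+ 2 * (2 * expR 1) <= _).
  by rewrite ler_wpM2l// mulr_ge0 ?sqr_ge0.
have k2 : k.*2.-1%:R <= 2 * k%:R :> R by rewrite -kk ler_nat leq_pred.
have e1 : 0 <= expR 1 :> R by exact: expR_ge0.
rewrite (_ : 8 * expR 1 * k%:R * r ^+ 2 = 2 * (2 * k%:R) * r ^+ 2 * (2 * expR 1)); last by ring.
by rewrite ler_wpM2r ?mulr_ge0// ler_wpM2r ?sqr_ge0// ler_wpM2l.
Qed.

(** One-sided smoothness of the squared norm with a constant of order [k], the logarithm of the
    number of coordinates; this is what makes second moments add up over martingale increments. *)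
Lemma pnorm2_taylor : pnorm2 (fun j => x j + y j) <=
  pnorm2 x + \sum_j pnorm2_grad x j * y j + 8 * expR 1 * k%:R * r ^+ 2.
Proof.
pose K s := f s + - f1 0 * s.
have dK : derives K (fun s => f1 s - f1 0).
  move=> s; apply: is_derive_add; first exact: df.
  by apply: (is_derive_val (mulr1 _)).
have M0 : 0 <= 8 * expR 1 * k%:R * r ^+ 2 by rewrite mulr_ge0 ?sqr_ge0// !mulr_ge0// expR_ge0.
have [s /andP[s0 s1] E] := mvt dK (@ler01 R).
have [t /andP[t0 ts] E2] := mvt df1 s0.
have : K 1 - K 0 <= 8 * expR 1 * k%:R * r ^+ 2.
  rewrite E subr0 mulr1 E2 subr0.
  apply: le_trans (_ : 8 * expR 1 * k%:R * r ^+ 2 * s <= _); first exact: (ler_wpM2r s0 (f2_le t)).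
  by rewrite ler_piMr.
have f1E : f1 0 = \sum_j pnorm2_grad x j * y j.
  have pt0 : pt 0 = x by apply/funext => j; rewrite /pt mul0r addr0.
  rewrite /f1 /f /p1 /p pt0 /pnorm2_grad mulr_suml !mulr_sumr; apply: eq_bigr => j _.
  have kk : k.*2%:R = 2 * k%:R :> R by rewrite -muln2 natrM mulrC.
  rewrite kk; field.
  by rewrite kn0 gt_eqF// psum_gt0.
have pt0 : pt 0 = x by apply/funext => j; rewrite /pt mul0r addr0.
have pt1 : pt 1 = fun j => x j + y j by apply/funext => j; rewrite /pt mul1r.
rewrite /K f1E /f pt0 pt1; lra.
Qed.

End line.
End power_smoothing.
Lemma sqr_sum_le (R : realFieldType) n (a : 'I_n -> R) :
  (\sum_i a i) ^+ 2 <= n%:R * \sum_i a i ^+ 2.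
Proof.
rewrite expr2 mulr_suml.
have h (i j : 'I_n) : a i * a j <= (a i ^+ 2 + a j ^+ 2) / 2.
  by have := sqr_ge0 (a i - a j); nra.
apply: le_trans (_ : \sum_i \sum_j (a i ^+ 2 + a j ^+ 2) / 2 <= _).
  by apply: ler_sum => i _; rewrite mulr_sumr; apply: ler_sum => j _.
rewrite le_eqVlt; apply/orP; left; apply/eqP.
under eq_bigr => i _ do rewrite -mulr_suml big_split/= sumr_const card_ord.
rewrite -mulr_suml big_split/= sumr_const card_ord -sumrMnl -mulr_natl.
under eq_bigr do rewrite -mulr_natl.
by rewrite -mulr_sumr; field.
Qed.

Lemma measurable_pnorm2 (R : realType) (J : finType) k (c : R) d (T : measurableType d) (xi : T -> J -> R) :
  (forall j, measurable_fun setT (fun x => xi x j)) ->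
  measurable_fun setT (fun x => pnorm2 k c (xi x)).
Proof.
move=> mxi; apply: measurableT_comp => //; apply: measurable_funM => //.
apply: measurableT_comp; first exact: measurable_ln.
apply: measurable_funD => //; apply: measurable_sum => j.
exact: measurable_funX.
Qed.

Lemma sum_ltnS (V : nmodType) n m (mn : (m < n)%N) (f : 'I_n -> V) :
  \sum_(i < n | (i < m.+1)%N) f i = \sum_(i < n | (i < m)%N) f i + f (Ordinal mn).
Proof.
rewrite (bigD1 (Ordinal mn))//= addrC; congr (_ + _); apply: eq_bigl => i.
by rewrite ltnS ltn_neqAle andbC.
Qed.

(** * Sup-norm second moments of martingales and degenerate pair sums *)

Section martingale.
Context (R : realType) d (T : measurableType d) (n : nat).
Variables (F : probability T R) (Q : probability (n.-tuple T) R).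
Hypothesis FQ : prodlike F Q.
Context (J : finType) (k : nat).
Hypothesis k0 : (0 < k)%N.
Hypothesis Nk : #|J|%:R <= expR k%:R :> R.
Local Notation M := (8 * expR 1 * k%:R : R).

Lemma measurable_resample (i : 'I_n) (f : n.-tuple T -> \bar R) : measurable_fun setT f ->
  (forall x, (0 <= f x)%E) -> measurable_fun setT (fun x => \int[F]_y f (upd x i y))%E.
Proof.
move=> mf f0.
have m2 : measurable_fun setT (fun z : n.-tuple T * T => f (upd z.1 i z.2)).
  by apply: measurableT_comp => //; exact: measurable_upd.
exact: (@measurable_fun_fubini_tonelli_F _ _ _ _ _ F _ m2).
Qed.

Lemma measurable_resample' (i : 'I_n) (f : n.-tuple T -> \bar R) : measurable_fun setT f ->
  (forall x, (0 <= f x)%E) -> measurable_fun setT (fun y => \int[Q]_x f (upd x i y))%E.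
Proof.
move=> mf f0.
have m2 : measurable_fun setT (fun z : n.-tuple T * T => f (upd z.1 i z.2)).
  by apply: measurableT_comp => //; exact: measurable_upd.
exact: (@measurable_fun_fubini_tonelli_G _ _ _ _ _ Q _ m2).
Qed.

Lemma resample_swap (i : 'I_n) (f : n.-tuple T -> \bar R) : measurable_fun setT f ->
  (forall x, (0 <= f x)%E) ->
  (\int[Q]_x f x = \int[F]_y \int[Q]_x f (upd x i y))%E.
Proof.
move=> mf f0; rewrite (resample FQ i mf f0).
have m2 : measurable_fun setT (fun z : n.-tuple T * T => f (upd z.1 i z.2)).
  by apply: measurableT_comp => //; exact: measurable_upd.
exact: (@fubini_tonelli _ _ _ _ _ Q F _ m2).
Qed.

Section increments.
Variable xi : 'I_n -> n.-tuple T -> J -> R.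
Hypothesis mxi : forall i j, measurable_fun setT (fun x => xi i x j).
Hypothesis past : forall (i l : 'I_n) x y, (i < l)%N -> xi i (upd x l y) = xi i x.
Hypothesis ixi : forall i x, intg F (fun y => supn (xi i (upd x i y)) ^+ 2).
Hypothesis cxi : forall i x j, Ex F (fun y => xi i (upd x i y) j) = 0.

Let mxiu i x j : measurable_fun setT (fun y => xi i (upd x i y) j).
Proof.
apply: (@measurableT_comp _ _ _ _ _ _ (fun x => xi i x j)) => //.
exact: measurable_upd2.
Qed.

Let ixi1 i x j : intg F (fun y => xi i (upd x i y) j).
Proof.
apply: (@intg_dom _ _ _ _ _ (fun y => 1 + supn (xi i (upd x i y)) ^+ 2)) => //.
  by apply: intgD => //; exact: intg_cst.
move=> y; apply: le_trans (le_supn _ j) _.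
by set s := supn _; nra.
Qed.

Let mS2 i : measurable_fun setT (fun x => (supn (xi i x) ^+ 2)%:E).
Proof.
by apply/measurable_EFinP; apply: measurable_funX; exact: measurable_supn.
Qed.

Let S m x j := \sum_(i < n | (i < m)%N) xi i x j.

Let mS m c : measurable_fun setT (fun x => (pnorm2 k c (S m x))%:E).
Proof.
apply/measurable_EFinP; apply: measurable_pnorm2 => j.
rewrite /S; under eq_fun do rewrite big_mkcond.
by apply: measurable_sum => i; case: (i < m)%N.
Qed.

(** Integrate out coordinate [m] first: the earlier sum is unaffected, the gradient term is linear
    in the new increment and vanishes by centring, and only the second-order remainder is left. *)
Let step c m (mn : (m < n)%N) : 0 < c ->
  (\int[Q]_x (pnorm2 k c (S m.+1 x))%:E <=
   \int[Q]_x (pnorm2 k c (S m x))%:E +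
   M%:E * \int[Q]_x (supn (xi (Ordinal mn) x) ^+ 2)%:E)%E.
Proof.
move=> c0; set im := Ordinal mn.
have M0 : 0 <= M by rewrite !mulr_ge0// expR_ge0.
rewrite (resample FQ im (mS _ _)); last by move=> x; rewrite lee_fin ltW// pnorm2_gt0.
rewrite [X in (_ + _ * X)%E](resample FQ im (mS2 im)); last first.
  by move=> x; rewrite lee_fin sqr_ge0.
have mI : measurable_fun setT (fun x => \int[F]_y (supn (xi im (upd x im y)) ^+ 2)%:E)%E.
  by apply: (measurable_resample im (mS2 im)) => x; rewrite lee_fin sqr_ge0.
have I0 x : (0 <= \int[F]_y (supn (xi im (upd x im y)) ^+ 2)%:E)%E.
  by apply: integral_ge0 => y _; rewrite lee_fin sqr_ge0.
have p0 x : (0 <= (pnorm2 k c (S m x))%:E)%E by rewrite lee_fin ltW// pnorm2_gt0.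
rewrite -(ge0_integralZl _ measurableT mI)//.
rewrite -ge0_integralD//; last 2 first.
- by move=> x _; rewrite mule_ge0// lee_fin.
- by apply: emeasurable_funM => //; exact: measurable_cst.
apply: ge0_le_integral => //.
- by move=> x _; apply: integral_ge0 => y _; rewrite lee_fin ltW// pnorm2_gt0.
- by apply: (measurable_resample im (mS m.+1 c)) => x; rewrite lee_fin ltW// pnorm2_gt0.
- by apply: emeasurable_funD => //; apply: emeasurable_funM => //; exact: measurable_cst.
move=> x _.
have SE y : S m.+1 (upd x im y) = (fun j => S m x j + xi im (upd x im y) j).
  apply/funext => j; rewrite /S (sum_ltnS mn); congr (_ + _).
  by apply: eq_bigr => i im_lt; rewrite past.
pose g y := pnorm2 k c (S m x) + \sum_j pnorm2_grad k c (S m x) j * xi im (upd x im y) j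
  + M * supn (xi im (upd x im y)) ^+ 2.
have ig1 : intg F (fun y => \sum_j pnorm2_grad k c (S m x) j * xi im (upd x im y) j).
  by apply: intg_sum => j; exact: intgZ.
have ig0 : intg F (fun y => pnorm2 k c (S m x) + \sum_j pnorm2_grad k c (S m x) j * xi im (upd x im y) j).
  by apply: intgD => //; exact: intg_cst.
have ig2 : intg F (fun y => M * supn (xi im (upd x im y)) ^+ 2) by exact: intgZ.
have gE : Ex F g = pnorm2 k c (S m x) + M * Ex F (fun y => supn (xi im (upd x im y)) ^+ 2).
  rewrite /g ExD// ExD//; last exact: intg_cst.
  rewrite Ex_cst Ex_sum; last by move=> j; exact: intgZ.
  rewrite big1 ?addr0; first by rewrite ExZ.
  by move=> j _; rewrite ExZ// cxi mulr0.
rewrite (Ex_EFin (ixi im x)) -EFinM -EFinD -gE.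
have ig : intg F g by exact: intgD.
have gp y : pnorm2 k c (S m.+1 (upd x im y)) <= g y.
  rewrite SE; apply: pnorm2_taylor => //; first exact: supn_ge0.
  by move=> j; exact: le_supn.
apply: Ex_le_int.
  apply: (intg_dom _ ig); last by move=> y; rewrite ger0_norm ?gp// ltW// pnorm2_gt0.
  apply/measurable_EFinP.
  apply: (@measurableT_comp _ _ _ _ _ _ (fun x => (pnorm2 k c (S m.+1 x))%:E)) => //.
  exact: measurable_upd2.
apply: Ex_le => //.
apply: (intg_dom _ ig); last by move=> y; rewrite ger0_norm ?gp// ltW// pnorm2_gt0.
apply/measurable_EFinP.
apply: (@measurableT_comp _ _ _ _ _ _ (fun x => (pnorm2 k c (S m.+1 x))%:E)) => //.
exact: measurable_upd2.
Qed.

Lemma martingale_supn2 :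
  (\int[Q]_x (supn (fun j => \sum_i xi i x j) ^+ 2)%:E <=
   M%:E * \sum_i \int[Q]_x (supn (xi i x) ^+ 2)%:E)%E.
Proof.
have M0 : 0 <= M by rewrite !mulr_ge0// expR_ge0.
have H c m : 0 < c -> (m <= n)%N -> (\int[Q]_x (pnorm2 k c (S m x))%:E <=
   (expR (k%:R^-1 * ln c))%:E +
   M%:E * \sum_(i < n | (i < m)%N) \int[Q]_x (supn (xi i x) ^+ 2)%:E)%E.
  move=> c0; elim: m => [_|m IH mn].
    rewrite [X in (_ + _ * X)%E]big1// mule0 adde0.
    under eq_integral => x _.
      rewrite (_ : S 0 x = fun=> 0); last by apply/funext => j; rewrite /S big1.
      rewrite pnorm2_0//.
      over.
    by rewrite integral_cst// [X in (_ * X)%E]probability_setT mule1.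
  apply: le_trans (step mn c0) _.
  have i0 i : (0 <= \int[Q]_x (supn (xi i x) ^+ 2)%:E)%E.
    by apply: integral_ge0 => y _; rewrite lee_fin sqr_ge0.
  have s0 : (0 <= \sum_(i < n | (i < m)%N) \int[Q]_x (supn (xi i x) ^+ 2)%:E)%E.
    by apply: sume_ge0.
  rewrite (sum_ltnS mn) (ge0_muleDr _ s0 (i0 _)).
  by rewrite addeA leeD2r// IH// ltnW.
apply/lee_addgt0Pr => e e0.
(* The regularisation [c = e ^+ k] makes the initial value of the smoothed norm exactly [e], which
   is arbitrary. *)
have c0 : 0 < e ^+ k by rewrite exprn_gt0.
have := H _ n c0 (leqnn n).
have -> : expR (k%:R^-1 * ln (e ^+ k)) = e.
  by rewrite lnXn// -[ln e *+ k]mulr_natl mulKf ?pnatr_eq0 -?lt0n// lnK ?posrE.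
rewrite addeC.
rewrite [X in (_ * X + _)%E](eq_bigl xpredT); last by move=> i; rewrite ltn_ord.
apply: le_trans; apply: ge0_le_integral => //.
- by move=> x _; rewrite lee_fin sqr_ge0.
- apply/measurable_EFinP; apply: measurable_funX; apply: measurable_supn => j.
  by apply: measurable_sum => i.
move=> x _; rewrite lee_fin; apply: le_trans (supn_le_pnorm2 k0 c0 _) _.
rewrite le_eqVlt; apply/orP; left; apply/eqP; congr pnorm2.
by apply/funext => j; apply: eq_bigl => i; rewrite ltn_ord.
Qed.

End increments.

Section pairs.
Variable phi : 'I_n -> 'I_n -> T -> T -> J -> R.
Hypothesis mphi : forall i l j, measurable_fun setT (fun z : T * T => phi i l z.1 z.2 j).
Hypothesis iphi1 : forall i l y, intg F (fun x => supn (phi i l x y) ^+ 2).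
Hypothesis iphi2 : forall i l x, intg F (fun y => supn (phi i l x y) ^+ 2).
Hypothesis cphi1 : forall i l y j, Ex F (fun x => phi i l x y j) = 0.
Hypothesis cphi2 : forall i l x j, Ex F (fun y => phi i l x y j) = 0.

Let xi (l : 'I_n) (x : n.-tuple T) j := \sum_(i < n | (i < l)%N) phi i l (tnth x i) (tnth x l) j.

Let mphix i l j y : measurable_fun setT (fun x => phi i l x y j).
Proof.
apply: (@measurableT_comp _ _ _ _ _ _ (fun z : T * T => phi i l z.1 z.2 j) _ (fun x => (x, y))) => //.
Qed.

Let mphiy i l j x : measurable_fun setT (fun y => phi i l x y j).
Proof.
apply: (@measurableT_comp _ _ _ _ _ _ (fun z : T * T => phi i l z.1 z.2 j) _ (fun y => (x, y))) => //.
exact: pair1_measurable.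
Qed.

Let mphit i l j : measurable_fun setT (fun x : n.-tuple T => phi i l (tnth x i) (tnth x l) j).
Proof.
apply: (@measurableT_comp _ _ _ _ _ _ (fun z : T * T => phi i l z.1 z.2 j) _ (fun x : n.-tuple T => (tnth x i, tnth x l))) => //.
by apply/measurable_fun_pair => /=; exact: measurable_tnth.
Qed.

Let mxi l j : measurable_fun setT (fun x => xi l x j).
Proof.
rewrite /xi; under eq_fun do rewrite big_mkcond.
by apply: measurable_sum => i; case: (i < l)%N.
Qed.

Let xiE l x y j : xi l (upd x l y) j = \sum_(i < n | (i < l)%N) phi i l (tnth x i) y j.
Proof.
apply: eq_bigr => i il; rewrite !tnth_upd eqxx; case: eqP => // E.
by rewrite E ltnn in il.
Qed.

Let iphiy i l x j : intg F (fun y => phi i l x y j).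
Proof.
apply: (@intg_dom _ _ _ _ _ (fun y => 1 + supn (phi i l x y) ^+ 2)) => //.
  by apply: intgD => //; exact: intg_cst.
move=> y; apply: le_trans (le_supn _ j) _.
by set s := supn _; nra.
Qed.

(** The martingale bound is applied twice, in the larger index and, with that coordinate frozen at
    [y], in the smaller one, hence the square of the constant. Degeneracy in each argument makes
    both families martingale differences. *)
Lemma degenerate_pairs_supn2 :
  (\int[Q]_x (supn (fun j => \sum_(l < n) \sum_(i < n | (i < l)%N) phi i l (tnth x i) (tnth x l) j) ^+ 2)%:E <=
   (M ^+ 2)%:E * \sum_(l < n) \sum_(i < n | (i < l)%N) \int[F]_y \int[F]_x (supn (phi i l x y) ^+ 2)%:E)%E.
Proof.
have M0 : 0 <= M by rewrite !mulr_ge0// expR_ge0.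
have H := @martingale_supn2 xi mxi.
apply: le_trans (H _ _ _) _.
- move=> i l x y il; apply/funext => j; apply: eq_bigr => i' ii'.
  rewrite !tnth_upd; case: eqP => [E|_]; first by rewrite E ltnNge ltnW in ii'.
  by case: eqP => [E|_]//; rewrite E ltnn in il.
- move=> l x.
  pose a y := \sum_(i < n | (i < l)%N) supn (phi i l (tnth x i) y).
  apply: (@intg_dom _ _ _ _ _ (fun y => n%:R * \sum_(i < n) supn (phi i l (tnth x i) y) ^+ 2)).
  + apply: measurable_funX; apply: measurable_supn => j.
    apply: (@measurableT_comp _ _ _ _ _ _ (fun x => xi l x j)) => //.
    exact: measurable_upd2.
  + by apply: intgZ; apply: intg_sum => i; exact: iphi2.
  move=> y; rewrite ger0_norm ?sqr_ge0//.
  have h1 : supn (xi l (upd x l y)) <= \sum_(i < n) supn (phi i l (tnth x i) y).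
    rewrite (_ : xi l (upd x l y) = fun j => \sum_(i < n | (i < l)%N) phi i l (tnth x i) y j); last first.
      by apply/funext => j; exact: xiE.
    apply: le_trans (supn_sum _ _ _) _.
    rewrite [leRHS](bigID (fun i : 'I_n => (i < l)%N))/= lerDl.
    by apply: sumr_ge0 => i _; exact: supn_ge0.
  apply: le_trans (_ : (\sum_(i < n) supn (phi i l (tnth x i) y)) ^+ 2 <= _).
    by rewrite lerXn2r ?nnegrE ?supn_ge0// sumr_ge0// => i _; exact: supn_ge0.
  exact: sqr_sum_le.
- move=> l x j; under eq_Ex do rewrite xiE.
  rewrite Ex_sum; last by move=> i; exact: iphiy.
  by rewrite big1// => i _; exact: cphi2.
have -> : ((M ^+ 2)%:E = M%:E * M%:E)%E by rewrite expr2 EFinM.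
rewrite -muleA; apply: lee_wpmul2l; first by rewrite lee_fin.
rewrite ge0_sume_distrr; last first.
  move=> l _; apply: sume_ge0 => i _; apply: integral_ge0 => y _.
  by apply: integral_ge0 => x _; rewrite lee_fin sqr_ge0.
apply: lee_sum => l _.
have mS2 : measurable_fun setT (fun x => (supn (xi l x) ^+ 2)%:E).
  by apply/measurable_EFinP; apply: measurable_funX; exact: measurable_supn.
rewrite (resample_swap l mS2); last by move=> x; rewrite lee_fin sqr_ge0.
pose I i y : \bar R := (\int[F]_x (supn (phi i l x y) ^+ 2)%:E)%E.
have I0 i y : (0 <= I i y)%E by apply: integral_ge0 => x _; rewrite lee_fin sqr_ge0.
have mI i : measurable_fun setT (I i).
  have m2 : measurable_fun setT (fun z : T * T => (supn (phi i l z.1 z.2) ^+ 2)%:E).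
    by apply/measurable_EFinP; apply: measurable_funX; exact: measurable_supn.
  by apply: (@measurable_fun_fubini_tonelli_G _ _ _ _ _ F _ m2) => z; rewrite lee_fin sqr_ge0.
rewrite -[X in (_ * X)%E]big_filter.
set r := [seq _ <- _ | _].
have mIs : measurable_fun setT (fun y => (\sum_(i <- r) I i y)%E).
  exact: emeasurable_sum.
rewrite -(ge0_integral_sum _ measurableT (fun i => mI i) (fun i y _ => I0 i y)).
have Is0 y : setT y -> (0 <= \sum_(i <- r) I i y)%E by move=> _; apply: sume_ge0.
rewrite -(ge0_integralZl _ measurableT mIs Is0)//.
apply: ge0_le_integral => //.
- by move=> y _; apply: integral_ge0 => x _; rewrite lee_fin sqr_ge0.
- by apply: (measurable_resample' l mS2) => x; rewrite lee_fin sqr_ge0.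
- by apply: emeasurable_funM => //; exact: measurable_cst.
move=> y _; rewrite big_filter.
(* The indicator of [i < l] as a factor turns the restricted sum into a full one, as
   [martingale_supn2] expects. *)
pose xi' (i : 'I_n) (x : n.-tuple T) j := (i < l)%N%:R * phi i l (tnth x i) y j.
have E x : xi l (upd x l y) = (fun j => \sum_i xi' i x j).
  apply/funext => j; rewrite xiE big_mkcond; apply: eq_bigr => i _.
  by rewrite /xi'; case: ifP => _; rewrite ?mul1r ?mul0r.
under eq_integral => x _ do rewrite E.
have s1 i x : supn (xi' i x) ^+ 2 <= supn (phi i l (tnth x i) y) ^+ 2.
  rewrite lerXn2r ?nnegrE ?supn_ge0//.
  apply: le_trans (supn_scale _ _) _.
  by case: (i < l)%N; rewrite ?normr1 ?mul1r// normr0 mul0r supn_ge0.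
have mt i j : measurable_fun setT (fun x : n.-tuple T => xi' i x j).
  by apply: measurable_funM => //; apply: (@measurable_tnth_comp _ _ n _ _ i (fun x => phi i l x y j)).
apply: le_trans (martingale_supn2 mt _ _ _) _.
- move=> i i' x z ii'; apply/funext => j; rewrite /xi' tnth_upd.
  by case: eqP => // E'; rewrite E' ltnn in ii'.
- move=> i x; apply: (intg_dom _ (iphi1 i l y)).
    apply: measurable_funX; apply: measurable_supn => j.
    apply: (@measurableT_comp _ _ _ _ _ _ (fun x => xi' i x j)) => //.
    exact: measurable_upd2.
  move=> z; rewrite ger0_norm ?sqr_ge0//; apply: le_trans (s1 _ _) _.
  by rewrite tnth_upd eqxx.
- move=> i x j; rewrite /xi'.
  under eq_Ex do rewrite tnth_upd eqxx.
  rewrite ExZ ?cphi1 ?mulr0//.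
  apply: (@intg_dom _ _ _ _ _ (fun x => 1 + supn (phi i l x y) ^+ 2)) => //.
    by apply: intgD => //; exact: intg_cst.
  move=> z; apply: le_trans (le_supn _ j) _.
  by set s := supn _; nra.
apply: lee_wpmul2l; first by rewrite lee_fin.
rewrite [leRHS]big_mkcond; apply: lee_sum => i _.
case: ifP => il.
  have mI2 : measurable_fun setT (fun x => (supn (phi i l x y) ^+ 2)%:E).
    by apply/measurable_EFinP; apply: measurable_funX; exact: measurable_supn.
  rewrite /I -(integral_tnth FQ i mI2); last by move=> x; rewrite lee_fin sqr_ge0.
  apply: ge0_le_integral => //.
  - by move=> x _; rewrite lee_fin sqr_ge0.
  - by apply/measurable_EFinP; apply: measurable_funX; exact: measurable_supn.
  - exact: (@measurable_tnth_comp _ _ n _ _ i _ mI2).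
  by move=> x _; rewrite lee_fin.
rewrite integral0_eq// => x _; congr (_%:E).
rewrite (_ : xi' i x = fun=> 0); last by apply/funext => j; rewrite /xi' il mul0r.
apply/eqP; rewrite expf_eq0/=; apply/eqP/le_anti; rewrite supn_ge0 andbT.
by apply: supn_le => // j; rewrite normr0.
Qed.

End pairs.
End martingale.

(** * Exchanging one summand *)

Lemma itv01_dist (R : realDomainType) (a b : R) :
  0 <= a <= 1 -> 0 <= b <= 1 -> `|a - b| <= 1.
Proof.
by move=> /andP[? ?] /andP[? ?]; rewrite ler_norml; apply/andP; split; lra.
Qed.

Section smooth_maximum.
Context (R : realType) (J : finType).
Variables (beta : R) (p : J -> R).
Hypotheses (beta0 : 0 < beta) (p0 : forall j, 0 < p j) (J0 : (0 < #|J|)%N).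

(** The weights [p] will carry the thresholds of an orthant as [expR (- (beta * c j))], so the
    orthant becomes a half-line for one scalar. All estimates must therefore be uniform in [p]. *)
Definition smax (x : J -> R) : R := beta^-1 * ln (\sum_j p j * expR (beta * x j)).

Definition tilt (v : J -> R) j := p j * expR (beta * v j).

Definition gibbs (v : J -> R) j := tilt v j / \sum_i tilt v i.

Lemma tilt_gt0 v j : 0 < tilt v j.
Proof. by rewrite mulr_gt0// expR_gt0. Qed.

Lemma tilt_ex v : exists j, 0 < tilt v j.
Proof. by have /card_gt0P[j _] := J0; exists j; exact: tilt_gt0. Qed.

Let bV : beta * beta^-1 = 1. Proof. by rewrite mulfV// gt_eqF. Qed.

Let tilt_ge0 v j : 0 <= tilt v j. Proof. exact/ltW/tilt_gt0. Qed.

Lemma sum_tilt_gt0 v : 0 < \sum_i tilt v i.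
Proof.
have [j _] := tilt_ex v; rewrite (bigD1 j)//= ltr_pwDl ?tilt_gt0//.
exact: sumr_ge0.
Qed.

Lemma tsum_smax v x s :
  ln (tsum (tilt v) (fun j => beta * x j) 0 s) = beta * smax (fun j => v j + s * x j).
Proof.
rewrite /smax mulrA mulfV ?gt_eqF// mul1r; congr ln; apply: eq_bigr => j _.
by rewrite expr0 mulr1 /tilt -mulrA -expRD; congr (_ * expR _); ring.
Qed.

Lemma gibbsE v y : tw (tilt v) y 0 = gibbs v.
Proof.
apply/funext => j; rewrite /tw /gibbs mul0r expR0 mulr1; congr (_ / _).
by apply: eq_bigr => i _; rewrite expr0 mulr1 mul0r expR0 mulr1.
Qed.

Lemma gibbs_ge0 v j : 0 <= gibbs v j.
Proof. by rewrite -(gibbsE v (fun=> 0)); exact: tw_ge0 (tilt_ex v) _ _. Qed.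

Lemma gibbs_sum1 v : \sum_j gibbs v j = 1.
Proof. by rewrite -(gibbsE v (fun=> 0)); exact: tw_sum1 (tilt_ex v) _. Qed.

Lemma smax_lip v x r : (forall j, `|x j| <= r) ->
  `|smax (fun j => v j + x j) - smax v| <= r.
Proof.
move=> xr.
have h := @lntsum_lip _ _ (tilt v) (fun j => beta * x j) (tilt_ge0 v) (tilt_ex v) 1 (beta * r).
have {}h := h (fun i => _) (introT andP (conj ler01 (lexx 1))).
have : `|beta * smax (fun j => v j + x j) - beta * smax v| <= beta * r.
  have e1 : beta * smax (fun j => v j + x j) = ln (tsum (tilt v) (fun j => beta * x j) 0 1).
    by rewrite tsum_smax; congr (_ * smax _); apply/funext => j; rewrite mul1r.
  have e0 : beta * smax v = ln (tsum (tilt v) (fun j => beta * x j) 0 0).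
    by rewrite tsum_smax; congr (_ * smax _); apply/funext => j; rewrite mul0r addr0.
  by rewrite e1 e0; apply: h => i; rewrite normrM gtr0_norm// ler_pM2l.
by rewrite -mulrBr normrM gtr0_norm// ler_pM2l.
Qed.

Lemma measurable_smax d (T : measurableType d) (xi : T -> J -> R) :
  (forall j, measurable_fun setT (fun x => xi x j)) ->
  measurable_fun setT (fun x => smax (xi x)).
Proof.
move=> mxi; apply: measurable_funM => //; apply: measurableT_comp; first exact: measurable_ln.
apply: measurable_sum => j; apply: measurable_funM => //.
by apply: measurableT_comp => //; exact: measurable_funM.
Qed.

Section smooth_indicator.
Variables (delta t : R).
Hypotheses (delta0 : 0 < delta) (l1 : 1 <= beta * delta).
Local Notation l := (beta * delta).
Local Notation C := (@cutoff_const R).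

Definition sind (x : J -> R) : R := cutoff ((smax x - t) / delta).

(** Outside it, no increment with [beta * |x j| <= 1] can bring the soft maximum into the zone where
    the cutoff varies, so all derivatives vanish along the move. *)
Definition window (v : J -> R) : bool := t - beta^-1 <= smax v <= t + delta + beta^-1.

Let l0 : 0 < l. Proof. exact: mulr_gt0. Qed.

Let bE (u : R) : beta * u / l = u / delta.
Proof. by field; rewrite !gt_eqF. Qed.

Lemma smoothind_sind v x s :
  smoothind (tilt v) (fun j => beta * x j) l (t / delta) s = sind (fun j => v j + s * x j).
Proof.
rewrite /smoothind tsum_smax /sind; congr cutoff.
by rewrite bE mulrBl.
Qed.

Lemma sind_itv x : 0 <= sind x <= 1.
Proof. exact: cutoff_itv. Qed.

Lemma sind_le x : sind x <= (smax x <= t + delta)%R%:R.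
Proof.
rewrite /sind; have [h|h] := leP (smax x); first by have /andP[] := cutoff_itv ((smax x - t) / delta).
by rewrite cutoff_ge1// ler_pdivlMr// mul1r; move: h; lra.
Qed.

Lemma sind_ge x : (smax x <= t)%R%:R <= sind x.
Proof.
rewrite /sind; have [h|h] := leP (smax x); last by have /andP[] := cutoff_itv ((smax x - t) / delta).
by rewrite cutoff_le0// ler_pdivrMr// mul0r; move: h; lra.
Qed.

Definition slin v x := smoothind1 (tilt v) (fun j => beta * x j) l (t / delta) 0.
Definition squad v x := smoothind2 (tilt v) (fun j => beta * x j) l (t / delta) 0.

Let arg v := (smax v - t) / delta.

Let argE v x : ln (tsum (tilt v) (fun j => beta * x j) 0 0) / l - t / delta = arg v.
Proof.
rewrite tsum_smax bE /arg mulrBl; congr (smax _ / _ - _); apply/funext => j.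
by rewrite mul0r addr0.
Qed.

Definition slin_coef v j : R := cutoff1 (arg v) / l * gibbs v j * beta.

Lemma slinE v x : slin v x = \sum_j slin_coef v j * x j.
Proof.
rewrite /slin /smoothind1 argE tmomE gibbsE.
rewrite mulrA mulrAC mulr_sumr; apply: eq_bigr => j _.
by rewrite expr1 /slin_coef; ring.
Qed.

(** Written as a matrix, so that after taking expectations the second-order term sees the increment
    only through its cross moments. *)
Definition squad_coef v j k : R :=
  (cutoff2 (arg v) / l - cutoff1 (arg v)) / l * beta ^+ 2 * (gibbs v j * gibbs v k)
  + (j == k)%:R * (cutoff1 (arg v) / l * beta ^+ 2 * gibbs v j).

Lemma squadE v x : squad v x = \sum_j \sum_k squad_coef v j k * (x j * x k).
Proof.
rewrite /squad /smoothind2 /tvar argE !tmomE gibbsE.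
rewrite [RHS](eq_bigr (fun j => (cutoff2 (arg v) / l - cutoff1 (arg v)) / l * ((gibbs v j * (beta * x j)) * \sum_k gibbs v k * (beta * x k)) + cutoff1 (arg v) / l * (gibbs v j * (beta * x j) ^+ 2))); last first.
  move=> j _; rewrite (bigD1 j)//= [X in _ + X = _](eq_bigr (fun k => (cutoff2 (arg v) / l - cutoff1 (arg v)) / l * (gibbs v j * (beta * x j)) * (gibbs v k * (beta * x k)))); last first.
    by move=> k /negbTE kj; rewrite /squad_coef eq_sym kj mul0r addr0; ring.
  rewrite -mulr_sumr [in RHS](bigD1 j)//= /squad_coef eqxx mul1r; ring.
rewrite big_split/= -!mulr_sumr -mulr_suml.
under [in LHS]eq_bigr do rewrite expr1.
ring.
Qed.

Lemma window_flat v x : ~~ window v -> (forall j, `|beta * x j| <= 1) -> forall s, 0 <= s <= 1 ->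
  [/\ smoothind1 (tilt v) (fun j => beta * x j) l (t / delta) s = 0,
      smoothind2 (tilt v) (fun j => beta * x j) l (t / delta) s = 0 &
      smoothind3 (tilt v) (fun j => beta * x j) l (t / delta) s = 0].
Proof.
move=> nw x1 s s01; apply: smoothind_flat.
have h := @lntsum_lip _ _ (tilt v) _ (tilt_ge0 v) (tilt_ex v) s 1 x1 s01.
move: h; rewrite !tsum_smax.
rewrite (_ : smax (fun j => v j + 0 * x j) = smax v); last first.
  by congr smax; apply/funext => j; rewrite mul0r addr0.
move: (smax (fun j => _)) => w h.
have h2 : `|w - smax v| <= beta^-1.
  rewrite -(ler_pM2l beta0) mulfV ?gt_eqF//.
  by rewrite -[X in X * `|_|](gtr0_norm beta0) -normrM mulrBr.
rewrite bE; move: nw h2; rewrite /window negb_and -!ltNge ler_distl => /orP[a|a] /andP[b c].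
  by left; rewrite ler_pM2r ?invr_gt0//; lra.
right; rewrite (_ : t / delta + 1 = (t + delta) / delta); last by field; rewrite gt_eqF.
by rewrite ler_pM2r ?invr_gt0//; lra.
Qed.

Lemma squad_coef_flat v j k : ~~ window v -> squad_coef v j k = 0.
Proof.
move=> nw; have ib : 0 < beta^-1 by rewrite invr_gt0.
have h : arg v <= 0 \/ 1 <= arg v.
  move: nw; rewrite /window negb_and -!ltNge /arg => /orP[a|a].
    by left; rewrite ler_pdivrMr// mul0r; lra.
  by right; rewrite ler_pdivlMr// mul1r; lra.
have [a b _] := cutoff_derivatives_out h.
by rewrite /squad_coef a b; ring.
Qed.

(** The Gibbs weights sum to one, so the entrywise norm of the Hessian is free of the dimension; an
    entrywise bound on the covariance error is then enough. *)
Lemma squad_coef_sum v : \sum_j \sum_k `|squad_coef v j k| <= 3 * C / l * beta ^+ 2.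
Proof.
have [c1 c2 _] := cutoff_bounds (arg v).
have C0 := @cutoff_const_ge0 R.
have il0 : 0 <= l^-1 by rewrite invr_ge0 ltW.
have il1 : l^-1 <= 1 by rewrite invf_le1.
have g0 := gibbs_ge0 v.
have b2 : 0 <= beta ^+ 2 by exact: sqr_ge0.
have h1 : `|(cutoff2 (arg v) / l - cutoff1 (arg v)) / l| <= 2 * C / l.
  rewrite normrM [X in _ * X]ger0_norm//; apply: ler_wpM2r => //.
  apply: le_trans (ler_normB _ _) _; rewrite normrM (ger0_norm il0).
  have : `|cutoff2 (arg v)| / l <= C.
    by apply: le_trans c2; rewrite ler_piMr.
  lra.
have h2 : `|cutoff1 (arg v) / l| <= C / l.
  by rewrite normrM (ger0_norm il0) ler_wpM2r.
apply: le_trans (_ : \sum_j \sum_k (2 * C / l * beta ^+ 2 * (gibbs v j * gibbs v k) + (j == k)%:R * (C / l * beta ^+ 2 * gibbs v j)) <= _).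
  apply: ler_sum => j _; apply: ler_sum => k _; apply: le_trans (ler_normD _ _) _.
  have gg : 0 <= gibbs v j * gibbs v k by rewrite mulr_ge0.
  apply: lerD.
    by rewrite normrM (ger0_norm gg) ler_wpM2r// normrM (ger0_norm b2) ler_wpM2r.
  rewrite normrM normr_nat ler_wpM2l//.
  by rewrite normrM (ger0_norm (g0 j)) ler_wpM2r// normrM (ger0_norm b2) ler_wpM2r.
rewrite le_eqVlt; apply/orP; left; apply/eqP.
rewrite (eq_bigr (fun j => 2 * C / l * beta ^+ 2 * gibbs v j + C / l * beta ^+ 2 * gibbs v j)); last first.
  move=> j _; rewrite big_split/= -!mulr_sumr gibbs_sum1 mulr1; congr (_ + _).
  by rewrite (bigD1 j)//= eqxx mul1r big1 ?addr0// => k /negbTE kj; rewrite eq_sym kj mul0r.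
by rewrite big_split/= -!mulr_sumr gibbs_sum1; ring.
Qed.

(** Its summands serve the third derivative, with the factor [expR 2] of [tabs3_stable], the first
    two derivatives, and the trivial bound 1 on a difference of values of [sind]. *)
Definition swap_const : R := 10 * C * expR 2 + 3 * C + 1.

Lemma swap_const_ge : 0 <= swap_const /\ 3 * C <= swap_const.
Proof.
have C0 := @cutoff_const_ge0 R.
have : 0 <= 10 * C * expR 2 by rewrite mulr_ge0 ?expR_ge0// mulr_ge0.
by rewrite /swap_const; split; lra.
Qed.

(* For |x| > 1/beta the trivial bounds on the three Taylor terms suffice. *)
Lemma sind_taylor v x :
  `|sind (fun j => v j + x j) - sind v - slin v x - squad v x / 2| <=
  (window v)%:R * (swap_const / l * \sum_j gibbs v j * (beta * `|x j|) ^+ 3)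
  + swap_const * (beta ^+ 2 * (supn x ^+ 2 * (beta^-1 < supn x)%R%:R)).
Proof.
have C0 := @cutoff_const_ge0 R.
have [K0 K3] := swap_const_ge.
have il0 : 0 <= l^-1 by rewrite invr_ge0 ltW.
have il1 : l^-1 <= 1 by rewrite invf_le1.
have S0 : 0 <= \sum_j gibbs v j * (beta * `|x j|) ^+ 3.
  by apply: sumr_ge0 => j _; rewrite mulr_ge0 ?gibbs_ge0// exprn_ge0// mulr_ge0// ltW.
have e1 : sind (fun j => v j + x j) = smoothind (tilt v) (fun j => beta * x j) l (t / delta) 1.
  by rewrite smoothind_sind; congr sind; apply/funext => j; rewrite mul1r.
have e0 : sind v = smoothind (tilt v) (fun j => beta * x j) l (t / delta) 0.
  by rewrite smoothind_sind; congr sind; apply/funext => j; rewrite mul0r addr0.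
have [h|h] := ltP beta^-1 (supn x); last first.
  rewrite mulr0 mulr0 mulr0 addr0.
  have x1 j : `|beta * x j| <= 1.
    rewrite normrM gtr0_norm// -bV ler_pM2l//.
    exact: le_trans (le_supn _ j) h.
  rewrite e1 e0 /slin /squad.
  have D1 := @derives_smoothind _ _ _ (fun j => beta * x j) (tilt_ge0 v) (tilt_ex v) l (t / delta).
  have D2 := @derives_smoothind1 _ _ _ (fun j => beta * x j) (tilt_ge0 v) (tilt_ex v) l (t / delta).
  have D3 := @derives_smoothind2 _ _ _ (fun j => beta * x j) (tilt_ge0 v) (tilt_ex v) l (t / delta).
  apply: (taylor3 D1 D2 D3) => s s01.
  have [w|nw] := boolP (window v); last first.
    by have [_ _ ->] := window_flat nw x1 s01; rewrite normr0 mul0r.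
  rewrite mul1r; apply: le_trans (smoothind3_le _ (tilt_ge0 v) (tilt_ex v) _ l1 s) _.
  have := tabs3_stable (tilt_ge0 v) (tilt_ex v) x1 s01.
  rewrite {2}/tabs3 gibbsE => hs.
  have {}hs : tabs3 (tilt v) (fun j => beta * x j) s <= expR 2 * \sum_j gibbs v j * (beta * `|x j|) ^+ 3.
    apply: le_trans hs _; rewrite ler_pM2l ?expR_gt0//; apply: ler_sum => j _.
    by rewrite normrM (gtr0_norm beta0).
  apply: le_trans (_ : 10 * C / l * (expR 2 * \sum_j gibbs v j * (beta * `|x j|) ^+ 3) <= _).
    by rewrite ler_wpM2l// !mulr_ge0.
  rewrite mulrA ler_wpM2r// mulrAC ler_wpM2r//.
  by rewrite /swap_const; lra.
rewrite mulr1.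
set r := beta * supn x.
have r1 : 1 <= r by rewrite /r -bV ler_pM2l// ltW.
have yr j : `|beta * x j| <= r by rewrite normrM gtr0_norm// ler_pM2l// le_supn.
rewrite -exprMn -/r.
apply: le_trans (_ : swap_const * r ^+ 2 <= _); last first.
  by rewrite lerDr mulr_ge0// mulr_ge0// divr_ge0// ltW.
have b1 : `|slin v x| <= C / l * r by exact: (smoothind1_le (tilt_ge0 v) (tilt_ex v) _ l1 _ yr).
have b2 : `|squad v x| <= 2 * C / l * r ^+ 2.
  by apply: (smoothind2_le (tilt_ge0 v) (tilt_ex v) _ l1 _ _ yr); lra.
have b1' : C / l * r <= C * r ^+ 2.
  rewrite expr2 mulrA; apply: ler_wpM2r; first lra.
  by rewrite ler_wpM2l//; apply: le_trans r1.
have b2' : 2 * C / l * r ^+ 2 <= 2 * C * r ^+ 2.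
  by apply: ler_wpM2r; [exact: sqr_ge0|rewrite ler_piMr// mulr_ge0].
have r2 : 1 <= r ^+ 2 by rewrite exprn_ege1.
have E0 : 0 <= 10 * C * expR 2 * r ^+ 2 by apply: mulr_ge0 (sqr_ge0 _); rewrite !mulr_ge0 ?expR_ge0.
have tr : `|sind (fun j => v j + x j) - sind v - slin v x - squad v x / 2| <= 1 + `|slin v x| + `|squad v x| / 2.
  have h1 : `|sind (fun j => v j + x j) - sind v| <= 1.
    by apply: itv01_dist; exact: sind_itv.
  apply: le_trans (ler_normB _ _) _; rewrite normrM [`|2^-1|]ger0_norm// lerD2r.
  by apply: le_trans (ler_normB _ _) _; rewrite lerD2r.
have C2 : 0 <= C * r ^+ 2 by rewrite mulr_ge0// sqr_ge0.
rewrite (_ : swap_const * r ^+ 2 = 10 * C * expR 2 * r ^+ 2 + 3 * (C * r ^+ 2) + r ^+ 2); last by rewrite /swap_const; ring.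
apply: le_trans tr _.
move: b1 b2 b1' b2' r2 E0 C2.
move: (C * r ^+ 2) (10 * C * expR 2 * r ^+ 2) (C / l * r) (2 * C / l * r ^+ 2) (r ^+ 2) `|slin v x| `|squad v x| => *.
lra.
Qed.

Lemma measurable_sind d (T : measurableType d) (xi : T -> J -> R) :
  (forall j, measurable_fun setT (fun x => xi x j)) ->
  measurable_fun setT (fun x => sind (xi x)).
Proof.
move=> mxi; apply: (@measurableT_comp _ _ _ _ _ _ (@cutoff R)).
  by apply: continuous_measurable_fun; exact: is_derive_continuous (@derives_cutoff R).
by apply: measurable_funM => //; apply: measurable_funB => //; exact: measurable_smax.
Qed.

Section centred_vectors.
Context d (T : measurableType d) (P : probability T R).

(** Third moments are asked for one coordinate at a time, which costs no dimension factor. Besides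
    integrability, the sup norm is controlled only beyond [1 / beta], where a Taylor expansion gives
    nothing. *)
Record swappable (xi : T -> J -> R) (m3 tau : R) : Prop := Swappable {
  swap_meas : forall j, measurable_fun setT (fun x => xi x j);
  swap_intg2 : intg P (fun x => supn (xi x) ^+ 2);
  swap_intg3 : forall j, intg P (fun x => `|xi x j| ^+ 3);
  swap_mean : forall j, Ex P (fun x => xi x j) = 0;
  swap_third : forall j, Ex P (fun x => `|xi x j| ^+ 3) <= m3;
  swap_tail : Ex P (fun x => supn (xi x) ^+ 2 * (beta^-1 < supn (xi x))%R%:R) <= tau }.

Variables (xi : T -> J -> R) (m3 tau : R).
Hypothesis S : swappable xi m3 tau.

Lemma swap_measurable_supn : measurable_fun setT (fun x => supn (xi x)).
Proof. by apply: measurable_supn; exact: swap_meas S. Qed.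

Lemma swap_intg_tail : intg P (fun x => supn (xi x) ^+ 2 * (beta^-1 < supn (xi x))%R%:R).
Proof.
apply: intg_dom (swap_intg2 S) _.
  apply: measurable_funM; first by apply: measurable_funX; exact: swap_measurable_supn.
  exact: measurable_fun_indic_gt swap_measurable_supn.
move=> x; rewrite normrM ger0_norm ?sqr_ge0// normr_nat.
by case: (_ < _)%R; rewrite ?mulr1// mulr0 sqr_ge0.
Qed.

Lemma swap_intgM j k : intg P (fun x => xi x j * xi x k).
Proof.
apply: intg_dom (swap_intg2 S) _.
  by apply: measurable_funM; exact: swap_meas S _.
move=> x; rewrite normrM expr2.
by apply: ler_pM => //; exact: le_supn.
Qed.

Lemma swap_intg1 j : intg P (fun x => xi x j).
Proof.
apply: (@intg_dom _ _ _ _ _ (fun x => 1 + supn (xi x) ^+ 2)).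
- exact: swap_meas S _.
- by apply: intgD; [exact: intg_cst|exact: swap_intg2 S].
move=> x; apply: le_trans (le_supn _ j) _.
by set s := supn _; nra.
Qed.

Lemma swap_small : beta ^+ 2 * tau <= 2^-1 ->
  2^-1 <= pr P [set x | supn (xi x) <= beta^-1].
Proof.
move=> h.
have mS : measurable [set x | supn (xi x) <= beta^-1].
  by apply: measurable_set_le; exact: swap_measurable_supn.
have e : pr P (~` [set x | supn (xi x) <= beta^-1]) <= 2^-1.
  apply: le_trans h.
  have ib : 0 < beta^-1 ^+ 2 by rewrite exprn_gt0// invr_gt0.
  apply: le_trans (markov_le swap_intg_tail _ (measurableC mS) ib _) _.
  - by move=> x; rewrite mulr_ge0// sqr_ge0.
  - move=> x /= /negP; rewrite -ltNge => h; rewrite h mulr1.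
    by rewrite lerXn2r ?nnegrE ?supn_ge0 ?invr_ge0 ?ltW.
  rewrite exprVn invrK mulrC ler_pM2l ?exprn_gt0//; exact: swap_tail S.
by move: e; rewrite pr_setC//; lra.
Qed.

(** The linear term integrates to zero by centring. The cubic term is a Gibbs average of third
    moments with weights frozen at [v], so the maximum over coordinates stays outside the
    expectation. *)
Lemma swap_one v : `|Ex P (fun x => sind (fun j => v j + xi x j)) - sind v -
   (\sum_j \sum_k squad_coef v j k * Ex P (fun x => xi x j * xi x k)) / 2| <=
  (window v)%:R * (swap_const / l * (beta ^+ 3 * m3)) + swap_const * (beta ^+ 2 * tau).
Proof.
have [K0 _] := swap_const_ge.
have iM := swap_intgM; have i1 := swap_intg1.
have ms : measurable_fun setT (fun x => sind (fun j => v j + xi x j)).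
  by apply: measurable_sind => j; apply: measurable_funD => //; exact: swap_meas S _.
have isd : intg P (fun x => sind (fun j => v j + xi x j)).
  apply: (@intg_bounded _ _ _ _ _ 1) => // x.
  by have /andP[a b] := sind_itv (fun j => v j + xi x j); rewrite ger0_norm.
have il : intg P (fun x => slin v (xi x)).
  under eq_fun do rewrite slinE.
  by apply: intg_sum => j; exact: intgZ.
have iq1 j : intg P (fun x => \sum_k squad_coef v j k * (xi x j * xi x k)).
  by apply: intg_sum => k; exact: intgZ.
have iq : intg P (fun x => squad v (xi x)).
  under eq_fun do rewrite squadE.
  by apply: intg_sum => j.
have el : Ex P (fun x => slin v (xi x)) = 0.
  under eq_Ex do rewrite slinE.
  rewrite Ex_sum; last by move=> j; exact: intgZ.
  by rewrite big1// => j _; rewrite ExZ// (swap_mean S) mulr0.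
have eq : Ex P (fun x => squad v (xi x)) = \sum_j \sum_k squad_coef v j k * Ex P (fun x => xi x j * xi x k).
  under eq_Ex do rewrite squadE.
  rewrite Ex_sum//; apply: eq_bigr => j _.
  rewrite Ex_sum; last by move=> k; exact: intgZ.
  by apply: eq_bigr => k _; rewrite ExZ.
have ia : intg P (fun x => sind (fun j => v j + xi x j) - sind v).
  exact: intgB isd (intg_cst P (sind v)).
have ib : intg P (fun x => sind (fun j => v j + xi x j) - sind v - slin v (xi x)) by exact: intgB.
have iq2 : intg P (fun x => squad v (xi x) / 2).
  by under eq_fun do rewrite mulrC; exact: intgZ.
pose r x := sind (fun j => v j + xi x j) - sind v - slin v (xi x) - squad v (xi x) / 2.
have ir : intg P r by exact: intgB.
have -> : Ex P (fun x => sind (fun j => v j + xi x j)) - sind v -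
   (\sum_j \sum_k squad_coef v j k * Ex P (fun x => xi x j * xi x k)) / 2 = Ex P r.
  rewrite /r (ExB ib iq2) (ExB ia il) (ExB isd (intg_cst P (sind v))).
  rewrite el Ex_cst subr0 -eq; congr (_ - _).
  by under [RHS]eq_Ex do rewrite mulrC; rewrite ExZ// mulrC.
pose g3 x := \sum_j gibbs v j * (beta * `|xi x j|) ^+ 3.
have i3 : intg P g3.
  apply: intg_sum => j; apply: intgZ.
  under eq_fun do rewrite exprMn.
  by apply: intgZ; exact: swap_intg3 S _.
have e3 : Ex P g3 <= beta ^+ 3 * m3.
  rewrite /g3 Ex_sum; last first.
    move=> j; apply: intgZ; under eq_fun do rewrite exprMn.
    by apply: intgZ; exact: swap_intg3 S _.
  apply: le_trans (_ : \sum_j gibbs v j * (beta ^+ 3 * m3) <= _); last first.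
    by rewrite -mulr_suml gibbs_sum1 mul1r.
  apply: ler_sum => j _; rewrite ExZ; last first.
    by under eq_fun do rewrite exprMn; apply: intgZ; exact: swap_intg3 S _.
  rewrite ler_wpM2l ?gibbs_ge0//.
  under eq_Ex do rewrite exprMn.
  rewrite ExZ; last exact: swap_intg3 S _.
  by rewrite ler_pM2l ?exprn_gt0//; exact: swap_third S _.
have it := swap_intg_tail.
pose g x := (window v)%:R * (swap_const / l * g3 x)
  + swap_const * (beta ^+ 2 * (supn (xi x) ^+ 2 * (beta^-1 < supn (xi x))%R%:R)).
have ig : intg P g by apply: intgD; do ?apply: intgZ.
have : Ex P g <= (window v)%:R * (swap_const / l * (beta ^+ 3 * m3)) + swap_const * (beta ^+ 2 * tau).
  rewrite /g ExD; [|by do ?apply: intgZ|by do ?apply: intgZ].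
  rewrite !ExZ//; do ?[exact: intgZ].
  apply: lerD; first by rewrite ler_wpM2l// ler_wpM2l// divr_ge0// ltW.
  by rewrite ler_wpM2l// ler_wpM2l ?sqr_ge0//; exact: swap_tail S.
apply: le_trans; apply: Ex_abs_le => // x.
exact: sind_taylor.
Qed.

End centred_vectors.

Lemma swap_two d1 (T1 : measurableType d1) (P1 : probability T1 R)
    d2 (T2 : measurableType d2) (P2 : probability T2 R)
    (xi : T1 -> J -> R) (eta : T2 -> J -> R) (m3 tau1 tau2 D : R) v :
  swappable P1 xi m3 tau1 -> swappable P2 eta m3 tau2 ->
  (forall j k, `|Ex P1 (fun x => xi x j * xi x k) - Ex P2 (fun x => eta x j * eta x k)| <= D) ->
  `|Ex P1 (fun x => sind (fun j => v j + xi x j)) - Ex P2 (fun x => sind (fun j => v j + eta x j))| <=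
  (window v)%:R * (swap_const / l * (beta ^+ 2 * D + 2 * beta ^+ 3 * m3))
  + swap_const * (beta ^+ 2 * (tau1 + tau2)).
Proof.
move=> S1 S2 hD.
have [K0 K3] := swap_const_ge.
have h1 := swap_one S1 v; have h2 := swap_one S2 v.
set q1 := \sum_j _ in h1; set q2 := \sum_j _ in h2.
have hq : `|q1 - q2| <= (window v)%:R * (swap_const / l * (beta ^+ 2 * D)).
  have -> : q1 - q2 = \sum_j \sum_k squad_coef v j k * (Ex P1 (fun x => xi x j * xi x k) - Ex P2 (fun x => eta x j * eta x k)).
    rewrite /q1 /q2 -sumrB; apply: eq_bigr => j _; rewrite -sumrB; apply: eq_bigr => k _.
    by rewrite mulrBr.
  have [w|nw] := boolP (window v); last first.
    rewrite mul0r big1 ?normr0// => j _; rewrite big1// => k _.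
    by rewrite squad_coef_flat// mul0r.
  rewrite mul1r; apply: le_trans (ler_norm_sum _ _ _) _.
  have D0 : 0 <= D.
    by have /card_gt0P[j _] := J0; apply: le_trans (hD j j).
  apply: le_trans (_ : (\sum_j \sum_k `|squad_coef v j k|) * D <= _).
    rewrite mulr_suml; apply: ler_sum => j _.
    apply: le_trans (ler_norm_sum _ _ _) _; rewrite mulr_suml; apply: ler_sum => k _.
    by rewrite normrM ler_wpM2l.
  rewrite mulrA ler_wpM2r//; apply: le_trans (squad_coef_sum v) _.
  rewrite ler_wpM2r ?sqr_ge0// ler_wpM2r//.
  by rewrite invr_ge0 ltW.
move: h1 h2 hq; set A := Ex P1 _; set B := Ex P2 _; move: (sind v) => s.
set w := (window v)%:R.
have -> : w * (swap_const / l * (beta ^+ 2 * D + 2 * beta ^+ 3 * m3)) =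
  w * (swap_const / l * (beta ^+ 2 * D)) + 2 * (w * (swap_const / l * (beta ^+ 3 * m3))) by ring.
have -> : swap_const * (beta ^+ 2 * (tau1 + tau2)) = swap_const * (beta ^+ 2 * tau1) + swap_const * (beta ^+ 2 * tau2) by ring.
move: (w * (swap_const / l * (beta ^+ 2 * D))) (w * (swap_const / l * (beta ^+ 3 * m3))) => a b.
move: (swap_const * _) (swap_const * _) A B q1 q2 => c e A B q1 q2.
rewrite !ler_norml => /andP[? ?] /andP[? ?] /andP[? ?]; apply/andP; split; lra.
Qed.

End smooth_indicator.
End smooth_maximum.

(** * Anti-concentration of Gaussian maxima *)

Section anticoncentration.
Context (R : realType) (J : finType) (n : nat).
Variables (N : probability R R) (G : probability (n.-tuple R) R).
Hypotheses (NE : std_normal N) (NG : prodlike N G).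
Hypothesis J0 : (0 < #|J|)%N.
Variable a : 'I_n -> J -> R.

Definition gaussv (e : n.-tuple R) (j : J) : R := linf (fun i => a i j) e.

Lemma measurable_gaussv j : measurable_fun setT (fun e => gaussv e j).
Proof. exact: measurable_linf. Qed.

Let s0 j : 0 <= \sum_i a i j ^+ 2.
Proof. by apply: sumr_ge0 => i _; exact: sqr_ge0. Qed.

Let mgfv j := linf_mgf NE NG (fun i => a i j).

Lemma gaussv_pow_intg j k : intg G (fun e => gaussv e j ^+ k.+1).
Proof. exact: (linf_intg_pow NE NG). Qed.

Lemma gaussv_abs3 j : intg G (fun e => `|gaussv e j| ^+ 3) /\
  Ex G (fun e => `|gaussv e j| ^+ 3) <= 6 * (2 * expR ((\sum_i a i j ^+ 2) / 2)).
Proof. exact: (mgf_abs3 (measurable_gaussv j) (mgfv j)). Qed.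

Lemma supn_pow_le (x : J -> R) k : (0 < k)%N -> supn x ^+ k <= \sum_j `|x j| ^+ k.
Proof.
move=> k0.
have /card_gt0P[i _] := J0.
have [j _ hj] := @eq_bigmax _ R J 0 i xpredT (fun j => `|x j|) isT (fun j _ => normr_ge0 (x j)).
rewrite /supn hj (bigD1 j)//= lerDl; apply: sumr_ge0 => l _.
by rewrite exprn_ge0.
Qed.

Lemma gaussv_supn_intg k : intg G (fun e => supn (gaussv e) ^+ k.+1).
Proof.
apply: (@intg_dom _ _ _ _ _ (fun e => \sum_j `|gaussv e j ^+ k.+1|)).
- by apply: measurable_funX; apply: measurable_supn => j; exact: measurable_gaussv.
- by apply: intg_sum => j; apply: intg_abs; exact: gaussv_pow_intg.
move=> e; rewrite ger0_norm ?exprn_ge0 ?supn_ge0//.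
by apply: le_trans (supn_pow_le _ _) _ => //; apply: ler_sum => j _; rewrite normrX.
Qed.

Section bounded_variance.
Variables L : R.
Hypotheses (L0 : 0 < L) (NL : 2 * #|J|%:R <= expR L).
Hypothesis var_le : forall j, \sum_i a i j ^+ 2 <= 2.

(* Jensen's inequality in the form ln x <= ln A + x / A - 1 with A = exp (2 L). *)
Lemma gaussv_supn_mean : Ex G (fun e => supn (gaussv e)) <= 2 * Num.sqrt L.
Proof.
set lam := Num.sqrt L; have lam0 : 0 < lam by rewrite sqrtr_gt0.
have lam2 : lam ^+ 2 = L by rewrite sqr_sqrtr// ltW.
pose S e := \sum_j expR (lam * `|gaussv e j|).
have iS : intg G S.
  by apply: intg_sum => j; exact: (mgf_abs_intg (measurable_gaussv j) (mgfv j)).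
pose X e := lam^-1 * (2 * L - 1 + expR (- (2 * L)) * S e).
have h e j : `|gaussv e j| <= X e.
  rewrite -(ler_pM2l lam0) /X mulrA mulfV ?gt_eqF// mul1r.
  have := expR_ge1Dx (lam * `|gaussv e j| - 2 * L).
  have : expR (lam * `|gaussv e j| - 2 * L) <= expR (- (2 * L)) * S e.
    rewrite addrC expRD ler_pM2l ?expR_gt0// /S (bigD1 j)//= lerDl.
    by apply: sumr_ge0 => i _; exact: expR_ge0.
  lra.
have h2 e : supn (gaussv e) <= X e.
  apply: supn_le => //.
  by have /card_gt0P[j _] := J0; apply: le_trans (h e j).
have i2 : intg G (fun e => expR (- (2 * L)) * S e) by exact: intgZ.
have i3 : intg G (fun e => 2 * L - 1 + expR (- (2 * L)) * S e).
  by apply: intgD => //; exact: intg_cst.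
have iX : intg G X by exact: intgZ.
apply: le_trans (Ex_le (gaussv_supn_intg 0) iX _) _ => //.
rewrite /X ExZ// ExD//; last exact: intg_cst.
rewrite Ex_cst ExZ//.
have hS : Ex G S <= expR (2 * L).
  rewrite /S Ex_sum; last by move=> j; exact: (mgf_abs_intg (measurable_gaussv j) (mgfv j)).
  apply: le_trans (_ : \sum_(j : J) 2 * expR L <= _).
    apply: ler_sum => j _.
    apply: le_trans (mgf_abs_le (measurable_gaussv j) (mgfv j) lam) _.
    by rewrite ler_pM2l// ler_expR lam2; have := var_le j; nra.
  rewrite sumr_const -[X in X <= _]mulr_natl mulrA [_ * 2]mulrC.
  by rewrite (_ : 2 * L = L + L); [rewrite expRD ler_pM2r ?expR_gt0|ring].
have hS2 : expR (- (2 * L)) * Ex G S <= 1.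
  by rewrite expRN mulrC ler_pdivrMr ?expR_gt0// mul1r.
rewrite -(ler_pM2l lam0) mulrA mulfV ?gt_eqF// mul1r.
rewrite (_ : lam * (2 * lam) = 2 * lam ^+ 2); last by ring.
by rewrite lam2; lra.
Qed.

End bounded_variance.

Section local_density.
Variables (beta t : R) (p : J -> R) (m1 : R).
Hypotheses (beta0 : 0 < beta) (p0 : forall j, 0 < p j).
Hypothesis var_ge : forall j, 2^-1 <= \sum_i a i j ^+ 2.
Hypothesis mean_le : Ex G (fun e => supn (gaussv e)) <= m1.

(* One more, constant, coordinate at level t: its Gibbs weight locates smax relative to t. *)
Let p' (o : option J) : R := if o is Some j then p j else expR (beta * t).
Let ext (x : J -> R) (o : option J) : R := if o is Some j then x j else 0.
Let p'0 o : 0 < p' o. Proof. by case: o => [j|] //=; exact: expR_gt0. Qed.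
Let J'0 : (0 < #|{: option J}|)%N. Proof. by rewrite card_option. Qed.
(** Writing [A = expR (beta * t)] and [S] for the partition function of [x], this is
    [ln (1 + S / A)], and the Gibbs weight [w0] of the extra coordinate is
    [A / (A + S) = expR (- U)]. *)
Let U (x : J -> R) : R := beta * (smax beta p' (ext x) - t).
Let w0 (x : J -> R) : R := gibbs beta p' (ext x) None.

Let bV : beta * beta^-1 = 1. Proof. by rewrite mulfV// gt_eqF. Qed.

Let sum_option (f : option J -> R) : \sum_o f o = f None + \sum_j f (Some j).
Proof.
rewrite (bigD1 None)//=; congr (_ + _).
rewrite (reindex_omap Some id)//=; last by case.
by apply: eq_bigl => j; rewrite eqxx.
Qed.

Let U_ge0 x : 0 <= U x.
Proof.
rewrite /U mulrBr subr_ge0 /smax mulrA bV mul1r sum_option /= mulr0 expR0 mulr1.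
rewrite -[leLHS]expRK ler_ln ?posrE ?expR_gt0//.
  by rewrite lerDl; apply: sumr_ge0 => j _; rewrite mulr_ge0 ?expR_ge0// ltW.
by rewrite ltr_pwDl ?expR_gt0//; apply: sumr_ge0 => j _; rewrite mulr_ge0 ?expR_ge0// ltW.
Qed.

Let U_lip x y r : (forall j, `|y j| <= r) -> 0 <= r -> U (fun j => x j + y j) <= U x + beta * r.
Proof.
move=> yr r0; rewrite /U -mulrDr ler_pM2l//.
have := @smax_lip _ _ _ _ beta0 p'0 J'0 (ext x) (ext y) r.
rewrite (_ : (fun o => ext x o + ext y o) = ext (fun j => x j + y j)); last first.
  by apply/funext; case=> [j|] //=; rewrite addr0.
have h : forall o, `|ext y o| <= r by case=> [j|] //=; rewrite normr0.
by move=> /(_ h); rewrite ler_norml => /andP[_]; lra.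
Qed.

Let w0_itv x : 0 <= w0 x <= 1.
Proof.
rewrite /w0 (gibbs_ge0 _ p'0 J'0)/= -(gibbs_sum1 beta p'0 J'0 (ext x)) sum_option lerDl.
by apply: sumr_ge0 => j _; exact: (gibbs_ge0 _ p'0 J'0).
Qed.

Let gx x j := gibbs beta p' (ext x) (Some j).

Let gx_sum x : \sum_j gx x j = 1 - w0 x.
Proof. by rewrite -(gibbs_sum1 beta p'0 J'0 (ext x)) sum_option addrAC subrr add0r. Qed.

Let gx_ge0 x j : 0 <= gx x j.
Proof. exact: (gibbs_ge0 _ p'0 J'0). Qed.

(** Cauchy-Schwarz for weights of total mass [1 - w0]. The missing mass is the gain: the extra
    coordinate does not move, so the Gibbs variance of an increment is at least [w0] times its
    second moment. *)
Let wcs x y : (\sum_j gx x j * y j) ^+ 2 <= (1 - w0 x) * \sum_j gx x j * y j ^+ 2.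
Proof.
rewrite -gx_sum expr2 !mulr_suml.
under eq_bigr => j _ do rewrite mulr_sumr.
under [leRHS]eq_bigr => j _ do rewrite mulr_sumr.
rewrite -subr_ge0 -sumrB.
pose D := \sum_j \sum_k gx x j * gx x k * (y j - y k) ^+ 2.
have D0 : 0 <= D.
  by do 2!(apply: sumr_ge0 => ? _); rewrite mulr_ge0 ?sqr_ge0// mulr_ge0.
suff -> : \sum_j (\sum_k gx x j * (gx x k * y k ^+ 2) - \sum_k gx x j * y j * (gx x k * y k)) = D / 2.
  by rewrite divr_ge0.
have e : D = \sum_j \sum_k (gx x j * (gx x k * y k ^+ 2) - gx x j * y j * (gx x k * y k)) +
             \sum_j \sum_k (gx x k * (gx x j * y j ^+ 2) - gx x k * y k * (gx x j * y j)).
  rewrite -big_split; apply: eq_bigr => j _; rewrite -big_split; apply: eq_bigr => k _/=.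
  by ring.
rewrite [X in _ + X]exchange_big/= in e.
rewrite e -mulr2n -[X in _ = X / 2]mulr_natl mulrAC mulfV// mul1r.
by apply: eq_bigr => j _; rewrite sumrB.
Qed.

Let U_taylor x y s r : 0 <= s -> 0 <= r -> (forall j, `|y j| <= r) ->
  U x + s * (\sum_j gx x j * (beta * y j)) +
  s ^+ 2 / 2 * (beta ^+ 2 * (w0 x * \sum_j gx x j * y j ^+ 2)) - 6 * (s * (beta * r)) ^+ 3 <=
  U (fun j => x j + s * y j).
Proof.
move=> s0' r0 yr.
pose z o := beta * ext (fun j => s * y j) o.
have A0 o : 0 <= tilt beta p' (ext x) o by exact/ltW/tilt_gt0.
have Ae := tilt_ex beta p'0 J'0 (ext x).
have D1 := is_derive_lntsum z A0 Ae.
have D2 := is_derive_tmom z A0 Ae 1.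
have D2' : derives (tmom (tilt beta p' (ext x)) z 1) (tvar (tilt beta p' (ext x)) z).
  by move=> u; apply: is_derive_val (D2 u); rewrite /tvar expr2.
have D3 := is_derive_tvar z A0 Ae.
have zr o : `|z o| <= s * (beta * r).
  rewrite /z; case: o => [j|] /=; last by rewrite mulr0 normr0 !mulr_ge0// ltW.
  by rewrite !normrM (ger0_norm s0') (gtr0_norm beta0) mulrCA ler_wpM2l// ler_pM2l.
have B u : 0 <= u <= 1 -> `|tcum3 (tilt beta p' (ext x)) z u| <= 6 * (s * (beta * r)) ^+ 3.
  move=> _; apply: le_trans (tcum3_le z A0 Ae u) _.
  rewrite ler_pM2l// /tabs3.
  apply: le_trans (_ : \sum_o tw (tilt beta p' (ext x)) z u o * (s * (beta * r)) ^+ 3 <= _).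
    apply: ler_sum => o _; rewrite ler_wpM2l ?tw_ge0//.
    by rewrite lerXn2r ?nnegrE// (le_trans _ (zr o)).
  by rewrite -mulr_suml tw_sum1// mul1r.
have := taylor3 D1 D2' D3 B.
have e1 : ln (tsum (tilt beta p' (ext x)) z 0 1) = U (fun j => x j + s * y j) + beta * t.
  rewrite (tsum_smax _ beta0) /U mulrBr subrK; congr (_ * smax _ _ _).
  by apply/funext; case=> [j|] /=; rewrite mul1r ?addr0.
have e0 : ln (tsum (tilt beta p' (ext x)) z 0 0) = U x + beta * t.
  rewrite (tsum_smax _ beta0) /U mulrBr subrK; congr (_ * smax _ _ _).
  by apply/funext; case=> [j|] /=; rewrite mul0r addr0.
have em1 : tmom (tilt beta p' (ext x)) z 1 0 = s * beta * \sum_j gx x j * y j.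
  rewrite tmomE gibbsE sum_option /z /= mulr0 expr1 mulr0 add0r mulr_sumr.
  by apply: eq_bigr => j _; rewrite expr1 /gx; ring.
have em2 : tmom (tilt beta p' (ext x)) z 2 0 = s ^+ 2 * beta ^+ 2 * \sum_j gx x j * y j ^+ 2.
  rewrite tmomE gibbsE sum_option /z /= !mulr0 expr0n/= mulr0 add0r mulr_sumr.
  by apply: eq_bigr => j _; rewrite /gx; ring.
have el : s * (\sum_j gx x j * (beta * y j)) = s * beta * \sum_j gx x j * y j.
  by rewrite -mulrA; congr (_ * _); rewrite mulr_sumr; apply: eq_bigr => j _; ring.
rewrite e1 e0 /tvar em1 em2 el.
have c := wcs x y.
have c2 : (s * beta * \sum_j gx x j * y j) ^+ 2 <= s ^+ 2 * beta ^+ 2 * ((1 - w0 x) * \sum_j gx x j * y j ^+ 2).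
  by rewrite !exprMn ler_wpM2l// mulr_ge0// sqr_ge0.
move: c2; rewrite mulrBl mul1r mulrBr.
rewrite (_ : s ^+ 2 / 2 * (beta ^+ 2 * (w0 x * \sum_j gx x j * y j ^+ 2)) = s ^+ 2 * beta ^+ 2 * (w0 x * \sum_j gx x j * y j ^+ 2) / 2); last by ring.
move: (s ^+ 2 * beta ^+ 2 * (w0 x * _)) (s ^+ 2 * beta ^+ 2 * _) (U (fun j => x j + s * y j)) (U x) (s * beta * _) (beta * t) (6 * _) => A B1 u' u E F' G'.
by rewrite ler_norml => ? /andP[? ?]; lra.
Qed.

Let Y := gaussv.
Let mU c : measurable_fun setT (fun e => U (fun j => c * Y e j)).
Proof.
apply: measurable_funM => //; apply: measurable_funB => //.
apply: measurable_smax => -[j|] //=; apply: measurable_funM => //.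
exact: measurable_gaussv.
Qed.

Let U_le x : U x <= U (fun=> 0) + beta * supn x.
Proof.
rewrite [X in U X <= _](_ : x = fun j => (fun=> 0) j + x j); last by apply/funext => j; rewrite add0r.
exact: (@U_lip (fun=> 0) x (supn x) (le_supn x) (supn_ge0 x)).
Qed.

Let isup : intg G (fun e => supn (Y e)). Proof. exact: (gaussv_supn_intg 0). Qed.

Let iU c : intg G (fun e => U (fun j => c * Y e j)).
Proof.
apply: (@intg_dom _ _ _ _ _ (fun e => U (fun=> 0) + beta * `|c| * supn (Y e))) => //.
  by apply: intgD; [exact: intg_cst|exact: intgZ].
move=> e; rewrite ger0_norm//; apply: le_trans (U_le _) _.
by rewrite lerD2l -mulrA ler_pM2l// supn_scale.
Qed.

Let w0E x : w0 x = expR (- U x).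
Proof.
rewrite /w0 /gibbs /tilt /= mulr0 expR0 mulr1 /U /smax mulrBr mulrA bV mul1r opprB expRD expRN.
by rewrite lnK// posrE; exact: (sum_tilt_gt0 beta p'0 J'0).
Qed.

(** Bounded away from zero exactly when [A] and [S] are comparable, that is when the soft maximum is
    within order [1 / beta] of [t]; a smooth detector of the event to be bounded. *)
Let D x := w0 x * (1 - w0 x).

Let D_itv x : 0 <= D x <= 1.
Proof. by rewrite /D; have /andP[h1 h2] := w0_itv x; apply/andP; split; nra. Qed.

Let mD : measurable_fun setT (fun e => D (Y e)).
Proof.
have mw : measurable_fun setT (fun e => w0 (Y e)).
  under eq_fun do rewrite w0E.
  apply: measurableT_comp => //; apply: measurableT_comp => //.
  have := mU 1; under eq_fun do under eq_fun do rewrite mul1r.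
  by [].
by apply: measurable_funM => //; apply: measurable_funB => //.
Qed.

Let iD : intg G (fun e => D (Y e)).
Proof. by apply: (@intg_bounded _ _ _ _ _ 1) => // e; have /andP[? ?] := D_itv (Y e); rewrite ger0_norm. Qed.

Let K3 : R := 6 * (beta ^+ 3 * Ex G (fun e => supn (Y e) ^+ 3)).

Let K3_ge0 : 0 <= K3.
Proof.
rewrite /K3 mulr_ge0// mulr_ge0//; first by rewrite exprn_ge0// ltW.
by apply: Ex_ge0 => e; rewrite exprn_ge0// supn_ge0.
Qed.

Let UsY_intg x s : intg G (fun e => U (fun j => x j + s * Y e j)).
Proof.
apply: (@intg_dom _ _ _ _ _ (fun e => U x + beta * `|s| * supn (Y e))).
- apply: measurable_funM => //; apply: measurable_funB => //.
  apply: measurable_smax => -[j|] //=; apply: measurable_funD => //.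
  by apply: measurable_funM => //; exact: measurable_gaussv.
- by apply: intgD; [exact: intg_cst|exact: intgZ].
move=> e; rewrite ger0_norm//.
apply: le_trans (@U_lip x (fun j => s * Y e j) _ (le_supn _) (supn_ge0 _)) _.
by rewrite lerD2l -mulrA ler_pM2l// supn_scale.
Qed.

(** Averaging the expansion over a centred Gaussian direction kills the linear term, and variances
    at least one half turn the quadratic term into [s^2 / 4 * beta^2 * D]. *)
Let inner x s : 0 <= s ->
  U x + s ^+ 2 / 4 * beta ^+ 2 * D x <= Ex G (fun e => U (fun j => x j + s * Y e j)) + s ^+ 3 * K3.
Proof.
move=> s0'.
pose low e := U x + s * (\sum_j gx x j * (beta * Y e j)) +
  s ^+ 2 / 2 * (beta ^+ 2 * (w0 x * \sum_j gx x j * Y e j ^+ 2)) - 6 * (s * (beta * supn (Y e))) ^+ 3.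
have h e : low e <= U (fun j => x j + s * Y e j).
  by apply: U_taylor => //; [exact: supn_ge0|exact: le_supn].
have i1 j : intg G (fun e => Y e j) by exact: (gaussv_pow_intg j 0).
have i2 j : intg G (fun e => Y e j ^+ 2) by exact: (gaussv_pow_intg j 1).
have i3 : intg G (fun e => supn (Y e) ^+ 3) by exact: (gaussv_supn_intg 2).
have ia j : intg G (fun e => gx x j * (beta * Y e j)) by do 2!apply: intgZ.
have ib j : intg G (fun e => gx x j * Y e j ^+ 2) by apply: intgZ.
have iA : intg G (fun e => \sum_j gx x j * (beta * Y e j)) by apply: intg_sum.
have iB : intg G (fun e => \sum_j gx x j * Y e j ^+ 2) by apply: intg_sum.
have iC : intg G (fun e => 6 * (s * (beta * supn (Y e))) ^+ 3).
  by apply: intgZ; under eq_fun do rewrite mulrA exprMn; exact: intgZ.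
have i4 : intg G (fun e => s * (\sum_j gx x j * (beta * Y e j))) by exact: intgZ.
have i5 : intg G (fun e => s ^+ 2 / 2 * (beta ^+ 2 * (w0 x * \sum_j gx x j * Y e j ^+ 2))).
  by do 3!apply: intgZ.
have i6 : intg G (fun e => U x + s * (\sum_j gx x j * (beta * Y e j))) by apply: intgD (intg_cst _ _) i4.
have i7 := intgD i6 i5.
have il : intg G low by exact: intgB i7 iC.
have := Ex_le il (UsY_intg x s) h.
rewrite /low (ExB i7 iC) (ExD i6 i5) (ExD (intg_cst _ _) i4) Ex_cst (ExZ _ iA).
rewrite Ex_sum// big1 ?mulr0 ?addr0; last first.
  move=> j _; rewrite ExZ; last exact: intgZ.
  by rewrite ExZ// [Ex _ _](linf_mean NE NG) !mulr0.
rewrite (ExZ _ (intgZ _ (intgZ _ iB))) (ExZ _ (intgZ _ iB)) (ExZ _ iB) Ex_sum//.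
rewrite (eq_bigr (fun j => gx x j * \sum_i a i j ^+ 2)); last first.
  by move=> j _; rewrite ExZ// [Ex _ _](linf_var NE NG).
have -> : Ex G (fun e => 6 * (s * (beta * supn (Y e))) ^+ 3) = s ^+ 3 * K3.
  rewrite (@eq_Ex _ _ _ _ _ (fun e => (6 * (s * beta) ^+ 3) * supn (Y e) ^+ 3)); last by move=> e; ring.
  by rewrite ExZ// /K3; ring.
have hv : (1 - w0 x) / 2 <= \sum_j gx x j * \sum_i a i j ^+ 2.
  by rewrite -gx_sum mulr_suml; apply: ler_sum => j _; rewrite ler_wpM2l.
have /andP[w1 w2] := w0_itv x.
have := ler_wpM2l w1 hv; move: (\sum_j _) => V hV.
have : s ^+ 2 / 2 * beta ^+ 2 * (w0 x * ((1 - w0 x) / 2)) <= s ^+ 2 / 2 * beta ^+ 2 * (w0 x * V).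
  by rewrite ler_wpM2l// mulr_ge0 ?sqr_ge0// divr_ge0// sqr_ge0.
rewrite (_ : s ^+ 2 / 2 * beta ^+ 2 * (w0 x * ((1 - w0 x) / 2)) = s ^+ 2 / 4 * beta ^+ 2 * D x); last by rewrite /D; field.
rewrite (_ : s ^+ 2 / 2 * (beta ^+ 2 * (w0 x * V)) = s ^+ 2 / 2 * beta ^+ 2 * (w0 x * V)); last by ring.
by move: (s ^+ 2 / 4 * _ * _) (s ^+ 2 / 2 * _ * _) (s ^+ 3 * K3) (Ex _ _) (U x) => *; lra.
Qed.

Let comb_eq s e e' : 0 < s -> let q := Num.sqrt (1 + s ^+ 2) in
  U (fun j => q * Y (comb q^-1 (s / q) e e') j) = U (fun j => Y e j + s * Y e' j).
Proof.
move=> s0' q; have q0 : 0 < q by rewrite sqrtr_gt0 ltr_pwDl// sqr_ge0.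
congr U; apply/funext => j; rewrite /Y /gaussv linf_comb.
by field; rewrite gt_eqF.
Qed.

(** [Y + s Y'] has the law of [sqrt (1 + s^2) Y], so the gain from an independent perturbation
    becomes growth of [E U] under dilation. *)
Let outer s : 0 < s ->
  Ex G (fun e => U (fun j => 1 * Y e j)) + s ^+ 2 / 4 * beta ^+ 2 * Ex G (fun e => D (Y e)) <=
  Ex G (fun e => U (fun j => Num.sqrt (1 + s ^+ 2) * Y e j)) + s ^+ 3 * K3.
Proof.
move=> s0'; set q := Num.sqrt _.
have q0 : 0 < q by rewrite sqrtr_gt0 ltr_pwDl// sqr_ge0.
have q2 : q ^+ 2 = 1 + s ^+ 2 by rewrite sqr_sqrtr// addr_ge0// sqr_ge0.
have cs : q^-1 ^+ 2 + (s / q) ^+ 2 = 1.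
  by rewrite expr_div_n exprVn q2; field; rewrite -q2 expf_eq0 gt_eqF.
have sq : 0 < s / q by rewrite divr_gt0.
pose f e := (U (fun j => q * Y e j))%:E.
have mf : measurable_fun setT f by apply/measurable_EFinP; exact: mU.
have f0 e : (0 <= f e)%E by rewrite lee_fin.
have i1 : intg G (fun e => U (fun j => 1 * Y e j) + s ^+ 2 / 4 * beta ^+ 2 * D (Y e)).
  by apply: intgD => //; exact: intgZ.
rewrite -(ExZ _ iD) -[leLHS](ExD (iU 1) (intgZ (s ^+ 2 / 4 * beta ^+ 2) iD)).
rewrite -lee_fin -(Ex_EFin i1) EFinD -(Ex_EFin (iU q)) -[X in (_ <= X + _)%E](gaussian_stable NE NG cs sq mf f0).
have m2 : measurable_fun setT (fun z : n.-tuple R * n.-tuple R => f (comb q^-1 (s / q) z.1 z.2)).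
  by apply: measurableT_comp => //; exact: measurable_comb.
have mI : measurable_fun setT (fun e => \int[G]_e' f (comb q^-1 (s / q) e e'))%E.
  exact: (@measurable_fun_fubini_tonelli_F _ _ _ _ _ G _ m2).
have I0 e : (0 <= \int[G]_e' f (comb q^-1 (s / q) e e'))%E by exact: integral_ge0.
have k0 : 0 <= s ^+ 3 * K3 by rewrite mulr_ge0// exprn_ge0// ltW.
rewrite -[X in (_ <= _ + X)%E](_ : (\int[G]_e (s ^+ 3 * K3)%:E)%E = _)%E; last first.
  by rewrite integral_cst// [X in (_ * X)%E]probability_setT mule1.
rewrite -ge0_integralD//.
apply: ge0_le_integral => //.
- move=> e _; rewrite lee_fin addr_ge0// mulr_ge0//; last by have /andP[] := D_itv (Y e).
  by rewrite mulr_ge0 ?sqr_ge0// divr_ge0// sqr_ge0.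
- apply/measurable_EFinP; exact: intg_measurable i1.
- by apply: emeasurable_funD.
move=> e _.
under eq_integral => e' _ do rewrite /f (comb_eq e e' s0').
rewrite (Ex_EFin (UsY_intg (Y e) s)) -EFinD lee_fin.
rewrite (_ : (fun j => 1 * Y e j) = Y e); last by apply/funext => j; rewrite mul1r.
by apply: inner; exact: ltW.
Qed.

Let U_scale x q : 1 <= q -> U (fun j => q * x j) <= U (fun j => 1 * x j) + beta * ((q - 1) * supn x).
Proof.
move=> q1; rewrite (_ : (fun j => q * x j) = (fun j => 1 * x j + (q - 1) * x j)); last first.
  by apply/funext => j; ring.
apply: U_lip; last by rewrite mulr_ge0 ?supn_ge0// subr_ge0.
by move=> j; rewrite normrM ger0_norm ?subr_ge0// ler_wpM2l ?subr_ge0// le_supn.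
Qed.

(** Dilating by [q = sqrt (1 + s^2)] raises [U] by at most [beta (q - 1)] times the sup norm, and
    [q - 1 <= s^2 / 2]. Compare with the gain of [outer], divide by [s^2 beta] and let [s]
    vanish. *)
Let spread : Ex G (fun e => D (Y e)) <= 2 * m1 / beta.
Proof.
suff : beta / 4 * Ex G (fun e => D (Y e)) - m1 / 2 <= 0.
  rewrite ler_pdivlMr//; lra.
apply: (@small_slope _ _ (K3 / beta) 1) => // s /andP[s0' s1].
have := outer s0'; set q := Num.sqrt _.
have q1 : 1 <= q.
  by rewrite -[leLHS]sqrtr1 ler_sqrt ?addr_ge0 ?sqr_ge0// lerDl sqr_ge0.
have q2 : q - 1 <= s ^+ 2 / 2.
  have : q ^+ 2 = 1 + s ^+ 2 by rewrite sqr_sqrtr// addr_ge0// sqr_ge0.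
  nra.
have : Ex G (fun e => U (fun j => q * Y e j)) <= Ex G (fun e => U (fun j => 1 * Y e j)) + beta * ((q - 1) * m1).
  have ig : intg G (fun e => beta * ((q - 1) * supn (Y e))) by do 2!apply: intgZ.
  apply: le_trans (Ex_le (iU q) (intgD (iU 1) ig) (fun e => U_scale (Y e) q1)) _.
  rewrite (ExD (iU 1) ig) lerD2l (ExZ _ (intgZ _ isup)) (ExZ _ isup) ler_pM2l//.
  by rewrite ler_wpM2l// subr_ge0.
have m0 : 0 <= m1 by apply: le_trans mean_le; apply: Ex_ge0 => e; exact: supn_ge0.
have : beta * ((q - 1) * m1) <= beta * (s ^+ 2 / 2 * m1) by rewrite ler_pM2l// ler_wpM2r.
move: (Ex G (fun e => D (Y e))) (Ex _ _) (Ex _ _) (beta * ((q - 1) * m1)) => x1 x2 x3 x4 h1 h2 h3.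
have sb : 0 < s ^+ 2 * beta by rewrite mulr_gt0// exprn_gt0.
rewrite -(ler_pM2l sb).
rewrite (_ : s ^+ 2 * beta * (s * (K3 / beta)) = s ^+ 3 * K3); last by field; rewrite gt_eqF.
rewrite (_ : s ^+ 2 * beta * (beta / 4 * x1 - m1 / 2) = s ^+ 2 / 4 * beta ^+ 2 * x1 - beta * (s ^+ 2 / 2 * m1)); last by field.
move: (s ^+ 2 / 4 * _ * _) (beta * (_ * m1)) (s ^+ 3 * K3) h1 h2 h3 => *; lra.
Qed.

(** The masses [A] and [S] differ by a factor at most [e <= 4], so [A S / (A + S)^2] is at least
    [4 / 25]. *)
Let D_ge x : t - beta^-1 <= smax beta p x <= t + beta^-1 -> 10^-1 <= D x.
Proof.
move=> /andP[h1 h2].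
set A := expR (beta * t); set S := \sum_j tilt beta p x j.
have SE : S = expR (beta * smax beta p x).
  rewrite /smax mulrA bV mul1r lnK// posrE; exact: (sum_tilt_gt0 beta p0 J0).
have A0 : 0 < A by exact: expR_gt0.
have S0 : 0 < S by rewrite SE expR_gt0.
have e4 : expR 1 <= 4 :> R.
  have h : expR 2^-1 <= 2 :> R.
    apply: le_trans (expR_le1D2x _) _; last lra.
    by apply/andP; split; lra.
  have -> : expR 1 = expR 2^-1 * expR 2^-1 :> R by rewrite -expRD; congr expR; field.
  have := @expR_gt0 R 2^-1; move: (expR 2^-1) h => u *; nra.
have SA : S <= 4 * A.
  apply: le_trans (_ : expR 1 * A <= _); last by rewrite ler_pM2r.
  rewrite SE /A -expRD ler_expR -bV -mulrDr ler_pM2l//; lra.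
have AS : A <= 4 * S.
  apply: le_trans (_ : expR 1 * S <= _); last by rewrite ler_pM2r.
  rewrite SE /A -expRD ler_expR -bV -mulrDr ler_pM2l//; lra.
have w0S : w0 x = A / (A + S).
  rewrite /w0 /gibbs /tilt /= mulr0 expR0 mulr1; congr (_ / _).
  by rewrite sum_option /= mulr0 expR0 mulr1.
have AS0 : 0 < A + S by exact: addr_gt0.
rewrite /D w0S (_ : A / (A + S) * _ = A * S / (A + S) ^+ 2); last by field; rewrite gt_eqF.
rewrite ler_pdivlMr ?exprn_gt0// mulrC ler_pdivrMr//.
nra.
Qed.

Lemma gaussv_local :
  pr G [set e | t - beta^-1 <= smax beta p (gaussv e) <= t + beta^-1] <= 20 * m1 / beta.
Proof.
have mF : measurable_fun setT (fun e => smax beta p (gaussv e)).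
  by apply: measurable_smax => j; exact: measurable_gaussv.
have i10 : (0 : R) < 10^-1 by rewrite invr_gt0.
have mE : measurable [set e | t - beta^-1 <= smax beta p (gaussv e) <= t + beta^-1].
  rewrite -[X in measurable X]setTI.
  by apply: (mF measurableT [set` `[t - beta^-1, t + beta^-1]]).
apply: le_trans (markov_le iD _ mE i10 _) _.
- by move=> e; have /andP[] := D_itv (Y e).
- by move=> e; exact: D_ge.
rewrite invrK; apply: le_trans (_ : 2 * m1 / beta * 10 <= _); first by rewrite ler_pM2r// spread.
by rewrite le_eqVlt; apply/orP; left; apply/eqP; ring.
Qed.

End local_density.

Section density.
Variables (beta : R) (p : J -> R) (m1 : R).
Hypotheses (beta0 : 0 < beta) (p0 : forall j, 0 < p j).
Hypothesis var_ge : forall j, 2^-1 <= \sum_i a i j ^+ 2.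
Hypothesis mean_le : Ex G (fun e => supn (gaussv e)) <= m1.

Lemma gaussv_anticoncentration t w : 0 <= w ->
  pr G [set e | t <= smax beta p (gaussv e) <= t + w] <= (w * beta / 2 + 2) * (20 * m1 / beta).
Proof.
move=> w0.
have mF : measurable_fun setT (fun e => smax beta p (gaussv e)).
  by apply: measurable_smax => j; exact: measurable_gaussv.
have mE u v : measurable [set e | u <= smax beta p (gaussv e) <= v].
  rewrite -[X in measurable X]setTI.
  by apply: (mF measurableT [set` `[u, v]]).
have m0 : 0 <= m1 by apply: le_trans mean_le; apply: Ex_ge0 => e; exact: supn_ge0.
(* The interval is covered by cells of length [2 / beta], each charged by [gaussv_local]. *)
have cells k : pr G [set e | t <= smax beta p (gaussv e) <= t + k%:R * (2 / beta)] <=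
    k.+1%:R * (20 * m1 / beta).
  elim: k => [|k IH].
    rewrite mul0r addr0 mul1r; apply: le_trans (gaussv_local t beta0 p0 var_ge mean_le).
    apply: pr_le => // e /= /andP[h1 h2].
    have := beta0; rewrite -invr_gt0 => ib.
    by apply/andP; split; lra.
  have ib := beta0; rewrite -invr_gt0 in ib.
  apply: le_trans (_ : pr G ([set e | t <= smax beta p (gaussv e) <= t + k%:R * (2 / beta)] `|`
     [set e | (t + k.+1%:R * (2 / beta) - beta^-1) - beta^-1 <= smax beta p (gaussv e) <= (t + k.+1%:R * (2 / beta) - beta^-1) + beta^-1]) <= _).
    apply: pr_le => //; first exact: measurableU.
    move=> e /= /andP[h1 h2].
    have [h|h] := leP (smax beta p (gaussv e)) (t + k%:R * (2 / beta)); [left|right].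
      by rewrite h1.
    move: h h2; rewrite -[k.+1%:R]natr1 mulrDl mul1r => h h2.
    by apply/andP; split; lra.
  apply: le_trans (pr_setU _ _ _) _ => //.
  have -> : k.+2%:R = k.+1%:R + 1 :> R by rewrite natr1.
  rewrite [X in _ <= X]mulrDl mul1r; apply: lerD; first exact: IH.
  exact: (gaussv_local _ beta0 p0 var_ge mean_le).
set k := Num.truncn (w * beta / 2).
have /andP[k1 k2] : k%:R <= w * beta / 2 < k.+1%:R.
  by apply: truncn_itv; rewrite divr_ge0// mulr_ge0// ltW.
have q0 : 0 <= 20 * m1 / beta by rewrite divr_ge0 ?mulr_ge0// ltW.
apply: le_trans (_ : k.+2%:R * (20 * m1 / beta) <= _); last first.
  by apply: ler_wpM2r => //; rewrite -2!natr1 -addrA lerD.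
apply: le_trans (cells k.+1); apply: pr_le => // e /= /andP[-> h2] /=.
apply: le_trans h2 _; rewrite lerD2l.
rewrite (_ : k.+1%:R * (2 / beta) = (2 * k.+1%:R) / beta); last by ring.
rewrite ler_pdivlMr//; lra.
Qed.

End density.
End anticoncentration.

(** * Lindeberg interpolation *)

Section unit_valued.
Context (R : realType) d1 (T1 : measurableType d1) d2 (T2 : measurableType d2).
Variables (P1 : probability T1 R) (P2 : probability T2 R) (f : T1 -> T2 -> R).
Hypotheses (mf : measurable_fun setT (fun z : T1 * T2 => f z.1 z.2))
  (f01 : forall x y, 0 <= f x y <= 1).

Let mf1 y : measurable_fun setT (fun x => f x y).
Proof. by apply: (@measurableT_comp _ _ _ _ _ _ (fun z : T1 * T2 => f z.1 z.2) _ (fun x => (x, y))). Qed.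

Let mf2 x : measurable_fun setT (f x).
Proof.
apply: (@measurableT_comp _ _ _ _ _ _ (fun z : T1 * T2 => f z.1 z.2) _ (fun y => (x, y))) => //.
exact: pair1_measurable.
Qed.

Let b1 (u : R) : 0 <= u <= 1 -> `|u| <= 1.
Proof. by move=> /andP[? ?]; rewrite ger0_norm. Qed.

Lemma unit_intg1 y : intg P1 (fun x => f x y).
Proof. by apply: (@intg_bounded _ _ _ _ _ 1) => // x; exact: b1. Qed.

Lemma unit_intg2 x : intg P2 (f x).
Proof. by apply: (@intg_bounded _ _ _ _ _ 1) => // y; exact: b1. Qed.

Lemma Ex_unit x : 0 <= Ex P2 (f x) <= 1.
Proof.
apply/andP; split; first by apply: Ex_ge0 => y; have /andP[] := f01 x y.
rewrite -(Ex_cst P2 1); apply: Ex_le => //; first exact: unit_intg2.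
  exact: intg_cst.
by move=> y; have /andP[] := f01 x y.
Qed.

Let mfE : measurable_fun setT (fun z : T1 * T2 => (f z.1 z.2)%:E).
Proof. exact/measurable_EFinP. Qed.

Let fE0 (z : T1 * T2) : (0 <= (f z.1 z.2)%:E)%E.
Proof. by rewrite lee_fin; have /andP[] := f01 z.1 z.2. Qed.

Lemma measurable_Ex2 : measurable_fun setT (fun x => Ex P2 (f x)).
Proof.
apply: (@measurableT_comp _ _ _ _ _ _ fine); first exact: (fine_measurable measurableT).
exact: (@measurable_fun_fubini_tonelli_F _ _ _ _ _ P2 _ mfE).
Qed.

Lemma intg_Ex2 : intg P1 (fun x => Ex P2 (f x)).
Proof. by apply: (@intg_bounded _ _ _ _ _ 1); [exact: measurable_Ex2|move=> x; apply: b1; exact: Ex_unit]. Qed.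

Lemma Ex_prod : Ex (P1 \x P2)%E (fun z => f z.1 z.2) = Ex P1 (fun x => Ex P2 (f x)).
Proof.
apply: (congr1 fine); rewrite (@fubini_tonelli1 _ _ _ _ _ P1 P2 _ mfE fE0).
by apply: eq_integral => x _; rewrite -(Ex_EFin (unit_intg2 x)).
Qed.

End unit_valued.

Lemma Ex_swap (R : realType) d1 (T1 : measurableType d1) d2 (T2 : measurableType d2)
    (P1 : probability T1 R) (P2 : probability T2 R) (f : T1 -> T2 -> R) :
  measurable_fun setT (fun z : T1 * T2 => f z.1 z.2) -> (forall x y, 0 <= f x y <= 1) ->
  Ex P1 (fun x => Ex P2 (f x)) = Ex P2 (fun y => Ex P1 (f^~ y)).
Proof.
move=> mf f01.
have mfE : measurable_fun setT (fun z : T1 * T2 => (f z.1 z.2)%:E) by exact/measurable_EFinP.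
have fE0 (z : T1 * T2) : (0 <= (f z.1 z.2)%:E)%E.
  by rewrite lee_fin; have /andP[] := f01 z.1 z.2.
rewrite -(Ex_prod P1 P2 mf f01); apply: (congr1 fine).
rewrite (@fubini_tonelli2 _ _ _ _ _ P1 P2 _ mfE fE0); apply: eq_integral => y _.
by rewrite -(Ex_EFin (unit_intg1 P1 mf f01 y)).
Qed.

Lemma pr_proj1 (R : realType) d1 (T1 : measurableType d1) d2 (T2 : measurableType d2)
    (P1 : probability T1 R) (P2 : probability T2 R) (A : set T1) : measurable A ->
  pr (P1 \x P2)%E [set z | A z.1] = pr P1 A.
Proof.
move=> mA; rewrite /pr (_ : [set z | A z.1] = A `*` setT); last first.
  by apply/seteqP; split => z //= [].
transitivity (fine (P1 A * P2 setT)); first by congr fine; exact: product_measure1E.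
by rewrite [X in (_ * X)%E]probability_setT mule1.
Qed.

Lemma pr_proj2 (R : realType) d1 (T1 : measurableType d1) d2 (T2 : measurableType d2)
    (P1 : probability T1 R) (P2 : probability T2 R) (A : set T2) : measurable A ->
  pr (P1 \x P2)%E [set z | A z.2] = pr P2 A.
Proof.
move=> mA; rewrite /pr (_ : [set z | A z.2] = setT `*` A); last first.
  by apply/seteqP; split => z //= [].
transitivity (fine (P1 setT * P2 A)); first by congr fine; exact: product_measure1E.
by rewrite [X in (X * _)%E]probability_setT mul1e.
Qed.

Lemma pr_setUd d (T : measurableType d) (R : realType) (P : probability T R) (A B : set T) :
  measurable A -> measurable B -> A `&` B = set0 -> pr P (A `|` B) = pr P A + pr P B.
Proof. by move=> mA mB AB; rewrite /pr measureU// fineD// fin_num_measure. Qed.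

Lemma resample_Ex (R : realType) d (T : measurableType d) n (F : probability T R)
    (Q : probability (n.-tuple T) R) (FQ : prodlike F Q) (i : 'I_n) (f : n.-tuple T -> R) :
  measurable_fun setT f -> (forall x, 0 <= f x <= 1) ->
  Ex Q f = Ex Q (fun x => Ex F (fun y => f (upd x i y))).
Proof.
move=> mf f01.
have m2 : measurable_fun setT (fun z : n.-tuple T * T => f (upd z.1 i z.2)).
  by apply: measurableT_comp => //; exact: measurable_upd.
apply: (congr1 fine); rewrite (resample FQ i); first last.
- by move=> x; rewrite lee_fin; have /andP[] := f01 x.
- exact/measurable_EFinP.
apply: eq_integral => x _.
by rewrite -(Ex_EFin (unit_intg2 F (f := fun x y => f (upd x i y)) m2 (fun x y => f01 (upd x i y)) x)).
Qed.

Lemma gaussian_stable_Ex (R : realType) n (N : probability R R) (G : probability (n.-tuple R) R)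
    (NE : std_normal N) (NG : prodlike N G) (c s : R) (f : n.-tuple R -> R) :
  c ^+ 2 + s ^+ 2 = 1 -> 0 < s -> measurable_fun setT f -> (forall x, 0 <= f x <= 1) ->
  Ex G f = Ex G (fun e => Ex G (fun e' => f (comb c s e e'))).
Proof.
move=> cs s0 mf f01.
have m2 : measurable_fun setT (fun z : n.-tuple R * n.-tuple R => f (comb c s z.1 z.2)).
  by apply: measurableT_comp => //; exact: measurable_comb.
apply: (congr1 fine).
have mE : measurable_fun setT (EFin \o f) by exact/measurable_EFinP.
have f0 x : (0 <= (EFin \o f) x)%E by rewrite lee_fin; have /andP[] := f01 x.
rewrite -[LHS](gaussian_stable NE NG cs s0 mE f0).
apply: eq_integral => x _.
by rewrite /= -(Ex_EFin (unit_intg2 G (f := fun x y => f (comb c s x y)) m2 (fun x y => f01 (comb c s x y)) x)).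
Qed.

Lemma sandwich_dist (R : realFieldType) (x y y1 y2 u u0 v v0 c e : R) :
  x <= u -> u0 <= y1 -> y2 <= v0 -> v <= x -> `|u - u0| <= c -> `|v - v0| <= c ->
  y1 - y <= e -> y - y2 <= e -> `|x - y| <= c + e.
Proof.
rewrite !ler_norml => ? ? ? ? /andP[? ?] /andP[? ?] ? ?.
by apply/andP; split; lra.
Qed.

Section lindeberg.
Context (R : realType) d (T : measurableType d) (n : nat) (J : finType).
Variables (F : probability T R) (Q : probability (n.-tuple T) R).
Variables (N : probability R R) (G : probability (n.-tuple R) R).
Hypotheses (FQ : prodlike F Q) (NE : std_normal N) (NG : prodlike N G).
Hypotheses (n0 : (0 < n)%N) (J0 : (0 < #|J|)%N).
Variables (beta delta : R) (p : J -> R).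
Hypotheses (beta0 : 0 < beta) (delta0 : 0 < delta) (l1 : 1 <= beta * delta).
Hypothesis p0 : forall j, 0 < p j.
Variables (zeta : T -> J -> R) (a : 'I_n -> J -> R) (m3 tau1 tau2 D A0 A1 : R).
Local Notation Y := (gaussv a).
Local Notation sm := (smax beta p).
Let eta (e : n.-tuple R) j := (Num.sqrt n%:R)^-1 * Y e j.
Hypotheses (S1 : swappable beta F zeta m3 tau1) (S2 : swappable beta G eta m3 tau2).
Hypothesis hD : forall j k,
  `|Ex F (fun x => zeta x j * zeta x k) - Ex G (fun e => eta e j * eta e k)| <= D.
Hypotheses (A00 : 0 <= A0) (A10 : 0 <= A1).
Hypothesis anti : forall t w, 0 <= w ->
  pr G [set e | t <= sm (Y e) <= t + w] <= A0 * w + A1.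
Local Notation K := (swap_const R).
Let k1 := K / (beta * delta) * (beta ^+ 2 * D + 2 * beta ^+ 3 * m3).
Let k2 := K * (beta ^+ 2 * (tau1 + tau2)).
Hypotheses (k1_small : 8 * (n%:R * k1) <= 1) (tau_small : beta ^+ 2 * tau1 <= 2^-1).

Let P := (Q \x G : probability _ _)%E.
Let S m (x : n.-tuple T) j := \sum_(i < n | (i < m)%N) zeta (tnth x i) j.
(** A single Gaussian vector scaled to variance [(n - m) / n] stands for the [n - m] independent
    pieces still to be exchanged. [W m] is the state after [m] exchanges and [V m] the state with
    the current summand left out. *)
Let sc m : R := Num.sqrt ((n - m)%:R / n%:R).
Let W m (x : n.-tuple T) (e : n.-tuple R) j := S m x j + sc m * Y e j.
Let V m (x : n.-tuple T) (e : n.-tuple R) j := S m x j + sc m.+1 * Y e j.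

Let nR : 0 < n%:R :> R. Proof. by rewrite ltr0n. Qed.

Let sc_step m : (m < n)%N -> sc m ^+ 2 = sc m.+1 ^+ 2 + n%:R^-1.
Proof.
move=> mn; rewrite !sqr_sqrtr ?divr_ge0//.
by rewrite -(subnSK mn) -natr1 mulrDl mul1r.
Qed.

Let sc_gt0 m : (m < n)%N -> 0 < sc m.
Proof. by move=> mn; rewrite sqrtr_gt0 divr_gt0// ltr0n subn_gt0. Qed.

Let mS m j : measurable_fun setT (fun x => S m x j).
Proof.
rewrite /S; under eq_fun do rewrite big_mkcond.
apply: measurable_sum => i; case: (i < m)%N => //.
by apply: (@measurable_tnth_comp _ _ _ _ _ i (fun y => zeta y j)); exact: swap_meas S1 j.
Qed.

Let mY j : measurable_fun setT (fun e => Y e j).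
Proof. exact: measurable_gaussv. Qed.

Let mVW c m j : measurable_fun setT (fun z : n.-tuple T * n.-tuple R => S m z.1 j + c * Y z.2 j).
Proof.
apply: measurable_funD; first exact: (measurableT_comp (mS m j)).
apply: measurable_funM => //.
exact: (measurableT_comp (mY j)).
Qed.

Section test_function.
Variable h : R -> R.
Hypotheses (mh : measurable_fun setT h) (h01 : forall u, 0 <= h u <= 1).

Let mhV c m : measurable_fun setT (fun z : n.-tuple T * n.-tuple R => h (sm (fun j => S m z.1 j + c * Y z.2 j))).
Proof. by apply: measurableT_comp => //; apply: measurable_smax => j; exact: mVW. Qed.

(** Stability with weights [sc m.+1 / sc m] and [1 / (sqrt n * sc m)] splits off a piece of variance
    [1 / n], because [sc m ^+ 2 = sc m.+1 ^+ 2 + 1 / n]. *)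
Lemma gaussian_step m : (m < n)%N -> Ex P (fun z => h (sm (W m z.1 z.2))) =
  Ex P (fun z => Ex G (fun e' => h (sm (fun j => V m z.1 z.2 j + eta e' j)))).
Proof.
move=> mn.
have m3' : measurable_fun setT (fun z : (n.-tuple T * n.-tuple R) * n.-tuple R =>
    h (sm (fun j => V m z.1.1 z.1.2 j + eta z.2 j))).
  apply: measurableT_comp => //; apply: measurable_smax => j; apply: measurable_funD.
    exact: (measurableT_comp (mVW _ m j)).
  by apply: measurable_funM => //; exact: (measurableT_comp (mY j)).
pose g (z : n.-tuple T * n.-tuple R) e' := h (sm (fun j => V m z.1 z.2 j + eta e' j)).
have me := measurable_Ex2 G (f := g) m3' (fun _ _ => h01 _).
have ue := Ex_unit G (f := g) m3' (fun _ _ => h01 _).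
rewrite (Ex_prod Q G (f := fun x e => h (sm (W m x e))) (mhV (sc m) m) (fun _ _ => h01 _)).
rewrite (@Ex_prod _ _ _ _ _ Q G (fun x e => Ex G (fun e' => h (sm (fun j => V m x e j + eta e' j)))) me (fun x e => ue (x, e))).
apply: eq_Ex => x.
have q0 := sc_gt0 mn.
have r0 : 0 < (Num.sqrt n%:R)^-1 :> R by rewrite invr_gt0 sqrtr_gt0.
have cs : (sc m.+1 / sc m) ^+ 2 + ((Num.sqrt n%:R)^-1 / sc m) ^+ 2 = 1.
  rewrite !expr_div_n exprVn [Num.sqrt n%:R ^+ 2]sqr_sqrtr; last exact: ltW.
  by rewrite -mulrDl -(sc_step mn) mulfV// expf_eq0 gt_eqF.
rewrite (gaussian_stable_Ex NE NG cs); first last.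
- by move=> e; exact: h01.
- by apply: measurableT_comp => //; apply: measurable_smax => j; apply: measurable_funD => //; apply: measurable_funM.
- exact: divr_gt0.
apply: eq_Ex => e; apply: eq_Ex => e'; congr (h (sm _)); apply/funext => j.
rewrite /W /V /eta /gaussv linf_comb.
have n1 : 0 < Num.sqrt n%:R :> R by rewrite sqrtr_gt0.
by field; rewrite (gt_eqF n1) (gt_eqF q0).
Qed.

Lemma sample_step m : (m < n)%N -> Ex P (fun z => h (sm (W m.+1 z.1 z.2))) =
  Ex P (fun z => Ex F (fun y => h (sm (fun j => V m z.1 z.2 j + zeta y j)))).
Proof.
move=> mn; set im := Ordinal mn.
have mz j : measurable_fun setT (fun y => zeta y j) by exact: swap_meas S1 j.
have m3' : measurable_fun setT (fun z : (n.-tuple T * n.-tuple R) * T =>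
    h (sm (fun j => V m z.1.1 z.1.2 j + zeta z.2 j))).
  apply: measurableT_comp => //; apply: measurable_smax => j; apply: measurable_funD.
    exact: (measurableT_comp (mVW _ m j)).
  exact: (measurableT_comp (mz j)).
pose g (z : n.-tuple T * n.-tuple R) y := h (sm (fun j => V m z.1 z.2 j + zeta y j)).
have me := measurable_Ex2 F (f := g) m3' (fun _ _ => h01 _).
have ue := Ex_unit F (f := g) m3' (fun _ _ => h01 _).
pose gA (x : n.-tuple T) (e : n.-tuple R) := h (sm (W m.+1 x e)).
have mA := measurable_Ex2 G (f := gA) (mhV (sc m.+1) m.+1) (fun _ _ => h01 _).
have uA := Ex_unit G (f := gA) (mhV (sc m.+1) m.+1) (fun _ _ => h01 _).
rewrite (Ex_prod Q G (f := gA) (mhV (sc m.+1) m.+1) (fun _ _ => h01 _)).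
rewrite (@Ex_prod _ _ _ _ _ Q G (fun x e => Ex F (fun y => h (sm (fun j => V m x e j + zeta y j)))) me (fun x e => ue (x, e))).
rewrite (resample_Ex FQ im mA uA); apply: eq_Ex => x.
rewrite -(@Ex_swap _ _ _ _ _ F G (fun y e => h (sm (fun j => V m x e j + zeta y j)))); first last.
- by move=> y e; exact: h01.
- apply: measurableT_comp => //; apply: measurable_smax => j; apply: measurable_funD.
    apply: measurable_funD => //; apply: measurable_funM => //.
    exact: (measurableT_comp (mY j)).
  exact: (measurableT_comp (mz j)).
apply: eq_Ex => y; apply: eq_Ex => e; congr (h (sm _)); apply/funext => j.
rewrite /V addrAC; congr (_ + _).
rewrite /S (sum_ltnS mn) tnth_upd eqxx; congr (_ + _).
by apply: eq_bigr => i il; rewrite tnth_upd; case: eqP => // E; rewrite E ltnn in il.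
Qed.

End test_function.

Let mW m : measurable_fun setT (fun z : n.-tuple T * n.-tuple R => sm (W m z.1 z.2)).
Proof. by apply: measurable_smax => j; exact: mVW. Qed.

Let mV m : measurable_fun setT (fun z : n.-tuple T * n.-tuple R => sm (V m z.1 z.2)).
Proof. by apply: measurable_smax => j; exact: mVW. Qed.

Let mY' : measurable_fun setT (fun e => sm (Y e)).
Proof. exact: measurable_smax. Qed.

Let PW m t := pr P [set z | sm (W m z.1 z.2) <= t].
Let PY t := pr G [set e | sm (Y e) <= t].

Let mle d' (T' : measurableType d') (f : T' -> R) t : measurable_fun setT f ->
  measurable [set z | f z <= t].
Proof. exact: measurable_set_le. Qed.

Let mitv d' (T' : measurableType d') (f : T' -> R) s t : measurable_fun setT f ->
  measurable [set z | s <= f z <= t].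
Proof.
move=> mf; rewrite -[X in measurable X]setTI.
exact: (mf measurableT [set` `[s, t]]).
Qed.

(* The increment zeta is at most 1/beta with probability at least 1/2. *)
Let window_step m t : (m < n)%N ->
  pr P [set z | window beta p delta t (V m z.1 z.2)] <=
  2 * pr P [set z | t - 2 * beta^-1 <= sm (W m.+1 z.1 z.2) <= t + delta + 2 * beta^-1].
Proof.
move=> mn.
have mz j : measurable_fun setT (fun y => zeta y j) by exact: swap_meas S1 j.
have mzs : measurable_fun setT (fun y => supn (zeta y)) by exact: measurable_supn.
have mB : measurable [set` `[t - 2 * beta^-1, t + delta + 2 * beta^-1]%R : interval R] by [].
set B := [set` `[t - 2 * beta^-1, t + delta + 2 * beta^-1]%R].
have mh : measurable_fun setT (\1_B : R -> R) by exact: measurable_indic.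
have h01 u : 0 <= (\1_B : R -> R) u <= 1 by rewrite indicE; case: (_ \in _); rewrite ?lexx ler01.
have mE : measurable [set z | window beta p delta t (V m z.1 z.2)] by exact: mitv.
have mZ : measurable [set y | supn (zeta y) <= beta^-1] by exact: mle.
rewrite [X in 2 * X]pr_Ex; last exact: mitv.
have -> : Ex P (\1_[set z | t - 2 * beta^-1 <= sm (W m.+1 z.1 z.2) <= t + delta + 2 * beta^-1]) =
    Ex P (fun z => (\1_B : R -> R) (sm (W m.+1 z.1 z.2))).
  apply: eq_Ex => z; rewrite !indicE; congr (_%:R); apply/idP/idP; rewrite !inE /B /= in_itv//.
rewrite (sample_step mh h01 mn) -ler_pdivrMl// pr_Ex// -ExZ; last exact: intg_indic.
have m3' : measurable_fun setT (fun z : (n.-tuple T * n.-tuple R) * T =>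
    (\1_B : R -> R) (sm (fun j => V m z.1.1 z.1.2 j + zeta z.2 j))).
  apply: measurableT_comp => //; apply: measurable_smax => j; apply: measurable_funD.
    exact: (measurableT_comp (mVW _ m j)).
  exact: (measurableT_comp (mz j)).
pose g (z : n.-tuple T * n.-tuple R) y := (\1_B : R -> R) (sm (fun j => V m z.1 z.2 j + zeta y j)).
apply: Ex_le.
- by apply: intgZ; exact: intg_indic.
- exact: (intg_Ex2 P F (f := g) m3' (fun _ _ => h01 _)).
move=> z; rewrite indicE; have [|_] := boolP (z \in _); last by rewrite mulr0; apply: Ex_ge0 => y; have /andP[] := h01 (sm (fun j => V m z.1 z.2 j + zeta y j)).
rewrite inE /= mulr1 => /andP[w1 w2].
apply: le_trans (swap_small beta0 S1 tau_small) _; rewrite pr_Ex//.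
apply: Ex_le.
- exact: intg_indic.
- exact: (unit_intg2 F (f := g) m3' (fun _ _ => h01 _) z).
move=> y; rewrite indicE; have [|_] := boolP (y \in _); last by have /andP[] := h01 (sm (fun j => V m z.1 z.2 j + zeta y j)).
rewrite inE /= => hy.
have := @smax_lip _ _ _ _ beta0 p0 J0 (V m z.1 z.2) (zeta y) beta^-1 _.
have hz j : `|zeta y j| <= beta^-1 by exact: le_trans (le_supn _ _) hy.
move=> /(_ hz); rewrite ler_distl => /andP[a1 a2].
rewrite indicE mem_set// /B /= in_itv/=; apply/andP; split; lra.
Qed.

(** The supremum runs over all intermediate stages as well as all levels, so the window mass at
    every stage is controlled by the same number and the estimate closes on itself. *)
Let rset : set R := [set u | exists m t, (m <= n)%N /\ u = `|PW m t - PY t|].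
Let r := sup rset.

Let pr01 d' (T' : measurableType d') (P' : probability T' R) A : measurable A -> 0 <= pr P' A <= 1.
Proof. by move=> mA; rewrite pr_ge0 pr_le1. Qed.

Let r_ub m t : (m <= n)%N -> `|PW m t - PY t| <= r.
Proof.
move=> mn; apply: ub_le_sup; last by exists m, t.
exists 1 => u [m' [t' [_ ->]]]; apply: itv01_dist; apply: pr01; exact: mle.
Qed.

Let PY_diff s t : s <= t -> PY t - PY s <= A0 * (t - s) + A1.
Proof.
move=> st; have := anti s (w := t - s); rewrite subr_ge0 => /(_ st); apply: le_trans.
rewrite lerBlDr /PY.
apply: le_trans (pr_setU _ (mitv _ _ mY') (mle _ mY')).
apply: pr_le; [exact: mle|exact: measurableU (mitv _ _ mY') (mle _ mY')|].
move=> e /= h; have [h2|h2] := leP (sm (Y e)) s; [by right|left].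
by rewrite (ltW h2) subrKC.
Qed.

Let b := A0 * (delta + 5 * beta^-1) + A1.

Let ib : 0 < beta^-1. Proof. by rewrite invr_gt0. Qed.

Let window_le m t : (m < n)%N ->
  pr P [set z | window beta p delta t (V m z.1 z.2)] <= 4 * r + 2 * b.
Proof.
move=> mn; apply: le_trans (window_step t mn) _.
(* [window_step] widens the interval by [2 / beta] on either side, and one more [1 / beta] turns the
   closed interval into a difference of distribution functions: [delta + 5 / beta] in all. *)
set s1 := t - 2 * beta^-1; set s2 := t + delta + 2 * beta^-1.
have : pr P [set z | s1 <= sm (W m.+1 z.1 z.2) <= s2] <= PW m.+1 s2 - PW m.+1 (s1 - beta^-1).
  rewrite lerBrDr /PW.
  rewrite (_ : pr P _ + _ = pr P ([set z | s1 <= sm (W m.+1 z.1 z.2) <= s2] `|` [set z | sm (W m.+1 z.1 z.2) <= s1 - beta^-1])); last first.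
    rewrite pr_setUd//; [exact: mitv|exact: mle|].
    apply/seteqP; split => z //= [/andP[h1 _] h2]; move: ib; lra.
  apply: pr_le; [exact: measurableU (mitv _ _ (mW _)) (mle _ (mW _))|exact: mle|].
  move=> z /= [/andP[_]//|h]; apply: le_trans h _; move: ib delta0; rewrite /s1 /s2; lra.
have r1 := r_ub s2 mn; have r2 := r_ub (s1 - beta^-1) mn.
have st : s1 - beta^-1 <= s2 by move: ib delta0; rewrite /s1 /s2; lra.
have := PY_diff st.
rewrite (_ : s2 - (s1 - beta^-1) = delta + 5 * beta^-1); last by rewrite /s1 /s2; ring.
rewrite -/b; move: r1 r2; rewrite !ler_norml => /andP[? ?] /andP[? ?] ? ?.
lra.
Qed.

Let msind t : measurable_fun setT (fun u : R => @cutoff R ((u - t) / delta)).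
Proof.
apply: (@measurableT_comp _ _ _ _ _ _ (@cutoff R)).
  by apply: continuous_measurable_fun; exact: is_derive_continuous (@derives_cutoff R).
by apply: measurable_funM => //; apply: measurable_funB.
Qed.

Let DW m t := Ex P (fun z => sind beta p delta t (W m z.1 z.2)).

Let k10 : 0 <= k1.
Proof.
have [K0 _] := swap_const_ge R.
have /card_gt0P[j _] := J0.
have D0 : 0 <= D by apply: le_trans (hD j j).
have m0 : 0 <= m3.
  by apply: le_trans (swap_third S1 j); apply: Ex_ge0 => x; rewrite exprn_ge0.
have b0 := ltW beta0.
apply: mulr_ge0; first by rewrite divr_ge0// mulr_ge0// ltW.
by rewrite addr_ge0 ?mulr_ge0 ?exprn_ge0.
Qed.

Let DW_step m t : (m < n)%N -> `|DW m.+1 t - DW m t| <= k1 * (4 * r + 2 * b) + k2.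
Proof.
move=> mn; pose h u := @cutoff R ((u - t) / delta).
have h01 u : 0 <= h u <= 1 by exact: cutoff_itv.
pose gF (z : n.-tuple T * n.-tuple R) y := h (sm (fun j => V m z.1 z.2 j + zeta y j)).
pose gG (z : n.-tuple T * n.-tuple R) e' := h (sm (fun j => V m z.1 z.2 j + eta e' j)).
have e1 : DW m.+1 t = Ex P (fun z => Ex F (gF z)) by exact: (sample_step (h := h) (msind t) h01 mn).
have e2 : DW m t = Ex P (fun z => Ex G (gG z)) by exact: (gaussian_step (h := h) (msind t) h01 mn).
have mz j : measurable_fun setT (fun y => zeta y j) by exact: swap_meas S1 j.
have mF : measurable_fun setT (fun z : (n.-tuple T * n.-tuple R) * T =>
    h (sm (fun j => V m z.1.1 z.1.2 j + zeta z.2 j))).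
  apply: (measurableT_comp (msind t)); apply: measurable_smax => j; apply: measurable_funD.
    exact: (measurableT_comp (mVW _ m j)).
  exact: (measurableT_comp (mz j)).
have mG : measurable_fun setT (fun z : (n.-tuple T * n.-tuple R) * n.-tuple R =>
    h (sm (fun j => V m z.1.1 z.1.2 j + eta z.2 j))).
  apply: (measurableT_comp (msind t)); apply: measurable_smax => j; apply: measurable_funD.
    exact: (measurableT_comp (mVW _ m j)).
  by apply: measurable_funM => //; exact: (measurableT_comp (mY j)).
have iF := intg_Ex2 P F (f := gF) mF (fun _ _ => h01 _).
have iG := intg_Ex2 P G (f := gG) mG (fun _ _ => h01 _).
have mE : measurable [set z | window beta p delta t (V m z.1 z.2)] by exact: mitv.
rewrite e1 e2 -(ExB iF iG).
pose wi := (\1_[set z | window beta p delta t (V m z.1 z.2)] : n.-tuple T * n.-tuple R -> R).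
have iw : intg P (fun z => k1 * wi z + k2).
  by apply: intgD; [apply: intgZ; exact: (intg_indic _ mE)|exact: intg_cst].
have dom z : `|Ex F (gF z) - Ex G (gG z)| <= k1 * wi z + k2.
  apply: le_trans (swap_two beta0 p0 J0 t delta0 l1 (V m z.1 z.2) S1 S2 hD) _.
  have ew : wi z = (window beta p delta t (V m z.1 z.2))%:R.
    by rewrite /wi indicE (_ : (z \in _) = window beta p delta t (V m z.1 z.2))//; apply/idP/idP; rewrite inE.
  by rewrite ew [k1 * _]mulrC lexx.
apply: le_trans (Ex_abs_le (intgB iF iG) iw dom) _.
have iwi : intg P wi by exact: (intg_indic _ mE).
rewrite (ExD (intgZ k1 iwi) (intg_cst P k2)) (ExZ _ iwi) Ex_cst lerD2r ler_wpM2l//.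
by rewrite -(pr_Ex _ mE); exact: window_le.
Qed.

Let DW_total m t : (m <= n)%N -> `|DW m t - DW 0 t| <= m%:R * (k1 * (4 * r + 2 * b) + k2).
Proof.
elim: m => [_|m IH mn]; first by rewrite subrr normr0 mul0r.
rewrite -natr1 mulrDl mul1r -(subrK (DW m t) (DW m.+1 t)) -addrA.
have h1 := IH (ltnW mn); have h2 := DW_step t mn.
move: (DW m.+1 t) (DW m t) (DW 0 t) (k1 * _ + k2) h1 h2 => u v w x h1 h2.
by apply: le_trans (ler_normD _ _) _; rewrite [leRHS]addrC lerD.
Qed.

Let isind m t : intg P (fun z => sind beta p delta t (W m z.1 z.2)).
Proof.
apply: (@intg_bounded _ _ _ _ _ 1); first by apply: measurable_sind => j; exact: mVW.
move=> z; have /andP[? ?] := sind_itv beta p delta t (W m z.1 z.2).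
by rewrite ger0_norm.
Qed.

Let PW_le m t : PW m t <= DW m t.
Proof.
rewrite /PW pr_Ex; last exact: mle.
apply: Ex_le => [||z]; [by apply: intg_indic; exact: mle|exact: isind|].
apply: le_trans (sind_ge _ _ _ delta0 _); rewrite indicE.
by rewrite (_ : (z \in _) = (sm (W m z.1 z.2) <= t)%R)//; apply/idP/idP; rewrite inE.
Qed.

Let PW_ge m t : DW m t <= PW m (t + delta).
Proof.
rewrite /PW pr_Ex; last exact: mle.
apply: Ex_le => [||z]; [exact: isind|by apply: intg_indic; exact: mle|].
apply: le_trans (sind_le _ _ _ delta0 _) _; rewrite indicE.
by rewrite (_ : (z \in _) = (sm (W m z.1 z.2) <= t + delta)%R)//; apply/idP/idP; rewrite inE.
Qed.

Let PW0 t : PW 0 t = PY t.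
Proof.
rewrite /PW; transitivity (pr P [set z | sm (Y z.2) <= t]); last exact: (pr_proj2 Q G (mle t mY')).
congr (pr P _).
have E z : W 0 z.1 z.2 = Y z.2.
  apply/funext => j; rewrite /W /S big1 ?add0r//.
  by rewrite /sc subn0 mulfV ?gt_eqF// sqrtr1 mul1r.
by apply/seteqP; split => z /=; rewrite E.
Qed.

Let PWn t : PW n t = pr Q [set x | sm (fun j => \sum_i zeta (tnth x i) j) <= t].
Proof.
have mSn : measurable_fun setT (fun x : n.-tuple T => sm (fun j => \sum_i zeta (tnth x i) j)).
  apply: measurable_smax => j; apply: measurable_sum => i.
  by apply: (@measurable_tnth_comp _ _ _ _ _ i (fun y => zeta y j)); exact: swap_meas S1 j.
rewrite /PW; transitivity (pr P [set z | sm (fun j => \sum_i zeta (tnth z.1 i) j) <= t]); last first.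
  exact: (pr_proj1 Q G (mle t mSn)).
congr (pr P _).
have E z : W n z.1 z.2 = (fun j => \sum_i zeta (tnth z.1 i) j).
  apply/funext => j; rewrite /W /sc subnn mul0r sqrtr0 mul0r addr0 /S.
  by apply: eq_bigl => i; rewrite ltn_ord.
by apply/seteqP; split => z /=; rewrite E.
Qed.

Let r_le : r <= 5 / 2 * b + 2 * (n%:R * k2).
Proof.
have b'b : A0 * delta + A1 <= b.
  by rewrite /b lerD2r ler_wpM2l// lerDl mulr_ge0// ltW.
have r0 : 0 <= r by apply: le_trans (r_ub 0 (leq0n n)).
have b0 : 0 <= b by rewrite /b addr_ge0// mulr_ge0// addr_ge0 ?mulr_ge0// ltW.
have k20 : 0 <= k2.
  have := DW_step 0 n0; have [K0 _] := swap_const_ge R.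
  have t1 : 0 <= tau1.
    by apply: le_trans (swap_tail S1); apply: Ex_ge0 => x; apply: mulr_ge0 => //; exact: sqr_ge0.
  have t2 : 0 <= tau2.
    by apply: le_trans (swap_tail S2); apply: Ex_ge0 => x; apply: mulr_ge0 => //; exact: sqr_ge0.
  by move=> _; rewrite /k2 mulr_ge0// mulr_ge0 ?sqr_ge0// addr_ge0.
have AA m t : (m <= n)%N -> `|DW m t - DW 0 t| <= r / 2 + b / 4 + n%:R * k2.
  move=> mn; apply: le_trans (DW_total t mn) _.
  apply: le_trans (_ : n%:R * (k1 * (4 * r + 2 * b) + k2) <= _).
    by rewrite ler_wpM2r ?ler_nat// addr_ge0// mulr_ge0// addr_ge0// mulr_ge0.
  (* The smallness of [n k1] turns [4 r + 2 b] into [r / 2 + b / 4]; this is where the self-bounding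
     gains its factor one half. *)
  have : (8 * (n%:R * k1)) * (r / 2 + b / 4) <= r / 2 + b / 4.
    by rewrite ler_piMl// addr_ge0// divr_ge0.
  rewrite (_ : n%:R * (k1 * (4 * r + 2 * b) + k2) = (8 * (n%:R * k1)) * (r / 2 + b / 4) + n%:R * k2); last by field.
  by rewrite lerD2r.
suff : r <= (r / 2 + b / 4 + n%:R * k2) + b by lra.
apply: ge_sup; first by exists `|PW 0 0 - PY 0|, 0%N, 0.
move=> u [m [t [mn ->]]].
have h1 := PW_le m t; have h2 := PW_ge 0 t; have h3 := AA m t mn.
have h4 := PW_le 0 (t - delta); have h5 := PW_ge m (t - delta); have h6 := AA m (t - delta) mn.
have t1 : t <= t + delta by rewrite lerDl ltW.
have t2 : t - delta <= t by rewrite gerBl ltW.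
have h7 := PY_diff t1; have h8 := PY_diff t2.
move: h2 h4 h5 h7 h8; rewrite !PW0 subrK (_ : t + delta - t = delta); last by ring.
rewrite opprB subrKC => h2 h4 h5 h7 h8.
exact: (sandwich_dist h1 h2 h4 h5 h3 h6 (le_trans h7 b'b) (le_trans h8 b'b)).
Qed.

(* The error of a swap is proportional to the mass of a window around t, which the
   distance r itself controls; this gives r <= a + r / 2, hence r <= 2 a. *)
Lemma lindeberg t :
  `|pr Q [set x | sm (fun j => \sum_i zeta (tnth x i) j) <= t] - pr G [set e | sm (Y e) <= t]| <=
  5 / 2 * (A0 * (delta + 5 * beta^-1) + A1) + 2 * (n%:R * (K * (beta ^+ 2 * (tau1 + tau2)))).
Proof. by rewrite -PWn; apply: le_trans (r_ub t (leqnn n)) r_le. Qed.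

End lindeberg.

(** * Bernstein's inequality for kernels of order three *)

Section permutation_average.
Context (R : realType) (n : nat).

(** A product of three transpositions, each one fixing the targets already reached. *)
Lemma perm_triple (i0 l0 m0 i l m : 'I_n) : i0 != l0 -> i0 != m0 -> l0 != m0 ->
  i != l -> i != m -> l != m ->
  exists s : {perm 'I_n}, [/\ s i0 = i, s l0 = l & s m0 = m].
Proof.
move=> il0 im0 lm0 il im lm.
pose s1 := tperm i0 i; pose s2 := tperm (s1 l0) l; pose s3 := tperm (s2 (s1 m0)) m.
have e1 : s1 i0 = i by rewrite tpermL.
have n1 : s1 l0 != i by rewrite -e1 (inj_eq perm_inj) eq_sym.
have e2 : s2 (s1 l0) = l by rewrite tpermL.
have e2' : s2 i = i by rewrite tpermD// eq_sym.
have n2 : s2 (s1 m0) != i by rewrite -[i in X in _ != X]e2' (inj_eq perm_inj) -e1 (inj_eq perm_inj) eq_sym.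
have n3 : s2 (s1 m0) != l by rewrite -[l in X in _ != X]e2 !(inj_eq perm_inj) eq_sym.
exists (s1 * s2 * s3)%g; rewrite !permM e1 e2 e2'; split.
- by rewrite /s3 tpermD// eq_sym.
- by rewrite /s3 tpermD// eq_sym.
- by rewrite /s3 tpermL.
Qed.

Lemma card_triples : \sum_(i < n) \sum_(l < n | l != i) \sum_(m < n | (m != i) && (m != l)) 1 =
  n%:R * (n%:R - 1) * (n%:R - 2) :> R.
Proof.
have E (i l : 'I_n) : l != i -> \sum_(m < n | (m != i) && (m != l)) (1 : R) = n%:R - 2.
  move=> li; have : \sum_(m < n) (1 : R) = n%:R by rewrite sumr_const card_ord.
  rewrite (bigD1 i)//= (bigD1 l)//= => <-; lra.
rewrite (eq_bigr (fun=> (n%:R - 1) * (n%:R - 2))); last first.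
  move=> i _; rewrite (eq_bigr (fun=> 1 * (n%:R - 2))); last by move=> l /E ->; rewrite mul1r.
  rewrite -mulr_suml; congr (_ * _).
  have : \sum_(m < n) (1 : R) = n%:R by rewrite sumr_const card_ord.
  by rewrite (bigD1 i)//= => <-; lra.
by rewrite sumr_const card_ord -[LHS]mulr_natl mulrA.
Qed.

Variable f : 'I_n -> 'I_n -> 'I_n -> R.

(** The symmetric group is transitive on triples of distinct indices, so every triple is reached
    equally often from [(i0, l0, m0)]. *)
Lemma sum_triples_perm (i0 l0 m0 : 'I_n) : i0 != l0 -> i0 != m0 -> l0 != m0 ->
  #|{perm 'I_n}|%:R * (\sum_(i < n) \sum_(l < n | l != i) \sum_(m < n | (m != i) && (m != l)) f i l m) =
  n%:R * (n%:R - 1) * (n%:R - 2) * \sum_(s : {perm 'I_n}) f (s i0) (s l0) (s m0).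
Proof.
move=> il im lm; rewrite -card_triples.
set S := \sum_(s : {perm 'I_n}) _.
transitivity (\sum_(s : {perm 'I_n}) \sum_(i < n) \sum_(l < n | l != i) \sum_(m < n | (m != i) && (m != l)) f (s i) (s l) (s m)).
  rewrite mulr_natl -sumr_const; apply: eq_bigr => s _.
  rewrite (reindex_inj (@perm_inj _ s))/=; apply: eq_bigr => i _.
  rewrite (reindex_inj (@perm_inj _ s))/=; apply: eq_big => [l|l _]; first by rewrite (inj_eq perm_inj).
  rewrite (reindex_inj (@perm_inj _ s))/=; apply: eq_big => [m|m _] //.
  by rewrite !(inj_eq perm_inj).
rewrite exchange_big/= mulr_suml; apply: eq_bigr => i _.
rewrite exchange_big/= mulr_suml; apply: eq_bigr => l li.
rewrite exchange_big/= mulr_suml; apply: eq_bigr => m /andP[mi ml].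
rewrite mul1r /S.
rewrite eq_sym in li; rewrite eq_sym in mi; rewrite eq_sym in ml.
have [s [s1 s2 s3]] := perm_triple il im lm li mi ml.
rewrite [RHS](reindex_inj (mulgI s))/=; apply: eq_bigr => t _.
by rewrite !permM s1 s2 s3.
Qed.

End permutation_average.

(** Tangent line of the exponential at the mean [c]. *)
Lemma expR_Jensen (R : realType) (I : finType) (u : I -> R) : (0 < #|I|)%N ->
  expR (#|I|%:R^-1 * \sum_i u i) <= #|I|%:R^-1 * \sum_i expR (u i).
Proof.
move=> I0; set c := _^-1 * _.
have n0 : 0 < #|I|%:R :> R by rewrite ltr0n.
have h i : expR c * (1 + (u i - c)) <= expR (u i).
  rewrite -[in leRHS](subrK c (u i)) [X in _ <= expR X]addrC expRD ler_pM2l ?expR_gt0//.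
  exact: expR_ge1Dx.
rewrite -(ler_pM2l n0) mulrA mulfV ?gt_eqF// mul1r.
apply: le_trans (ler_sum _ (fun i _ => h i)).
rewrite -mulr_sumr big_split/= sumrB !sumr_const -[c *+ _]mulr_natl.
have cE : #|I|%:R * c = \sum_i u i by rewrite /c mulrA mulfV ?gt_eqF// mul1r.
rewrite [X in _ <= _ * (_ + (_ - X))](_ : _ = \sum_i u i)// subrr addr0 mulrC.
by rewrite le_eqVlt; apply/orP; left; apply/eqP; congr (_ * _).
Qed.

Section block_independence.
Context (R : realType) d (T : measurableType d) (n : nat).
Variables (F : probability T R) (Q : probability (n.-tuple T) R).
Hypothesis FQ : prodlike F Q.

Lemma resample_mul (i : 'I_n) (u P : n.-tuple T -> \bar R) :
  measurable_fun setT u -> (forall x, (0 <= u x)%E) ->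
  measurable_fun setT P -> (forall x, (0 <= P x)%E) -> (forall x y, P (upd x i y) = P x) ->
  (\int[Q]_x (u x * P x) = \int[Q]_x ((\int[F]_y u (upd x i y)) * P x))%E.
Proof.
move=> mu u0 mP P0 Pi.
rewrite (resample FQ i); first last.
- by move=> x; rewrite mule_ge0.
- exact: emeasurable_funM.
apply: eq_integral => x _.
under eq_integral => y _ do rewrite Pi.
rewrite ge0_integralZr//.
by apply: (measurableT_comp mu); exact: measurable_upd2.
Qed.

Variable f : T -> T -> T -> R.
Hypotheses (mf : measurable_fun setT (fun z : T * T * T => f z.1.1 z.1.2 z.2))
  (f0 : forall x y z, 0 <= f x y z).

(** The indices of the head block do not occur in the tail, so its three coordinates are integrated
    out one after another while the product over the tail stays fixed. *)
Lemma integral_triples (r : seq ('I_n * 'I_n * 'I_n)) (c : R) : 0 <= c ->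
  (\int[F]_x \int[F]_y \int[F]_z (f x y z)%:E <= c%:E)%E ->
  uniq (flatten [seq [:: t.1.1; t.1.2; t.2] | t <- r]) ->
  (\int[Q]_x (\prod_(t <- r) f (tnth x t.1.1) (tnth x t.1.2) (tnth x t.2))%:E <=
   (c ^+ size r)%:E)%E.
Proof.
move=> c0 fc; elim: r => [|[[i l] m] r IH] /=.
  by under eq_integral do rewrite big_nil; rewrite integral_cst// [X in (_ * X)%E]probability_setT mule1.
rewrite !inE !negb_or => /and4P[/and3P[il im ir] /andP[lm lr] mr ur].
pose P (x : n.-tuple T) := \prod_(t <- r) f (tnth x t.1.1) (tnth x t.1.2) (tnth x t.2).
have mt (t : 'I_n * 'I_n * 'I_n) : measurable_fun setT (fun x : n.-tuple T => f (tnth x t.1.1) (tnth x t.1.2) (tnth x t.2)).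
  apply: (@measurableT_comp _ _ _ _ _ _ (fun z : T * T * T => f z.1.1 z.1.2 z.2) _ (fun x : n.-tuple T => (tnth x t.1.1, tnth x t.1.2, tnth x t.2))) => //.
  apply/measurable_fun_pair => /=; last exact: measurable_tnth.
  by apply/measurable_fun_pair => /=; exact: measurable_tnth.
have mP : measurable_fun setT (fun x => (P x)%:E).
  by apply/measurable_EFinP; apply: measurable_prod => t _; exact: mt.
have P0 x : (0 <= (P x)%:E)%E by rewrite lee_fin; apply: prodr_ge0.
have Pi k x y : k \notin flatten [seq [:: t.1.1; t.1.2; t.2] | t <- r] -> ((P (upd x k y))%:E = (P x)%:E)%E.
  move=> kr; congr (_%:E); rewrite /P big_seq [RHS]big_seq; apply: eq_bigr => t tr.
  have h j : j \in [:: t.1.1; t.1.2; t.2] -> tnth (upd x k y) j = tnth x j.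
    move=> jt; rewrite tnth_upd; case: eqP => // jk; case/negP: kr; apply/flattenP.
    by exists [:: t.1.1; t.1.2; t.2]; [exact: map_f|rewrite -jk].
  by rewrite !h// !inE eqxx ?orbT.
pose u1 x := (f (tnth x i) (tnth x l) (tnth x m))%:E.
pose u2 x := (\int[F]_y u1 (upd x m y))%E.
pose u3 x := (\int[F]_y u2 (upd x l y))%E.
pose u4 x := (\int[F]_y u3 (upd x i y))%E.
have u10 x : (0 <= u1 x)%E by rewrite lee_fin.
have m1 : measurable_fun setT u1 by apply/measurable_EFinP; exact: (mt (i, l, m)).
have u20 x : (0 <= u2 x)%E by exact: integral_ge0.
have m2 : measurable_fun setT u2 by exact: (measurable_resample F m m1).
have u30 x : (0 <= u3 x)%E by exact: integral_ge0.
have m3 : measurable_fun setT u3 by exact: (measurable_resample F l m2).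
have u40 x : (0 <= u4 x)%E by exact: integral_ge0.
have m4 : measurable_fun setT u4 by exact: (measurable_resample F i m3).
rewrite [X in (X <= _)%E](_ : _ = \int[Q]_x (u1 x * (P x)%:E))%E; last first.
  by apply: eq_integral => x _; rewrite big_cons EFinM.
rewrite (resample_mul m1 u10 mP P0 (fun x y => Pi m x y mr)).
rewrite (resample_mul m2 u20 mP P0 (fun x y => Pi l x y lr)).
rewrite (resample_mul m3 u30 mP P0 (fun x y => Pi i x y ir)) -/u4.
have u4c x : (u4 x <= c%:E)%E.
  apply: le_trans fc; rewrite le_eqVlt; apply/orP; left; apply/eqP.
  apply: eq_integral => y1 _; apply: eq_integral => y2 _; apply: eq_integral => y3 _.
  rewrite /u1 !tnth_upd !eqxx (negbTE il) (negbTE im) (negbTE lm).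
  by rewrite ?eqxx.
apply: le_trans (_ : (\int[Q]_x (c%:E * (P x)%:E) <= _)%E).
  apply: ge0_le_integral => //.
  - by move=> x _; exact: mule_ge0 (u40 x) (P0 x).
  - exact: emeasurable_funM.
  - by apply: emeasurable_funM => //; exact: measurable_cst.
  by move=> x _; exact: (lee_wpmul2r (P0 x) (u4c x)).
rewrite ge0_integralZl// exprS EFinM; apply: lee_wpmul2l; first by rewrite lee_fin.
exact: IH.
Qed.

End block_independence.

Lemma expR_le1DDsqr (R : realType) (x : R) : `|x| <= 4^-1 -> expR x <= 1 + x + x ^+ 2.
Proof.
move=> x1; have := expR_taylor3 x; rewrite ler_norml => /andP[_ h].
have e2 : expR `|x| <= 2.
  apply: le_trans (expR_le1D2x _) _; last lra.
  by apply/andP; split => //; lra.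
have h3 : `|x| ^+ 3 * expR `|x| <= x ^+ 2 / 2.
  rewrite exprS -mulrA mulrC -(real_normK (num_real x)) -mulrA ler_wpM2l ?sqr_ge0//.
  by have := normr_ge0 x; nra.
lra.
Qed.

Lemma blocks_iota N : flatten [seq [:: 3 * b; 3 * b + 1; 3 * b + 2]%N | b <- iota 0 N] = iota 0 (3 * N).
Proof.
elim: N => [|N IH]; first by [].
rewrite -[N.+1]addn1 iotaD map_cat flatten_cat IH add0n mulnDr iotaD add0n muln1.
by congr (_ ++ _); rewrite /= addn1 addn2.
Qed.

(** * Exponential moments of a bounded U-statistic of order three *)

Section bernstein.
Context (R : realType) d (T : measurableType d) (n : nat).
Variables (F : probability T R) (Q : probability (n.-tuple T) R).
Hypothesis FQ : prodlike F Q.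
Hypothesis n3 : (3 <= n)%N.
Variable g : T -> T -> T -> R.
Variables (M v : R).
Hypotheses (mg : measurable_fun setT (fun z : T * T * T => g z.1.1 z.1.2 z.2))
  (gM : forall x y z, `|g x y z| <= M).
Let P3 := ((F \x F) \x F : probability _ _)%E.
Hypothesis gv : Ex P3 (fun z => g z.1.1 z.1.2 z.2 ^+ 2) <= v.
Let mu := Ex P3 (fun z => g z.1.1 z.1.2 z.2).

Definition ustat3 (x : n.-tuple T) : R := (n%:R * (n%:R - 1) * (n%:R - 2))^-1 *
  \sum_(i < n) \sum_(l < n | l != i) \sum_(m < n | (m != i) && (m != l)) g (tnth x i) (tnth x l) (tnth x m).

Let N := (n %/ 3)%N.
Let hb (b : 'I_N) k : (k < 3)%N -> (3 * b + k < n)%N.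
Proof.
move=> k3; apply: leq_trans (_ : 3 * N <= n)%N; last by rewrite mulnC leq_divM.
apply: leq_trans (_ : 3 * b.+1 <= _)%N; last by rewrite leq_mul2l ltn_ord.
by rewrite mulnS addnC ltn_add2r.
Qed.
Let ob (b : 'I_N) k (k3 : (k < 3)%N) : 'I_n := Ordinal (hb b k3).
(** For a fixed permutation these are disjoint triples of coordinates, so the kernel values over [b]
    are independent. *)
Let blk (s : {perm 'I_n}) (b : 'I_N) : 'I_n * 'I_n * 'I_n :=
  (s (ob b (isT : 0 < 3)%N), s (ob b (isT : 1 < 3)%N), s (ob b (isT : 2 < 3)%N)).

Let N0 : (0 < N)%N. Proof. by rewrite divn_gt0. Qed.

Let blocks_uniq s : uniq (flatten [seq [:: t.1.1; t.1.2; t.2] | t <- [seq blk s b | b <- enum 'I_N]]).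
Proof.
rewrite -map_comp.
have -> : [seq ((fun t => [:: t.1.1; t.1.2; t.2]) \o blk s) b | b <- enum 'I_N] =
    [seq map s t | t <- [seq [:: ob b (isT : 0 < 3)%N; ob b (isT : 1 < 3)%N; ob b (isT : 2 < 3)%N] | b <- enum 'I_N]].
  by rewrite -[RHS]map_comp; apply: eq_map.
rewrite -map_flatten map_inj_uniq; last exact: perm_inj.
rewrite -(map_inj_uniq val_inj) map_flatten -map_comp.
rewrite (_ : flatten _ = iota 0 (3 * N)) ?iota_uniq//.
rewrite -blocks_iota -val_enum_ord -map_comp; congr flatten; apply: eq_map => b /=.
by rewrite addn0.
Qed.

Let M0 : 0 <= M.
Proof. by apply: le_trans (gM point point point). Qed.

Let mu_le : `|mu| <= M.
Proof.
rewrite -(Ex_cst P3 M); apply: Ex_abs_le => //; last exact: intg_cst.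
exact: (intg_bounded _ _ (fun z => gM _ _ _)).
Qed.

Let ig : intg P3 (fun z => g z.1.1 z.1.2 z.2).
Proof. exact: (intg_bounded _ mg (fun z => gM _ _ _)). Qed.

Let v0 : 0 <= v.
Proof. by apply: le_trans gv; apply: Ex_ge0 => z; exact: sqr_ge0. Qed.

(** The centred kernel is at most [2 M], so [8 s M <= 1] keeps the exponent within [1 / 4], where
    [expR] lies below its quadratic majorant. *)
Let mgf1 s : 0 <= s -> 8 * (s * M) <= 1 ->
  (\int[F]_x \int[F]_y \int[F]_z (expR (s * (g x y z - mu)))%:E <= (expR (s ^+ 2 * v))%:E)%E.
Proof.
move=> s0 sM.
pose W (z : T * T * T) := s * (g z.1.1 z.1.2 z.2 - mu).
have iW : intg P3 W by apply: intgZ; apply: intgB => //; exact: intg_cst.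
have Wb z : `|W z| <= 4^-1.
  rewrite /W normrM ger0_norm//.
  have : `|g z.1.1 z.1.2 z.2 - mu| <= 2 * M.
    by apply: le_trans (ler_normB _ _) _; rewrite mulr_natl mulr2n lerD.
  move=> /(ler_wpM2l s0); lra.
have mW := intg_measurable iW.
have mE : measurable_fun setT (fun z => expR (W z)) by apply: measurableT_comp.
have iE : intg P3 (fun z => expR (W z)).
  apply: (@intg_bounded _ _ _ _ _ (expR 4^-1)) => // z.
  by rewrite ger0_norm ?expR_ge0// ler_expR; exact: le_trans (ler_norm _) (Wb z).
have i2 : intg P3 (fun z => W z ^+ 2).
  apply: (@intg_bounded _ _ _ _ _ (4^-1 ^+ 2)); first exact: measurable_funX.
  by move=> z; rewrite normrX lerXn2r ?nnegrE.
have ig2 : intg P3 (fun z => g z.1.1 z.1.2 z.2 ^+ 2).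
  apply: (@intg_bounded _ _ _ _ _ (M ^+ 2)); first exact: measurable_funX.
  by move=> z; rewrite normrX lerXn2r ?nnegrE.
have EW : Ex P3 W = 0.
  rewrite /W ExZ; last by apply: intgB => //; exact: intg_cst.
  by rewrite (ExB ig (intg_cst P3 mu)) Ex_cst subrr mulr0.
have EW2 : Ex P3 (fun z => W z ^+ 2) <= s ^+ 2 * v.
  rewrite (@eq_Ex _ _ _ _ _ (fun z => s ^+ 2 * (g z.1.1 z.1.2 z.2 ^+ 2 - (2 * mu * g z.1.1 z.1.2 z.2 - mu ^+ 2)))); last by move=> z; rewrite /W; ring.
  have i3 : intg P3 (fun z => 2 * mu * g z.1.1 z.1.2 z.2) by exact: intgZ.
  have i4 := intgB i3 (intg_cst P3 (mu ^+ 2)).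
  rewrite (ExZ _ (intgB ig2 i4)) (ExB ig2 i4) (ExB i3 (intg_cst P3 (mu ^+ 2))) (ExZ _ ig) Ex_cst.
  rewrite ler_wpM2l ?sqr_ge0// -/mu.
  have := sqr_ge0 mu; move: gv; rewrite expr2; lra.
have mEE : measurable_fun setT (fun z : T * T * T => (expR (W z))%:E) by exact/measurable_EFinP.
have E0 (z : T * T * T) : (0 <= (expR (W z))%:E)%E by rewrite lee_fin expR_ge0.
have -> : (\int[F]_x \int[F]_y \int[F]_z (expR (s * (g x y z - mu)))%:E = \int[P3]_z (expR (W z))%:E)%E.
  rewrite (@fubini_tonelli1 _ _ _ _ _ (F \x F : probability _ _)%E F _ mEE E0).
  have mI := @measurable_fun_fubini_tonelli_F _ _ _ _ _ F _ mEE E0.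
  by rewrite (@fubini_tonelli1 _ _ _ _ _ F F _ mI)// => z; exact: integral_ge0.
apply: Ex_le_int => //.
apply: le_trans (_ : Ex P3 (fun z => 1 + W z + W z ^+ 2) <= _).
  by apply: Ex_le => //; [apply: intgD => //; apply: intgD => //; exact: intg_cst|move=> z; exact: expR_le1DDsqr].
rewrite (ExD (intgD (intg_cst P3 1) iW) i2) (ExD (intg_cst P3 1) iW) Ex_cst EW addr0.
by apply: le_trans (expR_ge1Dx _); rewrite lerD2l.
Qed.

Let perms := {perm 'I_n}.
Let P0 : (0 < #|{: perms}|)%N.
Proof. by apply/card_gt0P; exists 1%g. Qed.

Let ustat3E x s : s * N%:R * (ustat3 x - mu) =
  #|{: perms}|%:R^-1 * \sum_(t : perms) \sum_(b < N) s * (g (tnth x (blk t b).1.1) (tnth x (blk t b).1.2) (tnth x (blk t b).2) - mu).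
Proof.
have pn : (#|{: perms}|%:R : R) != 0 by rewrite pnatr_eq0 -lt0n.
have nn : n%:R * (n%:R - 1) * (n%:R - 2) != 0 :> R.
  have : 3 <= n%:R :> R by rewrite ler_nat.
  by move=> h; rewrite !mulf_neq0//; lra.
pose f i l m := g (tnth x i) (tnth x l) (tnth x m).
have E (b : 'I_N) : \sum_(t : perms) f (blk t b).1.1 (blk t b).1.2 (blk t b).2 = #|{: perms}|%:R * ustat3 x.
  have d1 : ob b (isT : 0 < 3)%N != ob b (isT : 1 < 3)%N by rewrite -val_eqE /= eqn_add2l.
  have d2 : ob b (isT : 0 < 3)%N != ob b (isT : 2 < 3)%N by rewrite -val_eqE /= eqn_add2l.
  have d3 : ob b (isT : 1 < 3)%N != ob b (isT : 2 < 3)%N by rewrite -val_eqE /= eqn_add2l.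
  rewrite /ustat3 mulrCA (sum_triples_perm f d1 d2 d3) mulrA mulVf// mul1r.
  by [].
rewrite exchange_big/=.
under eq_bigr => b _ do rewrite -mulr_sumr sumrB E sumr_const -[mu *+ _]mulr_natl -mulrBr.
rewrite sumr_const card_ord -[X in _ = _ * X]mulr_natl.
by field.
Qed.

(* Hoeffding: [ustat3] is an average over permutations of means of N = n / 3 independent
   blocks, so Jensen reduces its moment generating function to that of one block. *)
Lemma ustat3_mgf s : 0 <= s -> 8 * (s * M) <= 1 ->
  (\int[Q]_x (expR (s * N%:R * (ustat3 x - mu)))%:E <= (expR (s ^+ 2 * v) ^+ N)%:E)%E.
Proof.
move=> s0 sM.
pose f x y z := expR (s * (g x y z - mu)).
have mf : measurable_fun setT (fun z : T * T * T => f z.1.1 z.1.2 z.2).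
  by apply: measurableT_comp => //; apply: measurable_funM => //; apply: measurable_funB.
have f0 x y z : 0 <= f x y z by exact: expR_ge0.
pose h (t : perms) (x : n.-tuple T) := \prod_(u <- [seq blk t b | b <- enum 'I_N]) f (tnth x u.1.1) (tnth x u.1.2) (tnth x u.2).
have h0 t x : (0 <= (h t x)%:E)%E by rewrite lee_fin; apply: prodr_ge0.
have mh t : measurable_fun setT (fun x => (h t x)%:E).
  apply/measurable_EFinP; apply: measurable_prod => u _.
  apply: (@measurableT_comp _ _ _ _ _ _ (fun z : T * T * T => f z.1.1 z.1.2 z.2) _ (fun x : n.-tuple T => (tnth x u.1.1, tnth x u.1.2, tnth x u.2))) => //.
  apply/measurable_fun_pair => /=; last exact: measurable_tnth.
  by apply/measurable_fun_pair => /=; exact: measurable_tnth.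
have hI t : (\int[Q]_x (h t x)%:E <= (expR (s ^+ 2 * v) ^+ N)%:E)%E.
  have := integral_triples FQ mf f0 (expR_ge0 (s ^+ 2 * v)) (mgf1 s0 sM) (blocks_uniq t).
  by rewrite size_map -cardE card_ord.
have hE t x : h t x = expR (\sum_(b < N) s * (g (tnth x (blk t b).1.1) (tnth x (blk t b).1.2) (tnth x (blk t b).2) - mu)).
  by rewrite expR_sum /h big_map big_enum.
have pn : (0 < #|{: perms}|%:R :> R) by rewrite ltr0n.
have mU : measurable_fun setT ustat3.
  apply: measurable_funM => //; apply: measurable_sum => i.
  under eq_fun do rewrite big_mkcond; apply: measurable_sum => l; case: (l != i) => //.
  under eq_fun do rewrite big_mkcond; apply: measurable_sum => m; case: ((m != i) && (m != l)) => //.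
  apply: (@measurableT_comp _ _ _ _ _ _ (fun z : T * T * T => g z.1.1 z.1.2 z.2) _ (fun x : n.-tuple T => (tnth x i, tnth x l, tnth x m))) => //.
  apply/measurable_fun_pair => /=; last exact: measurable_tnth.
  by apply/measurable_fun_pair => /=; exact: measurable_tnth.
apply: le_trans (_ : (\int[Q]_x ((#|{: perms}|%:R^-1)%:E * \sum_(t : perms) (h t x)%:E) <= _)%E).
  apply: ge0_le_integral => //.
  - by apply/measurable_EFinP; apply: measurableT_comp => //; apply: measurable_funM => //; apply: measurable_funB.
  - by apply: emeasurable_funM; [exact: measurable_cst|exact: emeasurable_sum].
  move=> x _; rewrite sumEFin -EFinM lee_fin ustat3E.
  apply: le_trans (expR_Jensen _ P0) _.
  by rewrite ler_pM2l ?invr_gt0//; apply: ler_sum => t _; rewrite hE.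
have ms : measurable_fun setT (fun x => \sum_(t : perms) (h t x)%:E)%E by exact: emeasurable_sum.
have s0' x : setT x -> (0 <= \sum_(t : perms) (h t x)%:E)%E by move=> _; apply: sume_ge0.
rewrite (ge0_integralZl _ measurableT ms s0')//.
rewrite ge0_integral_sum//.
apply: le_trans (_ : ((#|{: perms}|%:R^-1)%:E * \sum_(t : perms) (expR (s ^+ 2 * v) ^+ N)%:E <= _)%E).
  by apply: lee_wpmul2l; [rewrite lee_fin invr_ge0 ltW|apply: lee_sum].
rewrite sumEFin -EFinM lee_fin sumr_const -[X in _ * X]mulr_natl mulrA mulVf ?mul1r ?gt_eqF//.
Qed.

Lemma measurable_ustat3 : measurable_fun setT ustat3.
Proof.
apply: measurable_funM => //; apply: measurable_sum => i.
under eq_fun do rewrite big_mkcond; apply: measurable_sum => l; case: (l != i) => //.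
under eq_fun do rewrite big_mkcond; apply: measurable_sum => m; case: ((m != i) && (m != l)) => //.
apply: (@measurableT_comp _ _ _ _ _ _ (fun z : T * T * T => g z.1.1 z.1.2 z.2) _ (fun x : n.-tuple T => (tnth x i, tnth x l, tnth x m))) => //.
apply/measurable_fun_pair => /=; last exact: measurable_tnth.
by apply/measurable_fun_pair => /=; exact: measurable_tnth.
Qed.

(** Chernoff with [s] left free: [2 s v <= t] lets half of the exponent absorb the variance term.
    The choice of [s] is postponed to where [t] and the truncation level are known. *)
Lemma ustat3_upper_tail s t : 0 <= s -> 8 * (s * M) <= 1 -> 2 * (s * v) <= t ->
  pr Q [set x | t <= ustat3 x - mu] <= expR (- (s * N%:R * t / 2)).
Proof.
move=> s0 sM sv.
have mU := measurable_ustat3.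
have mS : measurable [set x | t <= ustat3 x - mu].
  rewrite (_ : [set x | _] = [set x | mu - ustat3 x <= - t]); last first.
    by apply/seteqP; split => x /=; lra.
  by apply: measurable_set_le; apply: measurable_funB.
have mE : measurable_fun setT (fun x => expR (s * N%:R * (ustat3 x - mu))).
  by apply: measurableT_comp => //; apply: measurable_funM => //; apply: measurable_funB.
have [iE hE] := intg_ge0 mE (fun x => expR_ge0 _) (ustat3_mgf s0 sM).
have N0' : 0 <= s * N%:R by rewrite mulr_ge0.
apply: le_trans (markov_le iE (fun x => expR_ge0 _) mS (expR_gt0 (s * N%:R * t)) _) _.
  by move=> x /= tx; rewrite ler_expR ler_wpM2l.
rewrite ler_pdivrMr ?expR_gt0//; apply: le_trans hE _.
rewrite -expRM_natl -expRD ler_expR.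
have := ler_wpM2l N0' sv.
rewrite (_ : s * N%:R * (2 * (s * v)) = 2 * (N%:R * (s ^+ 2 * v))); last by ring.
by move: (s * N%:R * t) (N%:R * (s ^+ 2 * v)) => *; lra.
Qed.

End bernstein.

Section bernstein_two_sided.
Context (R : realType) d (T : measurableType d) (n : nat).
Variables (F : probability T R) (Q : probability (n.-tuple T) R).
Hypotheses (FQ : prodlike F Q) (n3 : (3 <= n)%N).
Variables (g : T -> T -> T -> R) (M v : R).
Hypotheses (mg : measurable_fun setT (fun z : T * T * T => g z.1.1 z.1.2 z.2))
  (gM : forall x y z, `|g x y z| <= M).
Let P3 := ((F \x F) \x F : probability _ _)%E.
Hypothesis gv : Ex P3 (fun z => g z.1.1 z.1.2 z.2 ^+ 2) <= v.
Let mu := Ex P3 (fun z => g z.1.1 z.1.2 z.2).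

Lemma ustat3_tail s t : 0 <= s -> 8 * (s * M) <= 1 -> 2 * (s * v) <= t ->
  pr Q [set x | t <= `|ustat3 g x - mu|] <= 2 * expR (- (s * (n %/ 3)%N%:R * t / 2)).
Proof.
move=> s0 sM sv.
have mg' : measurable_fun setT (fun z : T * T * T => - g z.1.1 z.1.2 z.2).
  exact: measurable_funN.
have gM' x y z : `|- g x y z| <= M by rewrite normrN.
have gv' : Ex P3 (fun z => (- g z.1.1 z.1.2 z.2) ^+ 2) <= v.
  by under eq_Ex do rewrite sqrrN.
have ig : intg P3 (fun z => g z.1.1 z.1.2 z.2) by exact: (intg_bounded _ mg (fun z => gM _ _ _)).
have h1 := ustat3_upper_tail FQ n3 mg gM gv s0 sM sv.
have h2 := ustat3_upper_tail FQ n3 (g := fun x y z => - g x y z) mg' gM' gv' s0 sM sv.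
have e x : ustat3 (fun x y z => - g x y z) x = - ustat3 g x.
  rewrite /ustat3 -mulrN; congr (_ * _).
  by rewrite -sumrN; apply: eq_bigr => i _; rewrite -sumrN; apply: eq_bigr => l _; rewrite -sumrN.
rewrite (ExN ig) -/mu in h2.
have mU := measurable_ustat3 mg (n := n).
have mS1 : measurable [set x : n.-tuple T | t <= ustat3 g x - mu].
  rewrite (_ : [set x | _] = [set x | mu - ustat3 g x <= - t]); last first.
    by apply/seteqP; split => x /=; lra.
  by apply: measurable_set_le; apply: measurable_funB.
have mS2 : measurable [set x : n.-tuple T | t <= ustat3 (fun x y z => - g x y z) x - - mu].
  rewrite (_ : [set x | _] = [set x | ustat3 g x - mu <= - t]); last first.
    by apply/seteqP; split => x /=; rewrite e; lra.
  by apply: measurable_set_le; apply: measurable_funB.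
rewrite (_ : [set x | _] = [set x | t <= ustat3 g x - mu] `|` [set x | t <= ustat3 (fun x y z => - g x y z) x - - mu]); last first.
  apply/seteqP; split => x /=; rewrite e ler_normr.
    by move=> /orP[h|h]; [left|right]; lra.
  by move=> [h|h]; apply/orP; [left|right]; lra.
apply: le_trans (pr_setU _ _ _) _ => //.
by rewrite mulr_natl mulr2n lerD.
Qed.

End bernstein_two_sided.

(** * U-statistics of orders two and three *)

Section ustat_algebra.
Context (R : realType) d (T : measurableType d) (n : nat).
Hypothesis n3 : (3 <= n)%N.
Implicit Types (x : n.-tuple T) (g : T -> T -> T -> R) (q : T -> T -> R).

Definition ustat2 q x : R := (n%:R * (n%:R - 1))^-1 *
  \sum_(i < n) \sum_(l < n | l != i) q (tnth x i) (tnth x l).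

Let n3R : 3 <= n%:R :> R. Proof. by rewrite ler_nat. Qed.
Let c2 : 0 < n%:R * (n%:R - 1) :> R. Proof. by have := n3R; nra. Qed.
Let c3 : 0 < n%:R * (n%:R - 1) * (n%:R - 2) :> R.
Proof. by rewrite mulr_gt0//; have := n3R; lra. Qed.

Let sum_third (i l : 'I_n) : l != i -> \sum_(m < n | (m != i) && (m != l)) (1 : R) = n%:R - 2.
Proof.
move=> li; have : \sum_(m < n) (1 : R) = n%:R by rewrite sumr_const card_ord.
rewrite (bigD1 i)//= (bigD1 l)//= => <-; lra.
Qed.

Let n20 : (n%:R - 2 != 0 :> R). Proof. by have := n3R; move=> h; apply/eqP; lra. Qed.
Let n10 : (n%:R - 1 != 0 :> R). Proof. by have := n3R; move=> h; apply/eqP; lra. Qed.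
Let n00 : (n%:R != 0 :> R). Proof. by have := n3R; move=> h; apply/eqP; lra. Qed.

Lemma ustat3_12 q x : ustat3 (fun a b _ => q a b) x = ustat2 q x.
Proof.
rewrite /ustat3 /ustat2.
rewrite (eq_bigr (fun i => (n%:R - 2) * \sum_(l < n | l != i) q (tnth x i) (tnth x l))); last first.
  move=> i _; rewrite mulr_sumr; apply: eq_bigr => l li.
  by rewrite -(sum_third li) mulr_suml; apply: eq_bigr => m _; rewrite mul1r.
by rewrite -mulr_sumr; field; rewrite n20 n10 n00.
Qed.

Lemma ustat3_13 q x : ustat3 (fun a _ b => q a b) x = ustat2 q x.
Proof.
rewrite -ustat3_12 /ustat3; congr (_ * _); apply: eq_bigr => i _.
rewrite (exchange_big_dep (fun m : 'I_n => m != i))/=; last by move=> l m _ /andP[].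
apply: eq_bigr => l li; apply: eq_bigl => m.
by rewrite li /= [l == m]eq_sym.
Qed.

Lemma ustat3D g1 g2 x : ustat3 (fun a b c => g1 a b c + g2 a b c) x = ustat3 g1 x + ustat3 g2 x.
Proof.
rewrite /ustat3 -mulrDr; congr (_ * _).
by rewrite -big_split; apply: eq_bigr => i _; rewrite -big_split; apply: eq_bigr => l _; rewrite -big_split.
Qed.

Lemma ustat3B g1 g2 x : ustat3 (fun a b c => g1 a b c - g2 a b c) x = ustat3 g1 x - ustat3 g2 x.
Proof.
rewrite /ustat3 -mulrBr; congr (_ * _).
by rewrite -sumrB; apply: eq_bigr => i _; rewrite -sumrB; apply: eq_bigr => l _; rewrite -sumrB.
Qed.

Lemma ustat3_norm g1 g2 x : (forall a b c, `|g1 a b c| <= g2 a b c) -> `|ustat3 g1 x| <= ustat3 g2 x.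
Proof.
move=> h; rewrite /ustat3 normrM ger0_norm; last by rewrite invr_ge0 ltW.
rewrite ler_pM2l ?invr_gt0//.
apply: le_trans (ler_norm_sum _ _ _) _; apply: ler_sum => i _.
apply: le_trans (ler_norm_sum _ _ _) _; apply: ler_sum => l _.
by apply: le_trans (ler_norm_sum _ _ _) _; apply: ler_sum.
Qed.

Lemma ustat3_dist g1 g2 q x : (forall a b c, `|g1 a b c - g2 a b c| <= q a b + q a c) ->
  `|ustat3 g1 x - ustat3 g2 x| <= 2 * ustat2 q x.
Proof.
move=> h; rewrite -ustat3B; apply: le_trans (ustat3_norm _ h) _.
by rewrite ustat3D ustat3_12 ustat3_13 mulr_natl mulr2n.
Qed.

Lemma ustat2_le q1 q2 x : (forall a b, q1 a b <= q2 a b) -> ustat2 q1 x <= ustat2 q2 x.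
Proof.
move=> h; rewrite /ustat2 ler_pM2l ?invr_gt0//.
by apply: ler_sum => i _; apply: ler_sum.
Qed.

Lemma ustat2_ge0 q x : (forall a b, 0 <= q a b) -> 0 <= ustat2 q x.
Proof.
move=> h; rewrite /ustat2 mulr_ge0 ?invr_ge0 ?(ltW c2)//.
by apply: sumr_ge0 => i _; apply: sumr_ge0.
Qed.

Lemma ustat2D q1 q2 x : ustat2 (fun a b => q1 a b + q2 a b) x = ustat2 q1 x + ustat2 q2 x.
Proof.
rewrite /ustat2 -mulrDr; congr (_ * _).
by rewrite -big_split; apply: eq_bigr => i _; rewrite -big_split.
Qed.

Lemma ustat2Z k q x : ustat2 (fun a b => k * q a b) x = k * ustat2 q x.
Proof.
rewrite /ustat2 mulrCA; congr (_ * _).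
by rewrite mulr_sumr; apply: eq_bigr => i _; rewrite mulr_sumr.
Qed.

Lemma ustat2_cst k x : ustat2 (fun _ _ => k) x = k.
Proof.
rewrite /ustat2 (eq_bigr (fun=> (n%:R - 1) * k)); last first.
  move=> i _; have : \sum_(l < n) k = n%:R * k by rewrite sumr_const card_ord mulr_natl.
  by rewrite (bigD1 i)//=; lra.
by rewrite sumr_const card_ord -[X in _ * X]mulr_natl; field; rewrite n10 n00.
Qed.

Lemma ustat2_norm q1 q2 x : (forall a b, `|q1 a b| <= q2 a b) -> `|ustat2 q1 x| <= ustat2 q2 x.
Proof. by move=> h; rewrite -!ustat3_12; apply: ustat3_norm => a b c. Qed.

Section coefficients.
Context (J : Type) (h : T -> T -> J -> R).

Definition ghat x (i : 'I_n) j : R := (n%:R - 1)^-1 * \sum_(l < n | l != i) h (tnth x i) (tnth x l) j.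

Definition Ustat x j : R := ustat2 (fun a b => h a b j) x.

(** The coefficient of the [i]-th centred weight in the reweighted statistic. The inner average
    [ghat] estimates the projection at [X_i], and subtracting [Ustat] is the effect of the
    correction term in the bootstrap. *)
Definition acoef x (i : 'I_n) j : R := (Num.sqrt n%:R)^-1 * (ghat x i j - Ustat x j).

Lemma sum_ghat x j : \sum_i ghat x i j = n%:R * Ustat x j.
Proof. by rewrite /ghat -mulr_sumr /Ustat /ustat2; field; rewrite n10 n00. Qed.

(** Multiplying two inner averages separates distinct inner indices, which form a U-statistic of
    order three whose mean is the wanted covariance, from coinciding ones, which carry the factor
    [1 / (n - 1)]. *)
Lemma sum_acoef x j k : \sum_i acoef x i j * acoef x i k =
  (n%:R - 2) / (n%:R - 1) * ustat3 (fun a b c => h a b j * h a c k) x +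
  (n%:R - 1)^-1 * ustat2 (fun a b => h a b j * h a b k) x - Ustat x j * Ustat x k.
Proof.
have sq : (Num.sqrt n%:R)^-1 ^+ 2 = n%:R^-1 :> R by rewrite exprVn sqr_sqrtr.
rewrite (eq_bigr (fun i => n%:R^-1 * (ghat x i j * ghat x i k) +
    n%:R^-1 * (- Ustat x k * ghat x i j + (- Ustat x j * ghat x i k + Ustat x j * Ustat x k)))); last first.
  by move=> i _; rewrite /acoef -sq; ring.
have S1 : \sum_(i < n) (- Ustat x k * ghat x i j + (- Ustat x j * ghat x i k + Ustat x j * Ustat x k)) =
    - (n%:R * (Ustat x j * Ustat x k)).
  rewrite big_split/= big_split/= -[X in X + _ = _]mulr_sumr -[X in _ + (X + _) = _]mulr_sumr !sum_ghat.
  by rewrite sumr_const card_ord -[(_ * _) *+ n]mulr_natl; ring.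
rewrite big_split/= -[X in X + _ = _]mulr_sumr -[X in _ + X = _]mulr_sumr S1 mulrN mulKf//.
congr (_ - _).
rewrite (eq_bigr (fun i => (n%:R - 1)^-2 *
    (\sum_(l < n | l != i) \sum_(m < n | (m != i) && (m != l)) h (tnth x i) (tnth x l) j * h (tnth x i) (tnth x m) k
     + \sum_(l < n | l != i) h (tnth x i) (tnth x l) j * h (tnth x i) (tnth x l) k))); last first.
  move=> i _; rewrite /ghat mulrACA -expr2 -exprVn; congr (_ * _).
  rewrite mulr_suml -big_split/=; apply: eq_bigr => l li.
  by rewrite (bigD1 l)//= mulrDr addrC mulr_sumr.
rewrite -mulr_sumr big_split/= /ustat3 /ustat2.
by field; rewrite n20 n10 n00.
Qed.

End coefficients.
End ustat_algebra.

Section ustat_mean.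
Context (R : realType) d (T : measurableType d) (n : nat).
Variables (F : probability T R) (Q : probability (n.-tuple T) R).
Hypotheses (FQ : prodlike F Q) (n3 : (3 <= n)%N).
Variable q : T -> T -> R.
Hypotheses (mq : measurable_fun setT (fun z : T * T => q z.1 z.2)) (q0 : forall x y, 0 <= q x y).
Hypothesis iq : intg (F \x F)%E (fun z => q z.1 z.2).

Lemma measurable_pair_tnth (i l : 'I_n) : measurable_fun setT (fun x : n.-tuple T => q (tnth x i) (tnth x l)).
Proof.
apply: (@measurableT_comp _ _ _ _ _ _ (fun z : T * T => q z.1 z.2) _ (fun x : n.-tuple T => (tnth x i, tnth x l))) => //.
by apply/measurable_fun_pair => /=; exact: measurable_tnth.
Qed.

Lemma measurable_ustat2 : measurable_fun setT (ustat2 (n := n) q).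
Proof.
apply: measurable_funM => //; apply: measurable_sum => i.
under eq_fun do rewrite big_mkcond; apply: measurable_sum => l; case: (l != i) => //.
exact: measurable_pair_tnth.
Qed.

Lemma Ex_pair_tnth (i l : 'I_n) : i != l ->
  intg Q (fun x => q (tnth x i) (tnth x l)) /\
  Ex Q (fun x => q (tnth x i) (tnth x l)) = Ex (F \x F)%E (fun z => q z.1 z.2).
Proof.
move=> il.
have mqE : measurable_fun setT (fun z : T * T => (q z.1 z.2)%:E) by exact/measurable_EFinP.
have q0E (z : T * T) : (0 <= (q z.1 z.2)%:E)%E by rewrite lee_fin.
have e : (\int[Q]_x (q (tnth x i) (tnth x l))%:E = \int[(F \x F)%E]_z (q z.1 z.2)%:E)%E.
  rewrite (integral_tnth2 FQ (f := fun a b => (q a b)%:E) il mqE (fun a b => q0E (a, b))).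
  by rewrite (@fubini_tonelli1 _ _ _ _ _ F F _ mqE q0E).
split; last by apply: (congr1 fine).
have h : (\int[Q]_x (q (tnth x i) (tnth x l))%:E <= (Ex (F \x F)%E (fun z => q z.1 z.2))%:E)%E.
  by rewrite e (Ex_EFin iq).
exact: (intg_ge0 (measurable_pair_tnth i l) (fun x => q0 _ _) h).1.
Qed.

Lemma Ex_ustat2 : intg Q (ustat2 (n := n) q) /\ Ex Q (ustat2 q) = Ex (F \x F)%E (fun z => q z.1 z.2).
Proof.
have n3R : 3 <= n%:R :> R by rewrite ler_nat.
pose f (i l : 'I_n) (x : n.-tuple T) := (l != i)%:R * q (tnth x i) (tnth x l).
have fi i l : intg Q (f i l).
  rewrite /f; case: (eqVneq l i) => [_|li].
    by under eq_fun do rewrite mul0r; exact: intg_cst.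
  by under eq_fun do rewrite mul1r; rewrite eq_sym in li; exact: (Ex_pair_tnth li).1.
have E x : ustat2 q x = (n%:R * (n%:R - 1))^-1 * \sum_(i < n) \sum_(l < n) f i l x.
  rewrite /ustat2; congr (_ * _); apply: eq_bigr => i _; rewrite big_mkcond; apply: eq_bigr => l _.
  by rewrite /f; case: (l != i); rewrite ?mul1r ?mul0r.
have fi2 i : intg Q (fun x => \sum_(l < n) f i l x) by exact: intg_sum.
have fi3 : intg Q (fun x => \sum_(i < n) \sum_(l < n) f i l x) by exact: intg_sum.
split; first by rewrite (funext E); exact: intgZ.
rewrite (eq_Ex _ E) ExZ// Ex_sum//.
rewrite (eq_bigr (fun i => (n%:R - 1) * Ex (F \x F)%E (fun z => q z.1 z.2))); last first.
  move=> i _; rewrite Ex_sum// (bigD1 i)//=.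
  rewrite {1}/f eqxx; under eq_Ex do rewrite mul0r.
  rewrite Ex_cst add0r (eq_bigr (fun=> Ex (F \x F)%E (fun z => q z.1 z.2))); last first.
    move=> l li; rewrite /f li; under eq_Ex do rewrite mul1r.
    by rewrite eq_sym in li; exact: (Ex_pair_tnth li).2.
  have : \sum_(l < n) Ex (F \x F)%E (fun z => q z.1 z.2) = n%:R * Ex (F \x F)%E (fun z => q z.1 z.2).
    by rewrite sumr_const card_ord mulr_natl.
  by rewrite (bigD1 i)//=; lra.
rewrite sumr_const card_ord -[(_ * _) *+ n]mulr_natl.
by field; apply/andP; split; apply/eqP; lra.
Qed.

End ustat_mean.

(** * The conditional covariance *)

Section change_of_variables.
Context (R : realType) d1 (T1 : measurableType d1) d2 (T2 : measurableType d2).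
Variables (P : probability T1 R) (P' : probability T2 R) (phi : T1 -> T2).
Hypotheses (mphi : measurable_fun setT phi)
  (PP' : forall A, measurable A -> P (phi @^-1` A) = P' A).

Lemma ge0_integral_map (f : T2 -> \bar R) : measurable_fun setT f -> (forall x, (0 <= f x)%E) ->
  (\int[P]_x f (phi x) = \int[P']_y f y)%E.
Proof.
move=> mf f0.
have := @ge0_integral_pushforward _ _ _ _ R phi mphi P setT f measurableT mf (fun y _ => f0 y).
rewrite preimage_setT => <-.
apply: eq_measure_integral => A mA _.
exact: (PP' mA).
Qed.

Lemma intg_map f : intg P' f -> intg P (fun x => f (phi x)).
Proof.
move=> If; have mf := intg_measurable If.
have ia := intg_abs If.
have mf' : measurable_fun setT (fun x => f (phi x)) by exact: (measurableT_comp mf mphi).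
have mfa : measurable_fun setT (fun y => `|f y|%:E) by apply/measurable_EFinP; exact: intg_measurable ia.
have f0 y : (0 <= `|f y|%:E)%E by rewrite lee_fin.
have h : (\int[P]_x (`|f (phi x)|)%:E <= (Ex P' (fun y => `|f y|))%:E)%E.
  by rewrite (ge0_integral_map mfa f0) (Ex_EFin ia).
have ma : measurable_fun setT (fun x => `|f (phi x)|) by exact: (measurableT_comp _ mf').
have [ia2 _] := intg_ge0 ma (fun x => normr_ge0 _) h.
exact: intg_dom mf' ia2 (fun x => lexx _).
Qed.

Lemma Ex_map f : intg P' f -> Ex P (fun x => f (phi x)) = Ex P' f.
Proof.
move=> If; have mf := intg_measurable If.
have pos (g : T2 -> R) : intg P' g -> (forall y, 0 <= g y) -> Ex P (fun x => g (phi x)) = Ex P' g.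
  move=> Ig g0; apply: (congr1 fine).
  apply: (ge0_integral_map (f := fun y => (g y)%:E)) => [|y]; last by rewrite lee_fin.
  by apply/measurable_EFinP; exact: intg_measurable Ig.
have ia := intg_abs If.
have is' := intgD ia If.
have e y : f y = (`|f y| + f y) - `|f y| by lra.
rewrite (eq_Ex _ (fun x => e (phi x))) [RHS](eq_Ex _ e).
rewrite (ExB (intg_map is') (intg_map ia)) (ExB is' ia) (pos _ ia)// (pos _ is')// => y.
by have := ler_norm (- f y); rewrite normrN; lra.
Qed.

End change_of_variables.

Section triple_marginals.
Context (R : realType) d (T : measurableType d) (F : probability T R).
Local Notation P2 := (F \x F : probability _ _)%E.
Local Notation P3 := (P2 \x F : probability _ _)%E.

Lemma triple_12 A : measurable A -> P3 ((fun z : T * T * T => z.1) @^-1` A) = P2 A.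
Proof.
move=> mA; rewrite (_ : _ @^-1` A = A `*` setT); last by apply/seteqP; split => z //= [].
transitivity ((P2 A * F setT)%E); first exact: product_measure1E.
by rewrite [X in (_ * X)%E]probability_setT mule1.
Qed.

Let phi (z : T * T * T) : T * T := (z.1.1, z.2).
Let mphi : measurable_fun setT phi.
Proof.
apply/measurable_fun_pair => //=.
exact: (measurableT_comp measurable_fst).
Qed.

Lemma triple_13 A : measurable A -> P3 (phi @^-1` A) = P2 A.
Proof.
move=> mA; apply/esym.
apply: (@product_measure_unique _ _ _ _ _ F F (pushforward P3 phi)) => // A0 B mA0 mB.
transitivity (P3 ((A0 `*` setT) `*` B)).
  by congr (P3 _); apply/seteqP; split => z /=; rewrite /phi /= => -[] // [].
transitivity ((P2 (A0 `*` setT) * F B)%E).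
  by apply: product_measure1E => //; exact: measurableX.
congr (_ * _)%E; transitivity ((F A0 * F setT)%E); first exact: product_measure1E.
by rewrite [X in (_ * X)%E]probability_setT mule1.
Qed.

Lemma Ex_triple12 (f : T * T -> R) : intg P2 f ->
  intg P3 (fun z => f z.1) /\ Ex P3 (fun z => f z.1) = Ex P2 f.
Proof.
move=> If; split; first exact: (intg_map (P := P3) measurable_fst triple_12 If).
exact: (Ex_map (P := P3) measurable_fst triple_12 If).
Qed.

Lemma Ex_triple13 (f : T * T -> R) : intg P2 f ->
  intg P3 (fun z => f (z.1.1, z.2)) /\ Ex P3 (fun z => f (z.1.1, z.2)) = Ex P2 f.
Proof.
move=> If; split; first exact: (intg_map (P := P3) mphi triple_13 If).
exact: (Ex_map (P := P3) mphi triple_13 If).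
Qed.

End triple_marginals.

Lemma pr_exists d (T : measurableType d) (R : realType) (P : probability T R) (J : finType) (A : J -> set T) :
  (forall j, measurable (A j)) -> measurable [set x | exists j, A j x] /\
  pr P [set x | exists j, A j x] <= \sum_j pr P (A j).
Proof.
move=> mA.
pose f x : R := \sum_j (\1_(A j) x : R).
have If : intg P f by apply: intg_sum => j; exact: intg_indic.
have E x : (exists j, A j x) <-> 1 <= f x.
  split=> [[j jx]|h].
    rewrite /f (bigD1 j)//= indicE mem_set// lerDl.
    by apply: sumr_ge0 => k _; rewrite indicE.
  apply: contrapT => nx; move: h; rewrite /f big1 ?ler10// => j _.
  by rewrite indicE memNset// => jx; apply: nx; exists j.
have mS : measurable [set x | exists j, A j x].
  rewrite (_ : [set x | _] = [set x | - f x <= - 1]); last first.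
    by apply/seteqP; split => x /=; rewrite lerN2 => /E.
  by apply: measurable_set_le; apply: measurable_funN; exact: intg_measurable If.
split => //.
apply: le_trans (markov_le If _ mS ltr01 _) _.
- by move=> x; apply: sumr_ge0 => k _; rewrite indicE.
- by move=> x /E.
rewrite divr1 /f Ex_sum; last by move=> j; exact: intg_indic.
by apply: ler_sum => j _; rewrite -pr_Ex.
Qed.

(** * Truncation of the kernel *)

Section truncation.
Context (R : realType) (T : Type) (J : finType) (h : T -> T -> J -> R).

Definition tailsq (c : R) (a b : T) : R := supn (h a b) ^+ 2 * (c < supn (h a b))%R%:R.

(** Cut by the sup norm, jointly in all coordinates, so one tail quantity [tailsq] controls every
    entry of the covariance at once. *)
Definition trunc (c : R) (a b : T) (j : J) : R := h a b j * (supn (h a b) <= c)%R%:R.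

Lemma tailsq_ge0 c a b : 0 <= tailsq c a b.
Proof. by rewrite mulr_ge0// sqr_ge0. Qed.

Lemma tailsq_antimono c c' a b : c <= c' -> tailsq c' a b <= tailsq c a b.
Proof.
move=> cc; rewrite /tailsq ler_wpM2l ?sqr_ge0// ler_nat.
by case: (ltP c' _) => // h1; rewrite (le_lt_trans cc h1).
Qed.

Lemma supn_sqr_le c a b : 0 <= c -> supn (h a b) ^+ 2 <= c ^+ 2 + tailsq c a b.
Proof.
move=> c0; rewrite /tailsq; case: ltP => h1; first by rewrite mulr1 lerDr sqr_ge0.
by rewrite mulr0 addr0 lerXn2r ?nnegrE ?supn_ge0.
Qed.

Lemma trunc_le c a b j : 0 <= c -> `|trunc c a b j| <= c.
Proof.
move=> c0; rewrite /trunc normrM normr_nat; case: (leP (supn (h a b)) c) => h1; last by rewrite mulr0.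
by rewrite mulr1; exact: le_trans (le_supn _ _) h1.
Qed.

Lemma trunc_dist c a b j : 0 < c -> `|h a b j - trunc c a b j| <= c^-1 * tailsq c a b.
Proof.
move=> c0; rewrite /trunc /tailsq; case: leP => h1.
  by rewrite mulr1 subrr normr0 mulr0 mulr0.
rewrite mulr0 subr0 mulr1; apply: le_trans (le_supn _ j) _.
by rewrite ler_pdivlMl// expr2 ler_wpM2r ?supn_ge0// ltW.
Qed.

(** If only one factor is cut, the other has sup norm at most [c] and hence below it, so the product
    is bounded by a single squared sup norm beyond [c]. *)
Lemma trunc_prod_dist c a b b' j k :
  `|h a b j * h a b' k - trunc c a b j * trunc c a b' k| <= 2 * tailsq c a b + 2 * tailsq c a b'.
Proof.
have h1 := le_supn (h a b) j; have h2 := le_supn (h a b') k.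
have s1 := supn_ge0 (h a b); have s2 := supn_ge0 (h a b').
have hp : `|h a b j * h a b' k| <= supn (h a b) * supn (h a b') by rewrite normrM ler_pM.
rewrite /trunc /tailsq.
case: leP => c1; case: leP => c2; rewrite ?mulr1 ?mulr0 ?subrr ?normr0 ?addr0 ?add0r ?subr0 ?mul0r ?subr0//.
- apply: le_trans hp _; nra.
- apply: le_trans hp _; nra.
- apply: le_trans hp _; nra.
Qed.

End truncation.

(** * The exceptional event for the covariance *)

Section covariance_event.
Context (R : realType) d (T : measurableType d) (n : nat) (J : finType).
Variables (F : probability T R) (Q : probability (n.-tuple T) R).
Hypotheses (FQ : prodlike F Q) (n3 : (3 <= n)%N).
Local Notation P2 := (F \x F : probability _ _)%E.
Local Notation P3 := (P2 \x F : probability _ _)%E.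
Variables (h : T -> T -> J -> R) (B : R).
Hypothesis mh : forall j, measurable_fun setT (fun z : T * T => h z.1 z.2 j).
Hypothesis ih2 : intg P2 (fun z => supn (h z.1 z.2) ^+ 2).
Hypothesis ih4 : forall j, intg P2 (fun z => h z.1 z.2 j ^+ 4).
Hypothesis h4 : forall j, Ex P2 (fun z => h z.1 z.2 j ^+ 4) <= B ^+ 2.
Hypothesis B1 : 1 <= B.
Hypothesis hmean : forall j, Ex P2 (fun z => h z.1 z.2 j) = 0.
Let cov j k := Ex P3 (fun z => h z.1.1 z.1.2 j * h z.1.1 z.2 k).
Hypothesis cov1 : forall j k, `|cov j k| <= 1.
Variables (t t2 r u tau s s2 eps : R).
Hypotheses (t0 : 0 < t) (t20 : 0 < t2) (r0 : 0 < r) (u0 : 0 < u) (tau0 : 0 < tau).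
Hypotheses (s0 : 0 <= s) (s20 : 0 <= s2).
Hypotheses (sM : 8 * (s * tau ^+ 2) <= 1) (sv : 2 * (s * (2 * B ^+ 2)) <= t).
Hypotheses (s2M : 8 * (s2 * tau) <= 1) (s2v : 2 * (s2 * (2 * B ^+ 2)) <= t2).
Hypothesis eps_le : Ex P2 (fun z => tailsq h tau z.1 z.2) <= eps.

Let mhx i j : measurable_fun setT (fun z : T * T * T => h z.1.1 z.1.2 j) /\
  measurable_fun setT (fun z : T * T * T => h z.1.1 z.2 (i : J)).
Proof.
split; first exact: (measurableT_comp (mh j)).
apply: (@measurableT_comp _ _ _ _ _ _ (fun z : T * T => h z.1 z.2 i) _ (fun z : T * T * T => (z.1.1, z.2))); first exact: mh.
by apply/measurable_fun_pair => //=; exact: (measurableT_comp measurable_fst).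
Qed.

Let msup : measurable_fun setT (fun z : T * T => supn (h z.1 z.2)).
Proof. exact: measurable_supn. Qed.

Let mtail c : measurable_fun setT (fun z : T * T => tailsq h c z.1 z.2).
Proof.
apply: measurable_funM; first exact: measurable_funX.
exact: measurable_fun_indic_gt.
Qed.

Let itail c : intg P2 (fun z => tailsq h c z.1 z.2).
Proof.
apply: (intg_dom (mtail c) ih2) => z; rewrite ger0_norm ?tailsq_ge0//.
by rewrite /tailsq; case: (c < _)%R; rewrite ?mulr1// mulr0 sqr_ge0.
Qed.

Let mtr c j : measurable_fun setT (fun z : T * T => trunc h c z.1 z.2 j).
Proof.
apply: measurable_funM => //.
rewrite (_ : (fun z => _) = (fun z : T * T => 1 - (c < supn (h z.1 z.2))%R%:R : R)); last first.
  by apply/funext => z; case: leP; rewrite ?subr0 ?subrr.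
by apply: measurable_funB => //; exact: measurable_fun_indic_gt.
Qed.

Let mtrx j k : measurable_fun setT (fun z : T * T * T => trunc h tau z.1.1 z.1.2 j) /\
  measurable_fun setT (fun z : T * T * T => trunc h tau z.1.1 z.2 (k : J)).
Proof.
split; first exact: (measurableT_comp (mtr tau j)).
apply: (@measurableT_comp _ _ _ _ _ _ (fun z : T * T => trunc h tau z.1 z.2 k) _ (fun z : T * T * T => (z.1.1, z.2))); first exact: mtr.
by apply/measurable_fun_pair => //=; exact: (measurableT_comp measurable_fst).
Qed.

Let kk j k (a b c : T) := trunc h tau a b j * trunc h tau a c k.
Let ll j (a b c : T) := trunc h tau a b j.

Let mkk j k : measurable_fun setT (fun z : T * T * T => kk j k z.1.1 z.1.2 z.2).
Proof. by have [? ?] := mtrx j k; exact: measurable_funM. Qed.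

Let mll j : measurable_fun setT (fun z : T * T * T => ll j z.1.1 z.1.2 z.2).
Proof. exact: (mtrx j j).1. Qed.

Let kkM j k a b c : `|kk j k a b c| <= tau ^+ 2.
Proof. by rewrite /kk normrM expr2 ler_pM// trunc_le// ltW. Qed.

Let llM j a b c : `|ll j a b c| <= tau.
Proof. by rewrite trunc_le// ltW. Qed.

Let tr_le a b j : `|trunc h tau a b j| <= `|h a b j|.
Proof.
by rewrite /trunc normrM normr_nat; case: (_ <= tau)%R; rewrite ?mulr1// mulr0.
Qed.

Let B2 : B ^+ 2 <= 2 * B ^+ 2 /\ 1 + B ^+ 2 <= 2 * B ^+ 2.
Proof. by move: B1 => B1'; split; nra. Qed.

Let kkv j k : Ex P3 (fun z => kk j k z.1.1 z.1.2 z.2 ^+ 2) <= 2 * B ^+ 2.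
Proof.
apply: le_trans (_ : B ^+ 2 <= _); last exact: B2.1.
have [i1 e1] := Ex_triple12 (ih4 j); have [i2 e2] := Ex_triple13 (ih4 k).
rewrite /= in i1 e1 i2 e2.
have i3 := intgZ 2^-1 (intgD i1 i2).
have ik : intg P3 (fun z => kk j k z.1.1 z.1.2 z.2 ^+ 2).
  apply: (@intg_bounded _ _ _ _ _ ((tau ^+ 2) ^+ 2)); first exact: measurable_funX.
  by move=> z; rewrite normrX lerXn2r ?nnegrE ?exprn_ge0// ltW.
apply: le_trans (Ex_le ik i3 _) _; last first.
  rewrite (ExZ _ (intgD i1 i2)) (ExD i1 i2) e1 e2.
  by have := h4 j; have := h4 k; lra.
move=> z.
have hj := tr_le z.1.1 z.1.2 j; have hk := tr_le z.1.1 z.2 k.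
have aj := normr_ge0 (trunc h tau z.1.1 z.1.2 j); have ak := normr_ge0 (trunc h tau z.1.1 z.2 k).
apply: le_trans (_ : `|h z.1.1 z.1.2 j| ^+ 2 * `|h z.1.1 z.2 k| ^+ 2 <= _).
  rewrite -(real_normK (num_real (kk j k _ _ _))) /kk normrM exprMn.
  by rewrite ler_pM ?sqr_ge0// lerXn2r ?nnegrE.
rewrite !real_normK ?num_real// -[4%N]/(2 * 2)%N !exprM.
by have := sqr_ge0 (h z.1.1 z.1.2 j ^+ 2 - h z.1.1 z.2 k ^+ 2); nra.
Qed.

Let llv j : Ex P3 (fun z => ll j z.1.1 z.1.2 z.2 ^+ 2) <= 2 * B ^+ 2.
Proof.
apply: le_trans B2.2.
have [i1 e1] := Ex_triple12 (ih4 j); rewrite /= in i1 e1.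
have ik : intg P3 (fun z => ll j z.1.1 z.1.2 z.2 ^+ 2).
  apply: (@intg_bounded _ _ _ _ _ (tau ^+ 2)); first exact: measurable_funX.
  by move=> z; rewrite normrX lerXn2r ?nnegrE ?(ltW tau0).
apply: le_trans (Ex_le ik (intgD (intg_cst P3 1) i1) _) _; last first.
  by rewrite (ExD (intg_cst P3 1) i1) Ex_cst e1 lerD2l.
move=> z; have hj := tr_le z.1.1 z.1.2 j.
apply: le_trans (_ : `|h z.1.1 z.1.2 j| ^+ 2 <= _).
  by rewrite -(real_normK (num_real (ll j _ _ _))) lerXn2r ?nnegrE.
rewrite real_normK ?num_real// -[4%N]/(2 * 2)%N exprM.
by have := sqr_ge0 (h z.1.1 z.1.2 j ^+ 2 - 1); nra.
Qed.

Let mean_kk j k : `|cov j k - Ex P3 (fun z => kk j k z.1.1 z.1.2 z.2)| <= 4 * eps.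
Proof.
have [i1 e1] := Ex_triple12 (itail tau); have [i2 e2] := Ex_triple13 (itail tau).
rewrite /= in i1 e1 i2 e2.
have [j1 _] := Ex_triple12 ih2; have [j2 _] := Ex_triple13 ih2.
rewrite /= in j1 j2.
have [mj mk] := mhx k j.
have ic : intg P3 (fun z => h z.1.1 z.1.2 j * h z.1.1 z.2 k).
  apply: (intg_dom _ (intgD j1 j2)) => [|z]; first exact: measurable_funM.
  have a1 := le_supn (h z.1.1 z.1.2) j; have a2 := le_supn (h z.1.1 z.2) k.
  have b1 := normr_ge0 (h z.1.1 z.1.2 j); have b2 := normr_ge0 (h z.1.1 z.2 k).
  rewrite normrM; apply: le_trans (ler_pM b1 b2 a1 a2) _.
  have := supn_ge0 (h z.1.1 z.1.2); have := supn_ge0 (h z.1.1 z.2); nra.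
have ik : intg P3 (fun z => kk j k z.1.1 z.1.2 z.2).
  exact: (intg_bounded _ (mkk j k) (fun z => kkM _ _ _ _ _)).
rewrite -(ExB ic ik).
have ib := intgD (intgZ 2 i1) (intgZ 2 i2).
apply: le_trans (Ex_abs_le (intgB ic ik) ib (fun z => trunc_prod_dist _ _ _ _ _ _ _)) _.
rewrite (ExD (intgZ 2 i1) (intgZ 2 i2)) (ExZ _ i1) (ExZ _ i2) e1 e2.
by move: eps_le; lra.
Qed.

Let ih1 j : intg P2 (fun z => h z.1 z.2 j).
Proof.
apply: (intg_dom (mh j) (intgD (intg_cst P2 1) ih2)) => z.
apply: le_trans (le_supn _ j) _; set w := supn _; nra.
Qed.

Let mean_ll j : `|Ex P3 (fun z => ll j z.1.1 z.1.2 z.2)| <= tau^-1 * eps.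
Proof.
have ib : intg P2 (fun z => trunc h tau z.1 z.2 j).
  exact: (intg_bounded _ (mtr tau j) (fun z => trunc_le _ _ _ _ (ltW tau0))).
have [i1 e1] := Ex_triple12 ib; rewrite /= in i1 e1.
rewrite [Ex _ _]e1 -[X in `|X|]opprK normrN -[X in `|X|]add0r -(hmean j) -(ExB (ih1 j) ib).
apply: le_trans (Ex_abs_le (intgB (ih1 j) ib) (intgZ tau^-1 (itail tau)) (fun z => trunc_dist _ _ _ _ tau0)) _.
by rewrite (ExZ _ (itail tau)) ler_pM2l// invr_gt0.
Qed.

(** Four ways to fail: the truncated covariance kernels, the truncated means, and the tail averages
    at the levels [u] and [tau]. A union bound with Bernstein handles the first two, Markov the last
    two. *)
Definition cov_bad : set (n.-tuple T) :=
  [set x | exists p : J * J, t <= `|ustat3 (kk p.1 p.2) x - Ex P3 (fun z => kk p.1 p.2 z.1.1 z.1.2 z.2)|] `|`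
  [set x | exists j, t2 <= `|ustat3 (ll j) x - Ex P3 (fun z => ll j z.1.1 z.1.2 z.2)|] `|`
  ([set x | u ^+ 2 < ustat2 (tailsq h u) x] `|` [set x | r < ustat2 (tailsq h tau) x]).

Let N := (n %/ 3)%N.

Let mge (g : T -> T -> T -> R) c e : measurable_fun setT (fun z : T * T * T => g z.1.1 z.1.2 z.2) ->
  measurable [set x : n.-tuple T | c <= `|ustat3 g x - e|].
Proof.
move=> mg; rewrite (_ : [set x | _] = [set x | - `|ustat3 g x - e| <= - c]); last first.
  by apply/seteqP; split => x /=; rewrite lerN2.
apply: measurable_set_le; apply: measurable_funN; apply: measurableT_comp => //.
by apply: measurable_funB => //; exact: measurable_ustat3.
Qed.

Lemma measurable_cov_bad : measurable cov_bad.
Proof.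
apply: measurableU; apply: measurableU.
- by apply: (pr_exists Q (A := fun p : J * J => [set x | t <= `|ustat3 (kk p.1 p.2) x - Ex P3 (fun z => kk p.1 p.2 z.1.1 z.1.2 z.2)|]) _).1 => p; exact: mge.
- by apply: (pr_exists Q (A := fun j => [set x | t2 <= `|ustat3 (ll j) x - Ex P3 (fun z => ll j z.1.1 z.1.2 z.2)|]) _).1 => j; exact: mge.
- by apply: measurable_set_gt; exact: measurable_ustat2.
- by apply: measurable_set_gt; exact: measurable_ustat2.
Qed.

Lemma pr_cov_bad : pr Q cov_bad <=
  #|J|%:R ^+ 2 * (2 * expR (- (s * N%:R * t / 2))) + #|J|%:R * (2 * expR (- (s2 * N%:R * t2 / 2))) +
  (Ex P2 (fun z => tailsq h u z.1 z.2) / u ^+ 2 + eps / r).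
Proof.
have [m1 p1] := pr_exists Q (A := fun p : J * J => [set x | t <= `|ustat3 (kk p.1 p.2) x - Ex P3 (fun z => kk p.1 p.2 z.1.1 z.1.2 z.2)|]) (fun p => mge _ _ (mkk _ _)).
have [m2 p2] := pr_exists Q (A := fun j => [set x | t2 <= `|ustat3 (ll j) x - Ex P3 (fun z => ll j z.1.1 z.1.2 z.2)|]) (fun j => mge _ _ (mll _)).
have mt c := measurable_ustat2 (n := n) (mtail c).
have m3 : measurable [set x : n.-tuple T | u ^+ 2 < ustat2 (tailsq h u) x] by exact: measurable_set_gt.
have m4 : measurable [set x : n.-tuple T | r < ustat2 (tailsq h tau) x] by exact: measurable_set_gt.
have tp c := Ex_ustat2 FQ n3 (mtail c) (tailsq_ge0 h c) (itail c).
apply: le_trans (pr_setU _ (measurableU _ _ m1 m2) (measurableU _ _ m3 m4)) _.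
apply: lerD.
  apply: le_trans (pr_setU _ m1 m2) _; apply: lerD.
    apply: le_trans p1 _.
    apply: le_trans (_ : \sum_(p : J * J) 2 * expR (- (s * N%:R * t / 2)) <= _).
      apply: ler_sum => p _.
      exact: (ustat3_tail FQ n3 (mkk p.1 p.2) (kkM p.1 p.2) (kkv p.1 p.2) s0 sM sv).
    by rewrite sumr_const -[X in X <= _]mulr_natl card_prod natrM expr2.
  apply: le_trans p2 _.
  apply: le_trans (_ : \sum_(j : J) 2 * expR (- (s2 * N%:R * t2 / 2)) <= _).
    apply: ler_sum => j _.
    exact: (ustat3_tail FQ n3 (mll j) (llM j) (llv j) s20 s2M s2v).
  by rewrite sumr_const -[X in X <= _]mulr_natl.
apply: le_trans (pr_setU _ m3 m4) _; apply: lerD.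
  rewrite -(tp u).2; apply: (markov_le (tp u).1 _ m3) => [x||x /= /ltW//]; last by rewrite exprn_gt0.
  by apply: ustat2_ge0 => // a b; exact: tailsq_ge0.
apply: le_trans (_ : Ex Q (ustat2 (tailsq h tau)) / r <= _); last first.
  by rewrite (tp tau).2 ler_pM2r ?invr_gt0.
apply: (markov_le (tp tau).1 _ m4) => [x||x /= /ltW//] //.
by apply: ustat2_ge0 => // a b; exact: tailsq_ge0.
Qed.

(** Serves twice: for the coinciding indices in [sum_acoef], and later for the size of the Gaussian
    chaos. *)
Lemma cov_good_sup x : ~ cov_bad x -> ustat2 (fun a b => supn (h a b) ^+ 2) x <= 2 * u ^+ 2.
Proof.
move=> nb; have hu : ustat2 (tailsq h u) x <= u ^+ 2.
  by rewrite leNgt; apply/negP => hx; apply: nb; right; left.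
apply: le_trans (ustat2_le n3 x (fun a b => supn_sqr_le _ _ _ (ltW u0))) _.
by rewrite ustat2D// ustat2_cst//; lra.
Qed.

(** Truncation costs [4 r] in the sample and [4 eps] in the mean, deviation costs [t], coinciding
    indices cost the term over [n - 1], and the square bounds the product of two U-statistics with
    mean zero. *)
Lemma cov_good x j k : ~ cov_bad x ->
  `|\sum_i acoef h x i j * acoef h x i k - cov j k| <=
  4 * r + t + 4 * eps + (1 + 2 * u ^+ 2) / (n%:R - 1) + (r / tau + t2 + eps / tau) ^+ 2.
Proof.
move=> nb.
have n3R : 3 <= n%:R :> R by rewrite ler_nat.
have hr : ustat2 (tailsq h tau) x <= r.
  by rewrite leNgt; apply/negP => hx; apply: nb; right; right.
have ht : `|ustat3 (kk j k) x - Ex P3 (fun z => kk j k z.1.1 z.1.2 z.2)| <= t.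
  by rewrite leNgt; apply/negP => hx; apply: nb; left; left; exists (j, k); exact: ltW.
have ht2 i : `|ustat3 (ll i) x - Ex P3 (fun z => ll i z.1.1 z.1.2 z.2)| <= t2.
  by rewrite leNgt; apply/negP => hx; apply: nb; left; right; exists i; exact: ltW.
have hs := cov_good_sup nb.
set U3 := ustat3 (fun a b c => h a b j * h a c k) x.
have d3 : `|U3 - cov j k| <= 4 * r + t + 4 * eps.
  have a1 : `|U3 - ustat3 (kk j k) x| <= 4 * r.
    apply: le_trans (ustat3_dist n3 x (q := fun a b => 2 * tailsq h tau a b) (fun a b c => trunc_prod_dist _ _ _ _ _ _ _)) _.
    by rewrite ustat2Z; lra.
  have a2 := mean_kk j k.
  move: a1 ht a2; rewrite !ler_norml; move: (ustat3 (kk j k) x) (Ex P3 _) (cov j k) => v1 v2 v3.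
  by move=> /andP[? ?] /andP[? ?] /andP[? ?]; apply/andP; split; lra.
have dU i : `|Ustat h x i| <= r / tau + t2 + eps / tau.
  have a1 : `|Ustat h x i - ustat3 (ll i) x| <= r / tau.
    rewrite /Ustat -(ustat3_12 n3) -ustat3B.
    apply: le_trans (ustat3_norm n3 x (g2 := fun a b _ => tau^-1 * tailsq h tau a b) (fun a b c => trunc_dist _ _ _ _ tau0)) _.
    by rewrite ustat3_12// ustat2Z mulrC ler_pM2r ?invr_gt0.
  have a2 := mean_ll i; have a3 := ht2 i; rewrite mulrC in a2.
  move: a1 a2 a3; rewrite !ler_norml; move: (ustat3 (ll i) x) (Ex P3 _) (Ustat h x i) => v1 v2 v3.
  by move=> /andP[? ?] /andP[? ?] /andP[? ?]; apply/andP; split; lra.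
have dd : `|ustat2 (fun a b => h a b j * h a b k) x| <= 2 * u ^+ 2.
  apply: le_trans hs; apply: ustat2_norm => // a b.
  by rewrite normrM expr2 ler_pM// le_supn.
rewrite sum_acoef// -/U3.
have dUU : `|Ustat h x j * Ustat h x k| <= (r / tau + t2 + eps / tau) ^+ 2.
  by rewrite normrM expr2 ler_pM.
set D := ustat2 _ x in dd *; set UU := _ * Ustat h x k in dUU *.
have n1 : 0 < (n%:R - 1)^-1 :> R by rewrite invr_gt0; lra.
have n11 : (n%:R - 1)^-1 <= 1 :> R by rewrite invf_le1; lra.
(* As [(n - 2) / (n - 1) = 1 - 1 / (n - 1)], the part of the covariance missing from the first term
   is charged to the diagonal one. *)
rewrite (_ : _ / _ * U3 + _ - UU - cov j k = (1 - (n%:R - 1)^-1) * (U3 - cov j k) + ((n%:R - 1)^-1 * (D - cov j k) - UU)); last first.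
  by field; apply/eqP; lra.
apply: le_trans (ler_normD _ _) _.
have b1 : `|(1 - (n%:R - 1)^-1) * (U3 - cov j k)| <= 4 * r + t + 4 * eps.
  apply: le_trans d3; rewrite normrM ger0_norm; last by rewrite subr_ge0.
  by rewrite ler_piMl//; lra.
have b2 : `|(n%:R - 1)^-1 * (D - cov j k) - UU| <= (1 + 2 * u ^+ 2) / (n%:R - 1) + (r / tau + t2 + eps / tau) ^+ 2.
  apply: le_trans (ler_normB _ _) _; apply: lerD => //.
  rewrite normrM gtr0_norm// mulrC ler_pM2r//.
  apply: le_trans (ler_normB _ _) _; have := cov1 j k; lra.
by rewrite -addrA; exact: lerD.
Qed.

End covariance_event.

(** * Hoeffding decomposition and degenerate parts *)

Section iterated_expectation.
Context (R : realType) d1 (T1 : measurableType d1) d2 (T2 : measurableType d2).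
Variables (P1 : probability T1 R) (P2 : probability T2 R).

Lemma Ex_iter_ge0 (f : T1 -> T2 -> R) : measurable_fun setT (fun z : T1 * T2 => f z.1 z.2) ->
  (forall x y, 0 <= f x y) -> intg (P1 \x P2)%E (fun z => f z.1 z.2) -> (forall x, intg P2 (f x)) ->
  intg P1 (fun x => Ex P2 (f x)) /\ Ex P1 (fun x => Ex P2 (f x)) = Ex (P1 \x P2)%E (fun z => f z.1 z.2).
Proof.
move=> mf f0 If If2.
have mE : measurable_fun setT (fun z : T1 * T2 => (f z.1 z.2)%:E) by exact/measurable_EFinP.
have E0 (z : T1 * T2) : (0 <= (f z.1 z.2)%:E)%E by rewrite lee_fin.
have mI : measurable_fun setT (fun x => Ex P2 (f x)).
  apply: (@measurableT_comp _ _ _ _ _ _ fine); first exact: (fine_measurable measurableT).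
  exact: (@measurable_fun_fubini_tonelli_F _ _ _ _ _ P2 _ mE).
have e : (\int[P1]_x (Ex P2 (f x))%:E = \int[(P1 \x P2)%E]_z (f z.1 z.2)%:E)%E.
  rewrite (@fubini_tonelli1 _ _ _ _ _ P1 P2 _ mE E0); apply: eq_integral => x _.
  by rewrite -(Ex_EFin (If2 x)).
split; last by apply: (congr1 fine).
have h : (\int[P1]_x (Ex P2 (f x))%:E <= (Ex (P1 \x P2)%E (fun z => f z.1 z.2))%:E)%E.
  by rewrite e (Ex_EFin If).
exact: (intg_ge0 mI (fun x => Ex_ge0 _ (f0 x)) h).1.
Qed.

(** Reduced to nonnegative functions by writing [f] as [(|f| + f) - |f|]. *)
Lemma Ex_iter (f : T1 -> T2 -> R) : measurable_fun setT (fun z : T1 * T2 => f z.1 z.2) ->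
  intg (P1 \x P2)%E (fun z => f z.1 z.2) -> (forall x, intg P2 (f x)) ->
  intg P1 (fun x => Ex P2 (f x)) /\ Ex P1 (fun x => Ex P2 (f x)) = Ex (P1 \x P2)%E (fun z => f z.1 z.2).
Proof.
move=> mf If If2.
have ia := intg_abs If; have ia2 x := intg_abs (If2 x).
have is' := intgD ia If; have is2 x := intgD (ia2 x) (If2 x).
have ma : measurable_fun setT (fun z : T1 * T2 => `|f z.1 z.2|) by exact: measurableT_comp.
have ms : measurable_fun setT (fun z : T1 * T2 => `|f z.1 z.2| + f z.1 z.2) by exact: measurable_funD.
have s0 x y : 0 <= `|f x y| + f x y.
  by have := ler_norm (- f x y); rewrite normrN; lra.
have [j1 e1] := Ex_iter_ge0 (f := fun x y => `|f x y|) ma (fun x y => normr_ge0 _) ia ia2.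
have [j2 e2] := Ex_iter_ge0 (f := fun x y => `|f x y| + f x y) ms s0 is' is2.
have E x : Ex P2 (f x) = Ex P2 (fun y => `|f x y| + f x y) - Ex P2 (fun y => `|f x y|).
  by rewrite (ExD (ia2 x) (If2 x)) addrAC subrr add0r.
rewrite (funext E); split; first exact: intgB.
by rewrite (ExB j2 j1) e1 e2 (ExD ia If) addrAC subrr add0r.
Qed.

End iterated_expectation.

(** Jensen for the cube from the tangent at [c]: the difference is [(y - c)^2 (y + 2 c)]. *)
Lemma Ex_cube_le d (T : measurableType d) (R : realType) (P : probability T R) (f : T -> R) :
  intg P f -> intg P (fun x => `|f x| ^+ 3) -> `|Ex P f| ^+ 3 <= Ex P (fun x => `|f x| ^+ 3).
Proof.
move=> If I3; have ia := intg_abs If.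
set c := `|Ex P f|; have c0 : 0 <= c by exact: normr_ge0.
have h x : 3 * c ^+ 2 * `|f x| - 2 * c ^+ 3 <= `|f x| ^+ 3.
  have := normr_ge0 (f x); move: `|f x| => y y0.
  have : 0 <= (y - c) ^+ 2 * (y + 2 * c) by rewrite mulr_ge0 ?sqr_ge0//; lra.
  lra.
have i1 := intgB (intgZ (3 * c ^+ 2) ia) (intg_cst P (2 * c ^+ 3)).
have := Ex_le i1 I3 h.
rewrite (ExB (intgZ (3 * c ^+ 2) ia) (intg_cst P (2 * c ^+ 3))) (ExZ _ ia) Ex_cst.
apply: le_trans.
have : 3 * c ^+ 2 * c <= 3 * c ^+ 2 * Ex P (fun x => `|f x|).
  by rewrite ler_wpM2l ?mulr_ge0 ?sqr_ge0//; exact: Ex_abs.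
lra.
Qed.

Lemma supn_scaleE (R : realType) (J : finType) (c : R) (y : J -> R) : 0 < c ->
  supn (fun j => c * y j) = c * supn y.
Proof.
move=> c0; apply/le_anti/andP; split.
  by apply: le_trans (supn_scale _ _) _; rewrite gtr0_norm.
rewrite -ler_pdivlMl//.
have := supn_scale c^-1 (fun j => c * y j).
rewrite ger0_norm ?invr_ge0 ?(ltW c0)//; apply: le_trans.
rewrite (_ : (fun j => c^-1 * (c * y j)) = y)//.
by apply/funext => j; rewrite mulrA mulVf ?mul1r// gt_eqF.
Qed.

Lemma expR1_le4 (R : realType) : expR 1 <= 4 :> R.
Proof.
have h : expR 2^-1 <= 2 :> R.
  apply: le_trans (expR_le1D2x _) _; last lra.
  by apply/andP; split; lra.
have -> : expR 1 = expR 2^-1 * expR 2^-1 :> R by rewrite -expRD; congr expR; field.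
have := @expR_gt0 R 2^-1; move: (expR 2^-1) h => u *; nra.
Qed.

(** * The projection of the kernel onto one argument *)

Section projection.
Context (R : realType) d (T : measurableType d) (J : finType).
Variable F : probability T R.
Local Notation P2 := (F \x F : probability _ _)%E.
Local Notation P3 := (P2 \x F : probability _ _)%E.
Variable h : T -> T -> J -> R.
Hypothesis mh : forall j, measurable_fun setT (fun z : T * T => h z.1 z.2 j).
Hypothesis hsym : forall x y, h x y = h y x.
Hypothesis ih4x : forall x, intg F (fun y => supn (h x y) ^+ 4).
Hypothesis ih4 : intg P2 (fun z => supn (h z.1 z.2) ^+ 4).

Lemma measurable_hx x j : measurable_fun setT (fun y => h x y j).
Proof.
apply: (@measurableT_comp _ _ _ _ _ _ (fun z : T * T => h z.1 z.2 j) _ (fun y => (x, y))) => //.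
exact: pair1_measurable.
Qed.

Let pow4 (s : R) k : (k <= 4)%N -> 0 <= s -> s ^+ k <= 1 + s ^+ 4.
Proof.
move=> k4 s0; have [s1|s1] := leP s 1.
  by rewrite ler_wpDr ?exprn_ge0// exprn_ile1.
by apply: ler_wpDl => //; apply: ler_weXn2l => //; exact: ltW.
Qed.

Lemma h_intg_pow x k : (k <= 4)%N -> intg F (fun y => supn (h x y) ^+ k).
Proof.
move=> k4; apply: (intg_dom _ (intgD (intg_cst F 1) (ih4x x))) => [|y].
  by apply: measurable_funX; apply: measurable_supn => j; exact: measurable_hx.
by rewrite ger0_norm ?exprn_ge0 ?supn_ge0// pow4// supn_ge0.
Qed.

Lemma h_intg2_pow k : (k <= 4)%N -> intg P2 (fun z => supn (h z.1 z.2) ^+ k).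
Proof.
move=> k4; apply: (intg_dom _ (intgD (intg_cst P2 1) ih4)) => [|y].
  by apply: measurable_funX; apply: measurable_supn => j; exact: mh.
by rewrite ger0_norm ?exprn_ge0 ?supn_ge0// pow4// supn_ge0.
Qed.

Lemma h_intg x j : intg F (fun y => h x y j).
Proof.
apply: (intg_dom (measurable_hx x j) (h_intg_pow x (isT : (1 <= 4)%N))) => y.
exact: le_supn.
Qed.

Lemma h_intg2 j : intg P2 (fun z => h z.1 z.2 j).
Proof.
apply: (intg_dom (mh j) (h_intg2_pow (isT : (1 <= 4)%N))) => y.
exact: le_supn.
Qed.

Lemma h_intg_abs x j k : (k <= 4)%N -> intg F (fun y => `|h x y j| ^+ k).
Proof.
move=> k4; apply: (intg_dom _ (h_intg_pow x k4)) => [|y].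
  by apply: measurable_funX; apply: measurableT_comp => //; exact: measurable_hx.
by rewrite ger0_norm ?exprn_ge0// lerXn2r ?nnegrE ?supn_ge0// le_supn.
Qed.

Lemma h_intg2_abs j k : (k <= 4)%N -> intg P2 (fun z => `|h z.1 z.2 j| ^+ k).
Proof.
move=> k4; apply: (intg_dom _ (h_intg2_pow k4)) => [|y].
  by apply: measurable_funX; apply: measurableT_comp => //; exact: mh.
by rewrite ger0_norm ?exprn_ge0// lerXn2r ?nnegrE ?supn_ge0// le_supn.
Qed.

Definition proj x j : R := Ex F (fun y => h x y j).

Lemma proj_intg j : intg F (fun x => proj x j).
Proof. exact: (Ex_iter (f := fun x y => h x y j) (mh j) (h_intg2 j) (h_intg^~ j)).1. Qed.

Lemma measurable_proj j : measurable_fun setT (fun x => proj x j).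
Proof. exact: intg_measurable (proj_intg j). Qed.

Lemma proj_mean j : Ex F (fun x => proj x j) = Ex P2 (fun z => h z.1 z.2 j).
Proof. exact: (Ex_iter (f := fun x y => h x y j) (mh j) (h_intg2 j) (h_intg^~ j)).2. Qed.

Let msup2 k : measurable_fun setT (fun z : T * T => supn (h z.1 z.2) ^+ k).
Proof. by apply: measurable_funX; exact: measurable_supn. Qed.

Let iter_supn k (k4 : (k <= 4)%N) := Ex_iter (f := fun x y => supn (h x y) ^+ k) (msup2 k) (h_intg2_pow k4) (fun x => h_intg_pow x k4).

Lemma supn_proj_le x : supn (proj x) <= Ex F (fun y => supn (h x y)).
Proof.
have i1 := h_intg_pow x (isT : (1 <= 4)%N).
apply: supn_le => [|j]; first by apply: Ex_ge0 => y; exact: supn_ge0.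
by apply: (Ex_abs_le (h_intg x j) i1) => y; exact: le_supn.
Qed.

Lemma supn_proj_sqr x : supn (proj x) ^+ 2 <= Ex F (fun y => supn (h x y) ^+ 2).
Proof.
have i1 := h_intg_pow x (isT : (1 <= 4)%N).
apply: le_trans (Ex_sqr_le i1 (h_intg_pow x (isT : (2 <= 4)%N))).
rewrite lerXn2r ?nnegrE ?supn_ge0// ?supn_proj_le//.
by apply: Ex_ge0 => y; exact: supn_ge0.
Qed.

Lemma proj_supn2_intg : intg F (fun x => supn (proj x) ^+ 2) /\
  Ex F (fun x => supn (proj x) ^+ 2) <= Ex P2 (fun z => supn (h z.1 z.2) ^+ 2).
Proof.
have [i2 e2] := iter_supn (isT : (2 <= 4)%N).
have I : intg F (fun x => supn (proj x) ^+ 2).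
  apply: (intg_dom _ i2) => [|x].
    by apply: measurable_funX; apply: measurable_supn => j; exact: measurable_proj.
  by rewrite ger0_norm ?sqr_ge0// supn_proj_sqr.
split => //; rewrite -e2; apply: Ex_le => // x; exact: supn_proj_sqr.
Qed.

Lemma proj_cube j : intg F (fun x => `|proj x j| ^+ 3) /\
  Ex F (fun x => `|proj x j| ^+ 3) <= Ex P2 (fun z => `|h z.1 z.2 j| ^+ 3).
Proof.
have m3 : measurable_fun setT (fun z : T * T => `|h z.1 z.2 j| ^+ 3).
  by apply: measurable_funX; apply: measurableT_comp.
have [i3 e3] := Ex_iter (f := fun x y => `|h x y j| ^+ 3) m3 (h_intg2_abs j (isT : (3 <= 4)%N)) (fun x => h_intg_abs x j (isT : (3 <= 4)%N)).
have le x : `|proj x j| ^+ 3 <= Ex F (fun y => `|h x y j| ^+ 3).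
  exact: Ex_cube_le (h_intg x j) (h_intg_abs x j (isT : (3 <= 4)%N)).
have I : intg F (fun x => `|proj x j| ^+ 3).
  apply: (intg_dom _ i3) => [|x].
    by apply: measurable_funX; apply: measurableT_comp => //; exact: measurable_proj.
  by rewrite ger0_norm ?exprn_ge0.
by split => //; rewrite -e3; exact: Ex_le.
Qed.

Lemma tailsq_intg c x : intg F (fun y => tailsq h c x y).
Proof.
have ms : measurable_fun setT (fun y => supn (h x y)).
  by apply: measurable_supn => j; exact: measurable_hx.
apply: (intg_dom _ (h_intg_pow x (isT : (2 <= 4)%N))) => [|y].
  apply: measurable_funM; first exact: measurable_funX.
  exact: measurable_fun_indic_gt.
rewrite ger0_norm ?tailsq_ge0// /tailsq; case: (c < _)%R; rewrite ?mulr1// mulr0 sqr_ge0//.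
Qed.

Lemma measurable_tailsq c : measurable_fun setT (fun z : T * T => tailsq h c z.1 z.2).
Proof.
apply: measurable_funM; first exact: msup2.
by apply: measurable_fun_indic_gt; exact: measurable_supn.
Qed.

Lemma tailsq_intg2 c : intg P2 (fun z => tailsq h c z.1 z.2).
Proof.
apply: (intg_dom (measurable_tailsq c) (h_intg2_pow (isT : (2 <= 4)%N))) => z.
rewrite ger0_norm ?tailsq_ge0// /tailsq; case: (c < _)%R; rewrite ?mulr1// mulr0 sqr_ge0//.
Qed.

(* If |E h(x,.)| > c then at least half of E|h(x,.)| comes from |h(x,.)| > c/2. *)
Lemma proj_tail_pointwise c x : 0 <= c ->
  supn (proj x) ^+ 2 * (c < supn (proj x))%R%:R <= 4 * Ex F (fun y => tailsq h (c / 2) x y).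
Proof.
move=> c0; have E0 : 0 <= Ex F (fun y => tailsq h (c / 2) x y).
  by apply: Ex_ge0 => y; exact: tailsq_ge0.
case: (ltP c (supn (proj x))) => h1; last by rewrite mulr0 mulr_ge0.
rewrite mulr1.
have ms : measurable_fun setT (fun y => supn (h x y)).
  by apply: measurable_supn => j; exact: measurable_hx.
have i1 := h_intg_pow x (isT : (1 <= 4)%N).
pose f y := supn (h x y) * (c / 2 < supn (h x y))%R%:R.
have If : intg F f.
  apply: (intg_dom _ i1) => [|y].
    by apply: measurable_funM => //; exact: measurable_fun_indic_gt.
  rewrite ger0_norm; last by rewrite mulr_ge0 ?supn_ge0.
  by rewrite /f expr1; case: (_ < _)%R; rewrite ?mulr1// mulr0 supn_ge0.
have f2 y : f y ^+ 2 = tailsq h (c / 2) x y.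
  by rewrite /f /tailsq exprMn; congr (_ * _); case: (_ < _)%R; rewrite ?expr1n ?expr0n.
have If2 : intg F (fun y => f y ^+ 2) by rewrite (funext f2); exact: tailsq_intg.
have := Ex_sqr_le If If2; rewrite (eq_Ex _ f2) => hsq.
have hE : Ex F (fun y => supn (h x y)) <= c / 2 + Ex F f.
  rewrite -(Ex_cst F (c / 2)) -(ExD (intg_cst F (c / 2)) If).
  apply: (Ex_le i1 (intgD (intg_cst F (c / 2)) If)) => y; rewrite /f.
  case: ltP => h2; last by rewrite mulr0 addr0.
  by rewrite mulr1 lerDr divr_ge0.
have := supn_proj_le x; move: (supn (proj x)) (Ex F f) (Ex F (fun y => supn (h x y))) h1 hE hsq => s A E h1 h2 hsq h3.
nra.
Qed.

Lemma proj_tail c : 0 <= c ->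
  Ex F (fun x => supn (proj x) ^+ 2 * (c < supn (proj x))%R%:R) <= 4 * Ex P2 (fun z => tailsq h (c / 2) z.1 z.2).
Proof.
move=> c0.
have [i2 e2] := Ex_iter (f := tailsq h (c / 2)) (measurable_tailsq (c / 2)) (tailsq_intg2 (c / 2)) (tailsq_intg (c / 2)).
rewrite -e2 -(ExZ _ i2); apply: Ex_le.
- have ms : measurable_fun setT (fun x => supn (proj x)).
    by apply: measurable_supn => j; exact: measurable_proj.
  apply: (intg_dom _ proj_supn2_intg.1) => [|x].
    by apply: measurable_funM; [exact: measurable_funX|exact: measurable_fun_indic_gt].
  rewrite normrM normr_nat ger0_norm ?sqr_ge0//; case: (c < _)%R; rewrite ?mulr1// mulr0 sqr_ge0//.
- exact: intgZ.
by move=> x; exact: proj_tail_pointwise.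
Qed.

(** Given the first argument the two factors are independent, so integrating the last two arguments
    in turn produces both projections. This identifies the mean of the order-three kernel. *)
Lemma proj_cov j k : Ex P3 (fun z => h z.1.1 z.1.2 j * h z.1.1 z.2 k) = Ex F (fun x => proj x j * proj x k).
Proof.
have hM (a b : R) (s s' : R) : `|a| <= s -> `|b| <= s' -> `|a * b| <= s ^+ 2 + s' ^+ 2.
  move=> h1 h2; rewrite normrM; have := normr_ge0 a; have := normr_ge0 b.
  by move=> ? ?; apply: le_trans (ler_pM _ _ h1 h2) _ => //; nra.
have [j1 _] := Ex_triple12 (h_intg2_pow (isT : (2 <= 4)%N)).
have [j2 _] := Ex_triple13 (h_intg2_pow (isT : (2 <= 4)%N)).
rewrite /= in j1 j2.
have mj : measurable_fun setT (fun z : T * T * T => h z.1.1 z.1.2 j) by exact: (measurableT_comp (mh j)).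
have mk : measurable_fun setT (fun z : T * T * T => h z.1.1 z.2 k).
  apply: (@measurableT_comp _ _ _ _ _ _ (fun z : T * T => h z.1 z.2 k) _ (fun z : T * T * T => (z.1.1, z.2))); first exact: mh.
  by apply/measurable_fun_pair => //=; exact: (measurableT_comp measurable_fst).
have m3 := measurable_funM mj mk.
have i3 : intg P3 (fun z => h z.1.1 z.1.2 j * h z.1.1 z.2 k).
  by apply: (intg_dom m3 (intgD j1 j2)) => z; apply: hM; exact: le_supn.
have i3x (z : T * T) : intg F (fun c => h z.1 z.2 j * h z.1 c k) by apply: intgZ; exact: h_intg.
have [_ <-] := Ex_iter (P1 := P2) (f := fun (z : T * T) c => h z.1 z.2 j * h z.1 c k) m3 i3 i3x.
rewrite (eq_Ex _ (fun z => ExZ (h z.1 z.2 j) (h_intg z.1 k))).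
have m2 : measurable_fun setT (fun z : T * T => h z.1 z.2 j * proj z.1 k).
  by apply: measurable_funM => //; exact: (measurableT_comp (measurable_proj k)).
have [k1 _] := proj_supn2_intg.
have k2 : intg P2 (fun z => supn (proj z.1) ^+ 2).
  apply: (intg_map (P := P2) (P' := F) measurable_fst _ k1) => A mA.
  rewrite (_ : _ @^-1` A = A `*` setT); last by apply/seteqP; split => z //= [].
  transitivity ((F A * F setT)%E); first exact: product_measure1E.
  by rewrite [X in (_ * X)%E]probability_setT mule1.
have i2 : intg P2 (fun z => h z.1 z.2 j * proj z.1 k).
  by apply: (intg_dom m2 (intgD (h_intg2_pow (isT : (2 <= 4)%N)) k2)) => z; apply: hM; exact: le_supn.
have i2x x : intg F (fun y => h x y j * proj x k).
  by under eq_fun do rewrite mulrC; apply: intgZ; exact: h_intg.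
have [_ <-] := Ex_iter (f := fun x y => h x y j * proj x k) m2 i2 i2x.
apply: eq_Ex => x; under eq_Ex do rewrite mulrC.
by rewrite (ExZ _ (h_intg x j)) mulrC.
Qed.

End projection.

(** * Gaussian and projected summands as inputs of the exchange *)

Section gaussian_swappable.
Context (R : realType) (n : nat) (J : finType).
Variables (N : probability R R) (G : probability (n.-tuple R) R).
Hypotheses (NE : std_normal N) (NG : prodlike N G) (n0 : (0 < n)%N) (J0 : (0 < #|J|)%N).
Variables (a : 'I_n -> J -> R) (beta : R).
Hypotheses (beta0 : 0 < beta) (va : forall j, \sum_i a i j ^+ 2 <= 2).
Local Notation sn := (Num.sqrt n%:R : R).

(** The tail is estimated at the coordinate attaining the maximum and then summed over all of them.
    The constant [48 = 6 * 2 * 4] combines [gaussv_abs3] with [expR 1 <= 4]. *)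
Lemma gaussv_swappable : swappable beta G (fun e j => sn^-1 * gaussv a e j)
  (48 * sn^-1 ^+ 3) (4 * #|J|%:R / n%:R * expR (4 - sn / beta)).
Proof.
have sn0 : 0 < sn by rewrite sqrtr_gt0 ltr0n.
have isn0 : 0 < sn^-1 by rewrite invr_gt0.
have sq : sn^-1 ^+ 2 = n%:R^-1 by rewrite exprVn sqr_sqrtr.
have mY j : measurable_fun setT (fun e => gaussv a e j) by exact: measurable_gaussv.
have sE e : supn (fun j => sn^-1 * gaussv a e j) = sn^-1 * supn (gaussv a e) by exact: supn_scaleE.
have tl j := mgf_tail (mY j) (linf_mgf NE NG (a^~ j)) (sn / beta).
split.
- by move=> j; apply: measurable_funM.
- under eq_fun do rewrite sE exprMn; apply: intgZ.
  exact: (gaussv_supn_intg NE NG J0 a 1).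
- move=> j; under eq_fun do rewrite normrM exprMn; apply: intgZ.
  exact: (gaussv_abs3 NE NG a j).1.
- by move=> j; rewrite ExZ; [rewrite [Ex _ _](linf_mean NE NG) mulr0|exact: (gaussv_pow_intg NE NG a j 0)].
- move=> j; under eq_Ex do rewrite normrM exprMn.
  have [i3 h3] := gaussv_abs3 NE NG a j.
  rewrite (ExZ _ i3) (gtr0_norm isn0) mulrC ler_pM2r ?exprn_gt0//.
  apply: le_trans h3 _; rewrite (_ : 48 = 6 * (2 * 4)); last by ring.
  rewrite ler_pM2l// ler_pM2l//; apply: le_trans (expR1_le4 R).
  by rewrite ler_expR; have := va j; lra.
pose f e := n%:R^-1 * \sum_j gaussv a e j ^+ 2 * (sn / beta < `|gaussv a e j|)%R%:R.
have If : intg G f by apply: intgZ; apply: intg_sum => j; exact: (tl j).1.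
apply: le_trans (_ : Ex G f <= _); last first.
  rewrite /f ExZ; last by apply: intg_sum => j; exact: (tl j).1.
  rewrite Ex_sum; last by move=> j; exact: (tl j).1.
  apply: le_trans (_ : n%:R^-1 * (\sum_(j : J) 4 * expR (4 - sn / beta)) <= _).
    rewrite ler_pM2l ?invr_gt0 ?ltr0n//; apply: ler_sum => j _; apply: le_trans (tl j).2 _.
    by rewrite ler_pM2l// ler_expR lerD2r; have := va j; lra.
  rewrite sumr_const -[X in _ * X]mulr_natl le_eqVlt; apply/orP; left; apply/eqP.
  by ring.
have dom e : supn (fun j => sn^-1 * gaussv a e j) ^+ 2 * (beta^-1 < supn (fun j => sn^-1 * gaussv a e j))%R%:R <= f e.
  rewrite sE exprMn sq -mulrA /f ler_pM2l ?invr_gt0 ?ltr0n//.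
  case: ltP => h; last first.
    by rewrite mulr0; apply: sumr_ge0 => j _; rewrite mulr_ge0// sqr_ge0.
  rewrite mulr1.
  have /card_gt0P[i _] := J0.
  have [j _ hj] := @eq_bigmax _ R J 0 i xpredT (fun j => `|gaussv a e j|) isT (fun j _ => normr_ge0 _).
  have sj : supn (gaussv a e) = `|gaussv a e j| by exact: hj.
  rewrite sj real_normK ?num_real// (bigD1 j)//=.
  have -> : (sn / beta < `|gaussv a e j|)%R = true.
    by move: h; rewrite ltr_pdivlMl// -sj.
  by rewrite mulr1 lerDl; apply: sumr_ge0 => k _; rewrite mulr_ge0// sqr_ge0.
apply: Ex_le => //.
apply: (intg_dom _ If) => [|e]; last by rewrite ger0_norm ?dom// mulr_ge0// sqr_ge0.
have ms : measurable_fun setT (fun e => supn (fun j => sn^-1 * gaussv a e j)).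
  by apply: measurable_supn => j; exact: measurable_funM.
by apply: measurable_funM; [exact: measurable_funX|exact: measurable_fun_indic_gt].
Qed.

End gaussian_swappable.

Section projection_swappable.
Context (R : realType) d (T : measurableType d) (J : finType) (n : nat).
Hypothesis n0 : (0 < n)%N.
Variable F : probability T R.
Local Notation P2 := (F \x F : probability _ _)%E.
Variable h : T -> T -> J -> R.
Hypothesis mh : forall j, measurable_fun setT (fun z : T * T => h z.1 z.2 j).
Hypothesis ih4x : forall x, intg F (fun y => supn (h x y) ^+ 4).
Hypothesis ih4 : intg P2 (fun z => supn (h z.1 z.2) ^+ 4).
Hypothesis hmean : forall j, Ex P2 (fun z => h z.1 z.2 j) = 0.
Variables (beta B eps : R).
Hypotheses (beta0 : 0 < beta) (h3 : forall j, Ex P2 (fun z => `|h z.1 z.2 j| ^+ 3) <= B).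
Local Notation sn := (Num.sqrt n%:R : R).
Hypothesis heps : Ex P2 (fun z => tailsq h (sn / beta / 2) z.1 z.2) <= eps.

(** The level [1 / beta] for the scaled summand is [sqrt n / beta] for [proj], and passing from the
    projection to the kernel halves it by [proj_tail]. *)
Lemma proj_swappable : swappable beta F (fun x j => sn^-1 * proj F h x j)
  (sn^-1 ^+ 3 * B) (4 / n%:R * eps).
Proof.
have sn0 : 0 < sn by rewrite sqrtr_gt0 ltr0n.
have isn0 : 0 < sn^-1 by rewrite invr_gt0.
have sq : sn^-1 ^+ 2 = n%:R^-1 by rewrite exprVn sqr_sqrtr.
have mY j : measurable_fun setT (fun x => proj F h x j) by exact: measurable_proj.
have sE x : supn (fun j => sn^-1 * proj F h x j) = sn^-1 * supn (proj F h x) by exact: supn_scaleE.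
have c0 : 0 <= sn / beta by rewrite divr_ge0// ltW.
split.
- by move=> j; apply: measurable_funM.
- by under eq_fun do rewrite sE exprMn; apply: intgZ; exact: (proj_supn2_intg mh ih4x ih4).1.
- by move=> j; under eq_fun do rewrite normrM exprMn; apply: intgZ; exact: (proj_cube mh ih4x ih4 j).1.
- by move=> j; rewrite ExZ; [rewrite proj_mean// hmean mulr0|exact: proj_intg].
- move=> j; under eq_Ex do rewrite normrM exprMn.
  have [i3 b3] := proj_cube mh ih4x ih4 j.
  by rewrite (ExZ _ i3) (gtr0_norm isn0) ler_pM2l ?exprn_gt0//; exact: le_trans b3 (h3 j).
have hT := proj_tail mh ih4x ih4 c0.
rewrite (@eq_Ex _ _ _ _ _ (fun x => n%:R^-1 * (supn (proj F h x) ^+ 2 * (sn / beta < supn (proj F h x))%R%:R))); last first.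
  move=> x; rewrite sE exprMn sq -mulrA; congr (_ * (_ * _%:R)).
  by rewrite -ltr_pdivlMl ?invr_gt0// invrK mulrC.
rewrite ExZ; last first.
  have ms : measurable_fun setT (fun x => supn (proj F h x)) by exact: measurable_supn.
  apply: (intg_dom _ (proj_supn2_intg mh ih4x ih4).1) => [|x].
    by apply: measurable_funM; [exact: measurable_funX|exact: measurable_fun_indic_gt].
  rewrite normrM normr_nat ger0_norm ?sqr_ge0//; case: (_ < supn _)%R; rewrite ?mulr1// mulr0 sqr_ge0//.
rewrite [leRHS]mulrAC mulrC ler_pM2r ?invr_gt0 ?ltr0n//.
by apply: le_trans hT _; rewrite ler_pM2l.
Qed.

End projection_swappable.

Lemma sum_offdiag_sym (R : realType) n (f : 'I_n -> 'I_n -> R) : (forall i l, f i l = f l i) ->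
  \sum_(i < n) \sum_(l < n | l != i) f i l = 2 * \sum_(l < n) \sum_(i < n | (i < l)%N) f i l.
Proof.
move=> fs.
have e i : \sum_(l < n | l != i) f i l = \sum_(l < n | (l < i)%N) f i l + \sum_(l < n | (i < l)%N) f i l.
  rewrite (bigID (fun l : 'I_n => (l < i)%N))/=; congr (_ + _); apply: eq_bigl => l.
    by rewrite andbC -val_eqE; case: ltngtP.
  by rewrite -leqNgt -val_eqE; case: ltngtP.
rewrite (eq_bigr _ (fun i _ => e i)) big_split/= mulr_natl mulr2n; congr (_ + _).
  by apply: eq_bigr => i _; apply: eq_bigr => l _; exact: fs.
by rewrite (exchange_big_dep xpredT).
Qed.

(** * The degenerate part of the statistic *)

Section degenerate_part.
Context (R : realType) d (T : measurableType d) (J : finType) (n : nat).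
Hypotheses (n3 : (3 <= n)%N) (J0 : (0 < #|J|)%N).
Variables (F : probability T R) (Q : probability (n.-tuple T) R).
Hypothesis FQ : prodlike F Q.
Local Notation P2 := (F \x F : probability _ _)%E.
Variable h : T -> T -> J -> R.
Hypothesis mh : forall j, measurable_fun setT (fun z : T * T => h z.1 z.2 j).
Hypothesis hsym : forall x y, h x y = h y x.
Hypothesis ih4x : forall x, intg F (fun y => supn (h x y) ^+ 4).
Hypothesis ih4 : intg P2 (fun z => supn (h z.1 z.2) ^+ 4).
Hypothesis hmean : forall j, Ex P2 (fun z => h z.1 z.2 j) = 0.
Variables (k : nat) (v : R).
Hypotheses (k0 : (0 < k)%N) (Jk : #|J|%:R <= expR k%:R :> R).
Hypothesis hv : Ex P2 (fun z => supn (h z.1 z.2) ^+ 2) <= v.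
Local Notation sn := (Num.sqrt n%:R : R).
Local Notation g := (proj F h).

(** The completely degenerate component of Hoeffding's decomposition: with a kernel of mean zero,
    each argument integrates to zero for every fixed value of the other. *)
Let phi (x y : T) j := h x y j - g x j - g y j.

Let phi_sym x y j : phi x y j = phi y x j.
Proof. by rewrite /phi hsym; ring. Qed.

Let D (x : n.-tuple T) j := sn / (n%:R * (n%:R - 1)) *
  \sum_(l < n) \sum_(i < n | (i < l)%N) phi (tnth x i) (tnth x l) j.

Lemma hoeffding_decomposition (x : n.-tuple T) j :
  sn * Ustat h x j / 2 = \sum_i sn^-1 * g (tnth x i) j + D x j.
Proof.
have n3R : 3 <= n%:R :> R by rewrite ler_nat.
have sn0 : 0 < sn by rewrite sqrtr_gt0; lra.
have sq : sn ^+ 2 = n%:R by rewrite sqr_sqrtr//; lra.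
rewrite /D -[X in _ = _ + _ * X](mulKf (_ : 2 != 0 :> R))//.
rewrite -(sum_offdiag_sym (f := fun i l => phi (tnth x i) (tnth x l) j)); last by move=> i l; exact: phi_sym.
have -> : \sum_(i < n) \sum_(l < n | l != i) phi (tnth x i) (tnth x l) j =
    n%:R * (n%:R - 1) * Ustat h x j - 2 * (n%:R - 1) * \sum_i g (tnth x i) j.
  rewrite (eq_bigr (fun i => \sum_(l < n | l != i) h (tnth x i) (tnth x l) j -
      ((n%:R - 1) * g (tnth x i) j + (\sum_l g (tnth x l) j - g (tnth x i) j)))); last first.
    move=> i _.
    have c : \sum_(l < n | l != i) g (tnth x i) j = (n%:R - 1) * g (tnth x i) j.
      have : \sum_(l < n) g (tnth x i) j = n%:R * g (tnth x i) j by rewrite sumr_const card_ord mulr_natl.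
      by rewrite (bigD1 i)//=; lra.
    have c2 : \sum_(l < n | l != i) g (tnth x l) j = \sum_l g (tnth x l) j - g (tnth x i) j.
      by rewrite [in RHS](bigD1 i)//= addrAC subrr add0r.
    by rewrite -c -c2 -big_split -sumrB; apply: eq_bigr => l _; rewrite /phi/=; ring.
  rewrite sumrB big_split/= -mulr_sumr sumrB sumr_const card_ord -[_ *+ n]mulr_natl.
  by rewrite /Ustat /ustat2; field; apply/andP; split; apply/eqP; lra.
rewrite -mulr_sumr; move: (\sum_i _) (Ustat h x j) => G U.
have n1 : (n%:R : R) - 1 != 0 by apply/eqP; lra.
have gen (s m : R) : s ^+ 2 = m -> 0 < s -> m - 1 != 0 ->
    s * U / 2 = s^-1 * G + s / (m * (m - 1)) * (2^-1 * (m * (m - 1) * U - 2 * (m - 1) * G)).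
  by move=> <- s0 s1; field; rewrite s1 gt_eqF.
exact: gen sq sn0 n1.
Qed.

Let mg j : measurable_fun setT (fun x => g x j). Proof. exact: measurable_proj. Qed.

Let mphi j : measurable_fun setT (fun z : T * T => phi z.1 z.2 j).
Proof.
apply: measurable_funB; first apply: measurable_funB => //.
  exact: (measurableT_comp (mg j)).
exact: (measurableT_comp (mg j)).
Qed.

Let phi_supn x y : supn (phi x y) ^+ 2 <= 3 * (supn (h x y) ^+ 2 + supn (g x) ^+ 2 + supn (g y) ^+ 2).
Proof.
have h1 : supn (phi x y) <= supn (h x y) + supn (g x) + supn (g y).
  apply: supn_le => [|j]; first by rewrite !addr_ge0// supn_ge0.
  rewrite /phi; apply: le_trans (ler_normB _ _) _; apply: lerD; last exact: le_supn.
  by apply: le_trans (ler_normB _ _) _; apply: lerD; exact: le_supn.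
have p0 := supn_ge0 (phi x y).
move: (supn (phi x y)) (supn (h x y)) (supn (g x)) (supn (g y)) h1 p0 => s a b c h1 p0.
apply: le_trans (_ : (a + b + c) ^+ 2 <= _); first by rewrite lerXn2r ?nnegrE//; lra.
by have := sqr_ge0 (a - b); have := sqr_ge0 (a - c); have := sqr_ge0 (b - c); nra.
Qed.

Let ig2 := (proj_supn2_intg mh ih4x ih4).1.

Let iphi2x x : intg F (fun y => supn (phi x y) ^+ 2).
Proof.
have I := intgZ 3 (intgD (intgD (h_intg_pow mh ih4x x (isT : (2 <= 4)%N)) (intg_cst F (supn (g x) ^+ 2))) ig2).
apply: (intg_dom _ I) => [|y]; last by rewrite ger0_norm ?sqr_ge0//; exact: phi_supn.
apply: measurable_funX; apply: measurable_supn => j.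
apply: measurable_funB => //; apply: measurable_funB => //.
exact: measurable_hx.
Qed.

Let iphi2y y : intg F (fun x => supn (phi x y) ^+ 2).
Proof.
rewrite (_ : (fun x => _) = (fun x => supn (phi y x) ^+ 2)); first exact: iphi2x.
by apply/funext => x; congr (supn _ ^+ 2); apply/funext => j; exact: phi_sym.
Qed.

Let cphi2 x j : Ex F (fun y => phi x y j) = 0.
Proof.
have i1 := h_intg mh ih4x x j; have i2 := proj_intg mh ih4x ih4 j.
rewrite (ExB (intgB i1 (intg_cst F (g x j))) i2) (ExB i1 (intg_cst F (g x j))) Ex_cst.
by rewrite proj_mean// hmean /proj subrr subr0.
Qed.

Let cphi1 y j : Ex F (fun x => phi x y j) = 0.
Proof. by rewrite -(cphi2 y j); apply: eq_Ex => x; exact: phi_sym. Qed.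

Let phi_mean : (\int[F]_y \int[F]_x (supn (phi x y) ^+ 2)%:E <= (9 * v)%:E)%E.
Proof.
have m2 : measurable_fun setT (fun z : T * T => supn (phi z.1 z.2) ^+ 2).
  by apply: measurable_funX; exact: measurable_supn.
have i1 : intg P2 (fun z => supn (g z.1) ^+ 2).
  apply: (intg_map (P := P2) (P' := F) measurable_fst _ ig2) => A mA.
  rewrite (_ : _ @^-1` A = A `*` setT); last by apply/seteqP; split => z //= [].
  transitivity ((F A * F setT)%E); first exact: product_measure1E.
  by rewrite [X in (_ * X)%E]probability_setT mule1.
have law2 A : measurable A -> P2 (snd @^-1` A) = F A.
  move=> mA; rewrite (_ : _ @^-1` A = setT `*` A); last by apply/seteqP; split => z //= [].
  transitivity ((F setT * F A)%E); first exact: product_measure1E.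
  by rewrite [X in (X * _)%E]probability_setT mul1e.
have i2 : intg P2 (fun z => supn (g z.2) ^+ 2) by exact: (intg_map (P := P2) (P' := F) measurable_snd law2 ig2).
have law1 A : measurable A -> P2 (fst @^-1` A) = F A.
  move=> mA; rewrite (_ : _ @^-1` A = A `*` setT); last by apply/seteqP; split => z //= [].
  transitivity ((F A * F setT)%E); first exact: product_measure1E.
  by rewrite [X in (_ * X)%E]probability_setT mule1.
have ih := h_intg2_pow mh ih4 (isT : (2 <= 4)%N).
have I := intgZ 3 (intgD (intgD ih i1) i2).
have ip : intg P2 (fun z => supn (phi z.1 z.2) ^+ 2).
  by apply: (intg_dom m2 I) => z; rewrite ger0_norm ?sqr_ge0//; exact: phi_supn.
have [j2 e2] := Ex_iter_ge0 (f := fun x y => supn (phi x y) ^+ 2) m2 (fun x y => sqr_ge0 _) ip iphi2x.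
have -> : (\int[F]_y \int[F]_x (supn (phi x y) ^+ 2)%:E = (Ex P2 (fun z => supn (phi z.1 z.2) ^+ 2))%:E)%E.
  rewrite -e2 -(Ex_EFin j2); apply: eq_integral => x _.
  rewrite -(Ex_EFin (iphi2x x)); apply: eq_integral => y _; congr (supn _ ^+ 2)%:E.
  by apply/funext => j; exact: phi_sym.
rewrite lee_fin; apply: le_trans (Ex_le ip I (fun z => phi_supn _ _)) _.
rewrite (ExZ _ (intgD (intgD ih i1) i2)) (ExD (intgD ih i1) i2) (ExD ih i1).
rewrite (Ex_map (P := P2) (P' := F) measurable_fst law1 ig2) (Ex_map (P := P2) (P' := F) measurable_snd law2 ig2).
have := (proj_supn2_intg mh ih4x ih4).2; move: hv; lra.
Qed.

Lemma card_pairs_lt : \sum_(l < n) \sum_(i < n | (i < l)%N) (1 : R) = n%:R * (n%:R - 1) / 2.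
Proof.
have := sum_offdiag_sym (f := fun _ _ : 'I_n => 1 : R) (fun _ _ => erefl).
rewrite (eq_bigr (fun=> n%:R - 1)); last first.
  move=> i _; have : \sum_(l < n) (1 : R) = n%:R by rewrite sumr_const card_ord.
  by rewrite (bigD1 i)//=; lra.
by rewrite sumr_const card_ord -[X in X = _]mulr_natl => ->; field.
Qed.

(** Markov for the squared sup norm. The [n (n - 1) / 2] pairs against the squared prefactor
    [n / (n (n - 1))^2] leave [1 / (2 (n - 1))]. *)
Lemma degenerate_part_tail eta : 0 < eta -> 0 <= v ->
  measurable [set x | eta < supn (D x)] /\
  pr Q [set x | eta < supn (D x)] <= (8 * expR 1 * k%:R) ^+ 2 * (9 * v) / (2 * (n%:R - 1) * eta ^+ 2).
Proof.
move=> eta0 v0; have n3R : 3 <= n%:R :> R by rewrite ler_nat.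
have sn0 : 0 < sn by rewrite sqrtr_gt0; lra.
have sq : sn ^+ 2 = n%:R by rewrite sqr_sqrtr//; lra.
have mD j : measurable_fun setT (fun x => D x j).
  apply: measurable_funM => //; apply: measurable_sum => l.
  under eq_fun do rewrite big_mkcond; apply: measurable_sum => i; case: (i < l)%N => //.
  apply: (@measurableT_comp _ _ _ _ _ _ (fun z : T * T => phi z.1 z.2 j) _ (fun x : n.-tuple T => (tnth x i, tnth x l))) => //.
  by apply/measurable_fun_pair => /=; exact: measurable_tnth.
have mS : measurable [set x | eta < supn (D x)] by apply: measurable_set_gt; exact: measurable_supn.
split => //.
set M := 8 * expR 1 * k%:R; have M0 : 0 <= M by rewrite !mulr_ge0// expR_ge0.
pose W (x : n.-tuple T) j := \sum_(l < n) \sum_(i < n | (i < l)%N) phi (tnth x i) (tnth x l) j.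
have mW j : measurable_fun setT (fun x => W x j).
  apply: measurable_sum => l.
  under eq_fun do rewrite big_mkcond; apply: measurable_sum => i; case: (i < l)%N => //.
  apply: (@measurableT_comp _ _ _ _ _ _ (fun z : T * T => phi z.1 z.2 j) _ (fun x : n.-tuple T => (tnth x i, tnth x l))) => //.
  by apply/measurable_fun_pair => /=; exact: measurable_tnth.
have hW : (\int[Q]_x (supn (W x) ^+ 2)%:E <= (M ^+ 2 * (n%:R * (n%:R - 1) / 2 * (9 * v)))%:E)%E.
  have := degenerate_pairs_supn2 FQ k0 Jk (phi := fun _ _ : 'I_n => phi) (fun _ _ => mphi)
    (fun _ _ => iphi2y) (fun _ _ => iphi2x) (fun _ _ => cphi1) (fun _ _ => cphi2).
  move/le_trans; apply; rewrite [X in (_ <= X)%E]EFinM; apply: lee_wpmul2l; first by rewrite lee_fin sqr_ge0.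
  apply: le_trans (_ : (\sum_(l < n) \sum_(i < n | (i < l)%N) (9 * v)%:E <= _)%E).
    by apply: lee_sum => l _; apply: lee_sum => i _; exact: phi_mean.
  rewrite -card_pairs_lt mulr_suml -sumEFin; apply: lee_sum => l _.
  by rewrite mulr_suml -sumEFin; apply: lee_sum => i _; rewrite mul1r.
have mWs : measurable_fun setT (fun x => supn (W x) ^+ 2).
  by apply: measurable_funX; exact: measurable_supn.
have [iW eW] := intg_ge0 mWs (fun x => sqr_ge0 _) hW.
set c := sn / (n%:R * (n%:R - 1)); have c0 : 0 < c by rewrite divr_gt0// mulr_gt0; lra.
have DE x : supn (D x) = c * supn (W x) by exact: supn_scaleE.
have iD : intg Q (fun x => supn (D x) ^+ 2).
  by under eq_fun do rewrite DE exprMn; exact: intgZ.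
have e2 : 0 < eta ^+ 2 by rewrite exprn_gt0.
apply: le_trans (markov_le iD (fun x => sqr_ge0 _) mS e2 _) _.
  by move=> x /= /ltW hx; rewrite lerXn2r ?nnegrE ?supn_ge0// ltW.
under eq_Ex do rewrite DE exprMn.
rewrite (ExZ _ iW).
rewrite (_ : M ^+ 2 * (9 * v) / (2 * (n%:R - 1) * eta ^+ 2) = c ^+ 2 * (M ^+ 2 * (n%:R * (n%:R - 1) / 2 * (9 * v))) / eta ^+ 2).
  by rewrite ler_pM2r ?invr_gt0// ler_wpM2l// sqr_ge0.
rewrite /c expr_div_n sq; field.
by rewrite !gt_eqF//; lra.
Qed.

End degenerate_part.

(** * The Gaussian chaos for a fixed sample *)

Section gaussian_chaos.
Context (R : realType) (J : finType) (n : nat).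
Hypotheses (n3 : (3 <= n)%N).
Variables (N : probability R R) (G : probability (n.-tuple R) R).
Hypotheses (NE : std_normal N) (NG : prodlike N G).
Variables (k : nat) (v : R).
Hypotheses (k0 : (0 < k)%N) (Jk : #|J|%:R <= expR k%:R :> R).
Variable c : 'I_n -> 'I_n -> J -> R.
Hypothesis hc : \sum_(l < n) \sum_(i < n | (i < l)%N) supn (c i l) ^+ 2 <= n%:R * (n%:R - 1) * v.
Local Notation sn := (Num.sqrt n%:R : R).

(** The part of the reweighted statistic that is quadratic in the centred weights, for coefficients
    [c] read off the sample. *)
Definition chaos (e : n.-tuple R) j : R := (sn * (n%:R - 1))^-1 *
  \sum_(l < n) \sum_(i < n | (i < l)%N) tnth e i * tnth e l * c i l j.

Let mgf1 t : (\int[N]_x (expR (t * x))%:E = (expR (t ^+ 2 * 1 / 2))%:E)%E.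
Proof. by rewrite (std_normal_mgf NE) mulr1. Qed.

Let iN2 : intg N (fun x => x ^+ 2).
Proof. exact: (@mgf_intg_pow _ _ _ N (fun x => x) 1 (@measurable_id _ _ setT) mgf1 1). Qed.

Let EN2 : Ex N (fun x => x ^+ 2) = 1.
Proof. exact: (@mgf_var _ _ _ N (fun x => x) 1 (@measurable_id _ _ setT) ler01 mgf1). Qed.

Let EN1 : Ex N (fun x => x) = 0.
Proof. exact: (@mgf_mean _ _ _ N (fun x => x) 1 (@measurable_id _ _ setT) ler01 mgf1). Qed.

Let iN1 : intg N (fun x => x).
Proof. exact: (@mgf_intg_pow _ _ _ N (fun x => x) 1 (@measurable_id _ _ setT) mgf1 0). Qed.

Let phi (i l : 'I_n) (a b : R) j := a * b * c i l j.

Let phiE i l a b : supn (phi i l a b) ^+ 2 <= a ^+ 2 * (b ^+ 2 * supn (c i l) ^+ 2).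
Proof.
rewrite mulrA -!exprMn -[leRHS](real_normK (num_real _)) lerXn2r ?nnegrE ?supn_ge0//.
apply: le_trans (supn_scale _ _) _.
by rewrite [leRHS]normrM [`|supn _|]ger0_norm ?supn_ge0.
Qed.

(** Products of distinct centred weights are degenerate in each weight, so the bound for pair sums
    applies with a kernel that depends on the pair. *)
Lemma chaos_tail eta : 0 < eta ->
  measurable [set e | eta < supn (chaos e)] /\
  pr G [set e | eta < supn (chaos e)] <= (8 * expR 1 * k%:R) ^+ 2 * v / ((n%:R - 1) * eta ^+ 2).
Proof.
move=> eta0; have n3R : 3 <= n%:R :> R by rewrite ler_nat.
have sn0 : 0 < sn by rewrite sqrtr_gt0; lra.
have sq : sn ^+ 2 = n%:R by rewrite sqr_sqrtr//; lra.
have mphi i l j : measurable_fun setT (fun z : R * R => phi i l z.1 z.2 j).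
  by apply: measurable_funM => //; apply: measurable_funM.
pose W (e : n.-tuple R) j := \sum_(l < n) \sum_(i < n | (i < l)%N) phi i l (tnth e i) (tnth e l) j.
have mW j : measurable_fun setT (fun x => W x j).
  apply: measurable_sum => l.
  under eq_fun do rewrite big_mkcond; apply: measurable_sum => i; case: (i < l)%N => //.
  by apply: measurable_funM => //; apply: measurable_funM; exact: measurable_tnth.
set q := (sn * (n%:R - 1))^-1; have q0 : 0 < q by rewrite invr_gt0 mulr_gt0//; lra.
have DE x : supn (chaos x) = q * supn (W x) by exact: supn_scaleE.
have mWs : measurable_fun setT (fun x => supn (W x)) by exact: measurable_supn.
have mS : measurable [set e | eta < supn (chaos e)].
  apply: measurable_set_gt; under eq_fun do rewrite DE.
  exact: measurable_funM.
split => //.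
have my i l b : measurable_fun setT (fun a => supn (phi i l a b) ^+ 2).
  apply: measurable_funX; apply: measurable_supn => j; apply: measurable_funM => //; exact: measurable_funM.
have mx i l a : measurable_fun setT (fun b => supn (phi i l a b) ^+ 2).
  apply: measurable_funX; apply: measurable_supn => j; apply: measurable_funM => //; exact: measurable_funM.
have i1 i l b : intg N (fun a => supn (phi i l a b) ^+ 2).
  apply: (intg_dom (my i l b) (intgZ (b ^+ 2 * supn (c i l) ^+ 2) iN2)) => a.
  by rewrite ger0_norm ?sqr_ge0// [leRHS]mulrC; exact: phiE.
have i2 i l a : intg N (fun b => supn (phi i l a b) ^+ 2).
  apply: (intg_dom (mx i l a) (intgZ (a ^+ 2 * supn (c i l) ^+ 2) iN2)) => b.
  by rewrite ger0_norm ?sqr_ge0// mulrAC -mulrA; exact: phiE.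
have c1 i l b j : Ex N (fun a => phi i l a b j) = 0.
  rewrite (@eq_Ex _ _ _ _ _ (fun a => b * c i l j * a)); last by move=> a; rewrite /phi; ring.
  by rewrite (ExZ _ iN1) EN1 mulr0.
have c2 i l a j : Ex N (fun b => phi i l a b j) = 0.
  rewrite (@eq_Ex _ _ _ _ _ (fun b => a * c i l j * b)); last by move=> b; rewrite /phi; ring.
  by rewrite (ExZ _ iN1) EN1 mulr0.
have hb i l : (\int[N]_b \int[N]_a (supn (phi i l a b) ^+ 2)%:E <= (supn (c i l) ^+ 2)%:E)%E.
  apply: le_trans (_ : (\int[N]_b (b ^+ 2 * supn (c i l) ^+ 2)%:E <= _)%E).
    apply: ge0_le_integral => //.
    - by move=> b _; apply: integral_ge0 => a _; rewrite lee_fin sqr_ge0.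
    - have m2 : measurable_fun setT (fun z : R * R => (supn (phi i l z.1 z.2) ^+ 2)%:E).
        by apply/measurable_EFinP; apply: measurable_funX; exact: measurable_supn.
      by apply: (@measurable_fun_fubini_tonelli_G _ _ _ _ _ N _ m2) => z; rewrite lee_fin sqr_ge0.
    - by apply/measurable_EFinP; apply: measurable_funM => //; exact: measurable_funX.
    move=> b _; rewrite (Ex_EFin (i1 i l b)) lee_fin.
    apply: le_trans (Ex_le (i1 i l b) (intgZ (b ^+ 2 * supn (c i l) ^+ 2) iN2) _) _.
      by move=> a; rewrite [leRHS]mulrC; exact: phiE.
    by rewrite (ExZ _ iN2) EN2 mulr1.
  have iz := intgZ (supn (c i l) ^+ 2) iN2.
  under eq_integral do rewrite mulrC.
  by rewrite (Ex_EFin iz) (ExZ _ iN2) EN2 mulr1.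
set M := 8 * expR 1 * k%:R; have M0 : 0 <= M by rewrite !mulr_ge0// expR_ge0.
have hW : (\int[G]_x (supn (W x) ^+ 2)%:E <= (M ^+ 2 * (n%:R * (n%:R - 1) * v))%:E)%E.
  have := degenerate_pairs_supn2 NG k0 Jk (phi := phi) mphi i1 i2 c1 c2.
  move/le_trans; apply; rewrite [X in (_ <= X)%E]EFinM; apply: lee_wpmul2l; first by rewrite lee_fin sqr_ge0.
  apply: le_trans (_ : (\sum_(l < n) \sum_(i < n | (i < l)%N) (supn (c i l) ^+ 2)%:E <= _)%E).
    by apply: lee_sum => l _; apply: lee_sum => i _; exact: hb.
  by under eq_bigr do rewrite sumEFin; rewrite sumEFin lee_fin.
have [iW eW] := intg_ge0 (measurable_funX 2 mWs) (fun x => sqr_ge0 _) hW.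
have iD : intg G (fun x => supn (chaos x) ^+ 2).
  by under eq_fun do rewrite DE exprMn; exact: intgZ.
have e2 : 0 < eta ^+ 2 by rewrite exprn_gt0.
apply: le_trans (markov_le iD (fun x => sqr_ge0 _) mS e2 _) _.
  by move=> x /= /ltW hx; rewrite lerXn2r ?nnegrE ?supn_ge0// ltW.
under eq_Ex do rewrite DE exprMn.
rewrite (ExZ _ iW).
rewrite (_ : M ^+ 2 * v / ((n%:R - 1) * eta ^+ 2) = q ^+ 2 * (M ^+ 2 * (n%:R * (n%:R - 1) * v)) / eta ^+ 2).
  by rewrite ler_pM2r ?invr_gt0// ler_wpM2l// sqr_ge0.
have -> : q ^+ 2 = (n%:R * (n%:R - 1) ^+ 2)^-1 by rewrite /q exprVn exprMn sq.
by field; rewrite !gt_eqF//; lra.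
Qed.

End gaussian_chaos.

(** * Comparison at a fixed rate *)

Section max_sandwich.
Context (R : realType) (J : finType).
Hypothesis J0 : (0 < #|J|)%N.
Variables (beta : R) (c : J -> R).
Hypothesis beta0 : 0 < beta.
Let p j := expR (- (beta * c j)).

Let pE x : \sum_j p j * expR (beta * x j) = \sum_j expR (beta * (x j - c j)).
Proof. by apply: eq_bigr => j _; rewrite /p -expRD; congr expR; ring. Qed.

(** A sum of [#|J|] exponentials is at most [#|J|] times the largest, so smoothing overshoots the
    maximum by no more than [L / beta]; [le_smax] is the other half of the sandwich. *)
Lemma smax_le x L : #|J|%:R <= expR L -> (forall j, x j <= c j) -> smax beta p x <= L / beta.
Proof.
move=> JL xc; rewrite /smax pE mulrC ler_wpM2r ?invr_ge0 ?(ltW beta0)//.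
rewrite -[leRHS]expRK ler_ln ?posrE ?expR_gt0//; last first.
  have [j _] := card_gt0P J0.
  rewrite (bigD1 j)//= ltr_pwDl ?expR_gt0// sumr_ge0// => i _; exact: expR_ge0.
apply: le_trans JL; rewrite -sum1_card natr_sum ler_sum// => j _.
by rewrite -expR0 ler_expR pmulr_rle0// subr_le0 xc.
Qed.

Lemma le_smax x : smax beta p x <= 0 -> forall j, x j <= c j.
Proof.
rewrite /smax pE pmulr_rle0 ?invr_gt0// => h j.
have sj : expR (beta * (x j - c j)) <= \sum_i expR (beta * (x i - c i)).
  by rewrite [leRHS](bigD1 j)//= lerDl sumr_ge0// => i _; exact: expR_ge0.
have s0 : 0 < \sum_i expR (beta * (x i - c i)) by apply: lt_le_trans sj; exact: expR_gt0.
have : expR (beta * (x j - c j)) <= expR 0.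
  by rewrite (le_trans sj)// -[leLHS]lnK ?posrE// ler_expR.
by rewrite ler_expR pmulr_rle0// subr_le0.
Qed.

End max_sandwich.

(** * From soft maxima to perturbed orthants *)

Section transfer.
Context (R : realType) (J : finType).
Hypothesis J0 : (0 < #|J|)%N.
Context d1 (T1 : measurableType d1) d2 (T2 : measurableType d2).
Variables (P1 : probability T1 R) (P2 : probability T2 R).

Lemma measurable_le_all d (T : measurableType d) (X : T -> J -> R) (c : J -> R) :
  (forall j, measurable_fun setT (fun x => X x j)) ->
  measurable [set x | forall j, X x j <= c j].
Proof.
move=> mX; have -> : [set x | forall j, X x j <= c j] = \bigcap_(j in [set: J]) [set x | X x j <= c j].
  by apply/seteqP; split => x /= h => [j _|j]; exact: h.
by apply: fin_bigcap_measurable => [|j _]; [exact: finite_finset|exact: measurable_set_le].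
Qed.

Variables (beta L eta e0 A0 A1 d10 d20 : R) (c : J -> R).
Variables (S D : T1 -> J -> R) (Y E : T2 -> J -> R).
Hypotheses (beta0 : 0 < beta) (JL : #|J|%:R <= expR L) (L0 : 0 <= L) (eta0 : 0 < eta).
Hypotheses (mS : forall j, measurable_fun setT (fun x => S x j))
  (mD : forall j, measurable_fun setT (fun x => D x j))
  (mY : forall j, measurable_fun setT (fun x => Y x j))
  (mE : forall j, measurable_fun setT (fun x => E x j)).
Let p j := expR (- (beta * c j)).
Let sm := smax beta p.
Hypothesis close : forall t, `|pr P1 [set x | sm (S x) <= t] - pr P2 [set x | sm (Y x) <= t]| <= e0.
Hypothesis anti : forall t w, 0 <= w -> pr P2 [set x | t <= sm (Y x) <= t + w] <= A0 * w + A1.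
Hypothesis D1 : pr P1 [set x | eta < supn (D x)] <= d10.
Hypothesis D2 : pr P2 [set x | eta < supn (E x)] <= d20.

Let p0 j : 0 < p j. Proof. exact: expR_gt0. Qed.

Let mle d (T : measurableType d) (X : T -> J -> R) t : (forall j, measurable_fun setT (fun x => X x j)) ->
  measurable [set x | sm (X x) <= t].
Proof. by move=> mX; apply: measurable_set_le; apply: measurable_smax. Qed.

Let mgt d (T : measurableType d) (X : T -> J -> R) : (forall j, measurable_fun setT (fun x => X x j)) ->
  measurable [set x | eta < supn (X x)].
Proof. by move=> mX; apply: measurable_set_gt; apply: measurable_supn. Qed.

Let upper d (T : measurableType d) (P : probability T R) (X Z : T -> J -> R) :
  (forall j, measurable_fun setT (fun x => X x j)) -> (forall j, measurable_fun setT (fun x => Z x j)) ->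
  pr P [set x | forall j, X x j + Z x j <= c j] <=
  pr P [set x | sm (X x) <= eta + L / beta] + pr P [set x | eta < supn (Z x)].
Proof.
move=> mX mZ; apply: (le_trans _ (pr_setU _ (mle _ mX) (mgt mZ))).
apply: pr_le => [|| x /= h].
- by apply: measurable_le_all => j; exact: measurable_funD.
- by apply: measurableU; [exact: mle|exact: mgt].
case: (lerP (supn (Z x)) eta) => hz; [left|by right].
have hl := smax_lip (beta := beta) beta0 p0 J0 (X x) (fun j => le_trans (le_supn (Z x) j) hz).
have hm := smax_le J0 beta0 JL h.
move: hl; rewrite ler_norml => /andP[hl _].
rewrite /= addrC -lerBlDr (le_trans _ hm)// lerBlDr -lerBlDl.
by rewrite -lerN2 opprB.
Qed.

Let lower d (T : measurableType d) (P : probability T R) (X Z : T -> J -> R) :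
  (forall j, measurable_fun setT (fun x => X x j)) -> (forall j, measurable_fun setT (fun x => Z x j)) ->
  pr P [set x | sm (X x) <= - eta] <=
  pr P [set x | forall j, X x j + Z x j <= c j] + pr P [set x | eta < supn (Z x)].
Proof.
move=> mX mZ.
have mA : measurable [set x | forall j, X x j + Z x j <= c j].
  by apply: (@measurable_le_all _ _ (fun x j => X x j + Z x j)) => j; exact: measurable_funD.
apply: (le_trans _ (pr_setU _ mA (mgt mZ))).
apply: pr_le => [|| x /= h]; first exact: mle.
  by apply: measurableU => //; exact: mgt.
case: (lerP (supn (Z x)) eta) => hz; [left|by right].
have hl := smax_lip (beta := beta) beta0 p0 J0 (X x) (fun j => le_trans (le_supn (Z x) j) hz).
apply: (le_smax beta0); move: hl; rewrite ler_norml => /andP[_ hl].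
by move: hl h; rewrite /sm; lra.
Qed.

(** Perturbations above [eta] are charged to [d10] and [d20]. Smaller ones move the soft maximum by
    at most [eta], so each orthant lies between the half-lines at [- eta] and [eta + L / beta], and
    anti-concentration pays for the gap. *)
Lemma transfer_orthant :
  `|pr P1 [set x | forall j, S x j + D x j <= c j] - pr P2 [set x | forall j, Y x j + E x j <= c j]| <=
  e0 + d10 + d20 + (A0 * (2 * (eta + L / beta)) + A1).
Proof.
have Lb : 0 <= L / beta by rewrite divr_ge0// (ltW beta0).
have s0 : 0 <= 2 * (eta + L / beta) by rewrite mulr_ge0// addr_ge0// (ltW eta0).
have gap : pr P2 [set x | sm (Y x) <= eta + L / beta] <=
    pr P2 [set x | sm (Y x) <= - eta] + (A0 * (2 * (eta + L / beta)) + A1).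
  apply: le_trans (lerD (lexx _) (anti (- eta) s0)).
  have mI : measurable [set x | - eta <= sm (Y x) <= - eta + 2 * (eta + L / beta)].
    rewrite (_ : [set x | _] = [set x | - sm (Y x) <= eta] `&` [set x | sm (Y x) <= - eta + 2 * (eta + L / beta)]).
      apply: measurableI; last exact: mle.
      by apply: measurable_set_le; apply: measurable_funN; apply: measurable_smax.
      by apply/seteqP; split => x /=; rewrite (lerNl eta); [move=> /andP[-> ->]|move=> [-> ->]].
  apply: le_trans (pr_setU _ (mle _ mY) mI).
  apply: pr_le => [|| x /= h]; first exact: mle.
    by apply: measurableU => //; exact: mle.
  case: (lerP (sm (Y x)) (- eta)) => hz; [by left|right].
  by rewrite /= (ltW hz)/=; move: h Lb; lra.
have := upper P1 mS mD; have := lower P1 mS mD; have := upper P2 mY mE; have := lower P2 mY mE.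
have := close (eta + L / beta); have := close (- eta); move: gap D1 D2.
rewrite !ler_norml; set s := _ + L / beta; lra.
Qed.

End transfer.

(** * Choice of the parameters *)

Section core.
Context (R : realType) (B K gam x L : R) (n : nat).
Hypotheses (n4 : (4 <= n)%N) (B1 : 1 <= B) (L1 : 1 <= L) (K0 : 0 <= K).
Hypotheses (gam0 : 0 < gam) (gam1 : gam <= 1) (gamL : expR (- (K * L)) <= gam).
Hypotheses (x0 : 0 < x) (small : (24 * 128) * ((K + 4) * (x * L)) <= 1).
Hypothesis rate : B ^+ 2 * L <= n%:R * x ^+ 6.

(** Equations in place of definitions keep the parameters opaque to the arithmetic tactics. [s]
    makes the Bernstein exponent [(K + 4) L]: [K L] pays for [gam] and [4 L] for the union over
    pairs of coordinates. [tau] solves [8 s tau^2 = 1], and [u ^+ 2 = x^3 n] is the level at which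
    the second-order remainders still have probability of order [x L]. *)
Variables (C2 Nn t t2 r eps s s2 tau u : R).
Hypotheses (C2E : C2 = 2 * (K + 4)) (NE : Nn = (n %/ 3)%:R).
Hypotheses (tE : t = x ^+ 2 / 8) (t2E : t2 = x / 4) (rE : r = x ^+ 2 / 64) (epsE : eps = gam * x ^+ 3).
Hypotheses (sE : s = C2 * L / (Nn * t)) (s2E : s2 = C2 * L / (Nn * t2)).
Hypotheses (tauE : tau = Num.sqrt (Nn * t / (8 * (C2 * L)))) (uE : u = Num.sqrt (x ^+ 3 * n%:R)).

Let nR : 0 < n%:R :> R. Proof. by rewrite ltr0n (leq_trans _ n4). Qed.
Let L0 : 0 < L. Proof. exact: lt_le_trans ltr01 L1. Qed.
Let C28 : 8 <= C2. Proof. rewrite C2E; move: K0; lra. Qed.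
Let C20 : 0 < C2. Proof. by move: C28; lra. Qed.
Let smallC : (12 * 128) * (C2 * (x * L)) <= 1.
Proof. by move: small; rewrite C2E; move: (x * L) => z; rewrite -!mulrA; lra. Qed.
Let xL : x <= x * L. Proof. by rewrite ler_peMr ?(ltW x0). Qed.
Let xL0 : 0 < x * L. Proof. exact: mulr_gt0. Qed.
Let smallw : (96 * 128) * (x * L) <= 1.
Proof. by rewrite (le_trans _ smallC)//; move: (ler_wpM2r (ltW xL0) C28); lra. Qed.
Let smallx : (96 * 128) * x <= 1. Proof. by move: xL smallw; lra. Qed.
Let x1 : x <= 1. Proof. by move: smallx x0; lra. Qed.
Let smallCx : (12 * 128) * (C2 * x) <= 1.
Proof. by have := ler_wpM2l (ltW C20) xL; move: smallC; lra. Qed.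
Let CL0 : 0 < C2 * L. Proof. exact: mulr_gt0. Qed.

Let NnE : n%:R / 6 <= Nn.
Proof.
rewrite ler_pdivrMr// NE -natrM ler_nat {1}(divn_eq n 3) (_ : 6 = 3 + 3)%N// mulnDr leq_add2l.
have r3 : (n %% 3 <= 2)%N by rewrite -ltnS ltn_pmod.
by apply: (leq_trans r3); apply: (@leq_trans (1 * 3)) => //; rewrite leq_mul2r/= divn_gt0// ltnW.
Qed.
Let Nn0 : 0 < Nn. Proof. by apply: (lt_le_trans _ NnE); exact: divr_gt0. Qed.
Let t0 : 0 < t. Proof. by rewrite tE divr_gt0// exprn_gt0. Qed.
Let t20 : 0 < t2. Proof. by rewrite t2E divr_gt0. Qed.
Let r0 : 0 < r. Proof. by rewrite rE divr_gt0// exprn_gt0. Qed.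
Let x30 : 0 < x ^+ 3. Proof. by rewrite exprn_gt0. Qed.
Let u0 : 0 < u. Proof. by rewrite uE sqrtr_gt0; exact: mulr_gt0. Qed.
Let u2 : u ^+ 2 = x ^+ 3 * n%:R.
Proof. by rewrite uE sqr_sqrtr// mulr_ge0 ?(ltW x30) ?(ltW nR). Qed.
Let tau0 : 0 < tau.
Proof. by rewrite tauE sqrtr_gt0; apply: divr_gt0; apply: mulr_gt0 => //; exact: mulr_gt0. Qed.
Let tau2 : tau ^+ 2 = Nn * t / (8 * (C2 * L)).
Proof. by rewrite tauE sqr_sqrtr// divr_ge0// mulr_ge0// ltW. Qed.
Let s0 : 0 <= s. Proof. by rewrite sE divr_ge0 ?(ltW CL0)// mulr_ge0// ltW. Qed.
Let s20 : 0 <= s2. Proof. by rewrite s2E divr_ge0 ?(ltW CL0)// mulr_ge0// ltW. Qed.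
Let eps0 : 0 < eps. Proof. by rewrite epsE; exact: mulr_gt0. Qed.
Let B2 : 1 <= B ^+ 2. Proof. by rewrite exprn_ege1. Qed.

Let Ln : L <= n%:R * x ^+ 6.
Proof. by apply: (le_trans _ rate); rewrite ler_peMl// ltW. Qed.

Let BLn k : (k <= 6)%N -> B ^+ 2 * L <= n%:R * x ^+ (6 - k) * x ^+ k.
Proof. by move=> k6; rewrite -mulrA -exprD subnK. Qed.

Let sM : 8 * (s * tau ^+ 2) <= 1.
Proof.
suff -> : 8 * (s * tau ^+ 2) = 1 by [].
by rewrite tau2 sE; field; rewrite !gt_eqF.
Qed.

Let sv : 2 * (s * (2 * B ^+ 2)) <= t.
Proof.
have -> : 2 * (s * (2 * B ^+ 2)) = 4 * C2 * (B ^+ 2 * L) / (Nn * t).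
  by rewrite sE; field; rewrite !gt_eqF.
rewrite ler_pdivrMr ?mulr_gt0//.
have h1 := ler_wpM2l (ltW C20) (BLn (isT : (2 <= 6)%N)).
have h2 : C2 * x ^+ 2 <= (12^-1 * 128^-1).
  apply: (@le_trans _ _ (C2 * x)); last by move: smallCx; lra.
  by rewrite ler_pM2l// exprS ler_piMr ?(ltW x0)// exprn_ile1// ltW.
have nx4 : 0 <= n%:R * x ^+ 4 by rewrite mulr_ge0 ?(ltW nR)// exprn_ge0// (ltW x0).
have h3 := ler_wpM2l nx4 h2.
have h4 := ler_wpM2r (exprn_ge0 4 (ltW x0)) NnE.
rewrite tE; move: h1 h3 h4; rewrite /=; nra.
Qed.

Let N96 : 96 * C2 * L <= Nn.
Proof.
apply: le_trans NnE; rewrite ler_pdivlMr//.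
have h : C2 * x ^+ 6 <= (12^-1 * 128^-1).
  apply: (@le_trans _ _ (C2 * x)); last by move: smallCx; lra.
  by rewrite ler_pM2l// exprS ler_piMr ?(ltW x0)// exprn_ile1// ltW.
have := ler_wpM2l (ltW C20) Ln; have := ler_wpM2l (ltW nR) h; move: nR; lra.
Qed.

Let s2M : 8 * (s2 * tau) <= 1.
Proof.
have e : (8 * (s2 * tau)) ^+ 2 = 16 * C2 * L / Nn.
  by rewrite [LHS]exprMn [(s2 * _) ^+ 2]exprMn tau2 s2E t2E tE; field; rewrite !gt_eqF.
have h : (8 * (s2 * tau)) ^+ 2 <= 1 ^+ 2.
  rewrite e expr1n ler_pdivrMr// mul1r; move: N96 CL0; lra.
by move: h; rewrite ler_sqr ?nnegrE// !mulr_ge0// (ltW tau0).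
Qed.

Let s2v : 2 * (s2 * (2 * B ^+ 2)) <= t2.
Proof.
have -> : 2 * (s2 * (2 * B ^+ 2)) = 4 * C2 * (B ^+ 2 * L) / (Nn * t2).
  by rewrite s2E; field; rewrite !gt_eqF.
rewrite ler_pdivrMr ?mulr_gt0//.
have h1 := ler_wpM2l (ltW C20) (BLn (isT : (4 <= 6)%N)).
have h2 : C2 * x ^+ 4 <= (12^-1 * 128^-1).
  apply: (@le_trans _ _ (C2 * x)); last by move: smallCx; lra.
  by rewrite ler_pM2l// exprS ler_piMr ?(ltW x0)// exprn_ile1// ltW.
have nx2 : 0 <= n%:R * x ^+ 2 by rewrite mulr_ge0 ?(ltW nR)// exprn_ge0// (ltW x0).
have h3 := ler_wpM2l nx2 h2.
have h4 := ler_wpM2r (exprn_ge0 2 (ltW x0)) NnE.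
rewrite t2E; move: h1 h3 h4; rewrite /=; nra.
Qed.

(** Lets the single tail bound at level [u] serve for the truncation at [tau] as well. *)
Let u_tau : u <= tau.
Proof.
rewrite uE tauE; apply: ler_wsqrtr; rewrite ler_pdivlMr; last exact: mulr_gt0.
have h := ler_wpM2r (exprn_ge0 2 (ltW x0)) NnE.
have h2 : 0 <= n%:R * x ^+ 2 by rewrite mulr_ge0 ?(ltW nR)// exprn_ge0// (ltW x0).
have := ler_wpM2l h2 smallC; rewrite tE; nra.
Qed.

Let u2_ge : B ^+ 2 <= u ^+ 2.
Proof.
rewrite u2; apply: (le_trans (ler_peMr (sqr_ge0 B) L1)).
apply: (le_trans rate); rewrite mulrC ler_wpM2r ?(ltW nR)//.
by rewrite -[leRHS]mulr1 (exprD x 3 3) ler_wpM2l ?(ltW x30)// exprn_ile1 ?(ltW x0).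
Qed.

Let tau1 : 1 <= tau.
Proof.
rewrite (le_trans _ u_tau)// -(@ler_sqr _ 1) ?nnegrE ?(ltW u0)// expr1n.
exact: le_trans B2 u2_ge.
Qed.

Let n2 : n%:R / 2 <= n%:R - 1 :> R.
Proof.
have : 4 <= n%:R :> R by rewrite ler_nat.
lra.
Qed.
Let n10 : 0 < n%:R - 1 :> R. Proof. by move: n2 nR; lra. Qed.

(** The budget of [cov_good]: [4 r + t] takes [3 / 16] of [x^2], the square takes a quarter, and
    what is of order [x^3] is negligible because [x] is at most [1 / (96 * 128)]. *)
Let delta_le : 4 * r + t + 4 * eps + (1 + 2 * u ^+ 2) / (n%:R - 1) +
  (r / tau + t2 + eps / tau) ^+ 2 <= x ^+ 2.
Proof.
have eps_le : eps <= x ^+ 3 by rewrite epsE ler_piMl// ltW.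
have x3 : (96 * 128) * x ^+ 3 <= x ^+ 2.
  by rewrite (exprSr x 2) mulrCA ler_piMr// sqr_ge0.
have x2 : (96 * 128) * x ^+ 2 <= x.
  by rewrite (expr2 x) mulrCA ler_piMr// ltW.
have nx : 1 <= x ^+ 3 * n%:R by rewrite -u2 (le_trans B2 u2_ge).
have h1 : (1 + 2 * u ^+ 2) / (n%:R - 1) <= 6 * x ^+ 3.
  rewrite ler_pdivrMr// u2; have := ler_wpM2l (ltW x30) n2; lra.
have itau : tau^-1 <= 1 by rewrite invf_le1.
have h2 : r / tau + t2 + eps / tau <= x / 2.
  have := ler_wpM2l (ltW r0) itau; have := ler_wpM2l (ltW eps0) itau.
  rewrite !mulr1 rE t2E; move: eps_le x3 x2 x0; lra.
have h3 : (r / tau + t2 + eps / tau) ^+ 2 <= (x / 2) ^+ 2.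
  rewrite ler_sqr ?nnegrE ?divr_ge0 ?(ltW x0)//.
  by rewrite !addr_ge0 ?divr_ge0 ?(ltW r0) ?(ltW tau0) ?(ltW t20) ?(ltW eps0).
apply: le_trans (lerD (lerD (lexx _) h1) h3) _.
rewrite expr_div_n rE tE; move: eps_le x3; have := exprn_ge0 2 (ltW x0); lra.
Qed.

Section event.
Context d (T : measurableType d) (J : finType).
Hypotheses (J0 : (0 < #|J|)%N) (J2 : 2 * #|J|%:R <= expR L).

Let expsN : expR (- (s * Nn * t / 2)) = expR (- ((K + 4) * L)).
Proof. by congr (expR (- _)); rewrite sE C2E; field; rewrite !gt_eqF. Qed.
Let exps2N : expR (- (s2 * Nn * t2 / 2)) = expR (- ((K + 4) * L)).
Proof. by congr (expR (- _)); rewrite s2E C2E; field; rewrite !gt_eqF. Qed.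

(** The shares are [gam / 8], [gam / 8], [gam / 4] and [gam / 8]. The union bounds use
    [2 #|J| expR (- L) <= 1], the Markov terms use [eps = gam x^3]. *)
Let pr_bad_le (E : R) : E <= eps ->
  #|J|%:R ^+ 2 * (2 * expR (- (s * Nn * t / 2))) + #|J|%:R * (2 * expR (- (s2 * Nn * t2 / 2))) +
  (E / u ^+ 2 + eps / r) <= gam.
Proof.
move=> Ee; rewrite expsN exps2N.
have -> : expR (- ((K + 4) * L)) = expR (- (K * L)) * expR (- L) ^+ 4.
  by rewrite -expRM_natl -expRD; congr expR; rewrite -[_ *+ _]mulr_natl; ring.
set m : R := #|J|%:R; set y := expR (- L).
have m1 : 1 <= m by rewrite ler1n.
have my : 2 * (m * y) <= 1.
  by move: J2; rewrite -/m -(ler_pM2r (expR_gt0 (- L))) -expRD subrr expR0 mulrA.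
have y0 : 0 <= y by exact: expR_ge0.
have g0 := expR_ge0 (- (K * L)).
have yh : 2 * y <= 1 by have := ler_wpM2r y0 m1; lra.
have my0 : 0 <= m * y by rewrite mulr_ge0//; lra.
have p1 : (m * y) ^+ 2 <= 4^-1 by nra.
have p2 : y ^+ 2 <= 4^-1 by nra.
have a1 : m ^+ 2 * y ^+ 4 <= 16^-1.
  by rewrite (_ : m ^+ 2 * y ^+ 4 = (m * y) ^+ 2 * y ^+ 2); [have := sqr_ge0 (m * y); have := sqr_ge0 y; nra|ring].
have a2 : m * y ^+ 4 <= 16^-1.
  rewrite (_ : m * y ^+ 4 = (m * y) * y * y ^+ 2); last by ring.
  have : m * y * y <= 4^-1 by nra.
  have : 0 <= m * y * y by rewrite mulr_ge0.
  have := sqr_ge0 y; nra.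
have b1 : m ^+ 2 * (2 * (expR (- (K * L)) * y ^+ 4)) <= gam / 8.
  rewrite (_ : m ^+ 2 * _ = 2 * (expR (- (K * L)) * (m ^+ 2 * y ^+ 4))); last by ring.
  have : 0 <= m ^+ 2 * y ^+ 4 by rewrite mulr_ge0 ?exprn_ge0//; lra.
  move: a1 g0 gamL; set z := m ^+ 2 * _; nra.
have b2 : m * (2 * (expR (- (K * L)) * y ^+ 4)) <= gam / 8.
  rewrite (_ : m * _ = 2 * (expR (- (K * L)) * (m * y ^+ 4))); last by ring.
  have : 0 <= m * y ^+ 4 by rewrite mulr_ge0 ?exprn_ge0//; lra.
  move: a2 g0 gamL; set z := m * _; nra.
have n4R : 4 <= n%:R :> R by rewrite ler_nat.
have b3 : E / u ^+ 2 <= gam / 4.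
  apply: (@le_trans _ _ (eps / u ^+ 2)); first by rewrite ler_wpM2r// invr_ge0 sqr_ge0.
  rewrite u2 epsE invfM mulrA mulfK ?gt_eqF// ler_wpM2l ?(ltW gam0)// lef_pV2 ?posrE//; lra.
have b4 : eps / r <= gam / 8.
  rewrite (_ : eps / r = gam * (64 * x)); last by rewrite epsE rE; field; rewrite gt_eqF.
  rewrite ler_wpM2l ?(ltW gam0)//; move: smallx; lra.
by move: b1 b2 b3 b4 gam0; rewrite -/m; lra.
Qed.


Variables (F : probability T R) (Q : probability (n.-tuple T) R).
Hypothesis FQ : prodlike F Q.
Variables (N : probability R R) (G : probability (n.-tuple R) R).
Hypotheses (NS : std_normal N) (NG : prodlike N G).
Let FF := (F \x F : probability _ _)%E.
Variable h : T -> T -> J -> R.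
Hypothesis mh : forall j, measurable_fun setT (fun z : T * T => h z.1 z.2 j).
Hypothesis hsym : forall y z, h y z = h z y.
Hypothesis ih4x : forall y, intg F (fun z => supn (h y z) ^+ 4).
Hypothesis ih4 : intg FF (fun z => supn (h z.1 z.2) ^+ 4).
Hypothesis hmean : forall j, Ex FF (fun z => h z.1 z.2 j) = 0.
Hypothesis h3 : forall j, Ex FF (fun z => `|h z.1 z.2 j| ^+ 3) <= B.
Hypothesis h4 : forall j, Ex FF (fun z => h z.1 z.2 j ^+ 4) <= B ^+ 2.
Hypothesis var1 : forall j, Ex F (fun y => proj F h y j ^+ 2) = 1.
Hypothesis htail : Ex FF (fun z => tailsq h u z.1 z.2) <= eps.

Let n3 : (3 <= n)%N := ltnW n4.
Let ih2 : intg FF (fun z => supn (h z.1 z.2) ^+ 2) := h_intg2_pow mh ih4 (isT : (2 <= 4)%N).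
Let ihj4 j : intg FF (fun z => h z.1 z.2 j ^+ 4).
Proof.
have := h_intg2_abs mh ih4 j (isT : (4 <= 4)%N); congr intg; apply/funext => z.
by rewrite -normrX ger0_norm// (exprM _ 2 2) sqr_ge0.
Qed.

Let htailtau : Ex FF (fun z => tailsq h tau z.1 z.2) <= eps.
Proof.
by apply: (le_trans _ htail); apply: Ex_le => [||z]; [exact: tailsq_intg2|exact: tailsq_intg2|exact: tailsq_antimono].
Qed.

Let bad : set (n.-tuple T) := cov_bad F h t t2 r u tau.

Lemma core_event : measurable bad /\ pr Q bad <= gam.
Proof.
split; first exact: measurable_cov_bad.
apply: (le_trans (pr_cov_bad FQ n3 mh ih2 ihj4 h4 B1 r0 u0 tau0 s0 s20 sM sv s2M s2v htailtau)).
by rewrite -NE; exact: pr_bad_le.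
Qed.

Let iproj2 j : intg F (fun y => proj F h y j ^+ 2).
Proof.
apply: (@intg_dom _ _ _ _ _ (fun y => supn (proj F h y) ^+ 2)).
- by apply: measurable_funX; exact: measurable_proj.
- exact: (proj_supn2_intg mh ih4x ih4).1.
- by move=> y; rewrite ger0_norm ?sqr_ge0// -real_normK ?num_real// ler_sqr ?nnegrE ?supn_ge0// le_supn.
Qed.

Let cov1 j k : `|Ex F (fun y => proj F h y j * proj F h y k)| <= 1.
Proof.
have iD : intg F (fun y => 2^-1 * (proj F h y j ^+ 2 + proj F h y k ^+ 2)).
  by apply: intgZ; exact: intgD.
have le y : `|proj F h y j * proj F h y k| <= 2^-1 * (proj F h y j ^+ 2 + proj F h y k ^+ 2).
  rewrite ler_norml; have := sqr_ge0 (proj F h y j + proj F h y k); have := sqr_ge0 (proj F h y j - proj F h y k).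
  by move: (proj F h y j) (proj F h y k) => a c *; apply/andP; split; nra.
have iM : intg F (fun y => proj F h y j * proj F h y k).
  by apply: (intg_dom _ iD le); apply: measurable_funM; exact: measurable_proj.
apply: (le_trans (Ex_abs_le iM iD le)).
by rewrite ExZ ?ExD ?var1//; [lra|exact: intgD].
Qed.

Section good.
Variable y : n.-tuple T.
Hypothesis good : ~ bad y.
Let a := acoef h y.

Lemma acoef_cov j k : `|\sum_i a i j * a i k - Ex F (fun z => proj F h z j * proj F h z k)| <= x ^+ 2.
Proof.
rewrite -(proj_cov mh ih4x ih4); apply: (le_trans _ delta_le).
have c1 i l : `|Ex (F \x F \x F)%E (fun z => h z.1.1 z.1.2 i * h z.1.1 z.2 l)| <= 1.
  by rewrite (proj_cov mh ih4x ih4); exact: cov1.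
exact: (cov_good n3 mh ih2 hmean c1 u0 tau0 htailtau j k good).
Qed.

Let avar j : 2^-1 <= \sum_i a i j ^+ 2 <= 2.
Proof.
have := acoef_cov j j; under [X in Ex _ X]eq_fun do rewrite -expr2.
under eq_bigr do rewrite -expr2.
rewrite var1 ler_norml.
have : x ^+ 2 <= 2^-1.
  apply: (@le_trans _ _ x); first by rewrite expr2 ler_piMr// ltW.
  by move: smallx; lra.
by move=> ? /andP[? ?]; apply/andP; split; lra.
Qed.


Let l := Num.sqrt L.
Let l1 : 1 <= l. Proof. by rewrite -(sqrtr1 R) ler_wsqrtr. Qed.
Let l2 : l ^+ 2 = L. Proof. by rewrite sqr_sqrtr// ltW. Qed.
Let l0 : 0 < l. Proof. exact: lt_le_trans ltr01 l1. Qed.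
Let Kc := swap_const R.
Let Kc0 : 0 <= Kc := (swap_const_ge R).1.
(** [beta] carries the factor [1 / C1], so the covariance and third-moment parts of [k1_small] scale
    as [Kc / C1^2] and [Kc / C1^3]; a large [C1] pushes both below their share. *)
Let C1 := 20 + 64 * Kc.
Let C120 : 20 <= C1. Proof. by rewrite /C1; move: Kc0; lra. Qed.
Let C10 : 0 < C1. Proof. by move: C120; lra. Qed.
Let beta := 2 * l / (C1 * x).
Let delta := C1 * (x * l).
Let eta := x * l.
Let sn := Num.sqrt n%:R : R.
Let sn0 : 0 < sn. Proof. by rewrite sqrtr_gt0. Qed.
Let sn2 : sn ^+ 2 = n%:R. Proof. by rewrite sqr_sqrtr// ltW. Qed.
Let snE : B * l <= sn * x ^+ 3.
Proof.
have x3 := ltW x30.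
have B0 : 0 <= B := le_trans ler01 B1.
have hB : (B * l) ^+ 2 <= (sn * x ^+ 3) ^+ 2.
  rewrite (_ : (B * l) ^+ 2 = B ^+ 2 * L); last by rewrite -l2; ring.
  by rewrite (_ : (sn * x ^+ 3) ^+ 2 = n%:R * x ^+ 6) // -sn2; ring.
by move: hB; rewrite ler_sqr ?nnegrE// mulr_ge0 ?(ltW sn0) ?(ltW l0).
Qed.
Let beta0 : 0 < beta. Proof. by apply: divr_gt0; apply: mulr_gt0. Qed.
Let delta0 : 0 < delta. Proof. by rewrite !mulr_gt0. Qed.
Let eta0 : 0 < eta. Proof. exact: mulr_gt0. Qed.
Let ibeta : beta^-1 = C1 * x / (2 * l). Proof. by rewrite /beta invf_div. Qed.
Let bd : beta * delta = 2 * L.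
Proof. by rewrite /beta /delta -l2; field; rewrite !gt_eqF. Qed.
Let D := x ^+ 2 / n%:R.
Let m3 := 48 * B * sn^-1 ^+ 3.
Let tau1' := 4 / n%:R * eps.
Let tau2' := 4 * #|J|%:R / n%:R * expR (4 - sn / beta).

(** The powers of [x], [L] and [n] cancel: the covariance part depends on [C1] alone, the
    third-moment part also on [B l / (sn x^3)], which the rate condition bounds by one. *)
Let k1_small : 8 * (n%:R * (Kc / (beta * delta) * (beta ^+ 2 * D + 2 * beta ^+ 3 * m3))) <= 1.
Proof.
have e1 : 8 * (n%:R * (Kc / (beta * delta) * (beta ^+ 2 * D))) = 16 * (Kc / C1 ^+ 2).
  by rewrite bd /beta /D -l2; field; rewrite !gt_eqF.
have e2 : 8 * (n%:R * (Kc / (beta * delta) * (2 * beta ^+ 3 * m3))) =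
    (24 * 128) * (Kc / C1 ^+ 3) * (B * l / (sn * x ^+ 3)).
  by rewrite bd /beta /m3 -l2 -sn2; field; rewrite !gt_eqF.
have e3 : B * l / (sn * x ^+ 3) <= 1 by rewrite ler_pdivrMr; [rewrite mul1r; exact: snE|exact: mulr_gt0].
have C64 : 64 * Kc <= C1 by rewrite /C1; lra.
have q2 : Kc / C1 ^+ 2 <= (10^-1 * 128^-1).
  by rewrite ler_pdivrMr ?exprn_gt0//; move: C120 C64 Kc0; nra.
have q3 : Kc / C1 ^+ 3 <= 20^-1 * (10^-1 * 128^-1).
  rewrite ler_pdivrMr ?exprn_gt0//.
  have : 400 <= C1 ^+ 2 by move: C120; nra.
  by move: C64 Kc0; rewrite (exprSr C1 2); nra.
have q30 : 0 <= Kc / C1 ^+ 3 by rewrite divr_ge0// exprn_ge0// ltW.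
rewrite mulrDr mulrDr mulrDr e1 e2.
have : (24 * 128) * (Kc / C1 ^+ 3) * (B * l / (sn * x ^+ 3)) <= (24 * 128) * (Kc / C1 ^+ 3).
  have c0 : 0 <= (24 * 128) * (Kc / C1 ^+ 3) by move: q30; lra.
  exact: (ler_piMr c0 e3).
by move: q2 q3; lra.
Qed.

Let ntau1 : n%:R * (beta ^+ 2 * tau1') <= x * L.
Proof.
have -> : n%:R * (beta ^+ 2 * tau1') = 16 / C1 ^+ 2 * gam * (x * L).
  by rewrite /tau1' /beta epsE -l2; field; rewrite !gt_eqF.
rewrite ler_piMl ?(ltW xL0)//.
have h16 : 16 / C1 ^+ 2 <= 1 by rewrite ler_pdivrMr ?exprn_gt0//; move: C120; nra.
by rewrite (le_trans _ gam1)// ler_piMl// ltW.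
Qed.

Let tau1_small : beta ^+ 2 * tau1' <= 2^-1.
Proof.
rewrite -(ler_pM2l nR); apply: (le_trans ntau1); apply: (@le_trans _ _ 1); first by move: smallw; lra.
have : 4 <= n%:R :> R by rewrite ler_nat.
lra.
Qed.

(** [sqrt n / beta] is at least ten times [X = x^-2], and [X] also dominates [L]. Hence the Gaussian
    tail swallows the factors [L], [X] and [#|J| <= expR X]. *)
Let ntau2 : n%:R * (beta ^+ 2 * tau2') <= x * L.
Proof.
pose X := (x ^+ 2)^-1.
have x20 : 0 < x ^+ 2 by rewrite exprn_gt0.
have X0 : 0 < X by rewrite invr_gt0.
have xX : x ^+ 2 * X = 1 by rewrite mulfV// gt_eqF.
have X1 : 1 <= X by rewrite invf_ge1// exprn_ile1// ltW.
have LX : L <= X.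
  rewrite -[leRHS]mul1r ler_pdivlMr// mulrC expr2 -mulrA.
  by rewrite (le_trans (ler_piMl (ltW xL0) x1))//; move: smallw xL0; lra.
have sb : 10 * X <= sn / beta.
  rewrite ibeta mulrA ler_pdivlMr ?mulr_gt0//.
  have hs : l <= sn * x ^+ 3 by rewrite (le_trans _ snE)// ler_peMl// ltW.
  have hh : X * l <= sn * x.
    rewrite -(ler_pM2l x20) mulrA xX mul1r (le_trans hs)// (exprSr x 2); lra.
  by move: (ler_wpM2r (mulr_ge0 (ltW sn0) (ltW x0)) C120) hh; nra.
have ce : 16 / C1 ^+ 2 <= 1 by rewrite ler_pdivrMr ?exprn_gt0//; move: C120; nra.
have -> : n%:R * (beta ^+ 2 * tau2') = 16 / C1 ^+ 2 * (L * X * #|J|%:R * expR (4 - sn / beta)).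
  by rewrite /tau2' /X {1}/beta -l2; field; rewrite !gt_eqF.
have Je : #|J|%:R <= expR X :> R.
  have : expR L <= expR X by rewrite ler_expR.
  by have := ler0n R #|J|; move: J2; lra.
have e1 : expR (4 - sn / beta) <= expR (- (6 * X)).
  by rewrite ler_expR; move: sb X1; lra.
have XE : X <= expR X by move: (expR_ge1Dx X); lra.
have h0 : 0 <= L * X * #|J|%:R * expR (4 - sn / beta) by rewrite !mulr_ge0 ?expR_ge0 ?(ltW L0) ?(ltW X0).
apply: (le_trans (ler_piMl h0 ce)).
apply: (@le_trans _ _ (X * X * expR X * expR (- (6 * X)))).
  apply: ler_pM => //; rewrite ?expR_ge0 ?mulr_ge0 ?(ltW L0) ?(ltW X0)//.
  apply: ler_pM => //; rewrite ?mulr_ge0 ?(ltW L0) ?(ltW X0)//.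
  by rewrite ler_wpM2r// ltW.
apply: (@le_trans _ _ (x ^+ 2)); last first.
  by rewrite (le_trans _ xL)// expr2 ler_piMr// ltW.
rewrite -(ler_pM2r X0) xX.
have -> : expR (- (6 * X)) = expR (- X) ^+ 6 by rewrite -expRM_natl; congr expR; rewrite mulrN.
have i1 : expR X * expR (- X) = 1 by rewrite -expRD subrr expR0.
have p0 := expR_gt0 X; have q0 := expR_gt0 (- X).
have Xq : X * expR (- X) <= 1 by rewrite -i1 ler_pM2r.
have Xq0 : 0 <= X * expR (- X) by rewrite mulr_ge0 ?(ltW X0)// ltW.
have q1 : expR (- X) <= 1 by rewrite -expR0 ler_expR; move: X0; lra.
rewrite (_ : X * X * expR X * expR (- X) ^+ 6 * X = (X * expR (- X)) ^+ 3 * (expR X * expR (- X)) * (expR (- X) ^+ 2)); last by ring.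
by rewrite i1 mulr1 mulr_ile1 ?exprn_ge0 ?exprn_ile1// ltW.
Qed.


Let JL : #|J|%:R <= expR L.
Proof. by have := ler0n R #|J|; move: J2; lra. Qed.

Let swap1 : swappable beta F (fun y j => sn^-1 * proj F h y j) m3 tau1'.
Proof.
have ub : u <= sn / beta / 2.
  suff hu : u ^+ 2 <= (sn / beta / 2) ^+ 2.
    by move: hu; rewrite ler_sqr ?nnegrE ?(ltW u0)// divr_ge0// divr_ge0// ltW.
  rewrite u2 ibeta.
  have -> : (sn * (C1 * x / (2 * l)) / 2) ^+ 2 = n%:R * (C1 ^+ 2 * x ^+ 2 / (16 * L)).
    by rewrite -sn2 -l2; field; rewrite gt_eqF.
  rewrite mulrC ler_wpM2l ?(ltW nR)// ler_pdivlMr ?mulr_gt0//.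
  have x20 : 0 < x ^+ 2 by rewrite exprn_gt0.
  have -> : x ^+ 3 * (16 * L) = 16 * (x * L) * x ^+ 2 by ring.
  by rewrite ler_pM2r//; move: smallw C120; nra.
have he : Ex FF (fun z => tailsq h (sn / beta / 2) z.1 z.2) <= eps.
  by apply: (le_trans _ htail); apply: Ex_le => [||z]; [exact: tailsq_intg2|exact: tailsq_intg2|exact: tailsq_antimono].
case: (proj_swappable (ltnW (ltnW n3)) mh ih4x ih4 hmean beta0 h3 he) => mz i2 i3 m0 th tl.
split => // j; apply: (le_trans (th j)); rewrite /m3.
have s3 : 0 <= sn^-1 ^+ 3 by rewrite exprn_ge0// invr_ge0 ltW.
have := ler_wpM2r s3 B1; move: (le_trans ler01 B1); nra.
Qed.

Let vle j : \sum_i a i j ^+ 2 <= 2. Proof. by case/andP: (avar j). Qed.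
Let vge j : 2^-1 <= \sum_i a i j ^+ 2. Proof. by case/andP: (avar j). Qed.

Let swap2 : swappable beta G (fun e j => sn^-1 * gaussv a e j) m3 tau2'.
Proof.
case: (gaussv_swappable NS NG (ltnW (ltnW n3)) J0 beta vle) => mz i2 i3 m0 th tl.
split => // j; apply: (le_trans (th j)); rewrite /m3.
have s3 : 0 <= sn^-1 ^+ 3 by rewrite exprn_ge0// invr_ge0 ltW.
by rewrite ler_wpM2r// ler_peMr.
Qed.

Let covD j k : `|Ex F (fun z => (sn^-1 * proj F h z j) * (sn^-1 * proj F h z k)) -
  Ex G (fun e => (sn^-1 * gaussv a e j) * (sn^-1 * gaussv a e k))| <= D.
Proof.
have iM : intg F (fun z => proj F h z j * proj F h z k).
  have iD : intg F (fun y => proj F h y j ^+ 2 + proj F h y k ^+ 2) by exact: intgD.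
  apply: (intg_dom _ iD); first by apply: measurable_funM; exact: measurable_proj.
  by move=> z; rewrite ler_norml; move: (proj F h z j) (proj F h z k) => b c; apply/andP; split; nra.
have e1 : Ex F (fun z => (sn^-1 * proj F h z j) * (sn^-1 * proj F h z k)) = n%:R^-1 * Ex F (fun z => proj F h z j * proj F h z k).
  rewrite -ExZ//; apply: eq_Ex => z; rewrite -sn2; field; exact: lt0r_neq0.
have e2 : Ex G (fun e => (sn^-1 * gaussv a e j) * (sn^-1 * gaussv a e k)) = n%:R^-1 * \sum_i a i j * a i k.
  rewrite -(linf_cov NS NG (fun i => a i j) (fun i => a i k)) -ExZ; last exact: (linf_cov_intg NS NG).
  apply: eq_Ex => e; rewrite /gaussv -sn2; field; exact: lt0r_neq0.
rewrite e1 e2 -mulrBr normrM ger0_norm ?invr_ge0 ?(ltW nR)// /D mulrC ler_wpM2r ?invr_ge0 ?(ltW nR)//.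
by rewrite distrC acoef_cov.
Qed.

Let A0 := 20 * l.
Let A1 := 80 * l / beta.

Let anti p (p0 : forall j, 0 < p j) s' w : 0 <= w ->
  pr G [set e | s' <= smax beta p (gaussv a e) <= s' + w] <= A0 * w + A1.
Proof.
move=> w0; have m1 := gaussv_supn_mean NS NG J0 L0 J2 vle.
apply: (le_trans (gaussv_anticoncentration NS NG J0 beta0 p0 vge m1 s' w0)).
by rewrite le_eqVlt; apply/orP; left; apply/eqP; rewrite /A0 /A1 -/l; field; rewrite gt_eqF.
Qed.

(** The exponent of [pnorm2] must be an integer above [ln #|J|] and of order [L]. *)
Let kk := (Num.truncn L).+1.
Let kkL : L <= kk%:R /\ kk%:R <= 2 * L.
Proof.
have /andP[k1 k2] := truncn_itv (ltW L0).
by split; [exact: ltW|rewrite /kk -natr1; move: k1 L1; lra].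
Qed.

Let Jkk : #|J|%:R <= expR kk%:R :> R.
Proof. by apply: (le_trans JL); rewrite ler_expR; exact: kkL.1. Qed.

Let e8 : (8 * expR 1 * kk%:R) ^+ 2 <= (64 * 64) * L ^+ 2.
Proof.
have -> : (64 * 64) * L ^+ 2 = (64 * L) ^+ 2 by ring.
rewrite ler_sqr ?nnegrE ?mulr_ge0 ?expR_ge0 ?(ltW L0)//.
by have := expR1_le4 R; have := expR_gt0 (1 : R); case: kkL; move: L0; nra.
Qed.

Let un : u ^+ 2 / ((n%:R - 1) * eta ^+ 2) <= 2 * x / L.
Proof.
rewrite u2 /eta exprMn l2 ler_pdivrMr ?mulr_gt0 ?exprn_gt0//.
have -> : 2 * x / L * ((n%:R - 1) * (x ^+ 2 * L)) = 2 * (n%:R - 1) * x ^+ 3 by field; rewrite gt_eqF.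
by rewrite mulrC ler_wpM2r ?(ltW x30)//; move: n2; lra.
Qed.

Let sup2 : Ex FF (fun z => supn (h z.1 z.2) ^+ 2) <= 2 * u ^+ 2.
Proof.
have it := tailsq_intg2 mh ih4 u.
apply: (@le_trans _ _ (Ex FF (fun z => u ^+ 2 + tailsq h u z.1 z.2))).
  by apply: Ex_le => [||z] //; [apply: intgD => //; exact: intg_cst|rewrite supn_sqr_le// ltW].
rewrite ExD ?Ex_cst//; last exact: intg_cst.
have : eps <= u ^+ 2.
  rewrite u2 epsE mulrC ler_wpM2l ?(ltW x30)// (le_trans gam1)// ler1n; exact: ltnW (ltnW n3).
by move: htail; lra.
Qed.

(** The shift [th] stands for the mean removed from the kernel. A constant cancels in [acoef] but
    not in the chaos, so the chaos is formed with the shifted kernel. *)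
Lemma core_compare (th c : J -> R) : (forall j, `|th j| <= B) ->
  `|pr Q [set z | forall j, sn * Ustat h z j / 2 <= c j] -
    pr G [set e | forall j, gaussv a e j +
      chaos (fun i l j => h (tnth y i) (tnth y l) j + th j) e j <= c j]| <=
  (335 * (20 + 64 * swap_const R) + 4 * swap_const R + 28 * (64 * 64) + 40) * (x * L).
Proof.
move=> thB; set ch := chaos _.
pose p j := expR (- (beta * c j)).
have p0 j : 0 < p j by exact: expR_gt0.
have l1' : 1 <= beta * delta by rewrite bd; move: L1; lra.
have A00 : 0 <= A0 by rewrite mulr_ge0// ltW.
have A10 : 0 <= A1 by rewrite divr_ge0 ?(ltW beta0)// mulr_ge0// ltW.
have lind := lindeberg FQ NS NG (ltnW (ltnW n3)) J0 beta0 delta0 l1' p0 swap1 swap2 covD A00 A10 (anti p0) k1_small tau1_small.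
pose Dg (z : n.-tuple T) j := sn / (n%:R * (n%:R - 1)) * \sum_(b < n) \sum_(i < n | (i < b)%N)
  (h (tnth z i) (tnth z b) j - proj F h (tnth z i) j - proj F h (tnth z b) j).
have u20 : 0 <= 2 * u ^+ 2 by rewrite mulr_ge0// sqr_ge0.
have [mDg pDg] := degenerate_part_tail n3 FQ mh hsym ih4x ih4 hmean (isT : (0 < kk)%N) Jkk sup2 eta0 u20.
have den : 0 < (n%:R - 1) * eta ^+ 2 by rewrite mulr_gt0// exprn_gt0.
have bound (v : R) : 0 <= v -> (8 * expR 1 * kk%:R) ^+ 2 * (v * u ^+ 2) / ((n%:R - 1) * eta ^+ 2) <= (64 * 64) * (2 * v) * (x * L).
  move=> v0; rewrite -mulrA.
  have q0 : 0 <= u ^+ 2 / ((n%:R - 1) * eta ^+ 2) by rewrite divr_ge0 ?sqr_ge0// ltW.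
  have q1 : v * u ^+ 2 / ((n%:R - 1) * eta ^+ 2) <= v * (2 * x / L).
    by rewrite -mulrA ler_wpM2l.
  have q2 : 0 <= v * u ^+ 2 / ((n%:R - 1) * eta ^+ 2) by rewrite -mulrA mulr_ge0.
  apply: (le_trans (ler_wpM2r q2 e8)); apply: (le_trans (ler_wpM2l _ q1)).
    by have := sqr_ge0 L; lra.
  by rewrite le_eqVlt; apply/orP; left; apply/eqP; field; rewrite gt_eqF.
have D1 : pr Q [set z | eta < supn (Dg z)] <= (64 * 64) * 18 * (x * L).
  apply: (le_trans pDg); rewrite (_ : _ / _ = (8 * expR 1 * kk%:R) ^+ 2 * (9 * u ^+ 2) / ((n%:R - 1) * eta ^+ 2)).
    by apply: (le_trans (bound 9 _)) => //; rewrite ler_wpM2r ?(ltW xL0)//; lra.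
  by field; rewrite !gt_eqF.
(* Here [5 = 2 * 2 + 1]: twice the bound [2 u^2] for the kernel, and [B^2 <= u^2] for the shift,
   which is counted over half of the ordered pairs. *)
have hc : \sum_(b < n) \sum_(i < n | (i < b)%N) supn (fun j => h (tnth y i) (tnth y b) j + th j) ^+ 2 <= n%:R * (n%:R - 1) * (5 * u ^+ 2).
  have hs : \sum_(b < n) \sum_(i < n | i != b) supn (h (tnth y b) (tnth y i)) ^+ 2 <= n%:R * (n%:R - 1) * (2 * u ^+ 2).
    by have := cov_good_sup n3 u0 good; rewrite /ustat2 ler_pdivrMl// mulr_gt0.
  have thn : supn th <= B by apply: supn_le => //; exact: le_trans ler01 B1.
  apply: (@le_trans _ _ (\sum_(b < n) (2 * \sum_(i < n | i != b) supn (h (tnth y b) (tnth y i)) ^+ 2 +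
      2 * B ^+ 2 * \sum_(i < n | (i < b)%N) 1))).
    apply: ler_sum => b _; rewrite mulr_sumr mulr_sumr.
    apply: (@le_trans _ _ (\sum_(i < n | (i < b)%N) (2 * supn (h (tnth y b) (tnth y i)) ^+ 2 + 2 * B ^+ 2 * 1))).
      apply: ler_sum => i _; rewrite mulr1 hsym.
      have := supn_triangle (h (tnth y b) (tnth y i)) th.
      have := supn_ge0 (h (tnth y b) (tnth y i)); have := supn_ge0 th.
      have := supn_ge0 (fun j => h (tnth y b) (tnth y i) j + th j).
      move: thn; set p1 := supn (fun j => _); set p2 := supn (h _ _); set p3 := supn th.
      move: p1 p2 p3 => p1 p2 p3 k1 k2 k3 k4 k5.
      have : p1 ^+ 2 <= (p2 + B) ^+ 2 by rewrite ler_sqr ?nnegrE//; lra.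
      have := sqr_ge0 (p2 - B); nra.
    rewrite big_split/= lerD2r [leRHS](bigID (fun i : 'I_n => (i < b)%N))/=.
    rewrite [X in X <= _](eq_bigl (fun i : 'I_n => (i != b) && (i < b)%N)).
      by rewrite lerDl sumr_ge0// => i _; rewrite mulr_ge0// sqr_ge0.
    by move=> i; case: (eqVneq i b) => [->|//]; rewrite ltnn.
  rewrite big_split/= -mulr_sumr -mulr_sumr card_pairs_lt.
  have : n%:R * (n%:R - 1) * B ^+ 2 <= n%:R * (n%:R - 1) * u ^+ 2 by rewrite ler_wpM2l// mulr_ge0// ltW.
  by move: hs; lra.
have [mch pch] := chaos_tail n3 NS NG (isT : (0 < kk)%N) Jkk hc eta0.
have D2 : pr G [set e | eta < supn (ch e)] <= (64 * 64) * 10 * (x * L).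
  by apply: (le_trans pch); apply: (le_trans (bound 5 _)) => //; rewrite ler_wpM2r ?(ltW xL0)//; lra.
pose S (z : n.-tuple T) j := \sum_i sn^-1 * proj F h (tnth z i) j.
have mS j : measurable_fun setT (fun z => S z j).
  apply: measurable_sum => i; apply: measurable_funM => //.
  exact: (measurableT_comp (measurable_proj mh ih4x ih4 j) (measurable_tnth i)).
have mDgj j : measurable_fun setT (fun z => Dg z j).
  apply: measurable_funM => //; apply: measurable_sum => b.
  under eq_fun do rewrite big_mkcond; apply: measurable_sum => i; case: (i < b)%N => //.
  have mp k : measurable_fun setT (fun z : n.-tuple T => proj F h (tnth z k) j).
    exact: (measurableT_comp (measurable_proj mh ih4x ih4 j) (measurable_tnth k)).
  apply: measurable_funB => //; apply: measurable_funB => //.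
  apply: (@measurableT_comp _ _ _ _ _ _ (fun z : T * T => h z.1 z.2 j) _ (fun z : n.-tuple T => (tnth z i, tnth z b))) => //.
  by apply/measurable_fun_pair => /=; exact: measurable_tnth.
have mchj j : measurable_fun setT (fun e => ch e j).
  apply: measurable_funM => //; apply: measurable_sum => b.
  under eq_fun do rewrite big_mkcond; apply: measurable_sum => i; case: (i < b)%N => //.
  by apply: measurable_funM => //; apply: measurable_funM; exact: measurable_tnth.
have mY j : measurable_fun setT (fun e => gaussv a e j) by exact: measurable_gaussv.
have := transfer_orthant J0 beta0 JL (ltW L0) eta0 mS mDgj mY mchj lind (anti p0) D1 D2.
have eS z j : sn * Ustat h z j / 2 = S z j + Dg z j by exact: hoeffding_decomposition.
rewrite (_ : [set z | forall j, S z j + Dg z j <= c j] = [set z | forall j, sn * Ustat h z j / 2 <= c j]); last first.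
  by apply/seteqP; split => z /= hz j; move: (hz j); rewrite eS.
move/le_trans; apply.
(* The interpolation contributes [275 C1 + 4 Kc], the transfer to orthants [60 C1 + 40], and the two
   second-order remainders [(18 + 10) * (64 * 64)]. *)
have b1 : A0 * delta = 20 * C1 * (x * L) by rewrite /A0 /delta -l2; ring.
have b2 : A0 * (5 / beta) = 50 * C1 * x by rewrite ibeta /A0; field; rewrite gt_eqF.
have b3 : A1 = 40 * C1 * x by rewrite /A1 ibeta; field; rewrite gt_eqF.
have b4 : A0 * eta = 20 * (x * L) by rewrite /A0 /eta -l2; ring.
have b5 : A0 * (L / beta) = 10 * C1 * (x * L) by rewrite ibeta /A0; field; rewrite gt_eqF.
have b6 : n%:R * (Kc * (beta ^+ 2 * (tau1' + tau2'))) <= Kc * (2 * (x * L)).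
  rewrite (_ : _ * (Kc * _) = Kc * (n%:R * (beta ^+ 2 * tau1') + n%:R * (beta ^+ 2 * tau2'))); last by ring.
  by rewrite ler_wpM2l//; move: ntau1 ntau2; lra.
have b7 : C1 * x <= C1 * (x * L) by rewrite ler_wpM2l// ltW.
rewrite b3 [A0 * (delta + _)]mulrDr b1 b2 [A0 * (2 * _)]mulrCA [A0 * (eta + _)]mulrDr b4 b5.
rewrite -/Kc -/C1; move: b6 b7; move: (n%:R * (Kc * _)) => q; lra.
Qed.

End good.
End event.
End core.

(* x is the target error divided by L, a bound for the logarithm of nd. *)
Lemma bootstrap_core (R : realType) d (T : measurableType d) (J : finType) n
    (F : probability T R) (Q : probability (n.-tuple T) R)
    (N : probability R R) (G : probability (n.-tuple R) R)
    (h : T -> T -> J -> R) (B K gam x L : R) :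
  prodlike F Q -> std_normal N -> prodlike N G ->
  (4 <= n)%N -> (0 < #|J|)%N -> 2 * #|J|%:R <= expR L ->
  1 <= B -> 1 <= L -> 0 <= K -> 0 < gam <= 1 -> expR (- (K * L)) <= gam ->
  0 < x -> (24 * 128) * ((K + 4) * (x * L)) <= 1 -> B ^+ 2 * L <= n%:R * x ^+ 6 ->
  (forall j, measurable_fun setT (fun z : T * T => h z.1 z.2 j)) ->
  (forall y z, h y z = h z y) ->
  (forall y, intg F (fun z => supn (h y z) ^+ 4)) ->
  intg (F \x F : probability _ _)%E (fun z => supn (h z.1 z.2) ^+ 4) ->
  (forall j, Ex (F \x F : probability _ _)%E (fun z => h z.1 z.2 j) = 0) ->
  (forall j, Ex (F \x F : probability _ _)%E (fun z => `|h z.1 z.2 j| ^+ 3) <= B) ->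
  (forall j, Ex (F \x F : probability _ _)%E (fun z => h z.1 z.2 j ^+ 4) <= B ^+ 2) ->
  (forall j, Ex F (fun y => proj F h y j ^+ 2) = 1) ->
  Ex (F \x F : probability _ _)%E (fun z => tailsq h (Num.sqrt (x ^+ 3 * n%:R)) z.1 z.2) <= gam * x ^+ 3 ->
  exists bad : set (n.-tuple T), [/\ measurable bad, pr Q bad <= gam &
    forall y, ~ bad y -> forall th c : J -> R, (forall j, `|th j| <= B) ->
    `|pr Q [set z | forall j, Num.sqrt n%:R * Ustat h z j / 2 <= c j] -
      pr G [set e | forall j, gaussv (acoef h y) e j +
        chaos (fun i l j => h (tnth y i) (tnth y l) j + th j) e j <= c j]| <=
    (335 * (20 + 64 * swap_const R) + 4 * swap_const R + (28 * (64 * 64) + 40)) * (x * L)].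
Proof.
move=> FQ NS NG n4 J0 J2 B1 L1 K0 /andP[gam0 gam1] gamL x0 small rate mh hsym ih4x ih4 hmean h3 h4 var1 htail.
pose C2 := 2 * (K + 4); pose Nn : R := (n %/ 3)%:R.
exists (cov_bad F h (x ^+ 2 / 8) (x / 4) (x ^+ 2 / 64) (Num.sqrt (x ^+ 3 * n%:R))
  (Num.sqrt (Nn * (x ^+ 2 / 8) / (8 * (C2 * L))))).
have [mb pb] := core_event n4 B1 L1 K0 gam0 gamL x0 small rate (erefl C2) (erefl Nn)
  (erefl _) (erefl _) (erefl _) (erefl _) (erefl _) (erefl _) (erefl _) (erefl _) J0 J2 FQ mh ih4 h4 htail.
split=> // y good th c thB; rewrite addrA.
exact: (core_compare n4 B1 L1 K0 gam0 gam1 x0 small rate (erefl C2) (erefl Nn)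
  (erefl _) (erefl _) (erefl _) (erefl _) (erefl _) (erefl _) J0 J2 FQ NS NG mh hsym ih4x ih4 hmean h3 var1 htail good c thB).
Qed.

(** * Centering and normalisation *)

Section null_sets.
Context d (T : measurableType d) (R : realType) (P : probability T R).
Variable N : set T.
Hypotheses (mN : measurable N) (PN : P N = 0).

Lemma eq_Ex_null f g : measurable_fun setT f -> measurable_fun setT g ->
  (forall x, ~ N x -> f x = g x) -> Ex P f = Ex P g.
Proof.
move=> mf mg fg; apply: (congr1 fine); apply: ae_eq_integral => //.
- exact/measurable_EFinP.
- exact/measurable_EFinP.
by exists N; split => // x /= /not_implyP[_ nx]; apply: contrapT => /fg e; apply: nx; rewrite e.
Qed.

Lemma eq_pr_null A B : measurable A -> measurable B ->
  (forall x, ~ N x -> (A x <-> B x)) -> pr P A = pr P B.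
Proof.
move=> mA mB AB; rewrite !pr_Ex//; apply: eq_Ex_null.
- exact: measurable_indic.
- exact: measurable_indic.
by move=> x /AB e; rewrite !indicE; apply: (congr1 (fun u : bool => u%:R)); apply/idP/idP => /set_mem/e/mem_set.
Qed.

Lemma null_some_coordinate n (Q : probability (n.-tuple T) R) : prodlike P Q ->
  measurable [set y : n.-tuple T | exists i, N (tnth y i)] /\
  Q [set y : n.-tuple T | exists i, N (tnth y i)] = 0.
Proof.
move=> PQ; have mi (i : 'I_n) : measurable [set y : n.-tuple T | N (tnth y i)].
  by rewrite -[X in measurable X]setTI; exact: measurable_tnth.
have [mE le] := pr_exists Q mi; split=> //; rewrite pr_EFin//; congr EFin; apply/eqP.
rewrite eq_le pr_ge0 andbT (le_trans le)// big1// => i _.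
pose A k := if k == i then N else setT.
have mA k : measurable (A k) by rewrite /A; case: ifP.
rewrite /pr (_ : [set y | N (tnth y i)] = rect A); last first.
  apply/seteqP; split => y /= h; last by have := h i; rewrite /A eqxx.
  by move=> k; rewrite /A; case: eqP => [->|].
by rewrite PQ// (bigD1 i)//= {1}/A eqxx PN mul0e.
Qed.

End null_sets.

(** Positive and negative parts are handled separately by Tonelli, so the points where the section
    is not integrable are covered too. *)
Lemma measurable_Ex_section (R : realType) d1 (T1 : measurableType d1) d2 (T2 : measurableType d2)
    (F : probability T2 R) (f : T1 -> T2 -> R) :
  measurable_fun setT (fun z : T1 * T2 => f z.1 z.2) -> measurable_fun setT (fun x => Ex F (f x)).
Proof.
move=> mf; have mE : measurable_fun setT (fun z : T1 * T2 => (f z.1 z.2)%:E) by exact/measurable_EFinP.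
apply: (@measurableT_comp _ _ _ _ _ _ fine) => //.
under eq_fun do rewrite integralE.
apply: emeasurable_funB.
- have mp : measurable_fun setT ((fun z : T1 * T2 => (f z.1 z.2)%:E)^\+)%E by exact: measurable_funepos.
  have H := @measurable_fun_fubini_tonelli_F _ _ _ _ _ F _ mp (fun z => funepos_ge0 (fun z : T1 * T2 => (f z.1 z.2)%:E) z).
  by rewrite (_ : (fun x => _) = fubini_F F ((fun z : T1 * T2 => (f z.1 z.2)%:E)^\+)%E)//; apply/funext => x; apply: eq_integral => y _; rewrite !funeposE.
- have mp : measurable_fun setT ((fun z : T1 * T2 => (f z.1 z.2)%:E)^\-)%E by exact: measurable_funeneg.
  have H := @measurable_fun_fubini_tonelli_F _ _ _ _ _ F _ mp (fun z => funeneg_ge0 (fun z : T1 * T2 => (f z.1 z.2)%:E) z).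
  by rewrite (_ : (fun x => _) = fubini_F F ((fun z : T1 * T2 => (f z.1 z.2)%:E)^\-)%E)//; apply/funext => x; apply: eq_integral => y _; rewrite !funenegE.
Qed.

(** * Centring, masking and unit variances *)

Section centering.
Context (R : realType) d (T : measurableType d) (D : nat).
Hypothesis D0 : (0 < D)%N.
Variable F : probability T R.
Let FF := (F \x F : probability _ _)%E.
Variables (hr : T -> T -> 'I_D -> R) (B : R).
Hypothesis mhr : forall m, measurable_fun setT (fun z : T * T => hr z.1 z.2 m).
Hypothesis hrsym : forall x y, hr x y = hr y x.
Hypothesis B1 : 1 <= B.
Hypothesis ihr4 : forall m, intg FF (fun z => hr z.1 z.2 m ^+ 4).
Hypothesis hr3 : forall m, Ex FF (fun z => `|hr z.1 z.2 m| ^+ 3) <= B.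
Hypothesis hr4 : forall m, Ex FF (fun z => hr z.1 z.2 m ^+ 4) <= B ^+ 2.

Let pow4E (s : R) : `|s| ^+ 4 = s ^+ 4.
Proof. by rewrite -normrX ger0_norm// (exprM _ 2 2) sqr_ge0. Qed.

Let D0' : (0 < #|'I_D|)%N. Proof. by rewrite card_ord. Qed.

Let msup k : measurable_fun setT (fun z : T * T => supn (hr z.1 z.2) ^+ k).
Proof. by apply: measurable_funX; exact: measurable_supn. Qed.

Lemma raw_supn4_intg : intg FF (fun z => supn (hr z.1 z.2) ^+ 4).
Proof.
have iS : intg FF (fun z => \sum_m hr z.1 z.2 m ^+ 4) by apply: intg_sum => m; exact: ihr4.
apply: (intg_dom (msup 4) iS) => z.
rewrite normrX pow4E; apply: (le_trans (supn_pow_le D0' (hr z.1 z.2) (isT : (0 < 4)%N))).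
by apply: ler_sum => m _; rewrite pow4E.
Qed.

Definition section4 (x : T) : \bar R := \int[F]_y (supn (hr x y) ^+ 4)%:E.
Definition non_integrable : set T := [set x | ~ (section4 x < +oo)%E].
Let N := non_integrable.

Let s4_ge0 x : (0 <= section4 x)%E.
Proof. by apply: integral_ge0 => y _; rewrite lee_fin exprn_ge0// supn_ge0. Qed.

Let ms4 : measurable_fun setT section4.
Proof.
have mE : measurable_fun setT (fun z : T * T => (supn (hr z.1 z.2) ^+ 4)%:E) by exact/measurable_EFinP.
by apply: (measurable_fun_fubini_tonelli_F _ mE) => z; rewrite lee_fin exprn_ge0// supn_ge0.
Qed.

(** By Tonelli: the section integrals of an integrable function form an integrable function, which
    is finite almost everywhere. *)
Lemma non_integrable_null : measurable N /\ F N = 0.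
Proof.
have E : N = section4 @^-1` [set +oo%E].
  by apply/seteqP; split => x; rewrite /N /non_integrable /=; [move/negP; rewrite ltey negbK => /eqP|move=> ->].
have mN : measurable N by rewrite E -[X in measurable X]setTI; exact: ms4.
have iS : F.-integrable setT section4.
  apply/integrableP; split; first exact: ms4.
  have mE : measurable_fun setT (fun z : T * T => (supn (hr z.1 z.2) ^+ 4)%:E) by exact/measurable_EFinP.
  have := raw_supn4_intg; rewrite /intg => /(integrable12ltyP F F mE).
  apply: le_lt_trans; apply: ge0_le_integral => //.
  - by apply: measurableT_comp => //; exact: ms4.
  - apply: (measurable_fun_fubini_tonelli_F (fun z : T * T => `|(supn (hr z.1 z.2) ^+ 4)%:E|%E)) => //.
    by apply: measurableT_comp.
  - move=> x _; rewrite gee0_abs//; apply: ge0_le_integral => //.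
    + by move=> y _; rewrite lee_fin exprn_ge0// supn_ge0.
    + apply/measurable_EFinP; apply: measurable_funX; apply: measurable_supn => m.
      exact: (measurableT_comp (mhr m) (pair1_measurable x)).
    + apply/measurable_EFinP; apply: measurableT_comp => //; apply: measurable_funX; apply: measurable_supn => m.
      exact: (measurableT_comp (mhr m) (pair1_measurable x)).
    + by move=> y _; exact: lee_abs.
split=> //; have [X [mX PX sX]] := integrable_ae measurableT iS.
apply/eqP; rewrite eq_le measure_ge0 andbT -PX.
apply: le_measure; [exact: mem_set|exact: mem_set|move=> x Nx].
by apply: sX => /=; rewrite E in Nx => /(_ I); rewrite Nx.
Qed.

(* Multiplying the kernel by this mask only changes it on a null set and makes every
   section integrable, which the pointwise estimates on the bootstrap side require. *)
Definition regular (x : T) : R := (section4 x < +oo)%E%:R.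
Let o := regular.

Lemma regular01 x : o x = 1 /\ ~ N x \/ o x = 0 /\ N x.
Proof.
rewrite /o /regular /N /non_integrable /=; case: (boolP (_ < _)%E) => h; [left|right]; split=> //.
Qed.

Let mo : measurable_fun setT o.
Proof.
have [mN _] := non_integrable_null.
rewrite (_ : o = \1_(~` N)); first by apply: measurable_indic; exact: measurableC.
apply/funext => x; rewrite indicE; case: (regular01 x) => -[-> h].
  by rewrite mem_set.
by rewrite memNset//= => /(_ h).
Qed.

Definition mean_hr m : R := Ex FF (fun z => hr z.1 z.2 m).
Definition proj_hr x m : R := Ex F (fun y => hr x y m) - mean_hr m.
Definition centered x y m : R := (hr x y m - mean_hr m) * (o x * o y).
Let h0 := centered.

Let oo01 x y : 0 <= o x * o y <= 1.
Proof. by case: (regular01 x) => -[-> _]; case: (regular01 y) => -[-> _]; rewrite ?mulr1 ?mulr0 ?ler01 ?lexx. Qed.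

Let mh0 m : measurable_fun setT (fun z : T * T => h0 z.1 z.2 m).
Proof.
apply: measurable_funM; first exact: measurable_funB.
by apply: measurable_funM; exact: measurableT_comp.
Qed.

Let h0sym x y : h0 x y = h0 y x.
Proof. by apply/funext => m; rewrite /h0 /centered hrsym (mulrC (o x)). Qed.

Let ihrk m k : (k <= 4)%N -> intg FF (fun z => `|hr z.1 z.2 m| ^+ k).
Proof.
move=> k4; have i4 : intg FF (fun z => 1 + hr z.1 z.2 m ^+ 4) by apply: intgD => //; exact: intg_cst.
apply: (intg_dom _ i4) => [|z].
  by apply: measurable_funX; exact: measurableT_comp.
rewrite normrX normr_id -pow4E; move: (`|hr z.1 z.2 m|) (normr_ge0 (hr z.1 z.2 m)) => s s0.
case: (lerP s 1) => s1; first by rewrite (le_trans (exprn_ile1 _ s0 s1))// lerDl exprn_ge0.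
by rewrite ler_wpDl// ler_weXn2l// ltW.
Qed.

Let ihr m : intg FF (fun z => hr z.1 z.2 m).
Proof.
by apply: (intg_dom _ (ihrk m (isT : (1 <= 4)%N))) => [|z] //; rewrite expr1.
Qed.

Lemma mean_hr3 m : `|mean_hr m| ^+ 3 <= B.
Proof. by apply: (le_trans _ (hr3 m)); exact: Ex_cube_le (ihr m) (ihrk m _). Qed.

Lemma mean_hr4 m : mean_hr m ^+ 4 <= B ^+ 2.
Proof.
apply: (le_trans _ (hr4 m)).
have i2 : intg FF (fun z => hr z.1 z.2 m ^+ 2).
  by apply: (intg_dom _ (ihrk m (isT : (2 <= 4)%N))) => [|z]; [exact: measurable_funX|rewrite normrX].
have i4 : intg FF (fun z => (hr z.1 z.2 m ^+ 2) ^+ 2).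
  by move: (ihr4 m); congr intg; apply/funext => z; rewrite -exprM.
have := Ex_sqr_le i2 i4; under [X in _ <= X -> _]eq_Ex do rewrite -exprM.
move/(le_trans _); apply; rewrite (exprM _ 2 2) ler_sqr ?nnegrE ?sqr_ge0//.
  exact: Ex_sqr_le.
by apply: Ex_ge0 => z; exact: sqr_ge0.
Qed.

Lemma mean_hr_le m : `|mean_hr m| <= B.
Proof.
rewrite leNgt; apply/negP => h; have := mean_hr3 m.
have : B < `|mean_hr m| ^+ 3; last by lra.
by rewrite (lt_le_trans h)// -[leLHS]expr1 ler_weXn2l// (le_trans B1)// ltW.
Qed.


Let mN : measurable N. Proof. exact: non_integrable_null.1. Qed.
Let FN : F N = 0. Proof. exact: non_integrable_null.2. Qed.

Let N2 : set (T * T) := [set z | N z.1] `|` [set z | N z.2].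

Let N2_null : measurable N2 /\ FF N2 = 0.
Proof.
have m1 : measurable [set z : T * T | N z.1] by rewrite -[X in measurable X]setTI; exact: measurable_fst.
have m2 : measurable [set z : T * T | N z.2] by rewrite -[X in measurable X]setTI; exact: measurable_snd.
have mN2 : measurable N2 by exact: measurableU.
split=> //; rewrite pr_EFin//; congr EFin; apply/eqP; rewrite eq_le pr_ge0 andbT.
apply: (le_trans (pr_setU FF m1 m2)); rewrite (pr_proj1 F F mN) (pr_proj2 F F mN).
by rewrite /pr FN addr0.
Qed.

Let onot1 x : ~ N x -> o x = 1. Proof. by case: (regular01 x) => -[]. Qed.

Let h0mean m : Ex FF (fun z => h0 z.1 z.2 m) = 0.
Proof.
have [mN2 FN2] := N2_null.
rewrite (@eq_Ex_null _ _ _ FF _ mN2 FN2 _ (fun z => hr z.1 z.2 m - mean_hr m)) //.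
- by rewrite ExB ?Ex_cst ?subrr//; exact: intg_cst.
- exact: measurable_funB.
by move=> z nz; rewrite /h0 /centered !onot1 ?mulr1// => nn; apply: nz; [right|left].
Qed.

Let h0_le x y m : `|h0 x y m| <= `|hr x y m - mean_hr m|.
Proof.
rewrite /h0 /centered normrM; have /andP[a0 a1] := oo01 x y.
by rewrite (ger0_norm a0) ler_piMr.
Qed.

Let h0_supn x y : supn (h0 x y) <= supn (hr x y) + B.
Proof.
apply: supn_le => [|m]; first by rewrite addr_ge0 ?supn_ge0//; exact: le_trans ler01 B1.
by rewrite (le_trans (h0_le _ _ _))// (le_trans (ler_normB _ _))// lerD ?le_supn ?mean_hr_le.
Qed.

Let pow4D (u v : R) : 0 <= u -> 0 <= v -> (u + v) ^+ 4 <= 8 * (u ^+ 4 + v ^+ 4).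
Proof.
move=> u0 v0; have h1 : (u + v) ^+ 2 <= 2 * (u ^+ 2 + v ^+ 2) by have := sqr_ge0 (u - v); nra.
rewrite (exprM (u + v) 2 2); apply: (@le_trans _ _ ((2 * (u ^+ 2 + v ^+ 2)) ^+ 2)).
  by rewrite ler_sqr ?nnegrE ?sqr_ge0// mulr_ge0// addr_ge0// sqr_ge0.
have := sqr_ge0 (u ^+ 2 - v ^+ 2); rewrite (exprM u 2 2) (exprM v 2 2).
by move: (u ^+ 2) (v ^+ 2) => p q; nra.
Qed.

Let h0_supn4 x y : supn (h0 x y) ^+ 4 <= 8 * (supn (hr x y) ^+ 4 + B ^+ 4).
Proof.
apply: (le_trans _ (pow4D (supn_ge0 _) (le_trans ler01 B1))).
by apply: lerXn2r; rewrite ?nnegrE ?addr_ge0 ?supn_ge0 ?(le_trans ler01 B1).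
Qed.

Let msec x m : measurable_fun setT (fun y => hr x y m).
Proof. exact: (measurableT_comp (mhr m) (pair1_measurable x)). Qed.

Let hrx4 x : ~ N x -> intg F (fun y => supn (hr x y) ^+ 4).
Proof.
move=> /contrapT h; apply/integrableP; split.
  by apply/measurable_EFinP; apply: measurable_funX; apply: measurable_supn.
apply: le_lt_trans h; rewrite le_eqVlt; apply/orP; left; apply/eqP.
by apply: eq_integral => y _; rewrite /= ger0_norm// exprn_ge0// supn_ge0.
Qed.

Let hrx x m : ~ N x -> intg F (fun y => hr x y m).
Proof.
move=> /hrx4 i4; have i : intg F (fun y => 1 + supn (hr x y) ^+ 4) by apply: intgD => //; exact: intg_cst.
apply: (intg_dom _ i) => // y.
apply: (le_trans (le_supn (hr x y) m)); move: (supn _) (supn_ge0 (hr x y)) => s s0.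
case: (lerP s 1) => s1; first by rewrite (le_trans s1)// lerDl exprn_ge0.
by rewrite ler_wpDl// -[leLHS]expr1 ler_weXn2l// ltW.
Qed.

Let ih4x x : intg F (fun y => supn (h0 x y) ^+ 4).
Proof.
have mx : measurable_fun setT (fun y => supn (h0 x y) ^+ 4).
  apply: measurable_funX; apply: measurable_supn => m; exact: (measurableT_comp (mh0 m) (pair1_measurable x)).
case: (regular01 x) => -[ox nx].
  have iD : intg F (fun y => 8 * (supn (hr x y) ^+ 4 + B ^+ 4)).
    by apply: intgZ; apply: intgD; [exact: hrx4|exact: intg_cst].
  by apply: (intg_dom mx iD) => y; rewrite ger0_norm ?exprn_ge0 ?supn_ge0.
apply: (intg_dom mx (intg_cst F 0)) => y.
rewrite (_ : supn _ = 0) ?expr0n ?normr0//; apply/eqP; rewrite eq_le supn_ge0 andbT supn_le// => m.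
by rewrite /h0 /centered -/o ox mul0r mulr0 normr0.
Qed.

Let ih4 : intg FF (fun z => supn (h0 z.1 z.2) ^+ 4).
Proof.
have iD : intg FF (fun z => 8 * (supn (hr z.1 z.2) ^+ 4 + B ^+ 4)).
  by apply: intgZ; apply: intgD; [exact: raw_supn4_intg|exact: intg_cst].
apply: (intg_dom _ iD) => [|z]; last by rewrite ger0_norm ?exprn_ge0 ?supn_ge0.
by apply: measurable_funX; apply: measurable_supn.
Qed.

Lemma proj_centered x m : ~ N x -> proj F h0 x m = proj_hr x m.
Proof.
move=> nx; rewrite /proj_hr -(Ex_cst F (mean_hr m)) -ExB; [|exact: hrx|exact: intg_cst].
apply: (eq_Ex_null mN FN).
- exact: (measurableT_comp (mh0 m) (pair1_measurable x)).
- exact: measurable_funB.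
by move=> y ny; rewrite /h0 /centered -/o !onot1// !mulr1.
Qed.

Let mproj_hr m : measurable_fun setT (fun x => proj_hr x m).
Proof. by apply: measurable_funB => //; exact: measurable_Ex_section. Qed.

Let mproj m : measurable_fun setT (fun x => proj F h0 x m).
Proof. exact: measurable_proj mh0 ih4x ih4 m. Qed.

Let iproj2 m : intg F (fun x => proj F h0 x m ^+ 2).
Proof.
apply: (intg_dom _ (proj_supn2_intg mh0 ih4x ih4).1) => [|x]; first exact: measurable_funX.
by rewrite ger0_norm ?sqr_ge0// -real_normK ?num_real// ler_sqr ?nnegrE ?supn_ge0// le_supn.
Qed.

(** The raw projection equals that of the masked kernel off a null set, and the latter is square
    integrable by [proj_supn2_intg]. *)
Lemma proj_hr2 m : intg F (fun x => proj_hr x m ^+ 2) /\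
  Ex F (fun x => proj_hr x m ^+ 2) = Ex F (fun x => proj F h0 x m ^+ 2).
Proof.
split; last first.
  by apply: (eq_Ex_null mN FN) => [||x nx]; rewrite ?proj_centered//; exact: measurable_funX.
apply/integrableP; split; first by apply/measurable_EFinP; exact: measurable_funX.
have /integrableP[_] := iproj2 m; apply: le_lt_trans; rewrite le_eqVlt; apply/orP; left; apply/eqP.
apply: ae_eq_integral => //.
- by apply: measurableT_comp => //; apply/measurable_EFinP; exact: measurable_funX.
- by apply: measurableT_comp => //; apply/measurable_EFinP; exact: measurable_funX.
exists N; split => // x /= /not_implyP[_ nx]; apply: contrapT => /proj_centered e; apply: nx.
by rewrite /= e.
Qed.


Variables (b kap : R).
Hypotheses (b0 : 0 < b) (kap1 : 1 <= kap) (kb : 1 <= kap ^+ 2 * b).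
Hypothesis gvar : forall m, b <= Ex F (fun x => proj_hr x m ^+ 2).

Let sig2 m := Ex F (fun x => proj F h0 x m ^+ 2).
Let isig m := (Num.sqrt (sig2 m))^-1.

Let sig2_ge m : b <= sig2 m.
Proof. by rewrite /sig2 -(proj_hr2 m).2. Qed.

Let sig2_gt0 m : 0 < sig2 m. Proof. exact: lt_le_trans b0 (sig2_ge m). Qed.

Let isig_gt0 m : 0 < isig m. Proof. by rewrite invr_gt0 sqrtr_gt0. Qed.

Let isig2 m : isig m ^+ 2 * sig2 m = 1.
Proof. by rewrite exprVn sqr_sqrtr ?mulVf ?gt_eqF// ltW. Qed.

Let kap0 : 0 < kap. Proof. exact: lt_le_trans ltr01 kap1. Qed.

(** Normalising to unit variance thus multiplies moments by powers of [kap], which will depend on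
    the variance bound [b] alone. *)
Let isig_le m : isig m <= kap.
Proof.
rewrite -ler_sqr ?nnegrE ?(ltW (isig_gt0 m)) ?(ltW kap0)//.
rewrite -(ler_pM2r (sig2_gt0 m)) isig2 (le_trans kb)// ler_wpM2l ?sqr_ge0//.
Qed.

Definition signed (s : bool) (v : R) : R := if s then - v else v.

(* Doubling each coordinate with both signs turns hyperrectangles into orthants. *)
Let hn x y (j : bool * 'I_D) : R := isig j.2 * signed j.1 (h0 x y j.2).

Let signedE s v : signed s v = (-1) ^+ s * v.
Proof. by case: s; rewrite /signed ?expr1 ?expr0 ?mulN1r ?mul1r. Qed.

Let signed_norm s v : `|signed s v| = `|v|. Proof. by case: s; rewrite //= normrN. Qed.

Let hnE x y j : hn x y j = (isig j.2 * (-1) ^+ j.1) * h0 x y j.2.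
Proof. by rewrite /hn signedE mulrA. Qed.

Let hn_norm x y j : `|hn x y j| = isig j.2 * `|h0 x y j.2|.
Proof. by rewrite /hn normrM signed_norm ger0_norm// ltW. Qed.

Let hn_le x y j : `|hn x y j| <= kap * `|h0 x y j.2|.
Proof. by rewrite hn_norm ler_wpM2r. Qed.

Let hn_supn x y : supn (hn x y) <= kap * (supn (hr x y) + B).
Proof.
have h : supn (hn x y) <= kap * supn (h0 x y).
  apply: supn_le => [|j]; first by rewrite mulr_ge0 ?supn_ge0// ltW.
  by rewrite (le_trans (hn_le _ _ _))// ler_wpM2l ?le_supn// ltW.
by rewrite (le_trans h)// ler_wpM2l// ltW.
Qed.

Let mhn j : measurable_fun setT (fun z : T * T => hn z.1 z.2 j).
Proof. under eq_fun do rewrite hnE; exact: measurable_funM. Qed.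

Let hnsym x y : hn x y = hn y x.
Proof. by apply/funext => j; rewrite /hn h0sym. Qed.

Let hn_supn4 x y : supn (hn x y) ^+ 4 <= kap ^+ 4 * supn (h0 x y) ^+ 4.
Proof.
rewrite -exprMn; apply: lerXn2r; rewrite ?nnegrE ?mulr_ge0 ?supn_ge0 ?(ltW kap0)//.
apply: supn_le => [|j]; first by rewrite mulr_ge0 ?supn_ge0// ltW.
by rewrite (le_trans (hn_le _ _ _))// ler_wpM2l ?le_supn// ltW.
Qed.

Let ihn4x x : intg F (fun y => supn (hn x y) ^+ 4).
Proof.
apply: (intg_dom _ (intgZ (kap ^+ 4) (ih4x x))) => [|y]; last by rewrite ger0_norm ?exprn_ge0 ?supn_ge0.
apply: measurable_funX; apply: measurable_supn => j; exact: (measurableT_comp (mhn j) (pair1_measurable x)).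
Qed.

Let ihn4 : intg FF (fun z => supn (hn z.1 z.2) ^+ 4).
Proof.
apply: (intg_dom _ (intgZ (kap ^+ 4) ih4)) => [|z]; last by rewrite ger0_norm ?exprn_ge0 ?supn_ge0.
by apply: measurable_funX; apply: measurable_supn.
Qed.

Let ih0m m : intg FF (fun z => h0 z.1 z.2 m).
Proof.
have iB : intg FF (fun z => `|hr z.1 z.2 m - mean_hr m|).
  by apply: intg_abs; apply: intgB => //; exact: intg_cst.
by apply: (intg_dom (mh0 m) iB).
Qed.

Let hnmean j : Ex FF (fun z => hn z.1 z.2 j) = 0.
Proof. by under eq_Ex do rewrite hnE; rewrite ExZ ?h0mean ?mulr0. Qed.

Let cube_le (u v : R) : 0 <= u -> 0 <= v -> (u + v) ^+ 3 <= 4 * (u ^+ 3 + v ^+ 3).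
Proof. by move=> u0 v0; have := sqr_ge0 (u - v); nra. Qed.

Let B0 : 0 <= B. Proof. exact: le_trans ler01 B1. Qed.

Let hn3 j : Ex FF (fun z => `|hn z.1 z.2 j| ^+ 3) <= 8 * kap ^+ 3 * B.
Proof.
have iD : intg FF (fun z => kap ^+ 3 * (4 * (`|hr z.1 z.2 j.2| ^+ 3 + `|mean_hr j.2| ^+ 3))).
  by apply: intgZ; apply: intgZ; apply: intgD; [exact: ihrk|exact: intg_cst].
have le (z : T * T) : `|hn z.1 z.2 j| ^+ 3 <= kap ^+ 3 * (4 * (`|hr z.1 z.2 j.2| ^+ 3 + `|mean_hr j.2| ^+ 3)).
  apply: (@le_trans _ _ (kap ^+ 3 * (`|hr z.1 z.2 j.2| + `|mean_hr j.2|) ^+ 3)); last first.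
    by rewrite ler_wpM2l ?exprn_ge0 ?(ltW kap0)// cube_le.
  rewrite -exprMn; apply: lerXn2r; rewrite ?nnegrE ?mulr_ge0 ?addr_ge0 ?(ltW kap0)//.
  rewrite (le_trans (hn_le _ _ _))// ler_wpM2l ?(ltW kap0)//.
  by rewrite (le_trans (h0_le _ _ _))// ler_normB.
have iL : intg FF (fun z => `|hn z.1 z.2 j| ^+ 3).
  by apply: (intg_dom _ iD) => [|z]; [apply: measurable_funX; exact: measurableT_comp|rewrite ger0_norm].
apply: (le_trans (Ex_le iL iD le)).
have i1 := intgD (ihrk j.2 (isT : (3 <= 4)%N)) (intg_cst FF (`|mean_hr j.2| ^+ 3)).
rewrite ExZ; last exact: intgZ.
rewrite ExZ// ExD ?Ex_cst; [|exact: ihrk|exact: intg_cst].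
rewrite (_ : 8 * kap ^+ 3 * B = kap ^+ 3 * (4 * (B + B))); last by ring.
by rewrite ler_wpM2l ?exprn_ge0 ?(ltW kap0)// ler_wpM2l// lerD// mean_hr3.
Qed.

(** Centring gives [16 kap^4 B^2], which is at most [64 kap^6 B^2]; so the single scale [8 kap^3 B]
    serves the third and the fourth moments. *)
Let hn4 j : Ex FF (fun z => hn z.1 z.2 j ^+ 4) <= (8 * kap ^+ 3 * B) ^+ 2.
Proof.
have iD : intg FF (fun z => kap ^+ 4 * (8 * (hr z.1 z.2 j.2 ^+ 4 + mean_hr j.2 ^+ 4))).
  by apply: intgZ; apply: intgZ; apply: intgD => //; exact: intg_cst.
have le (z : T * T) : hn z.1 z.2 j ^+ 4 <= kap ^+ 4 * (8 * (hr z.1 z.2 j.2 ^+ 4 + mean_hr j.2 ^+ 4)).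
  apply: (@le_trans _ _ (kap ^+ 4 * (`|hr z.1 z.2 j.2| + `|mean_hr j.2|) ^+ 4)); last first.
    by rewrite ler_wpM2l ?exprn_ge0 ?(ltW kap0)// (le_trans (pow4D _ _))// !pow4E.
  rewrite -pow4E -exprMn; apply: lerXn2r; rewrite ?nnegrE ?mulr_ge0 ?addr_ge0 ?(ltW kap0)//.
  rewrite (le_trans (hn_le _ _ _))// ler_wpM2l ?(ltW kap0)//.
  by rewrite (le_trans (h0_le _ _ _))// ler_normB.
have iL : intg FF (fun z => hn z.1 z.2 j ^+ 4).
  by apply: (intg_dom _ iD) => [|z]; [exact: measurable_funX|rewrite normrX pow4E].
apply: (le_trans (Ex_le iL iD le)).
have i1 := intgD (ihr4 j.2) (intg_cst FF (mean_hr j.2 ^+ 4)).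
rewrite ExZ; last exact: intgZ.
rewrite ExZ// ExD ?Ex_cst//; last exact: intg_cst.
apply: (@le_trans _ _ (kap ^+ 4 * (8 * (B ^+ 2 + B ^+ 2)))).
  by rewrite ler_wpM2l ?exprn_ge0 ?(ltW kap0)// ler_wpM2l// lerD// mean_hr4.
have k2 : 1 <= kap ^+ 2 by rewrite exprn_ege1.
rewrite (_ : kap ^+ 4 * _ = 16 * (kap ^+ 4 * B ^+ 2)); last by ring.
rewrite (_ : (8 * kap ^+ 3 * B) ^+ 2 = 64 * (kap ^+ 4 * B ^+ 2) * kap ^+ 2); last by ring.
have q0 : 0 <= kap ^+ 4 * B ^+ 2 by rewrite mulr_ge0 ?sqr_ge0// exprn_ge0// ltW.
by move: (kap ^+ 4 * _) q0 (kap ^+ 2) k2 => q q0 p p1; nra.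
Qed.

Let hn_proj x j : proj F hn x j = (isig j.2 * (-1) ^+ j.1) * proj F h0 x j.2.
Proof.
rewrite /proj -ExZ; first by apply: eq_Ex => y; rewrite hnE.
exact: (h_intg mh0 ih4x).
Qed.

Let hnvar j : Ex F (fun x => proj F hn x j ^+ 2) = 1.
Proof.
rewrite -(isig2 j.2) -ExZ//; apply: eq_Ex => x.
by rewrite hn_proj !exprMn sqrr_sign mulr1.
Qed.

Variables (K gam x L : R) (n : nat).
Hypotheses (n4 : (4 <= n)%N) (DL : (4 * D)%:R <= expR L) (L1 : 1 <= L) (K0 : 0 <= K).
Hypotheses (gam01 : 0 < gam <= 1) (gamL : expR (- (K * L)) <= gam).
Hypotheses (x0 : 0 < x) (small : (24 * 128) * ((K + 4) * (x * L)) <= 1).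
Let B' := 8 * kap ^+ 3 * B.
Hypothesis rate : B' ^+ 2 * L <= n%:R * x ^+ 6.
Let u := Num.sqrt (x ^+ 3 * n%:R).
Hypothesis raw_tail : Ex FF (fun z => (kap * (supn (hr z.1 z.2) + B)) ^+ 2 *
  (u < kap * (supn (hr z.1 z.2) + B))%R%:R) <= gam * x ^+ 3.
Variables (Q : probability (n.-tuple T) R) (Nm : probability R R) (G : probability (n.-tuple R) R).
Hypotheses (FQ : prodlike F Q) (NS : std_normal Nm) (NG : prodlike Nm G).

Let hntail : Ex FF (fun z => tailsq hn u z.1 z.2) <= gam * x ^+ 3.
Proof.
apply: (le_trans _ raw_tail); apply: Ex_le.
- exact: tailsq_intg2 mhn ihn4 u.
- have ms : measurable_fun setT (fun z : T * T => kap * (supn (hr z.1 z.2) + B)).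
    by apply: measurable_funM => //; apply: measurable_funD => //; exact: measurable_supn.
  have iD : intg FF (fun z => kap ^+ 2 * (2 * (1 + supn (hr z.1 z.2) ^+ 4 + B ^+ 2))).
    by do 2 apply: intgZ; apply: intgD; [apply: intgD; [exact: intg_cst|exact: raw_supn4_intg]|exact: intg_cst].
  apply: (intg_dom _ iD) => [|z].
    apply: measurable_funM; first exact: measurable_funX.
    exact: measurable_fun_indic_gt.
  rewrite ger0_norm; last exact: mulr_ge0 (sqr_ge0 _) (ler0n _ _).
  apply: (@le_trans _ _ ((kap * (supn (hr z.1 z.2) + B)) ^+ 2)).
    by rewrite ler_piMr ?sqr_ge0//; case: (_ < _).
  rewrite exprMn ler_wpM2l ?sqr_ge0//.
  have s0 := supn_ge0 (hr z.1 z.2); move: (supn _) s0 => s s0.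
  have := sqr_ge0 (s - B); have := sqr_ge0 (s ^+ 2 - 1); rewrite (exprM s 2 2); nra.
move=> z; rewrite /tailsq; have h := hn_supn z.1 z.2; have s0 := supn_ge0 (hn z.1 z.2).
have le2 : supn (hn z.1 z.2) ^+ 2 <= (kap * (supn (hr z.1 z.2) + B)) ^+ 2.
  by rewrite ler_sqr ?nnegrE//; exact: le_trans h.
case: (ltrP u (supn (hn z.1 z.2))) => hu; last by rewrite mulr0; exact: mulr_ge0 (sqr_ge0 _) (ler0n _ _).
by rewrite (lt_le_trans hu h) !mulr1.
Qed.


Let J0 : (0 < #|{: bool * 'I_D}|)%N.
Proof. by rewrite card_prod card_bool card_ord muln_gt0. Qed.

Let J2 : 2 * #|{: bool * 'I_D}|%:R <= expR L.
Proof. by rewrite card_prod card_bool card_ord -natrM mulnA. Qed.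

Let NQ : set (n.-tuple T) := [set y | exists i, N (tnth y i)].

Let hnon i l j (y : n.-tuple T) : ~ NQ y ->
  hn (tnth y i) (tnth y l) j = (isig j.2 * (-1) ^+ j.1) * (hr (tnth y i) (tnth y l) j.2 - mean_hr j.2).
Proof.
move=> nq; have ok k : o (tnth y k) = 1 by apply: onot1 => h; apply: nq; exists k.
by rewrite hnE /h0 /centered -/o !ok !mulr1.
Qed.

(** Off the null set of samples with an irregular coordinate the mask is 1, and dividing each
    inequality by [isig] undoes the normalisation. The subtracted mean returns through the shift
    [th]. *)
Lemma centered_comparison : exists bad : set (n.-tuple T), [/\ measurable bad, pr Q bad <= gam &
  forall y, ~ bad y -> forall c : bool * 'I_D -> R,
  `|pr Q [set z | forall j, signed j.1 (Num.sqrt n%:R * (Ustat hr z j.2 - mean_hr j.2) / 2) <= c j] -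
    pr G [set e | forall j, signed j.1 (gaussv (acoef hr y) e j.2 +
      chaos (fun i l m => hr (tnth y i) (tnth y l) m) e j.2) <= c j]| <=
  (335 * (20 + 64 * swap_const R) + 4 * swap_const R + (28 * (64 * 64) + 40)) * (x * L)].
Proof.
have k3 : 1 <= kap ^+ 3 by rewrite exprn_ege1.
have BB' : kap * B <= B'.
  rewrite /B' (_ : 8 * kap ^+ 3 * B = (8 * kap ^+ 2) * (kap * B)); last by ring.
  rewrite ler_peMl ?mulr_ge0 ?(ltW kap0)//; have : 1 <= kap ^+ 2 by rewrite exprn_ege1.
  lra.
have B'1 : 1 <= B'.
  by apply: (le_trans _ BB'); apply: (le_trans B1); rewrite ler_peMl.
have [bad [mb pb cmp]] := bootstrap_core FQ NS NG n4 J0 J2 B'1 L1 K0 gam01 gamL x0 small rate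
  mhn hnsym ihn4x ihn4 hnmean hn3 hn4 hnvar hntail.
have [mNQ QNQ] := null_some_coordinate mN FN FQ.
exists (bad `|` NQ); split; first exact: measurableU.
  apply: (le_trans (pr_setU Q mb mNQ)).
  by rewrite {2}/pr QNQ addr0.
move=> y nbad c; have nb : ~ bad y by move=> h; apply: nbad; left.
have nq : ~ NQ y by move=> h; apply: nbad; right.
have nR : 0 < n%:R :> R by rewrite ltr0n (leq_trans _ n4).
have n10 : 0 < n%:R - 1 :> R by rewrite subr_gt0 ltr1n (leq_trans _ n4).
pose k (j : bool * 'I_D) := isig j.2 * (-1) ^+ j.1.
have UE (z : n.-tuple T) j : ~ NQ z -> Ustat hn z j = k j * (Ustat hr z j.2 - mean_hr j.2).
  move=> nz; transitivity (ustat2 (fun a b => k j * (hr a b j.2 + - mean_hr j.2)) z).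
    by rewrite /Ustat /ustat2; congr (_ * _); apply: eq_bigr => i _; apply: eq_bigr => l _; exact: hnon.
  by rewrite ustat2Z ustat2D ?ustat2_cst// ltnW.
have gE i j : acoef hn y i j = k j * acoef hr y i j.2.
  have c1 : \sum_(l < n | l != i) (1 : R) = n%:R - 1.
    have : \sum_(l < n) (1 : R) = n%:R by rewrite sumr_const card_ord.
    by rewrite (bigD1 i)//= => <-; rewrite addrC addrK.
  rewrite /acoef UE// (_ : ghat hn y i j = k j * (ghat hr y i j.2 - mean_hr j.2)); first by ring.
  rewrite /ghat (eq_bigr (fun l => k j * (hr (tnth y i) (tnth y l) j.2 - mean_hr j.2 * 1))); last first.
    by move=> l _; rewrite mulr1; exact: hnon.
  rewrite -mulr_sumr sumrB -mulr_sumr c1; field; exact: lt0r_neq0.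
pose th (j : bool * 'I_D) := k j * mean_hr j.2.
have thB j : `|th j| <= B'.
  rewrite /th /k !normrM normr_sign mulr1 ger0_norm ?(ltW (isig_gt0 _))//.
  by apply: (le_trans _ BB'); rewrite ler_pM ?(ltW (isig_gt0 _))// mean_hr_le.
have cE e j : chaos (fun i l j => hn (tnth y i) (tnth y l) j + th j) e j =
    k j * chaos (fun i l m => hr (tnth y i) (tnth y l) m) e j.2.
  rewrite /chaos mulrCA [k j * \sum_(_ < _) _]mulr_sumr; congr (_ * _); apply: eq_bigr => l _; rewrite mulr_sumr.
  by apply: eq_bigr => i _; rewrite hnon// /th /k; ring.
have gvE e j : gaussv (acoef hn y) e j = k j * gaussv (acoef hr y) e j.2.
  by rewrite /gaussv /linf mulr_sumr; apply: eq_bigr => i _; rewrite gE; exact: esym (mulrA _ _ _).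
have kE j v : (k j * v <= isig j.2 * c j) = (signed j.1 v <= c j).
  by rewrite /k -mulrA -signedE ler_pM2l.
have := cmp y nb th (fun j => isig j.2 * c j) thB.
rewrite (_ : [set e | forall j, gaussv (acoef hn y) e j + chaos _ e j <= _] =
    [set e | forall j, signed j.1 (gaussv (acoef hr y) e j.2 +
      chaos (fun i l m => hr (tnth y i) (tnth y l) m) e j.2) <= c j]); last first.
  by apply/seteqP; split => e /= h j; move: (h j); rewrite -kE cE gvE mulrDr.
have mU (f : T -> T -> R) : measurable_fun setT (fun z : T * T => f z.1 z.2) ->
    measurable_fun setT (fun z : n.-tuple T => ustat2 f z) by move=> mf; exact: measurable_ustat2.
rewrite (_ : pr Q [set z | forall j, _ * Ustat hn z j / 2 <= _] =
    pr Q [set z | forall j, signed j.1 (Num.sqrt n%:R * (Ustat hr z j.2 - mean_hr j.2) / 2) <= c j])//.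
apply: (eq_pr_null mNQ QNQ).
- apply: (@measurable_le_all _ _ _ _ (fun z j => Num.sqrt n%:R * Ustat hn z j / 2)) => j.
  by apply: measurable_funM => //; apply: measurable_funM => //; exact: mU.
- apply: (@measurable_le_all _ _ _ _ (fun z (j : bool * 'I_D) => signed j.1 (Num.sqrt n%:R * (Ustat hr z j.2 - mean_hr j.2) / 2))) => j.
  under eq_fun do rewrite signedE.
  apply: measurable_funM => //; apply: measurable_funM => //; apply: measurable_funM => //.
  by apply: measurable_funB => //; exact: mU.
move=> z nz /=; split=> h j; move: (h j); rewrite -kE UE// (_ : _ * (k j * _) / 2 = k j * (Num.sqrt n%:R * (Ustat hr z j.2 - mean_hr j.2) / 2))//; ring.
Qed.

End centering.

(** * Conditional laws and hyperrectangles *)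

Lemma le_mu d (T : measurableType d) (R : realType) (mu : {measure set T -> \bar R}) (A B : set T) :
  measurable A -> measurable B -> A `<=` B -> (mu A <= mu B)%E.
Proof. by move=> mA mB AB; apply: le_measure => //; exact: mem_set. Qed.

(** * Regular conditional law as an image of the weight law *)

Section laws.
Context (R : realType) dO (Om : measurableType dO) (P : probability Om R).

Lemma pushforward_probability d (T : measurableType d) (X : Om -> T) : measurable_fun setT X ->
  exists Q : probability T R, forall A, measurable A -> P (X @^-1` A) = Q A.
Proof.
move=> mX; pose Xm : {mfun Om >-> T} := mfun_Sub (mem_set mX : X \in mfun).
exists (distribution P Xm) => A mA.
by rewrite /distribution /pushforward.
Qed.

Context d1 (T1 : measurableType d1) d2 (T2 : measurableType d2) d3 (T3 : measurableType d3).
Variables (X : Om -> T1) (W : Om -> T2) (Q : probability T1 R) (G : probability T2 R).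
Hypotheses (mX : measurable_fun setT X) (mW : measurable_fun setT W).
Hypothesis XQ : forall A, measurable A -> P (X @^-1` A) = Q A.
Hypothesis WG : forall A, measurable A -> P (W @^-1` A) = G A.
Hypothesis XW : forall A B, measurable A -> measurable B ->
  P ((W @^-1` A) `&` (X @^-1` B)) = (P (W @^-1` A) * P (X @^-1` B))%E.

Lemma joint_law S : measurable S -> P ((fun o => (X o, W o)) @^-1` S) = (Q \x G)%E S.
Proof.
move=> mS; have mp : measurable_fun setT (fun o => (X o, W o)) by exact/measurable_fun_pair.
have [M MP] := pushforward_probability mp.
rewrite MP//; apply/esym; apply: (product_measure_unique (m' := M)) => // A B mA mB.
transitivity (P ((fun o => (X o, W o)) @^-1` (A `*` B))).
  by apply/esym; apply: MP; exact: measurableX.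
transitivity (P (W @^-1` B) * P (X @^-1` A))%E; first by rewrite -XW// setIC.
by rewrite muleC; congr (_ * _)%E; [exact: XQ|exact: WG].
Qed.

Variable Phi : T1 -> T2 -> T3.
Hypothesis mPhi : measurable_fun setT (fun z : T1 * T2 => Phi z.1 z.2).
Variable kappa : R.-pker T1 ~> T3.
Hypothesis condP : forall A B, measurable A -> measurable B ->
  P (((fun o => Phi (X o) (W o)) @^-1` A) `&` (X @^-1` B)) =
  (\int[P]_(o in X @^-1` B) kappa (X o) A)%E.

Lemma kappa_le1 y A : measurable A -> (kappa y A <= 1)%E.
Proof. by move=> mA; rewrite -(prob_kernel (s := kappa) y); exact: le_mu. Qed.

(** Both sides have the same integral over every event of the sample, one by the defining property
    of [kappa], the other by the product form of the joint law. *)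
Lemma kappa_ae A : measurable A -> exists N, [/\ measurable N, Q N = 0 &
  forall y, ~ N y -> kappa y A = G [set e | A (Phi y e)]].
Proof.
move=> mA; pose S : set (T1 * T2) := (fun z => Phi z.1 z.2) @^-1` A.
have mS : measurable S by rewrite -[S]setTI; exact: mPhi.
have xS y : xsection S y = [set e | A (Phi y e)].
  by apply/seteqP; split => e; [move/xsectionP|move=> h; apply/xsectionP].
have mk : measurable_fun setT (fun y => kappa y A) by exact: measurable_kernel.
have mg : measurable_fun setT (fun y => G (xsection S y)) by exact: measurable_fun_xsection.
have ik : Q.-integrable setT (fun y => kappa y A).
  apply/integrableP; split => //; apply: (@le_lt_trans _ _ (\int[Q]_y 1)%E); last first.
    by rewrite integral_cst// mul1e [X in (X < _)%E]probability_setT ltry.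
  apply: ge0_le_integral => //; first exact: measurableT_comp.
  by move=> y _; rewrite gee0_abs// kappa_le1.
have eqE E : E `<=` setT -> measurable E -> (\int[Q]_(y in E) kappa y A = \int[Q]_(y in E) G (xsection S y))%E.
  move=> _ mE; transitivity (\int[P]_(o in X @^-1` E) kappa (X o) A)%E.
    rewrite [RHS]integral_mkcond [LHS]integral_mkcond.
    rewrite -(ge0_integral_map mX XQ).
    - by apply: eq_integral => o _; rewrite /patch; congr (if _ then _ else _).
    - by apply/(measurable_restrictT _ _).1 => //; exact: measurable_funTS.
    - by move=> y; rewrite /patch; case: ifP.
  rewrite -condP//.
  have mSE : measurable (S `&` (E `*` setT)) by apply: measurableI => //; exact: measurableX.
  transitivity ((Q \x G)%E (S `&` (E `*` setT))).
    rewrite -joint_law//; congr (P _).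
    by apply/seteqP; split => o /=; [move=> [? ?]|move=> [? []]].
  rewrite [RHS]integral_mkcond; apply: eq_integral => y _ /=.
  rewrite /patch; case: ifPn => yE.
    congr (G _); apply/seteqP; split => e; first by move/xsectionP => -[/xsectionP].
    by move/xsectionP => h; apply/xsectionP; split => //; split => //=; exact: set_mem.
  rewrite (_ : xsection _ _ = set0) ?measure0//; apply/seteqP; split => e //.
  by move/xsectionP => -[_ [/= yE' _]]; move: yE; rewrite mem_set.
have [N [mN QN sN]] := integral_ae_eq measurableT ik mg eqE.
exists N; split => // y Ny; rewrite -xS; apply: contrapT => h; apply: Ny; apply: sN => /=.
by move=> /(_ I).
Qed.

(* A conditional law is only determined almost surely for each fixed event; the null sets
   are uniform over rational orthants, from which real ones follow by approximation. *)
Lemma kappa_ae_countable (I : countType) (A : I -> set T3) : (forall i, measurable (A i)) ->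
  exists N, [/\ measurable N, Q N = 0 &
    forall y, ~ N y -> forall i, kappa y (A i) = G [set e | A i (Phi y e)]].
Proof.
move=> mA.
pose N0 k : set T1 := if unpickle k is Some i then [set y | kappa y (A i) <> G [set e | A i (Phi y e)]] else set0.
have nN0 k : Q.-negligible (N0 k).
  rewrite /N0; case: unpickle => [i|]; last exact: negligible_set0.
  have [N [mN QN hN]] := kappa_ae (mA i).
  by exists N; split => // y /= h; apply: contrapT => /hN.
have [N [mN QN sN]] := negligible_bigcup nN0.
exists N; split => // y Ny i; apply: contrapT => h; apply: Ny; apply: sN; exists (pickle i) => //.
by rewrite /N0 pickleK.
Qed.

End laws.

(** * Orthants and hyperrectangles *)

Section orthants.
Context (R : realType) (D : nat).
Let T := D.-tuple R.

Definition orthant (c : bool * 'I_D -> R) : set T := [set x | forall j, signed j.1 (tnth x j.2) <= c j].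

Lemma measurable_orthant c : measurable (orthant c).
Proof.
apply: (@measurable_le_all _ _ _ _ (fun (x : T) (j : bool * 'I_D) => signed j.1 (tnth x j.2))) => -[[] j] /=.
- by apply: measurable_funN; exact: measurable_tnth.
- exact: measurable_tnth.
Qed.

Variables (mu nu : {measure set T -> \bar R}).
Hypotheses (mu1 : mu setT = 1%E) (nu1 : nu setT = 1%E).

Let finm (m : {measure set T -> \bar R}) A : m setT = 1%E -> measurable A -> m A \is a fin_num.
Proof.
move=> m1 mA; rewrite ge0_fin_numE//; apply: (@le_lt_trans _ _ (m setT)); last by rewrite m1 ltry.
exact: le_mu.
Qed.

(** A rational orthant fits between the thresholds [c] and [c + 1 / (k + 1)]; letting [k] grow,
    continuity of [m2] from above gives one inequality, and exchanging the measures gives the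
    other. *)
Lemma orthant_le (m1 m2 : {measure set T -> \bar R}) : m1 setT = 1%E -> m2 setT = 1%E ->
  (forall q : {ffun bool * 'I_D -> rat}, m1 (orthant (fun j => ratr (q j))) = m2 (orthant (fun j => ratr (q j)))) ->
  forall c, (m1 (orthant c) <= m2 (orthant c))%E.
Proof.
move=> h1 h2 rat12 c.
pose C k : set T := orthant (fun j => c j + k.+1%:R^-1).
have lek k : (m1 (orthant c) <= m2 (C k))%E.
  have ex j : exists q : rat, c j <= ratr q <= c j + k.+1%:R^-1.
    have lt : c j < c j + k.+1%:R^-1 by rewrite ltrDl invr_gt0 ltr0n.
    by have [q] := rat_in_itvoo lt; rewrite in_itv/= => /andP[a b]; exists q; rewrite !ltW.
  have [q hq] := choice ex.
  pose qf : {ffun bool * 'I_D -> rat} := [ffun j => q j].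
  apply: (@le_trans _ _ (m1 (orthant (fun j => ratr (qf j))))).
    apply: le_mu; [exact: measurable_orthant|exact: measurable_orthant|].
    by move=> x h j; rewrite (le_trans (h j))// ffunE; case/andP: (hq j).
  rewrite rat12; apply: le_mu; [exact: measurable_orthant|exact: measurable_orthant|].
  by move=> x h j; rewrite (le_trans (h j))// ffunE; case/andP: (hq j).
have CE : \bigcap_k C k = orthant c.
  apply/seteqP; split => x h; last by move=> k _ j; rewrite (le_trans (h j))// lerDl invr_ge0.
  move=> j.
  apply/ler_addgt0Pr => e e0.
  have [k ke] : exists k, k.+1%:R^-1 < e.
    have ie : 0 <= e^-1 by rewrite invr_ge0 ltW.
    exists (Num.truncn e^-1); rewrite invf_plt ?posrE//.
    by have /andP[] := truncn_itv ie.
  by rewrite (le_trans (h k I j))// lerD2l ltW.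
have m2C : (m2 \o C) x @[x --> \oo] --> m2 (\bigcap_k C k).
  apply: nonincreasing_cvg_mu.
  - by rewrite -ge0_fin_numE// finm//; exact: measurable_orthant.
  - by move=> k; exact: measurable_orthant.
  - by rewrite CE; exact: measurable_orthant.
  move=> k l kl; apply/subsetPset => x h j; rewrite (le_trans (h j))// lerD2l lef_pV2 ?posrE ?ltr0n//.
  by rewrite ler_nat.
rewrite -CE; have <- : limn (m2 \o C) = m2 (\bigcap_k C k) by apply/cvg_lim.
apply: lime_ge; first by apply/cvg_ex; eexists; exact: m2C.
by apply: nearW => k; rewrite CE; exact: lek.
Qed.

Let cvg_fine (m : {measure set T -> \bar R}) (F : nat -> set T) A : m setT = 1%E ->
  measurable A -> (m \o F) k @[k --> \oo] --> m A -> fine (m (F k)) @[k --> \oo] --> fine (m A).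
Proof.
move=> m1 mA cv; apply: (@fine_cvg _ _ _ _ (m \o F)).
by rewrite fineK ?finm.
Qed.

(** With both signs of each coordinate a bounded hyperrectangle is an orthant. Infinite sides are
    replaced by [k], and the uniform bound passes to the limit along the increasing sets. *)
Lemma rectangle_comparison (delta : R) : 0 <= delta ->
  (forall c, `|fine (mu (orthant c)) - fine (nu (orthant c))| <= delta) ->
  forall A, hyperrectangles A -> measurable A /\ `|fine (mu A) - fine (nu A)| <= delta.
Proof.
move=> d0 cmp A [a [b [ab ->]]].
case: (pselect (exists j, a j = +oo%E \/ b j = -oo%E)) => [[j hj]|nab].
  rewrite (_ : [set x | _] = set0).
    by rewrite !measure0/= subrr normr0.
  apply/seteqP; split => x //= /(_ j) /andP[h1 h2].
  by case: hj => e; move: h1 h2; rewrite e.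
pose c (k : nat) (j : bool * 'I_D) : R := if j.1 then
  (if a j.2 is r%:E then - r else k%:R) else (if b j.2 is r%:E then r else k%:R).
pose F k : set T := orthant (c k).
have Fup : {homo F : k l / (k <= l)%N >-> (k <= l)%O}.
  move=> k l kl; apply/subsetPset => x h j; rewrite (le_trans (h j))// /c.
  by case: j.1; [case: (a j.2)|case: (b j.2)] => *; rewrite ?ler_nat.
have FE : [set x : T | forall j, (a j <= (tnth x j)%:E <= b j)%E] = \bigcup_k F k.
  apply/seteqP; split => x /= h; last first.
    case: h => k _ h j; apply/andP; split.
      have := h (true, j); rewrite /c/=; have naj : a j != +oo%E by apply/eqP => e; apply: nab; exists j; left.
      by case: (a j) naj => [r||]//= _; rewrite ?leNye// lee_fin lerN2.
    have := h (false, j); rewrite /c/=; have nbj : b j != -oo%E by apply/eqP => e; apply: nab; exists j; right.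
    by case: (b j) nbj => [r||]//= _; rewrite ?leey// lee_fin.
  pose k := (Num.truncn (\sum_j `|tnth x j|)).+1.
  have hk j : `|tnth x j| <= k%:R.
    have s0 : 0 <= \sum_j `|tnth x j| by apply: sumr_ge0.
    apply: (@le_trans _ _ (\sum_j `|tnth x j|)); first by rewrite (bigD1 j)//= lerDl sumr_ge0.
    by have /andP[_ /ltW] := truncn_itv s0.
  exists k => // -[s j]; have /andP[h1 h2] := h j; have := hk j; rewrite ler_norml => /andP[h3 h4].
  rewrite /c /signed /=; case: s.
    by move: h1; case: (a j) => [r||]// h1; rewrite ?lerN2// lerNl.
  by move: h2; case: (b j) => [r||]// h2.
have mF k : measurable (F k) by exact: measurable_orthant.
have mA : measurable (\bigcup_k F k) by exact: bigcup_measurable.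
rewrite FE; split=> //.
have c1 := cvg_fine mu1 mA (nondecreasing_cvg_mu mF mA Fup).
have c2 := cvg_fine nu1 mA (nondecreasing_cvg_mu mF mA Fup).
have cB : (fun k => `|fine (mu (F k)) - fine (nu (F k))|) k @[k --> \oo] --> `|fine (mu (\bigcup_k F k)) - fine (nu (\bigcup_k F k))|.
  by apply: cvg_norm; exact: cvgB.
by apply: (cvgr_to_le cB); apply: nearW => k; exact: cmp.
Qed.

End orthants.

Section reweighting.
Context (R : realType) d (T : measurableType d) (n D : nat).
Hypothesis n4 : (4 <= n)%N.
Variable h : T -> T -> 'I_D -> R.
Hypothesis hsym : forall x y, h x y = h y x.

(** Expand [w i * w j = 1 + e_i + e_j + e_i e_j]. The constant part cancels against [U], the
    correction by [wbar] centres the linear part into [acoef], and the products form the chaos. *)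
Lemma reweighted_ustat (y : n.-tuple T) (w : 'I_n -> R) (e : n.-tuple R) k : (forall i, w i = 1 + tnth e i) ->
  let U := (n%:R * (n%:R - 1))^-1 * \sum_(i < n) \sum_(j < n | i != j) h (tnth y i) (tnth y j) k in
  Num.sqrt n%:R * ((n%:R * (n%:R - 1))^-1 *
    (\sum_(i < n) \sum_(j < n | i != j) w i * w j * h (tnth y i) (tnth y j) k)
    - 2 * (n%:R^-1 * \sum_(i < n) w i - 1) * U - U) / 2 =
  gaussv (acoef h y) e k + chaos (fun i l m => h (tnth y i) (tnth y l) m) e k.
Proof.
move=> wE U; have nR : 0 < n%:R :> R by rewrite ltr0n (leq_trans _ n4).
have n10 : 0 < n%:R - 1 :> R by rewrite subr_gt0 ltr1n (leq_trans _ n4).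
set sn := Num.sqrt n%:R; have sn0 : 0 < sn by rewrite sqrtr_gt0.
have sn2 : sn ^+ 2 = n%:R by rewrite sqr_sqrtr// ltW.
pose H i l := h (tnth y i) (tnth y l) k.
have Hs i l : H i l = H l i by rewrite /H hsym.
pose E := tnth e.
pose S0 := \sum_(i < n) \sum_(j < n | j != i) H i j.
pose S1 := \sum_(i < n) E i * \sum_(j < n | j != i) H i j.
pose S2 := \sum_(l < n) \sum_(i < n | (i < l)%N) E i * E l * H i l.
have UE : U = (n%:R * (n%:R - 1))^-1 * S0.
  by rewrite /U; congr (_ * _); apply: eq_bigr => i _; apply: eq_bigl => j; rewrite eq_sym.
have UE' : Ustat h y k = U by rewrite UE.
have wS : \sum_(i < n) w i = n%:R + \sum_i E i.
  by rewrite (eq_bigr _ (fun i _ => wE i)) big_split/= sumr_const card_ord.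
have WS : \sum_(i < n) \sum_(j < n | i != j) w i * w j * h (tnth y i) (tnth y j) k = S0 + 2 * S1 + 2 * S2.
  have S1' : \sum_(i < n) \sum_(j < n | j != i) E j * H i j = S1.
    rewrite (exchange_big_dep xpredT)//=; apply: eq_bigr => j _; rewrite mulr_sumr.
    by apply: eq_big => [i|i _]; [rewrite eq_sym|rewrite Hs].
  have S2' : \sum_(i < n) \sum_(j < n | j != i) E i * E j * H i j = 2 * S2.
    by rewrite sum_offdiag_sym// => i l; rewrite Hs (mulrC (E i)).
  rewrite -S2' (_ : 2 * S1 = S1 + S1); last by ring.
  rewrite -{2}S1' /S0 /S1 addrA -!big_split/=; apply: eq_bigr => i _.
  rewrite mulr_sumr -!big_split/=; apply: eq_big => [j|j _]; first by rewrite eq_sym.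
  by rewrite !wE /E /H; ring.
have gE : gaussv (acoef h y) e k = sn^-1 * ((n%:R - 1)^-1 * S1 - U * \sum_i E i).
  rewrite /gaussv /linf /S1 mulr_sumr mulr_sumr -sumrB mulr_sumr; apply: eq_bigr => i _.
  by rewrite /acoef /ghat UE' -/sn /E /H; ring.
have cE : chaos (fun i l m => h (tnth y i) (tnth y l) m) e k = (sn * (n%:R - 1))^-1 * S2 by [].
rewrite gE cE WS wS UE -sn2; move: (\sum_i E i) => z.
by field; rewrite sn2 !gt_eqF.
Qed.

End reweighting.

(** * The model *)

(** Transporting positive and negative parts separately also covers the arguments at which the
    section diverges and [fine] returns its default, as [gprojE] requires. *)
Lemma Ex_map_measurable (R : realType) d1 (T1 : measurableType d1) d2 (T2 : measurableType d2)
    (P : probability T1 R) (P' : probability T2 R) (phi : T1 -> T2) :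
  measurable_fun setT phi -> (forall A, measurable A -> P (phi @^-1` A) = P' A) ->
  forall f : T2 -> R, measurable_fun setT f -> Ex P (fun x => f (phi x)) = Ex P' f.
Proof.
move=> mphi PP' f mf; apply: (congr1 fine); rewrite integralE [RHS]integralE.
have mE : measurable_fun setT (fun y => (f y)%:E) by exact/measurable_EFinP.
congr (_ - _)%E.
- rewrite -(ge0_integral_map mphi PP' (measurable_funepos mE)) => [|y]; last exact: funepos_ge0.
  by apply: eq_integral => x _; rewrite !funeposE.
- rewrite -(ge0_integral_map mphi PP' (measurable_funeneg mE)) => [|y]; last exact: funeneg_ge0.
  by apply: eq_integral => x _; rewrite !funenegE.
Qed.

Section model_facts.
Context (R : realType) (n d p : nat) (M : model R n d p).
Let P := Pr M.
Let F := lawF M.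
Let T := p.-tuple R.
Let FF := (F \x F : probability _ _)%E.
Let n4 : (4 <= n)%N := n_ge4 M.

Definition kernel_fun (x y : T) (k : 'I_d) : R := tnth (hker M x y) k.
Let hr := kernel_fun.

Let mhr k : measurable_fun setT (fun z : T * T => hr z.1 z.2 k).
Proof. exact: (measurableT_comp (measurable_tnth k) (h_measurable M)). Qed.

Let hrsym x y : hr x y = hr y x.
Proof. by apply/funext => k; rewrite /hr /kernel_fun h_sym. Qed.

Lemma law_Xa_Xb S : measurable S -> P ((fun o => (Xa M o, Xb M o)) @^-1` S) = FF S.
Proof.
apply: (joint_law (X := Xa M) (W := Xb M)) => //.
- by move=> A mA; rewrite -(Xa_law M).
- by move=> A mA; rewrite -(Xb_law M).
by move=> A B mA mB; rewrite setIC muleC; exact: (XaXb_indep M mB mA).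
Qed.

Lemma law_X1_X2 (i j : 'I_n) : i != j -> forall S, measurable S ->
  P ((fun o => (Xs M i o, Xs M j o)) @^-1` S) = FF S.
Proof.
move=> ij S mS; apply: (joint_law (X := Xs M i) (W := Xs M j)) => //.
- by move=> A mA; rewrite -(X_law M i).
- by move=> A mA; rewrite -(X_law M j).
move=> A B mA mB.
have := @X_indep _ _ _ _ M [set i; j]%SET (fun k => if k == i then B else A).
rewrite (_ : \bigcap_(k in _) _ = (Xs M j @^-1` A) `&` (Xs M i @^-1` B)); last first.
  have ji : (j == i) = false by rewrite eq_sym (negbTE ij).
  apply/seteqP; split => o /= h.
    have hi := h i; have hj := h j; move: hi hj; rewrite /= !inE !eqxx orbT ji/=.
    by move=> hi hj; split; [exact: hj|exact: hi].
  move=> k /=; rewrite !inE => /orP[]/eqP ->; rewrite ?eqxx; first by case: h.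
  by rewrite eq_sym (negbTE ij); case: h.
move=> ->; last by move=> k; case: ifP.
rewrite big_setU1 ?inE//= big_set1 eqxx eq_sym (negbTE ij).
by rewrite muleC.
Qed.

Let mXaXb : measurable_fun setT (fun o => (Xa M o, Xb M o)).
Proof. by apply/measurable_fun_pair; exact: measurable_funPT. Qed.

Lemma expectation_Xa_Xb (f : T -> T -> R) (c : R) :
  measurable_fun setT (fun z : T * T => f z.1 z.2) -> (forall x y, 0 <= f x y) ->
  ('E_P[(fun o => f (Xa M o) (Xb M o))] <= c%:E)%E ->
  intg FF (fun z => f z.1 z.2) /\ Ex FF (fun z => f z.1 z.2) <= c.
Proof.
move=> mf f0 h; apply: intg_ge0 => //.
have mE : measurable_fun setT (fun z : T * T => (f z.1 z.2)%:E) by exact/measurable_EFinP.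
have f0E z : (0 <= (f z.1 z.2)%:E)%E by rewrite lee_fin.
rewrite -(ge0_integral_map mXaXb law_Xa_Xb mE f0E).
by move: h; rewrite unlock.
Qed.

Section moments.
Variables (b B : R).
Hypothesis mom : moment_conditions M b B.

Let pow4E (s : R) : `|s| ^+ 4 = s ^+ 4.
Proof. by rewrite -normrX ger0_norm// (exprM _ 2 2) sqr_ge0. Qed.

Lemma model_moment4 m : intg FF (fun z => hr z.1 z.2 m ^+ 4) /\ Ex FF (fun z => hr z.1 z.2 m ^+ 4) <= B ^+ 2.
Proof.
apply: (expectation_Xa_Xb (f := fun x y => hr x y m ^+ 4)).
- exact: measurable_funX.
- by move=> x y; rewrite -pow4E exprn_ge0.
have [_ /(_ 2%N (or_intror erefl))] := mom m.
by under eq_fun do rewrite pow4E.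
Qed.

Lemma model_moment3 m : Ex FF (fun z => `|hr z.1 z.2 m| ^+ 3) <= B.
Proof.
apply: (expectation_Xa_Xb (f := fun x y => `|hr x y m| ^+ 3) _ _ _).2.
- by apply: measurable_funX; exact: measurableT_comp.
- by move=> x y; rewrite exprn_ge0.
by have [_ /(_ 1%N (or_introl erefl))] := mom m; rewrite expr1.
Qed.

Lemma theta_mean k : theta M k = mean_hr F hr k.
Proof.
have ij : ord1st (n_ge4 M) != ord2nd (n_ge4 M) by [].
have mX12 : measurable_fun setT (fun o => (Xs M (ord1st (n_ge4 M)) o, Xs M (ord2nd (n_ge4 M)) o)).
  by apply/measurable_fun_pair; exact: measurable_funPT.
rewrite /theta /mean_hr -(Ex_map_measurable mX12 (law_X1_X2 ij) (mhr k)).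
by rewrite unlock.
Qed.

Lemma gprojE x k : gproj M x k = proj_hr F hr x k.
Proof.
rewrite /gproj /proj_hr theta_mean; congr (_ - _).
have mx : measurable_fun setT (fun y => hr x y k) by exact: (measurableT_comp (mhr k) (pair1_measurable x)).
have mXb : measurable_fun setT (Xb M) by exact: measurable_funPT.
rewrite -(Ex_map_measurable mXb (Xb_law M) mx).
by rewrite unlock.
Qed.

Let D0 : (0 < d)%N. Proof. by rewrite (leq_trans _ (d_ge3 M)). Qed.

Lemma model_variance (B1 : 1 <= B) m : b <= Ex F (fun x => proj_hr F hr x m ^+ 2).
Proof.
have [i2 _] := proj_hr2 D0 mhr B1 (fun m => (model_moment4 m).1) (fun m => model_moment3 m) m.
have [h _] := mom m; rewrite -lee_fin -(Ex_EFin i2); apply: (le_trans h).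
have mXa : measurable_fun setT (Xa M) by exact: measurable_funPT.
have mp : measurable_fun setT (fun x => (proj_hr F hr x m ^+ 2)%:E).
  by apply/measurable_EFinP; exact: intg_measurable i2.
rewrite -(ge0_integral_map mXa (Xa_law M) mp); last by move=> x; rewrite lee_fin sqr_ge0.
by rewrite unlock; under eq_fun do rewrite gprojE.
Qed.

End moments.

Let X := @X1n R n d p M.
Let W (o : Omega M) : n.-tuple R := [tuple ws M i o - 1 | i < n].
Let Wraw (o : Omega M) : n.-tuple R := [tuple ws M i o | i < n].

Let mX : measurable_fun setT X.
Proof.
apply/measurable_fun_tnthP => i; rewrite (_ : _ \o _ = Xs M i); first exact: measurable_funPT.
by apply/funext => o /=; rewrite tnth_mktuple.
Qed.

Let mW : measurable_fun setT W.
Proof.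
apply/measurable_fun_tnthP => i; rewrite (_ : _ \o _ = fun o => ws M i o - 1); last first.
  by apply/funext => o /=; rewrite tnth_mktuple.
by apply: measurable_funB => //; exact: measurable_funPT.
Qed.

Let W_X A B : measurable A -> measurable B ->
  P ((W @^-1` A) `&` (X @^-1` B)) = (P (W @^-1` A) * P (X @^-1` B))%E.
Proof.
move=> mA mB; pose sh (v : n.-tuple R) : n.-tuple R := [tuple tnth v i - 1 | i < n].
have msh : measurable_fun setT sh.
  apply/measurable_fun_tnthP => i; rewrite (_ : _ \o _ = fun v : n.-tuple R => tnth v i - 1); last first.
    by apply/funext => o /=; rewrite tnth_mktuple.
  by apply: measurable_funB => //; exact: measurable_tnth.
have e : W @^-1` A = Wraw @^-1` (sh @^-1` A).
  rewrite /W /Wraw /sh /preimage/=; apply/funext => o /=; congr (A _).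
  by apply: eq_from_tnth => i; rewrite !tnth_mktuple.
rewrite e; apply: (w_X_indep M) => //.
by rewrite -[X in measurable X]setTI; exact: msh.
Qed.

Let Fprod (Q : probability (n.-tuple T) R) : (forall A, measurable A -> P (X @^-1` A) = Q A) -> prodlike F Q.
Proof.
move=> XQ A mA; rewrite -XQ; last exact: measurable_rect.
have := @X_indep _ _ _ _ M [set: 'I_n]%SET A mA.
rewrite (_ : \bigcap_(k in _) _ = X @^-1` (rect A)); last first.
  apply/seteqP; split => o /= h i; last by move=> _; have := h i; rewrite tnth_mktuple.
  by rewrite tnth_mktuple; apply: h; rewrite /= inE.
move=> ->; apply: eq_big => [i|i _]; first by rewrite inE.
 exact: (X_law M i (mA i)).
Qed.

Let Gprod (G : probability (n.-tuple R) R) : (forall A, measurable A -> P (W @^-1` A) = G A) ->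
  exists N : probability R R, std_normal N /\ prodlike N G.
Proof.
move=> WG.
have ms i : measurable_fun setT (fun o => ws M i o - 1).
  by apply: measurable_funB => //; exact: measurable_funPT.
have wlaw i A : measurable A -> P ((fun o => ws M i o - 1) @^-1` A) = normal_prob (0 : R) 1 A.
  move=> mA; rewrite -normal_shift//; have msh : measurable ((fun z : R => z - 1) @^-1` A).
    by rewrite -[X in measurable X]setTI; apply: (measurable_funB (f := id) (g := cst 1)).
  exact: (w_law M i msh).
have [N NP] := pushforward_probability P (ms (ord1st n4)).
exists N; split; first by move=> A mA; rewrite -NP// wlaw.
move=> A mA; rewrite -WG; last exact: measurable_rect.
have mA' i : measurable ((fun z : R => z - 1) @^-1` A i).
  by rewrite -[X in measurable X]setTI; apply: (measurable_funB (f := id) (g := cst 1)).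
have := @w_indep _ _ _ _ M [set: 'I_n]%SET _ mA'.
rewrite (_ : \bigcap_(k in _) _ = W @^-1` (rect A)); last first.
  apply/seteqP; split => o /= h i; last by move=> _; have := h i; rewrite tnth_mktuple.
  by rewrite tnth_mktuple; apply: h; rewrite /= inE.
move=> ->; apply: eq_big => [i|i _]; first by rewrite inE.
  transitivity (normal_prob (0 : R) 1 (A i)); first exact: (wlaw i (A i) (mA i)).
by rewrite -NP// wlaw.
Qed.

(** The reweighted statistic as a function of the sample and the centred weights: its conditional
    law is that of [Phi y] under the law of the weights. *)
Let Phi (y : n.-tuple T) (e : n.-tuple R) : d.-tuple R :=
  [tuple gaussv (acoef hr y) e k + chaos (fun i l m => hr (tnth y i) (tnth y l) m) e k | k < d].

Let mPhi : measurable_fun setT (fun z : n.-tuple T * n.-tuple R => Phi z.1 z.2).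
Proof.
apply/measurable_fun_tnthP => k.
rewrite (_ : _ \o _ = fun z : n.-tuple T * n.-tuple R => gaussv (acoef hr z.1) z.2 k +
    chaos (fun i l m => hr (tnth z.1 i) (tnth z.1 l) m) z.2 k); last first.
  by apply/funext => z /=; rewrite tnth_mktuple.
have mp i l : measurable_fun setT (fun z : n.-tuple T * n.-tuple R => hr (tnth z.1 i) (tnth z.1 l) k).
  have mq := @measurable_pair_tnth _ _ _ n (fun x y => hr x y k) (mhr k) i l.
  by apply: (@measurableT_comp _ _ _ _ _ _ (fun y : n.-tuple T => hr (tnth y i) (tnth y l) k) _ fst).
have mt i : measurable_fun setT (fun z : n.-tuple T * n.-tuple R => tnth z.2 i).
  exact: (measurableT_comp (measurable_tnth i) measurable_snd).
apply: measurable_funD.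
  apply: measurable_sum => i; apply: measurable_funM => //; apply: measurable_funM => //.
  apply: measurable_funB; last first.
    have mq := @measurable_ustat2 _ _ _ n (fun x y => hr x y k) (mhr k).
    by apply: (@measurableT_comp _ _ _ _ _ _ (fun y : n.-tuple T => ustat2 (fun a b => hr a b k) y) _ fst).
  apply: measurable_funM => //; under eq_fun do rewrite big_mkcond; apply: measurable_sum => l.
  by case: (l != i).
apply: measurable_funM => //; apply: measurable_sum => l.
under eq_fun do rewrite big_mkcond; apply: measurable_sum => i; case: (i < l)%N => //.
by apply: measurable_funM => //; apply: measurable_funM.
Qed.

Lemma Tflat_chaos o : Tflat o = Phi (X o) (W o).
Proof.
apply: eq_from_tnth => k; rewrite !tnth_mktuple.
rewrite -(reweighted_ustat n4 hrsym (X o) (w := fun i => ws M i o) (e := W o)); last first.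
  by move=> i; rewrite tnth_mktuple addrC subrK.
rewrite /Uflat /Un /wbar.
have e i j : hr (tnth (X o) i) (tnth (X o) j) k = tnth (hker M (Xs M i o) (Xs M j o)) k.
  by rewrite !tnth_mktuple.
under [X in _ = _ * (_ * X - _ - _) / _]eq_bigr => i _ do under eq_bigr => j _ do rewrite e.
under [X in _ = _ * (_ - _ * (_ * X) - _) / _]eq_bigr => i _ do under eq_bigr => j _ do rewrite e.
under [X in _ = _ * (_ - _ - _ * X) / _]eq_bigr => i _ do under eq_bigr => j _ do rewrite e.
by [].
Qed.

Lemma Tn_Ustat o k : tnth (Tn o) k = Num.sqrt n%:R * (Ustat hr (X o) k - mean_hr F hr k) / 2.
Proof.
rewrite tnth_mktuple theta_mean; congr (_ * (_ - _) / _).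
rewrite /Un /Ustat /ustat2; congr (_ * _); apply: eq_bigr => i _; apply: eq_big => [j|j _].
  by rewrite eq_sym.
by rewrite !tnth_mktuple.
Qed.


Let mTn : measurable_fun setT (@Tn R n d p M).
Proof.
apply/measurable_fun_tnthP => k.
rewrite (_ : _ \o _ = fun o => Num.sqrt n%:R * (Ustat hr (X o) k - mean_hr F hr k) / 2); last first.
  by apply/funext => o' /=; rewrite Tn_Ustat.
apply: measurable_funM => //; apply: measurable_funM => //; apply: measurable_funB => //.
have mq := @measurable_ustat2 _ _ _ n (fun x y => hr x y k) (mhr k).
by apply: (@measurableT_comp _ _ _ _ _ _ (fun y : n.-tuple T => ustat2 (fun a b => hr a b k) y) _ X).
Qed.

Variable kappa : R.-pker (n.-tuple T) ~> (d.-tuple R).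

Lemma rhoB_le (delta : R) o : 0 <= delta ->
  (forall c, `|fine (P (@Tn R n d p M @^-1` orthant c)) - fine (kappa (X o) (orthant c))| <= delta) ->
  (rhoB kappa o <= delta%:E)%E.
Proof.
move=> delta0 cmp; apply: ge_ereal_sup => _ /= [A hA <-].
have [mu muE] := pushforward_probability P mTn.
have kT : kappa (X o) setT = 1%E by exact: prob_kernel.
have muT : mu setT = 1%E by exact: probability_setT.
have cmpc c : `|fine (mu (orthant c)) - fine (kappa (X o) (orthant c))| <= delta.
  rewrite -[mu _]muE; first exact: cmp.
  exact: measurable_orthant.
have [mA hA'] := rectangle_comparison muT kT delta0 cmpc hA.
have f1 : mu A = (fine (mu A))%:E by rewrite fineK// fin_num_measure.
have f2 : kappa (X o) A = (fine (kappa (X o) A))%:E.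
  rewrite fineK// ge0_fin_numE//; apply: (@le_lt_trans _ _ 1%E); last exact: ltry.
  exact: kappa_le1.
rewrite [Pr M _](muE A mA) f1 -[X1n o]/(X o) f2 -EFinB abse_EFin lee_fin.
exact: hA'.
Qed.

Lemma rhoB_le1 (o : Omega M) : (rhoB kappa o <= 1)%E.
Proof.
apply: rhoB_le => // c; have mo := measurable_orthant c.
have mT : measurable (@Tn R n d p M @^-1` orthant c) by rewrite -[X in measurable X]setTI; exact: mTn.
have k1 := kappa_le1 kappa (X o) mo.
have kf : kappa (X o) (orthant c) \is a fin_num.
  by rewrite ge0_fin_numE// (le_lt_trans k1)// ltry.
have k0 : 0 <= fine (kappa (X o) (orthant c)) by exact: fine_ge0.
have k1' : fine (kappa (X o) (orthant c)) <= 1 by rewrite -lee_fin fineK.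
have := pr_ge0 P (@Tn R n d p M @^-1` orthant c); have := pr_le1 P mT; rewrite /pr.
by rewrite ler_norml; move: k0 k1'; lra.
Qed.

Variables (b B kap K gam x : R).
Let L : R := ln (n * d)%:R.
Hypotheses (cond : cond_law_Tflat M kappa) (B1 : 1 <= B) (mom : moment_conditions M b B).
Hypotheses (b0 : 0 < b) (kap1 : 1 <= kap) (kb : 1 <= kap ^+ 2 * b) (K0 : 0 <= K).
Hypotheses (gam01 : 0 < gam <= 1) (gamL : ln (1 / gam) <= K * L).
Hypotheses (x0 : 0 < x) (small : (24 * 128) * ((K + 4) * (x * L)) <= 1).
Hypothesis rate : (8 * kap ^+ 3 * B) ^+ 2 * L <= n%:R * x ^+ 6.
Hypothesis raw_tail : Ex FF (fun z => (kap * (supn (hr z.1 z.2) + B)) ^+ 2 *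
  (Num.sqrt (x ^+ 3 * n%:R) < kap * (supn (hr z.1 z.2) + B))%R%:R) <= gam * x ^+ 3.

Let nd12 : 12 <= (n * d)%:R :> R.
Proof. by rewrite (ler_nat R 12) (@leq_mul 4 3)// (d_ge3 M). Qed.

Let nd0 : 0 < (n * d)%:R :> R. Proof. exact: lt_le_trans nd12. Qed.

Let eL : expR L = (n * d)%:R. Proof. by rewrite lnK. Qed.

Let L1 : 1 <= L.
Proof. by rewrite -ler_expR eL (le_trans (expR1_le4 R))// (le_trans _ nd12)// ler_nat. Qed.

Let D0 : (0 < d)%N. Proof. by rewrite (leq_trans _ (d_ge3 M)). Qed.

Let dL : (4 * d)%:R <= expR L.
Proof. by rewrite eL ler_nat leq_mul2r n4 orbT. Qed.

Let gamL' : expR (- (K * L)) <= gam.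
Proof.
have /andP[g0 _] := gam01.
by rewrite -[leRHS]lnK ?posrE// ler_expR lerNl -lnV ?posrE// -[_^-1]mul1r.
Qed.

Definition comparison_const : R := 335 * (20 + 64 * swap_const R) + 4 * swap_const R + (28 * (64 * 64) + 40).
Let delta := comparison_const * (x * L).

Let delta0 : 0 <= delta.
Proof.
have k0 := (swap_const_ge R).1; have L0 := le_trans ler01 L1.
rewrite mulr_ge0 ?mulr_ge0 ?(ltW x0)// /comparison_const.
have : 0 <= 28 * (64 * 64) :> R by rewrite !mulr_ge0.
lra.
Qed.

Lemma model_comparison : holds_with_prob_ge P (1 - gam) [set o | (rhoB kappa o <= (comparison_const * (x * L))%:E)%E].
Proof.
have [Q XQ] := pushforward_probability P mX.
have [G WG] := pushforward_probability P mW.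
have FQ := Fprod XQ; have [N [NS NG]] := Gprod WG.
have condP A A' : measurable A -> measurable A' ->
    P (((fun o => Phi (X o) (W o)) @^-1` A) `&` (X @^-1` A')) = (\int[P]_(o in X @^-1` A') kappa (X o) A)%E.
  move=> mA mA'; rewrite -(cond mA mA'); congr (P (_ `&` _)).
  by apply/seteqP; split => o /=; rewrite Tflat_chaos.
have [Nul [mNul QNul kE]] := kappa_ae_countable mX mW XQ WG W_X mPhi condP
  (A := fun q : {ffun bool * 'I_d -> rat} => orthant (fun j => ratr (q j)))
  (fun q => measurable_orthant _).
have [bad [mbad pbad cmp]] := centered_comparison D0 mhr hrsym B1 (fun m => (model_moment4 mom m).1)
  (model_moment3 mom) (fun m => (model_moment4 mom m).2) b0 kap1 kb (model_variance mom B1) n4 dL L1 K0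
  gam01 gamL' x0 small rate raw_tail FQ NS NG.
have mBN : measurable (bad `|` Nul) by exact: measurableU.
exists (X @^-1` (~` (bad `|` Nul))); split.
- by rewrite -[X in measurable X]setTI; apply: mX => //; exact: measurableC.
- move=> o nbad /=; have nb : ~ bad (X o) by move=> h; apply: nbad; left.
  have nN : ~ Nul (X o) by move=> h; apply: nbad; right.
  have mPo : measurable_fun setT (Phi (X o)).
    exact: (@measurableT_comp _ _ _ _ _ _ (fun z : n.-tuple T * n.-tuple R => Phi z.1 z.2) _ (fun e => (X o, e)) mPhi (pair1_measurable (X o))).
  have [nu nuE] := pushforward_probability G mPo.
  have kT : kappa (X o) setT = 1%E by exact: prob_kernel.
  have nuT : nu setT = 1%E by exact: probability_setT.
  have rat12 q : kappa (X o) (orthant (fun j => ratr ((q : {ffun bool * 'I_d -> rat}) j))) = nu (orthant (fun j => ratr (q j))).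
    by rewrite kE// -nuE//; exact: measurable_orthant.
  (* Agreement on rational orthants extends to all thresholds, with no further null set, by
     approximation from above in both directions. *)
  have kappaE c : kappa (X o) (orthant c) = nu (orthant c).
    apply/eqP; rewrite eq_le; apply/andP; split; first exact: (orthant_le kT nuT).
    by apply: (orthant_le nuT kT) => q; rewrite rat12.
  apply: rhoB_le => // c; have mo := measurable_orthant c.
  rewrite kappaE -nuE//.
  rewrite (_ : Phi (X o) @^-1` orthant c = [set e | forall j, signed j.1 (gaussv (acoef hr (X o)) e j.2 +
      chaos (fun i l m => hr (tnth (X o) i) (tnth (X o) l) m) e j.2) <= c j]); last first.
    by apply/seteqP; split => e /= h j; move: (h j); rewrite tnth_mktuple.
  rewrite (_ : @Tn R n d p M @^-1` orthant c = X @^-1` [set z | forall j,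
      signed j.1 (Num.sqrt n%:R * (Ustat hr z j.2 - mean_hr F hr j.2) / 2) <= c j]); last first.
    by apply/seteqP; split => o' /= h j; move: (h j); rewrite Tn_Ustat.
  rewrite XQ; first exact: cmp.
  apply: (@measurable_le_all _ _ _ _ (fun z (j : bool * 'I_d) => signed j.1 (Num.sqrt n%:R * (Ustat hr z j.2 - mean_hr F hr j.2) / 2))) => -[s k].
  have mU : measurable_fun setT (fun z : n.-tuple T => Num.sqrt n%:R * (Ustat hr z k - mean_hr F hr k) / 2).
    apply: measurable_funM => //; apply: measurable_funM => //; apply: measurable_funB => //.
    exact: (@measurable_ustat2 _ _ _ n (fun x y => hr x y k) (mhr k)).
  by case: s => //=; exact: measurable_funN.
- rewrite XQ; last exact: measurableC.
  rewrite pr_EFin; last exact: measurableC.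
  rewrite pr_setC// lee_fin lerD2l lerN2 (le_trans (pr_setU Q mbad mNul))//.
  by rewrite {2}/pr QNul addr0.
Qed.

End model_facts.

(** * Tails of the kernel *)

Section tails.
Context (R : realType) (n d p : nat) (M : model R n d p).
Let F := lawF M.
Let T := p.-tuple R.
Let FF := (F \x F : probability _ _)%E.
Let hr : T -> T -> 'I_d -> R := @kernel_fun R n d p M.
Variables (b B kap gam x u : R).
Hypotheses (B1 : 1 <= B) (kap1 : 1 <= kap).
(** The scale at which two factors [expR (s / b')] together grow like [expR (|h| / (2 B))], up to
    [expR (1 / 2)]. *)
Let b' := 4 * kap * B.
Let s (z : T * T) := kap * (supn (hr z.1 z.2) + B).
Let tail z := s z ^+ 2 * (u < s z)%R%:R.

Let d0 : (0 < d)%N. Proof. by rewrite (leq_trans _ (d_ge3 M)). Qed.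
Let B0 : 0 < B. Proof. exact: lt_le_trans ltr01 B1. Qed.
Let kap0 : 0 < kap. Proof. exact: lt_le_trans ltr01 kap1. Qed.
Let b'0 : 0 < b'. Proof. by rewrite !mulr_gt0. Qed.

Let mhr k : measurable_fun setT (fun z : T * T => hr z.1 z.2 k).
Proof. exact: (measurableT_comp (measurable_tnth k) (h_measurable M)). Qed.

Let ms : measurable_fun setT s.
Proof. by apply: measurable_funM => //; apply: measurable_funD => //; exact: measurable_supn. Qed.

Let mtail : measurable_fun setT tail.
Proof. by apply: measurable_funM; [exact: measurable_funX|exact: measurable_fun_indic_gt]. Qed.

Let s_ge0 z : 0 <= s z. Proof. by rewrite mulr_ge0 ?addr_ge0 ?supn_ge0 ?(ltW B0) ?(ltW kap0). Qed.

Let tail_ge0 z : 0 <= tail z. Proof. exact: mulr_ge0 (sqr_ge0 _) (ler0n _ _). Qed.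

Let sup_attained z : exists m : 'I_d, supn (hr z.1 z.2) = `|hr z.1 z.2 m|.
Proof.
pose m0 := Ordinal d0.
have [m _ e] := @eq_bigmax _ _ _ 0 m0 predT (fun m => `|hr z.1 z.2 m|) isT (fun m _ => normr_ge0 _).
by exists m.
Qed.

Let tail_le (g : T * T -> R) (c : R) : intg FF g -> (forall z, tail z <= g z) -> Ex FF g <= c -> Ex FF tail <= c.
Proof.
move=> ig le; apply: le_trans; apply: Ex_le => //.
by apply: (intg_dom mtail ig) => z; rewrite ger0_norm.
Qed.

(** One exponential factor absorbs the square, a second one produces the decay in [u]. Bounding the
    maximum over coordinates by the sum costs the factor [d]. *)
Lemma exponential_tail : (forall m, (psi1_norm (Pr M) (fun o => tnth (hker M (Xa M o) (Xb M o)) m) <= B%:E)%E) ->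
  Ex FF tail <= (16 * 16) * kap ^+ 2 * B ^+ 2 * d%:R * expR (- (u / b')).
Proof.
move=> psi.
have mexp (C : R) m : measurable_fun setT (fun o : Omega M => expR (`|tnth (hker M (Xa M o) (Xb M o)) m| / C) - 1).
  apply: measurable_funB => //; apply: measurableT_comp => //; apply: measurable_funM => //.
  apply: measurableT_comp => //.
  apply: (@measurableT_comp _ _ _ _ _ _ (fun z : T * T => hr z.1 z.2 m) _ (fun o => (Xa M o, Xb M o))) => //.
  by apply/measurable_fun_pair; exact: measurable_funPT.
have Em m : intg FF (fun z => expR (`|hr z.1 z.2 m| / (2 * B)) - 1) /\
    Ex FF (fun z => expR (`|hr z.1 z.2 m| / (2 * B)) - 1) <= 1.
  have mf : measurable_fun setT (fun z : T * T => expR (`|hr z.1 z.2 m| / (2 * B)) - 1).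
    apply: measurable_funB => //; apply: measurableT_comp => //; apply: measurable_funM => //.
    exact: measurableT_comp.
  apply: (expectation_Xa_Xb (f := fun x y => expR (`|hr x y m| / (2 * B)) - 1)) => //.
    by move=> a c; rewrite subr_ge0 -expR0 ler_expR divr_ge0// mulr_ge0// ltW.
  (* The norm is an infimum; working at [2 B], strictly above it, guarantees an admissible constant
     [C < 2 B]. *)
  have lt : (psi1_norm (Pr M) (fun o => tnth (hker M (Xa M o) (Xb M o)) m) < (2 * B)%:E)%E.
    by apply: (le_lt_trans (psi m)); rewrite lte_fin; move: B0; lra.
  have [_ [C [C0 EC] <-] CB] := ereal_inf_lt lt.
  apply: le_trans EC; rewrite unlock; apply: ge0_le_integral => //.
  - by move=> o _; rewrite lee_fin subr_ge0 -expR0 ler_expR divr_ge0// mulr_ge0// ltW.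
  - by apply/measurable_EFinP; exact: (mexp (2 * B) m).
  - by apply/measurable_EFinP; exact: (mexp C m).
  move=> o _; rewrite lee_fin lerD2r ler_expR ler_wpM2l// lef_pV2 ?posrE ?mulr_gt0// ltW//.
pose c0 := 32 * kap ^+ 2 * B ^+ 2 * 4 * expR (- (u / b')).
pose g (z : T * T) := c0 * \sum_m ((expR (`|hr z.1 z.2 m| / (2 * B)) - 1) + 1).
have i1 m : intg FF (fun z => expR (`|hr z.1 z.2 m| / (2 * B)) - 1 + 1).
  by apply: intgD; [exact: (Em m).1|exact: intg_cst].
have ig : intg FF g by apply: intgZ; apply: intg_sum => m; exact: i1.
have c00 : 0 <= c0.
  rewrite mulr_ge0 ?expR_ge0//; have : 0 <= kap ^+ 2 * B ^+ 2 by rewrite mulr_ge0 ?sqr_ge0.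
  by rewrite -(mulrA 32); lra.
apply: (tail_le ig).
  move=> z; have [m em] := sup_attained z.
  have gm : c0 * expR (`|hr z.1 z.2 m| / (2 * B)) <= g z.
    by rewrite /g ler_wpM2l// (bigD1 m)//= subrK lerDl sumr_ge0// => k _; rewrite subrK expR_ge0.
  apply: le_trans gm; rewrite /tail; case: (ltrP u (s z)) => us; last first.
    by rewrite mulr0 mulr_ge0// expR_ge0.
  rewrite mulr1.
  have e2 : s z ^+ 2 <= 2 * b' ^+ 2 * expR (s z / b').
    have q0 : 0 <= s z / b' by rewrite divr_ge0// ltW.
    have := powr_le_expR 1 q0; rewrite (_ : 2`!%:R = 2 :> R)// => h.
    rewrite (_ : s z ^+ 2 = b' ^+ 2 * (s z / b') ^+ 2); last by field; rewrite gt_eqF.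
    rewrite (_ : 2 * b' ^+ 2 * expR _ = b' ^+ 2 * (2 * expR (s z / b'))); last by ring.
    by rewrite ler_wpM2l ?sqr_ge0.
  apply: (le_trans e2).
  (* On [u < s] this product is at least one, so multiplying by it is free and brings in the
     decay. *)
  have e3 : 1 <= expR (s z / b') * expR (- (u / b')).
    by rewrite -expRD -expR0 ler_expR subr_ge0 ler_pM2r ?invr_gt0// ltW.
  have e4 : expR (s z / b') * expR (s z / b') <= 4 * expR (`|hr z.1 z.2 m| / (2 * B)).
    apply: (@le_trans _ _ (expR 1 * expR (`|hr z.1 z.2 m| / (2 * B)))); last by rewrite ler_wpM2r ?expR_ge0// expR1_le4.
    rewrite -!expRD ler_expR /s em /b'.
    rewrite (_ : kap * _ / _ + _ = 2^-1 + `|hr z.1 z.2 m| / (2 * B)); first by rewrite lerD2r; lra.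
    by field; rewrite !gt_eqF.
  have q0 : 0 <= 2 * b' ^+ 2 by rewrite mulr_ge0// sqr_ge0.
  rewrite (_ : c0 * expR _ = 2 * b' ^+ 2 * (4 * expR (`|hr z.1 z.2 m| / (2 * B)) * expR (- (u / b')))); last first.
    by rewrite /c0 /b'; ring.
  rewrite ler_wpM2l//; apply: (@le_trans _ _ (expR (s z / b') * (expR (s z / b') * expR (- (u / b'))))).
    by rewrite ler_peMr ?expR_ge0.
  by rewrite mulrA ler_wpM2r ?expR_ge0.
rewrite ExZ; last by apply: intg_sum => m; exact: i1.
rewrite Ex_sum//.
apply: (@le_trans _ _ (c0 * \sum_(m < d) 2)).
  rewrite ler_wpM2l//; apply: ler_sum => m _; rewrite ExD ?Ex_cst; [|exact: (Em m).1|exact: intg_cst].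
  by have := (Em m).2; lra.
by rewrite sumr_const card_ord -[_ *+ d]mulr_natr /c0 le_eqVlt; apply/orP; left; apply/eqP; ring.
Qed.

(** On [u < s] the square of [s / u] is at most its power [q], since [q >= 2]. Moreover [s / b'] is
    at most the larger of 1 and [|h| / B], whose power [q] is dominated by [V + 1], of mean at most
    2. *)
Lemma polynomial_tail q : 4 <= q -> 0 < u ->
  ('E_(Pr M)[(fun o => \big[Num.max/0]_(m < d) (`|tnth (hker M (Xa M o) (Xb M o)) m| / B) `^ q)%R] <= 1%:E)%E ->
  Ex FF tail <= 2 * u ^+ 2 / (u / b') `^ q.
Proof.
move=> q4 u0 Eq; have q0 : 0 <= q by apply: le_trans q4.
pose V (y z : T) := \big[Num.max/0]_(m < d) (`|hr y z m| / B) `^ q.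
have VE y z : V y z = supn (fun m => (`|hr y z m| / B) `^ q).
  by apply: eq_bigr => m _; rewrite [RHS]ger0_norm ?powR_ge0.
have V0 y z : 0 <= V y z by rewrite VE supn_ge0.
have mV : measurable_fun setT (fun z : T * T => V z.1 z.2).
  under eq_fun do rewrite VE; apply: measurable_supn => m.
  apply: (@measurableT_comp _ _ _ _ _ _ (fun y : R => y `^ q)) => //.
  by apply: measurable_funM => //; exact: measurableT_comp.
have [iV EV] := expectation_Xa_Xb mV V0 Eq.
pose c0 := u ^+ 2 / (u / b') `^ q.
have ub0 : 0 < u / b' by rewrite divr_gt0.
have c00 : 0 <= c0 by rewrite divr_ge0 ?sqr_ge0 ?powR_ge0.
have iV1 : intg FF (fun z => V z.1 z.2 + 1) by apply: intgD => //; exact: intg_cst.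
apply: (tail_le (intgZ c0 iV1)); last first.
  rewrite ExZ// ExD ?Ex_cst//; last exact: intg_cst.
  by rewrite -[2 * u ^+ 2 / _]mulrA -/c0 mulrC ler_wpM2r//; move: EV; lra.
move=> z; rewrite /tail; case: (ltrP u (s z)) => us; last first.
  by rewrite mulr0 mulr_ge0// addr_ge0.
rewrite mulr1; have [m em] := sup_attained z.
have r1 : 1 <= s z / u by rewrite ler_pdivlMr// mul1r ltW.
have h2 : (s z / u) ^+ 2 <= (s z / u) `^ q.
  rewrite -powR_mulrn; last exact: le_trans r1.
  by apply: ler_powR => //; apply: le_trans q4; rewrite ler_nat.
have hV : (`|hr z.1 z.2 m| / B) `^ q <= V z.1 z.2 by exact: (le_bigmax 0 (fun m => (`|hr z.1 z.2 m| / B) `^ q) m).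
have sb0 : 0 <= s z / b' by rewrite divr_ge0// ltW.
have h3 : (s z / b') `^ q <= V z.1 z.2 + 1.
  have -> : s z / b' = (`|hr z.1 z.2 m| / B + 1) / 4.
    by rewrite /s em /b'; field; rewrite !gt_eqF.
  have a0 : 0 <= `|hr z.1 z.2 m| / B by rewrite divr_ge0// ltW.
  case: (lerP (`|hr z.1 z.2 m| / B) 1) => hz.
    apply: (@le_trans _ _ (1 `^ q)); last by rewrite powR1 lerDr.
    by apply: ge0_ler_powR => //; rewrite ?nnegrE ?divr_ge0 ?addr_ge0//; lra.
  apply: (@le_trans _ _ ((`|hr z.1 z.2 m| / B) `^ q)); last by rewrite (le_trans hV)// lerDl.
  by apply: ge0_ler_powR => //; rewrite ?nnegrE ?divr_ge0 ?addr_ge0//; lra.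
have pE : (s z / u) `^ q = (s z / b') `^ q / (u / b') `^ q.
  rewrite -[LHS](mulfK (lt0r_neq0 (powR_gt0 q ub0))) -powRM ?(ltW ub0) ?(le_trans ler01 r1)//.
  by congr (_ `^ _ / _); field; rewrite !gt_eqF.
rewrite (_ : s z ^+ 2 = u ^+ 2 * (s z / u) ^+ 2); last by field; rewrite gt_eqF.
apply: (@le_trans _ _ (u ^+ 2 * ((s z / b') `^ q / (u / b') `^ q))).
  by rewrite ler_wpM2l ?sqr_ge0// -pE.
rewrite (_ : u ^+ 2 * _ = c0 * (s z / b') `^ q); last by rewrite /c0; ring.
by rewrite ler_wpM2l.
Qed.

End tails.

(** * The two regimes *)

Lemma varpi1X6 (R : realType) n d (B : R) : (0 < n * d)%N ->
  0 <= varpi1 n d B /\ varpi1 n d B ^+ 6 = B ^+ 2 * ln (n * d)%:R ^+ 7 / n%:R.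
Proof.
move=> nd; split; first exact: powR_ge0.
have l0 : 0 <= ln (n * d)%:R :> R by rewrite ln_ge0// ler1n.
rewrite -powR_mulrn ?powR_ge0// /varpi1 -powRrM (_ : 1 / 6 * 6%:R = 1 :> R); last by field.
by rewrite powRr1// divr_ge0// mulr_ge0 ?sqr_ge0// exprn_ge0.
Qed.

Lemma varpi2BX3 (R : realType) n d (B q gam : R) : (0 < n * d)%N ->
  0 <= varpi2B n d B q gam /\
  varpi2B n d B q gam ^+ 3 = B ^+ 2 * ln (n * d)%:R ^+ 3 / (gam `^ (2 / q) * n%:R `^ (1 - 2 / q)).
Proof.
move=> nd; split; first exact: powR_ge0.
have l0 : 0 <= ln (n * d)%:R :> R by rewrite ln_ge0// ler1n.
rewrite -powR_mulrn ?powR_ge0// /varpi2B -powRrM (_ : 1 / 3 * 3%:R = 1 :> R); last by field.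
rewrite powRr1//; apply: divr_ge0; apply: mulr_ge0; rewrite ?sqr_ge0 ?exprn_ge0//; exact: powR_ge0.
Qed.

Section regimes.
Context (R : realType) (n d p : nat) (M : model R n d p).
Variable kappa : R.-pker (n.-tuple (p.-tuple R)) ~> (d.-tuple R).
Variables (b B kap bbar K gam : R).
Hypotheses (cond : cond_law_Tflat M kappa) (B1 : 1 <= B) (mom : moment_conditions M b B).
Hypotheses (b0 : 0 < b) (kap1 : 1 <= kap) (kb : 1 <= kap ^+ 2 * b) (K0 : 0 <= K).
Hypothesis growth : growth_conditions n d bbar K gam.
Let F := lawF M.
Let T := p.-tuple R.
Let hr : T -> T -> 'I_d -> R := @kernel_fun R n d p M.
Let L : R := ln (n * d)%:R.
Let raw_tail x := Ex (F \x F : probability _ _)%E (fun z => (kap * (supn (hr z.1 z.2) + B)) ^+ 2 *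
  (Num.sqrt (x ^+ 3 * n%:R) < kap * (supn (hr z.1 z.2) + B))%R%:R).

Let n4 := n_ge4 M.
Let nd12 : 12 <= (n * d)%:R :> R.
Proof. by rewrite (ler_nat R 12) (@leq_mul 4 3)// (d_ge3 M). Qed.
Let nd0 : 0 < (n * d)%:R :> R. Proof. exact: lt_le_trans nd12. Qed.
Let ndN : (0 < n * d)%N. Proof. by rewrite -(ltr0n R). Qed.
Let eL : expR L = (n * d)%:R. Proof. by rewrite lnK. Qed.
Let L1 : 1 <= L.
Proof. by rewrite -ler_expR eL (le_trans (expR1_le4 R))// (le_trans _ nd12)// ler_nat. Qed.
Let L0 : 0 < L. Proof. exact: lt_le_trans ltr01 L1. Qed.
Let nR : 0 < n%:R :> R. Proof. by rewrite ltr0n (leq_trans _ n4). Qed.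
Let gam0 : 0 < gam. Proof. by case: growth => /andP[]. Qed.
Let gam01 : 0 < gam <= 1.
Proof.
case: growth => /andP[-> h] _ _ /=; rewrite (le_trans (ltW h))// -expR0 ler_expR; lra.
Qed.
Let gamL : ln (1 / gam) <= K * L. Proof. by case: growth => _ h _; rewrite /L mulnC. Qed.
Let B0 : 0 < B. Proof. exact: lt_le_trans ltr01 B1. Qed.
Let kap0 : 0 < kap. Proof. exact: lt_le_trans ltr01 kap1. Qed.

Let expKL : expR (- (K * L)) <= gam.
Proof.
by rewrite -[leRHS]lnK ?posrE// ler_expR lerNl -lnV ?posrE// -[_^-1]mul1r.
Qed.

(** For [w > c0] the claimed bound exceeds one and nothing has to be shown; otherwise the smallness
    conditions hold at [x = w / L]. *)
Lemma comparison_or_trivial (w c0 : R) : 0 < w -> 0 < c0 ->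
  (8 * kap ^+ 3 * B) ^+ 2 * L ^+ 7 <= n%:R * w ^+ 6 ->
  (w <= c0 -> (24 * 128) * ((K + 4) * w) <= 1 /\ raw_tail (w / L) <= gam * (w / L) ^+ 3) ->
  holds_with_prob_ge (Pr M) (1 - gam) [set o | (rhoB kappa o <= ((comparison_const R + c0^-1) * w)%:E)%E].
Proof.
move=> w0 c00 rate h; have cc : 0 <= comparison_const R.
  have k0 := (swap_const_ge R).1; rewrite /comparison_const.
  have : 0 <= 28 * (64 * 64) :> R by rewrite !mulr_ge0.
  by move: k0; lra.
case: (lerP w c0) => wc.
  have [small tl] := h wc.
  have x0 : 0 < w / L by rewrite divr_gt0.
  have xL : w / L * L = w by rewrite divfK// gt_eqF.
  have small' : (24 * 128) * ((K + 4) * (w / L * L)) <= 1 by rewrite xL.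
  have rate' : (8 * kap ^+ 3 * B) ^+ 2 * L <= n%:R * (w / L) ^+ 6.
    rewrite (_ : n%:R * (w / L) ^+ 6 = n%:R * w ^+ 6 / L ^+ 6); last by field; rewrite gt_eqF.
    rewrite ler_pdivlMr ?exprn_gt0// (_ : _ * L ^+ 6 = (8 * kap ^+ 3 * B) ^+ 2 * L ^+ 7)//.
    by rewrite -[LHS]mulrA -exprS.
  have [E [mE sE PE]] := model_comparison cond B1 mom b0 kap1 kb K0 gam01 gamL x0 small' rate' tl.
  exists E; split => // o /sE /= le; apply: (le_trans le).
  by rewrite xL lee_fin ler_wpM2r ?(ltW w0)// lerDl invr_ge0 ltW.
exists setT; split => //.
  move=> o _ /=; apply: (le_trans (rhoB_le1 kappa o)); rewrite lee_fin mulrDl.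
  by rewrite ler_wpDl ?mulr_ge0 ?(ltW w0)// mulrC ler_pdivlMr// mul1r ltW.
by rewrite probability_setT lee_fin; move: gam0; lra.
Qed.

(** The scale [B] was inflated to [8 kap^3 B] by centring and normalisation; the factor [4 kap] in
    front of [varpi1] more than absorbs it. *)
Let w_rate (w : R) : 4 * kap * varpi1 n d B <= w -> (8 * kap ^+ 3 * B) ^+ 2 * L ^+ 7 <= n%:R * w ^+ 6.
Proof.
move=> hw; have [v0 v6] := varpi1X6 B ndN.
have : (4 * kap * varpi1 n d B) ^+ 6 <= w ^+ 6.
  have q0 : 0 <= 4 * kap * varpi1 n d B by rewrite !mulr_ge0// ltW.
  by apply: lerXn2r => //; rewrite nnegrE// (le_trans q0).
rewrite exprMn v6 -/L => h; apply: (@le_trans _ _ (n%:R * ((4 * kap) ^+ 6 * (B ^+ 2 * L ^+ 7 / n%:R)))); last first.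
  by rewrite ler_wpM2l// ltW.
rewrite (_ : n%:R * _ = 64 * (64 * (kap ^+ 6 * (B ^+ 2 * L ^+ 7)))); last by field; rewrite gt_eqF.
rewrite (_ : _ * L ^+ 7 = 64 * (kap ^+ 6 * (B ^+ 2 * L ^+ 7))); last by ring.
have q0 : 0 <= kap ^+ 6 * (B ^+ 2 * L ^+ 7) by rewrite !mulr_ge0 ?exprn_ge0 ?(ltW kap0) ?(ltW B0) ?(ltW L0).
by lra.
Qed.

(** The exponent [A L] splits in three: [K L] pays for [gam], one [L] for [1 / (n d)], and the
    logarithm for the constant [256 kap^2] of [exponential_tail]. *)
Lemma subexponential_regime (w : R) : 0 < w -> 4 * kap * varpi1 n d B <= w ->
  (forall m, (psi1_norm (Pr M) (fun o => tnth (hker M (Xa M o) (Xb M o)) m) <= B%:E)%E) ->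
  holds_with_prob_ge (Pr M) (1 - gam) [set o | (rhoB kappa o <= ((comparison_const R +
    ((24 * 128) * (K + 4) + (K + 1 + ln ((16 * 16) * kap ^+ 2)))) * w)%:E)%E].
Proof.
move=> w0 hw psi; set A := K + 1 + _.
have k2 : 1 <= kap ^+ 2 by rewrite exprn_ege1.
have k256 : 1 <= (16 * 16) * kap ^+ 2 by lra.
have lA : 0 <= ln ((16 * 16) * kap ^+ 2) by rewrite ln_ge0.
have A1 : 1 <= A by rewrite /A; move: K0 lA; lra.
have c0 : 0 < (24 * 128) * (K + 4) + A by move: K0 A1; lra.
have [S SE] : exists S, S = (24 * 128) * (K + 4) + A by exists ((24 * 128) * (K + 4) + A).
rewrite -SE in c0 *.
(* The threshold is the inverse of the constant, so that [c0^-1] in the conclusion is the constant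
   itself. *)
rewrite -[S]invrK; apply: comparison_or_trivial; [exact: w0|by rewrite invr_gt0|exact: w_rate|rewrite {}SE in c0 *].
move=> wc; have wA : ((24 * 128) * (K + 4) + A) * w <= 1.
  by rewrite mulrC -ler_pdivlMr// div1r.
have Aw : A * w <= 1 by have : 0 <= (K + 4) * w by [rewrite mulr_ge0 ?(ltW w0)//; move: K0; lra]; move: wA; lra.
split; first by have : 0 <= A * w by [rewrite mulr_ge0 ?(ltW w0)//; move: A1; lra]; move: wA; lra.
set x := w / L; have x0 : 0 < x by rewrite divr_gt0.
have xL : x * L = w by rewrite divfK// gt_eqF.
have w1 : w <= 1 by rewrite (le_trans _ Aw)// ler_peMl// ltW.
have x1 : x <= 1 by rewrite ler_pdivrMr// mul1r (le_trans w1).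
have rate : (8 * kap ^+ 3 * B) ^+ 2 * L <= n%:R * x ^+ 6.
  rewrite (_ : n%:R * x ^+ 6 = n%:R * w ^+ 6 / L ^+ 6); last by rewrite /x; field; rewrite gt_eqF.
  rewrite ler_pdivlMr ?exprn_gt0// (_ : _ * L ^+ 6 = (8 * kap ^+ 3 * B) ^+ 2 * L ^+ 7); first exact: w_rate.
  by rewrite -[LHS]mulrA -exprS.
have kap4 : 1 <= kap ^+ 4 by rewrite exprn_ege1.
have kap6 : 1 <= kap ^+ 6 by rewrite exprn_ege1.
apply: (le_trans (exponential_tail _ B1 kap1 psi)).
set u := Num.sqrt _; set b' := 4 * kap * B.
have b'0 : 0 < b' by rewrite !mulr_gt0.
have u2 : u ^+ 2 = x ^+ 3 * n%:R by rewrite sqr_sqrtr// mulr_ge0 ?exprn_ge0 ?(ltW x0) ?(ltW nR).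
have u0 : 0 <= u by exact: sqrtr_ge0.
(* After squaring, [A w <= 1] and the rate condition give this with a factor [4 kap^4] to spare. *)
have AL : A * L <= u / b'.
  rewrite -ler_sqr ?nnegrE ?divr_ge0 ?(ltW b'0) ?mulr_ge0 ?(ltW L0) ?(le_trans ler01 A1)//.
  rewrite expr_div_n u2 ler_pdivlMr ?exprn_gt0// -(ler_pM2l (exprn_gt0 3 x0)).
  rewrite (_ : x ^+ 3 * (x ^+ 3 * n%:R) = n%:R * x ^+ 6); last by ring.
  apply: le_trans rate.
  rewrite (_ : x ^+ 3 * _ = (16 * kap ^+ 2 * B ^+ 2 * L) * ((A * (x * L)) ^+ 2 * (x / L))); last first.
    by rewrite /b'; field; rewrite gt_eqF.
  rewrite (_ : (8 * kap ^+ 3 * B) ^+ 2 * L = (16 * kap ^+ 2 * B ^+ 2 * L) * (4 * kap ^+ 4)); last by ring.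
  rewrite ler_wpM2l//; first by apply: mulr_ge0 (ltW L0); apply: mulr_ge0 (sqr_ge0 _); apply: mulr_ge0 (sqr_ge0 _).
  have q1 : (A * (x * L)) ^+ 2 <= 1.
    by rewrite xL exprn_ile1// mulr_ge0 ?(ltW w0)//; move: A1; lra.
  have q2 : 0 <= x / L <= 1.
    by rewrite divr_ge0 ?(ltW x0) ?(ltW L0)//= ler_pdivrMr// mul1r (le_trans x1).
  by have := sqr_ge0 (A * (x * L)); move: q1 q2 kap4; move: (_ ^+ 2) (x / L) (kap ^+ 4) => ? ? ?; nra.
have eA : expR (- (u / b')) <= gam * ((n * d)%:R)^-1 * ((16 * 16) * kap ^+ 2)^-1.
  apply: (@le_trans _ _ (expR (- (K * L)) * expR (- L) * expR (- ln ((16 * 16) * kap ^+ 2)))).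
    rewrite -!expRD ler_expR; have := ler_wpM2l lA L1; move: AL; rewrite /A; lra.
  rewrite [expR (- L)]expRN eL [expR (- ln _)]expRN lnK ?posrE; last by lra.
  apply: ler_wpM2r; first by rewrite invr_ge0; lra.
  by apply: ler_wpM2r => //; rewrite invr_ge0 ltW.
have dn0 : 0 < d%:R :> R by rewrite ltr0n (leq_trans _ (d_ge3 M)).
apply: (@le_trans _ _ (gam * (B ^+ 2 / n%:R))).
  apply: (@le_trans _ _ ((16 * 16) * kap ^+ 2 * B ^+ 2 * d%:R * (gam * ((n * d)%:R)^-1 * ((16 * 16) * kap ^+ 2)^-1))).
    apply: ler_wpM2l eA; apply: mulr_ge0 (ltW dn0); apply: mulr_ge0 (sqr_ge0 _).
    exact: le_trans ler01 k256.
  rewrite natrM le_eqVlt; apply/orP; left; apply/eqP; field.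
  by rewrite !gt_eqF.
rewrite ler_wpM2l ?(ltW gam0)//; apply: (@le_trans _ _ (x ^+ 6)).
  rewrite ler_pdivrMr// mulrC; apply: le_trans rate.
  rewrite (_ : _ * L = 64 * (kap ^+ 6 * (B ^+ 2 * L))); last by ring.
  have q0 : B ^+ 2 <= B ^+ 2 * L by rewrite ler_peMr ?sqr_ge0.
  have q1 : B ^+ 2 * L <= kap ^+ 6 * (B ^+ 2 * L) by rewrite ler_peMl// (le_trans _ q0)// sqr_ge0.
  by have := sqr_ge0 B; move: q0 q1; lra.
by rewrite (exprD x 3 3) ler_piMl ?exprn_ge0 ?exprn_ile1 ?(ltW x0).
Qed.

(** The second rate is what the truncated second moment demands: it makes [(u / b')^2] at least
    [4 (n / gam)^(2 / q)]. *)
Lemma polynomial_regime (w q : R) : 0 < w -> 4 <= q ->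
  4 * kap * (varpi1 n d B + varpi2B n d B q gam) <= w ->
  ('E_(Pr M)[(fun o => \big[Num.max/0]_(m < d) (`|tnth (hker M (Xa M o) (Xb M o)) m| / B) `^ q)%R] <= 1%:E)%E ->
  holds_with_prob_ge (Pr M) (1 - gam) [set o | (rhoB kappa o <= ((comparison_const R +
    (24 * 128) * (K + 4)) * w)%:E)%E].
Proof.
move=> w0 q4 hw Eq; have [v1 _] := varpi1X6 B ndN; have [v2 v23] := varpi2BX3 B q gam ndN.
have c0 : 0 < (24 * 128) * (K + 4) by move: K0; lra.
have qp : 0 < q by apply: lt_le_trans q4.
have [S SE] : exists S, S = (24 * 128) * (K + 4) by exists ((24 * 128) * (K + 4)).
rewrite -SE in c0 *.
rewrite -[S]invrK; apply: comparison_or_trivial; [exact: w0|by rewrite invr_gt0| |rewrite {}SE in c0 *].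
  by apply: w_rate; rewrite (le_trans _ hw)// ler_wpM2l ?mulr_ge0 ?(ltW kap0)// lerDl.
move=> wc; split.
  have : w * ((24 * 128) * (K + 4)) <= 1 by rewrite -ler_pdivlMr// div1r.
  lra.
set x := w / L; have x0 : 0 < x by rewrite divr_gt0.
pose u := Num.sqrt (x ^+ 3 * n%:R); have u2 : u ^+ 2 = x ^+ 3 * n%:R by rewrite sqr_sqrtr// mulr_ge0 ?exprn_ge0 ?(ltW x0) ?(ltW nR).
have u0 : 0 < u by rewrite sqrtr_gt0 mulr_gt0 ?exprn_gt0.
apply: (le_trans (polynomial_tail B1 kap1 q4 u0 Eq)).
set b' := 4 * kap * B; have b'0 : 0 < b' by rewrite !mulr_gt0.
have ub : 0 < u / b' by rewrite divr_gt0.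
rewrite ler_pdivrMr ?powR_gt0// u2.
(* The factor [x^3] cancels since [u ^+ 2 = x^3 n]. In the remaining inequality [Y] equals
   [(n / gam)^(2 / q)], and the 4 in [4 Y] yields [4^(q / 2) >= 2]. *)
suff h : 2 * n%:R <= gam * (u / b') `^ q.
  by have := ler_wpM2l (ltW (exprn_gt0 3 x0)) h; lra.
pose Y := n%:R / (gam `^ (2 / q) * n%:R `^ (1 - 2 / q)).
have g1 : 0 < gam `^ (2 / q) by rewrite powR_gt0.
have n1 : 0 < n%:R `^ (1 - 2 / q) :> R by rewrite powR_gt0.
have Y0 : 0 < Y by rewrite divr_gt0// mulr_gt0.
have Yq : Y `^ (q / 2) = n%:R / gam.
  have qq : 2 / q * (q / 2) = 1 by field; rewrite gt_eqF.
  have YE : Y * gam `^ (2 / q) = n%:R `^ (2 / q).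
    have e1 : n%:R `^ (1 - 2 / q) * n%:R `^ (2 / q) = n%:R :> R.
      rewrite -powRD ?subrK ?powRr1 ?(ltW nR)//.
      by rewrite (gt_eqF nR) implybT.
    by rewrite /Y -[X in X / _]e1; field; rewrite !gt_eqF.
  have := congr1 (fun y => y `^ (q / 2)) YE.
  rewrite powRM ?(ltW Y0) ?(ltW g1)// -!powRrM qq !powRr1 ?(ltW gam0) ?(ltW nR)// => <-.
  by field; rewrite gt_eqF.
have w3 : 64 * kap ^+ 3 * (B ^+ 2 * L ^+ 3 / (gam `^ (2 / q) * n%:R `^ (1 - 2 / q))) <= w ^+ 3.
  rewrite -v23 (_ : 64 * kap ^+ 3 * _ = (4 * kap * varpi2B n d B q gam) ^+ 3); last by ring.
  have q0 : 0 <= 4 * kap * varpi2B n d B q gam by rewrite !mulr_ge0// ltW.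
  apply: lerXn2r; rewrite ?nnegrE ?(ltW w0)//.
  by rewrite (le_trans _ hw)// ler_wpM2l ?mulr_ge0 ?(ltW kap0)// lerDr.
have uY : 4 * Y <= (u / b') ^+ 2.
  rewrite expr_div_n u2 ler_pdivlMr ?exprn_gt0// expr_div_n.
  rewrite (_ : w ^+ 3 / L ^+ 3 * n%:R = w ^+ 3 * (n%:R / L ^+ 3)); last by ring.
  have nL : 0 <= n%:R / L ^+ 3 by rewrite divr_ge0 ?exprn_ge0 ?(ltW L0) ?(ltW nR).
  apply: (le_trans _ (ler_wpM2r nL w3)).
  rewrite (_ : 4 * Y * b' ^+ 2 = 64 * kap ^+ 2 * B ^+ 2 * Y); last by rewrite /b'; ring.
  rewrite (_ : 64 * kap ^+ 3 * _ * _ = kap * (64 * kap ^+ 2 * B ^+ 2 * Y)); last first.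
    by rewrite /Y; field; rewrite !gt_eqF.
  rewrite ler_peMl//; apply: mulr_ge0 (ltW Y0); apply: mulr_ge0 (sqr_ge0 _); apply: mulr_ge0 (sqr_ge0 _).
  exact: ler0n.
have uq : (u / b') `^ q = ((u / b') ^+ 2) `^ (q / 2).
  rewrite -powR_mulrn ?(ltW ub)// -powRrM; congr (_ `^ _); by field.
rewrite uq; apply: (@le_trans _ _ (gam * (4 * Y) `^ (q / 2))); last first.
  rewrite ler_wpM2l ?(ltW gam0)//; apply: ge0_ler_powR => //; rewrite ?nnegrE ?sqr_ge0 ?divr_ge0 ?(ltW qp)//.
  by rewrite mulr_ge0// ltW.
rewrite powRM ?(ltW Y0)// Yq (_ : gam * _ = 4 `^ (q / 2) * n%:R); last by field; rewrite gt_eqF.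
rewrite ler_wpM2r ?(ltW nR)//; apply: (@le_trans _ _ (4 `^ 1)); first by rewrite powRr1//; lra.
apply: ler_powR; lra.
Qed.

End regimes.

Theorem theorem3p4 (R : realType) (b bbar K : R)
    (b_gt0 : 0 < b) (bbar_gt0 : 0 < bbar) (K_gt0 : 0 < K) :
  (exists2 C : R, 0 < C &
    forall (n d p : nat) (M : model R n d p)
      (kappa : R.-pker (n.-tuple (p.-tuple R)) ~> (d.-tuple R))
      (B gamma : R),
    cond_law_Tflat M kappa -> 1 <= B ->
    moment_conditions M b B -> growth_conditions n d bbar K gamma ->
    (forall m : 'I_d,
      (psi1_norm (Pr M) (fun o => tnth (hker M (Xa M o) (Xb M o)) m) <= B%:E)%E) ->
    holds_with_prob_ge (Pr M) (1 - gamma)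
      [set o | (@rhoB R n d p M kappa o <= (C * varpi1 n d B)%:E)%E]) /\
  (forall q : R, 4 <= q -> exists2 C : R, 0 < C &
    forall (n d p : nat) (M : model R n d p)
      (kappa : R.-pker (n.-tuple (p.-tuple R)) ~> (d.-tuple R))
      (B gamma : R),
    cond_law_Tflat M kappa -> 1 <= B ->
    moment_conditions M b B -> growth_conditions n d bbar K gamma ->
    ('E_(Pr M)[(fun o => \big[Num.max/0]_(m < d)
        (`|tnth (hker M (Xa M o) (Xb M o)) m| / B) `^ q)%R] <= 1%:E)%E ->
    holds_with_prob_ge (Pr M) (1 - gamma)
      [set o | (@rhoB R n d p M kappa o <=
        (C * (varpi1 n d B + varpi2B n d B q gamma))%:E)%E]).
Proof.
(* This choice gives both [1 <= kap] and [kap^2 b = b + 2 + 1 / b >= 1] for every positive [b],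
   without comparing [b] with one. *)
pose kap := 1 + b^-1.
have ib : 0 < b^-1 by rewrite invr_gt0.
have kap1 : 1 <= kap by rewrite /kap lerDl ltW.
have kb : 1 <= kap ^+ 2 * b.
  have -> : kap ^+ 2 * b = b + 2 + b^-1 by rewrite /kap; field; rewrite gt_eqF.
  by move: ib b_gt0; lra.
have cc : 0 < comparison_const R.
  have k0 := (swap_const_ge R).1; rewrite /comparison_const.
  have : 0 <= 28 * (64 * 64) :> R by rewrite !mulr_ge0.
  by move: k0; lra.
have kp : 0 < 4 * kap by move: kap1; lra.
have varpi1_gt0 n d p (M : model R n d p) (B : R) : 1 <= B -> 0 < varpi1 n d B.
  move=> B1; have n4 := n_ge4 M; have d3 := d_ge3 M.
  have nd : (1 < n * d)%N by rewrite (leq_trans (_ : 1 < 4 * 3)%N)// leq_mul.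
  have B0 : 0 < B := lt_le_trans ltr01 B1.
  rewrite powR_gt0// divr_gt0 ?mulr_gt0 ?exprn_gt0 ?ln_gt0 ?ltr1n ?ltr0n//; exact: leq_trans n4.
split.
  have lk : 0 <= ln ((16 * 16) * kap ^+ 2).
    have k2 : 1 <= kap ^+ 2 by rewrite exprn_ege1.
    by rewrite ln_ge0//; lra.
  exists ((comparison_const R + ((24 * 128) * (K + 4) + (K + 1 + ln ((16 * 16) * kap ^+ 2)))) * (4 * kap)).
    by apply: mulr_gt0 kp; move: cc lk K_gt0; lra.
  move=> n d p M kappa B gam cond B1 mom growth psi; rewrite -mulrA.
  apply: (subexponential_regime cond B1 mom b_gt0 kap1 kb (ltW K_gt0) growth) => //.
  by rewrite mulr_gt0// (varpi1_gt0 _ _ _ M).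
move=> q q4; exists ((comparison_const R + (24 * 128) * (K + 4)) * (4 * kap)).
  by apply: mulr_gt0 kp; move: cc K_gt0; lra.
move=> n d p M kappa B gam cond B1 mom growth Eq; rewrite -mulrA.
apply: (polynomial_regime cond B1 mom b_gt0 kap1 kb (ltW K_gt0) growth _ q4 _ Eq) => //.
by rewrite mulr_gt0// ltr_pwDl ?powR_ge0// (varpi1_gt0 _ _ _ M).
Qed.
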